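(* Let $G$ be a Lie group. Then the algebra $C^\infty_c(G)$ of smooth functions with compact support on $G$, with pointwise multiplication and with the comultiplication $\Delta(f)(r,s)=f(rs)$, is a bornological quantum group.
   Context: Conventions. Vector spaces are complex. A bornological vector space is a vector space with a convex bornology, whose members are called small sets; it is always assumed complete (every small set lies in a small disk $T$ whose linear span $\langle T\rangle$ is a Banach space for the Minkowski gauge of $T$). $\mathrm{Hom}(V,W)$ is the space of bounded linear maps (those mapping small sets to small sets) with the equibounded bornology; all linear maps considered are bounded and isomorphisms are bounded with bounded inverse. $\hat\otimes$ is the completed bornological tensor product (universal for bounded bilinear maps). $V$ has the approximation property if for each compact disk $S\subset V$ (i.e. compact in some Banach space $\langle T\rangle$, $T$ a small disk) there is a sequence of bounded finite rank operators $f_n:V\to V$ with $f_n\to\mathrm{id}$ in $\mathrm{Hom}(\langle S\rangle,V)$. A bornological algebra is a bornological vector space $H$ with a bounded associative multiplication $\mu:H\hat\otimes H\to H$ (no unit required). For a right $H$-module $M$ and a left $H$-module $V$, $M\hat\otimes_H V$ is the quotient of $M\hat\otimes V$ by the closure of the span of all $mh\otimes v-m\otimes hv$. A left $H$-module $V$ is essential if the action induces an isomorphism $H\hat\otimes_H V\cong V$ (similarly for right modules); $H$ is essential if it is nonzero and $\mu$ induces an isomorphism $H\hat\otimes_H H\cong H$. The multiplier algebra $M(H)$ consists of pairs $(L,R)$ of bounded linear maps $H\to H$ with $L(fg)=L(f)g$, $R(fg)=fR(g)$, $fL(g)=R(f)g$, with the bornology and multiplication inherited from left and right multipliers. A homomorphism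 $f:H\to M(K)$ is essential if it turns $K$ into an essential left and right $H$-module; for essential $K$ it extends uniquely to a unital homomorphism $M(H)\to M(K)$, denoted by the same letter. A bounded functional $\omega$ on $H$ is faithful if ($\omega(fg)=0$ for all $g$) implies $f=0$ and ($\omega(fg)=0$ for all $f$) implies $g=0$. Bornological quantum groups. Let $H$ be an essential bornological algebra with the approximation property and a faithful bounded functional; then $H\subset M(H)$, and similarly for tensor powers. A comultiplication is an essential homomorphism $\Delta:H\to M(H\hat\otimes H)$ with $(\Delta\hat\otimes\mathrm{id})\Delta=(\mathrm{id}\hat\otimes\Delta)\Delta$. Its Galois maps $H\hat\otimes H\to M(H\hat\otimes H)$ are $\gamma_l(f\otimes g)=\Delta(f)(g\otimes 1)$, $\gamma_r(f\otimes g)=\Delta(f)(1\otimes g)$, $\rho_l(f\otimes g)=(f\otimes 1)\Delta(g)$, $\rho_r(f\otimes g)=(1\otimes f)\Delta(g)$. If these are bounded maps into $H\hat\otimes H$, then for a bounded functional $\omega$ the multiplier $(\mathrm{id}\hat\otimes\omega)\Delta(f)\in M(H)$ is defined by $(\mathrm{id}\hat\otimes\omega)\Delta(f)\cdot g=(\mathrm{id}\hat\otimes\omega)\gamma_l(f\otimes g)$, $g\cdot(\mathrm{id}\hat\otimes\omega)\Delta(f)=(\mathrm{id}\hat\otimes\omega)\rho_l(g\otimes f)$. A bounded functional $\phi$ is left invariant if $(\mathrm{id}\hat\otimes\phi)\Delta(f)=\phi(f)1$ for all $f$. A bornological quantum group is an essential bornological algebra with the approximation property together with a comultiplication all of whose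 four Galois maps are isomorphisms of $H\hat\otimes H$ onto itself, and a faithful left invariant functional. The example. $C^\infty_c(G)$ carries the bornology of bounded subsets for its natural LF-topology. $C^\infty_c(G)\hat\otimes C^\infty_c(G)\cong C^\infty_c(G\times G)$, and the multiplier algebra of $C_c^\infty(M)$, $M$ a smooth manifold, is the algebra $\mathcal{E}(M)$ of all smooth functions on $M$; thus $\Delta(f)(r,s)=f(rs)$ defines a map $\Delta:C^\infty_c(G)\to M(C^\infty_c(G\times G))$. The left invariant functional is $\phi(f)=\int_G f(t)\,dt$ for a left Haar measure $dt$. *)

(* Defs.v *)
From HB Require Import structures.
From mathcomp Require Import all_boot all_order all_algebra.
From mathcomp Require Import all_classical all_reals all_analysis.
From mathcomp Require Import complex.

Set Implicit Arguments.
Unset Strict Implicit.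
Unset Printing Implicit Defensive.

Import Order.TTheory GRing.Theory Num.Theory.
Import numFieldNormedType.Exports.

Local Open Scope classical_set_scope.
Local Open Scope ring_scope.
Local Open Scope complex_scope.

Section Disks.
Context {R : realType} {V : lmodType R[i]}.
Implicit Types (A T : set V) (v x y : V).

Definition is_disk T := T !=set0 /\
  forall (a b : R[i]) x y, `|a| + `|b| <= 1 -> T x -> T y -> T (a *: x + b *: y).

Definition disked_hull A : set V :=
  [set v | forall T, is_disk T -> A `<=` T -> T v].

Definition lspan A : set V :=
  [set v | exists n (c : 'I_n -> R[i]) (x : 'I_n -> V),
     (forall k, A (x k)) /\ v = \sum_(k < n) c k *: x k].

(* Minkowski gauge; only meaningful on the linear span of T. *)
Definition gauge T v : R :=
  inf [set r : R | 0 < r /\ exists2 t, T t & v = r%:C *: t].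

(* (lspan T, gauge T) is a Banach space *)
Definition banach_disk T := [/\ is_disk T,
  forall v, lspan T v -> gauge T v = 0 -> v = 0 &
  forall u : nat -> V, (forall n, lspan T (u n)) ->
    (forall e : R, 0 < e -> exists N, forall m n, (N <= m)%N -> (N <= n)%N ->
       gauge T (u m - u n) < e) ->
    exists2 l, lspan T l & gauge T (u n - l) @[n --> \oo] --> (0 : R)].

Definition gauge_open T (U : set V) := forall x, lspan T x -> U x ->
  exists2 e : R, 0 < e & forall y, lspan T y -> gauge T (y - x) < e -> U y.

Definition gauge_compact T (S : set V) := S `<=` lspan T /\
  forall (I : Type) (U : I -> set V), (forall k, gauge_open T (U k)) ->
    S `<=` \bigcup_k U k ->
    exists n (k : 'I_n -> I), S `<=` \bigcup_j U (k j).

Lemma norm_realC (r : R) : 0 <= r -> `|r%:C| = r%:C :> R[i].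
Proof. by move=> r0; rewrite ger0_norm ?ler0c. Qed.

Lemma is_disk0 T : is_disk T -> T 0.
Proof.
move=> [[x Tx] dT]; rewrite -[0](addr0 (0 : V)) -[X in X + _](scale0r x).
rewrite -[X in _ + X](scale0r x); apply: dT => //.
by rewrite normr0 addr0 ler01.
Qed.

Lemma is_diskZ T a x : is_disk T -> `|a| <= 1 -> T x -> T (a *: x).
Proof.
move=> dT a1 Tx; rewrite -[a *: x]addr0 -[X in _ + X](scale0r x).
by apply: (dT.2) => //; rewrite normr0 addr0.
Qed.

Lemma is_disk_hull A : is_disk (disked_hull A).
Proof.
split; first by exists 0 => T dT _; exact: is_disk0.
by move=> a b x y ab hx hy T dT AT; apply: dT.2 => //; [exact: hx|exact: hy].
Qed.

Lemma sub_disked_hull A : A `<=` disked_hull A.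
Proof. by move=> x Ax T _; apply. Qed.

Lemma disked_hull_sub A T : is_disk T -> A `<=` T -> disked_hull A `<=` T.
Proof. by move=> dT AT x; apply. Qed.

Lemma lspan_submod_closed A : submod_closed (mem (lspan A) : {pred V}).
Proof.
split=> [|a u v]; rewrite !inE.
  exists 0%N, (fun=> 0), (fun=> 0); split; first by case.
  by rewrite big_ord0.
move=> [m [c [x [Ax ->]]]] [n [d [y [Ay ->]]]].
exists (m + n)%N.
exists (fun k => match fintype.split k with inl i => a * c i | inr j => d j end).
exists (fun k => match fintype.split k with inl i => x i | inr j => y j end).
split; first by move=> k; case: fintype.split.
rewrite big_split_ord /= scaler_sumr; congr (_ + _); apply: eq_bigr => i _.
  by rewrite (unsplitK (inl i)) scalerA.
by rewrite (unsplitK (inr i)).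
Qed.

End Disks.

Record disk (R : realType) (V : lmodType R[i]) :=
  Disk { disk_set :> set V ; diskP : is_disk disk_set }.

HB.mixin Record Lmodule_isBornological (R : realType) V
    of GRing.Lmodule R[i] V := {
  small : set (set V) ;
  small_set1 : forall x, small [set x] ;
  small_sub : forall A B, A `<=` B -> small B -> small A ;
  smallU : forall A B, small A -> small B -> small (A `|` B) ;
  smallD : forall A B, small A -> small B ->
    small [set x | exists a b, [/\ A a, B b & x = a + b]] ;
  smallZ : forall (c : R[i]) A, small A -> small [set c *: x | x in A] ;
  small_hull : forall A, small A -> small (disked_hull A)
}.

#[short(type="bornType")]
HB.structure Definition Bornological (R : realType) :=
  {V of GRing.Lmodule R[i] V & Lmodule_isBornological R V}.

Arguments small_sub {R s A B}.
Arguments smallU {R s A B}.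
Arguments smallD {R s A B}.
Arguments smallZ {R s} c {A}.
Arguments small_hull {R s A}.

Section Bornology.
Context {R : realType}.

Definition complete_born (V : bornType R) :=
  forall A : set V, small A ->
    exists T : set V, [/\ A `<=` T, small T & banach_disk T].

Definition born_cvg (V : bornType R) (u : nat -> V) (l : V) :=
  exists T : set V, [/\ is_disk T, small T, (forall n, lspan T (u n)), lspan T l
    & gauge T (u n - l) @[n --> \oo] --> (0 : R)].

(* Closed sets are those stable under limits of sequences; adding the limits of
   sequences of A once need not produce the closure of A. *)
Definition born_closed (V : bornType R) (F : set V) :=
  forall u l, (forall n, F (u n)) -> born_cvg u l -> F l.

Definition born_closure (V : bornType R) (A : set V) : set V :=
  \bigcap_(F in [set F | born_closed F /\ A `<=` F]) F.

Definition bounded_linear (V W : bornType R) (f : V -> W) :=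
  linear f /\ forall A, small A -> small (f @` A).

Definition bounded_bilinear (V W X : bornType R) (b : V -> W -> X) :=
  [/\ forall w, linear (b^~ w), forall v, linear (b v) &
      forall A B, small A -> small B ->
        small [set x | exists v w, [/\ A v, B w & x = b v w]]].

End Bornology.

(* The linear span of a disk, with the bornology given by its gauge. *)
Section DiskSpan.
Context {R : realType} {V : lmodType R[i]} (S : disk V).

Definition dspan_pred : {pred V} := mem (lspan S).
HB.instance Definition _ := GRing.isSubmodClosed.Build R[i] V dspan_pred
  (lspan_submod_closed S).

Record dspan := DSpan { dspan_val : V ; _ : dspan_val \in dspan_pred }.
HB.instance Definition _ := [isSub for dspan_val].
HB.instance Definition _ := [Choice of dspan by <:].
HB.instance Definition _ := [SubChoice_isSubLmodule of dspan by <:].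

Definition dspan_small : set (set dspan) :=
  [set B | exists r : R, forall x, B x -> gauge S (val x) <= r].


Lemma gauge_le (r : R) (s : V) : 0 < r -> disk_set S s -> gauge S (r%:C *: s) <= r.
Proof.
by move=> r0 Ss; apply: ge_inf; [exists 0 => t /= [/ltW]|split=> //; exists s].
Qed.

Lemma lspan_diskP (v : V) : lspan S v ->
  exists2 r : R, 0 < r & exists2 s, disk_set S s & v = r%:C *: s.
Proof.
move=> [n [c [x [Sx ->]]]]; have dS := diskP S.
elim: n c x Sx => [|n IH] c x Sx.
  exists 1 => //; exists 0; first exact: is_disk0.
  by rewrite big_ord0 scaler0.
rewrite big_ord_recl /=.
have [r r0 [s Ss ->]] := IH (fun k => c (lift ord0 k))
  (fun k => x (lift ord0 k)) (fun k => Sx (lift ord0 k)).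
pose a := c ord0; pose m : R := ComplexField.Normc.normc a.
have mE : `|a| = m%:C by [].
have m0 : 0 <= m by rewrite -ler0c -mE normr_ge0.
have rm : 0 < m + r by rewrite ltr_wpDl.
exists (m + r) => //.
have rmn : (m + r)%:C != 0 :> R[i] by rewrite (inj_eq (@complexI R)) gt_eqF.
exists ((a / (m + r)%:C) *: x ord0 + (r%:C / (m + r)%:C) *: s); last first.
  by rewrite scalerDr !scalerA ![_ * (_ / _)]mulrC !divfK.
apply: dS.2 => //.
rewrite !normrM mE !normfV.
rewrite !norm_realC ?(ltW r0) ?(ltW rm)//.
by rewrite -mulrDl -rmorphD divff.
Qed.

Lemma gauge_lt (v : V) (r : R) : lspan S v -> gauge S v < r ->
  exists2 s, disk_set S s & v = r%:C *: s.
Proof.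
move=> Sv; have dS := diskP S; have [r1 r10 [s1 Ss1 v1]] := lspan_diskP Sv.
move=> /inf_lt[|r2 [r20 [s Ss ->]] r2r].
  by exists r1; split=> //; exists s1.
have r0 : 0 < r by apply: lt_trans r2r.
have rn : r%:C != 0 :> R[i] by rewrite (inj_eq (@complexI R)) gt_eqF.
exists ((r2%:C / r%:C) *: s); last by rewrite scalerA mulrC divfK.
apply: is_diskZ => //.
rewrite normrM normfV !norm_realC ?(ltW r0) ?(ltW r20)//.
by rewrite ler_pdivrMr ?ltcR// mul1r lecR ltW.
Qed.

Lemma dspan_smallP B : dspan_small B <->
  exists2 r : R, 0 < r & forall x, B x -> exists2 s, disk_set S s & val x = r%:C *: s.
Proof.
split=> [[r Br]|[r r0 Br]].
  exists (`|r| + 1); first by rewrite ltr_wpDl.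
  move=> x Bx; apply: gauge_lt; first by case: x {Bx} => x /= /set_mem.
  by rewrite (le_lt_trans (Br _ Bx))// (le_lt_trans (ler_norm r))// ltrDl.
by exists r => x /Br[s Ss ->]; exact: gauge_le.
Qed.

Lemma dspan_small_set1 x : dspan_small [set x].
Proof. by exists (gauge S (val x)) => y ->. Qed.

Lemma dspan_small_sub A B : A `<=` B -> dspan_small B -> dspan_small A.
Proof. by move=> AB [r Br]; exists r => x /AB/Br. Qed.

Lemma dspan_smallU A B : dspan_small A -> dspan_small B -> dspan_small (A `|` B).
Proof.
move=> [r Ar] [q Bq]; exists (Num.max r q) => x [/Ar|/Bq] h.
  by rewrite le_max h.
by rewrite le_max h orbT.
Qed.

Lemma dspan_smallD A B : dspan_small A -> dspan_small B ->
  dspan_small [set x | exists a b, [/\ A a, B b & x = a + b]].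
Proof.
move=> /dspan_smallP[r r0 Ar] /dspan_smallP[q q0 Bq].
apply/dspan_smallP; exists (r + q); first exact: addr_gt0.
move=> _ [a [b [/Ar[s Ss sa] /Bq[t St tb] ->]]] /=.
have rn : (r + q)%:C != 0 :> R[i].
  by rewrite (inj_eq (@complexI R)) gt_eqF// addr_gt0.
exists ((r%:C / (r + q)%:C) *: s + (q%:C / (r + q)%:C) *: t).
  apply: (diskP S).2 => //.
  rewrite !normrM !normfV !norm_realC ?addr_ge0 ?(ltW r0) ?(ltW q0)//.
  by rewrite -mulrDl -rmorphD divff.
by rewrite scalerDr !scalerA ![_ * (_ / _)]mulrC !divfK// -sa -tb.
Qed.

Lemma dspan_smallZ (c : R[i]) A :
  dspan_small A -> dspan_small [set c *: x | x in A].
Proof.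
move=> /dspan_smallP[r r0 Ar]; apply/dspan_smallP.
pose m : R := ComplexField.Normc.normc c.
have mE : `|c| = m%:C by [].
have m0 : 0 <= m by rewrite -ler0c -mE normr_ge0.
have m1 : 0 < m + 1 by rewrite ltr_wpDl.
have mn : (m + 1)%:C != 0 :> R[i] by rewrite (inj_eq (@complexI R)) gt_eqF.
exists ((m + 1) * r); first exact: mulr_gt0.
move=> _ [a /Ar[s Ss sa] <-] /=; exists ((c / (m + 1)%:C) *: s).
  apply: is_diskZ => //; first exact: diskP.
  rewrite normrM normfV mE norm_realC ?(ltW m1)//.
  by rewrite ler_pdivrMr ?ltcR// mul1r lecR lerDl.
rewrite scalerA rmorphM/= mulrAC [_%:C * (_ / _)]mulrC divfK// -scalerA.
by congr (_ *: _).
Qed.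

Lemma dspan_small_hull A : dspan_small A -> dspan_small (disked_hull A).
Proof.
move=> /dspan_smallP[r r0 Ar]; apply/dspan_smallP; exists r => // x hx.
apply: (hx [set x | exists2 s, disk_set S s & val x = r%:C *: s]) => //; split.
  by exists 0; exists 0; [exact: is_disk0 (diskP S)|rewrite scaler0 raddf0].
move=> a b y z ab [s Ss sy] [t St tz]; exists (a *: s + b *: t).
  exact: (diskP S).2.
rewrite [LHS]/= -[dspan_val y]/(val y) -[dspan_val z]/(val z) sy tz.
by rewrite scalerDr !scalerA ![r%:C * _]mulrC.
Qed.

HB.instance Definition _ := Lmodule_isBornological.Build R dspan
  dspan_small_set1 dspan_small_sub dspan_smallU dspan_smallD dspan_smallZ
  dspan_small_hull.

End DiskSpan.

Lemma smallW (R : realType) (V : bornType R) (A B : set V) :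
  small B -> A `<=` B -> small A.
Proof. by move=> sB AB; exact: small_sub AB sB. Qed.

Section BHom.
Context {R : realType} (V W : bornType R).

Definition hom_pred : {pred V -> W} := mem [set f | bounded_linear f].

Lemma hom_submod_closed : submod_closed hom_pred.
Proof.
split=> [|a f g]; rewrite !inE.
  split=> [c u v|A _]; first by rewrite /= scaler0 addr0.
  by apply: smallW (small_set1 0) _ => _ [x _ <-].
move=> [fl fb] [gl gb]; split=> [c u v|A sA].
  rewrite fctE /= fctE /= fl gl !scalerDr !scalerA [a * c]mulrC.
  by rewrite -!addrA; congr (_ + _); rewrite addrCA.
apply: smallW (smallD (smallZ a (fb _ sA)) (gb _ sA)) _ => _ [x Ax <-].
exists (a *: f x), (g x); split; [|by exists x|by []].
by exists (f x) => //; exists x.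
Qed.
HB.instance Definition _ := GRing.isSubmodClosed.Build R[i] (V -> W) hom_pred
  hom_submod_closed.

Record bhom := BHom { hom_fun :> V -> W ; _ : hom_fun \in hom_pred }.
HB.instance Definition _ := [isSub for hom_fun].
HB.instance Definition _ := [Choice of bhom by <:].
HB.instance Definition _ := [SubChoice_isSubLmodule of bhom by <:].

Lemma homP (f : bhom) : bounded_linear f.
Proof. by case: f => f fP; exact: (set_mem fP). Qed.

Definition mkhom (f : V -> W) (fP : bounded_linear f) : bhom := BHom (mem_set fP).

Definition hom_apply (L : set bhom) (A : set V) : set W :=
  [set y | exists f x, [/\ L f, A x & y = hom_fun f x]].

Definition hom_small : set (set bhom) :=
  [set L | forall A, small A -> small (hom_apply L A)].

Lemma hom_small_set1 f : hom_small [set f].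
Proof.
move=> A sA; apply: smallW ((homP f).2 _ sA) _ => _ [_ [x [-> Ax ->]]].
by exists x.
Qed.

Lemma hom_small_sub L M : L `<=` M -> hom_small M -> hom_small L.
Proof.
move=> LM sM A sA; apply: smallW (sM _ sA) _ => _ [f [x [/LM Lf Ax ->]]].
by exists f, x.
Qed.

Lemma hom_smallU L M : hom_small L -> hom_small M -> hom_small (L `|` M).
Proof.
move=> sL sM A sA; apply: smallW (smallU (sL _ sA) (sM _ sA)) _.
by move=> _ [f [x [[Lf|Mf] Ax ->]]]; [left|right]; exists f, x.
Qed.

Lemma hom_smallD L M : hom_small L -> hom_small M ->
  hom_small [set h | exists f g, [/\ L f, M g & h = f + g]].
Proof.
move=> sL sM A sA; apply: smallW (smallD (sL _ sA) (sM _ sA)) _.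
move=> _ [_ [x [[f [g [Lf Mg ->]]] Ax ->]]].
by exists (f x), (g x); split=> //; [exists f, x|exists g, x].
Qed.

Lemma hom_smallZ (c : R[i]) L : hom_small L -> hom_small [set c *: f | f in L].
Proof.
move=> sL A sA; apply: smallW (smallZ c (sL _ sA)) _.
by move=> _ [_ [x [[f Lf <-] Ax ->]]]; exists (f x) => //; exists f, x.
Qed.

Lemma hom_small_hull L : hom_small L -> hom_small (disked_hull L).
Proof.
move=> sL A sA; apply: smallW (small_hull (sL _ sA)) _.
move=> _ [f [x [hf Ax ->]]] T dT LT.
apply: (hf [set g : bhom | T (g x)]) => [|g Lg]; last first.
  by apply: LT; exists g, x.
split; first by exists 0; exact: (is_disk0 dT).
by move=> a b g h ab; apply: dT.2.
Qed.

HB.instance Definition _ := Lmodule_isBornological.Build R bhom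
  hom_small_set1 hom_small_sub hom_smallU hom_smallD hom_smallZ hom_small_hull.

End BHom.

Section BHomTheory.
Context {R : realType}.

Definition is_isom (V W : bornType R) (f : bhom V W) :=
  exists g : bhom W V, cancel f g /\ cancel g f.

Definition finite_rank (V W : bornType R) (f : bhom V W) :=
  exists n (e : 'I_n -> W), forall x, lspan (range e) (f x).

Definition compact_disk (V : bornType R) (S : set V) := is_disk S /\
  exists T, [/\ small T, banach_disk T & gauge_compact T S].

Definition approximation_property (V : bornType R) :=
  forall S : disk V, compact_disk S ->
    exists f : nat -> bhom V V, (forall n, finite_rank (f n)) /\
    exists (g : nat -> bhom (dspan S) V) (j : bhom (dspan S) V),
      [/\ forall n x, g n x = f n (val x), forall x, j x = val x & born_cvg g j].

(* T, with the bilinear map t, is a completed bornological tensor product of V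
   and W: the universal property determines it up to unique isomorphism. *)
Definition is_ctensor (V W T : bornType R) (t : V -> W -> T) :=
  [/\ complete_born T, bounded_bilinear t &
      forall (X : bornType R) (b : V -> W -> X),
        complete_born X -> bounded_bilinear b ->
        exists! f : bhom T X, forall v w, f (t v w) = b v w].

(* p identifies Q with the quotient of T by the subspace N. *)
Definition is_quotient (T Q : bornType R) (N : set T) (p : bhom T Q) :=
  [/\ forall y, exists x, p x = y,
      forall x, p x = 0 <-> N x &
      forall B : set Q, small B <-> exists2 A, small A & p @` A = B].

End BHomTheory.

Record is_born_alg (R : realType) (V : bornType R) (m : V -> V -> V) : Prop := {
  born_alg_complete : complete_born V ;
  born_alg_bilinear : bounded_bilinear m ;
  born_alg_mulA : associative m }.

Record bornAlg (R : realType) := BornAlg {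
  balg :> bornType R ;
  bmul : balg -> balg -> balg ;
  balgP : is_born_alg bmul }.

Section Modules.
Context {R : realType}.

(* M and V are a right and a left H-module by ra and la: b induces an
   isomorphism from the tensor product of M and V over H onto X. *)
Definition induces_isom (H : bornAlg R) (M V X : bornType R)
    (ra : M -> H -> M) (la : H -> V -> V) (b : M -> V -> X) :=
  exists (T : bornType R) (t : M -> V -> T) (Q : bornType R) (p : bhom T Q)
         (a : bhom Q X),
    let N := lspan [set z | exists m h v, z = t (ra m h) v - t m (la h v)] in
    [/\ is_ctensor t, is_quotient (born_closure N) p, is_isom a &
        forall m v, a (p (t m v)) = b m v].

Definition essential_left (H : bornAlg R) (V : bornType R) (la : H -> V -> V) :=
  [/\ bounded_bilinear la, forall f g v, la (bmul f g) v = la f (la g v) &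
      induces_isom (@bmul R H) la la].

Definition essential_right (H : bornAlg R) (M : bornType R) (ra : M -> H -> M) :=
  [/\ bounded_bilinear ra, forall m f g, ra m (bmul f g) = ra (ra m f) g &
      induces_isom ra (@bmul R H) ra].

Definition essential_alg (H : bornAlg R) :=
  (exists x : H, x != 0) /\ induces_isom (@bmul R H) (@bmul R H) (@bmul R H).

End Modules.

Section Multipliers.
Context {R : realType} (H : bornAlg R).
Local Notation "x ** y" := (@bmul R H x y) (at level 40, left associativity).

Lemma bmulDl x y z : (x + y) ** z = x ** z + y ** z.
Proof.
by have [/(_ z 1 x y) + _ _] := born_alg_bilinear (balgP H); rewrite !scale1r.
Qed.

Lemma bmulDr x y z : x ** (y + z) = x ** y + x ** z.
Proof.
by have [_ /(_ x 1 y z) + _] := born_alg_bilinear (balgP H); rewrite !scale1r.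
Qed.

Lemma bmul0l x : 0 ** x = 0.
Proof. by apply: (addrI (0 ** x)); rewrite -bmulDl !addr0. Qed.

Lemma bmul0r x : x ** 0 = 0.
Proof. by apply: (addrI (x ** 0)); rewrite -bmulDr !addr0. Qed.

Lemma bmulZl a x y : (a *: x) ** y = a *: (x ** y).
Proof.
have [/(_ y a x 0) + _ _] := born_alg_bilinear (balgP H).
by rewrite !addr0 bmul0l addr0.
Qed.

Lemma bmulZr a x y : x ** (a *: y) = a *: (x ** y).
Proof.
have [_ /(_ x a y 0) + _] := born_alg_bilinear (balgP H).
by rewrite !addr0 bmul0r addr0.
Qed.

Definition mult_pred : {pred bhom H H * bhom H H} :=
  mem [set LR : bhom H H * bhom H H | let: (L, R) := LR in
    forall f g, [/\ L (f ** g) = L f ** g, R (f ** g) = f ** R g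
                  & f ** L g = R f ** g]].

Lemma mult_submod_closed : submod_closed mult_pred.
Proof.
split=> [|a [L M] [L' M']]; rewrite !inE /=.
  by move=> f g; rewrite !bmul0l !bmul0r.
move=> LM LM' f g; have [e1 e2 e3] := LM f g; have [f1 f2 f3] := LM' f g.
split.
- by rewrite /= !fctE e1 f1 bmulDl bmulZl.
- by rewrite /= !fctE e2 f2 bmulDr bmulZr.
- by rewrite /= !fctE bmulDl bmulDr bmulZl bmulZr e3 f3.
Qed.
HB.instance Definition _ := GRing.isSubmodClosed.Build R[i]
  (bhom H H * bhom H H)%type mult_pred mult_submod_closed.

Record multiplier :=
  Multiplier { mult_val : bhom H H * bhom H H ; _ : mult_val \in mult_pred }.
HB.instance Definition _ := [isSub for mult_val].
HB.instance Definition _ := [Choice of multiplier by <:].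
HB.instance Definition _ := [SubChoice_isSubLmodule of multiplier by <:].

(* mL m f and mR m f are the products m f and f m. *)
Definition mL (m : multiplier) : bhom H H := (val m).1.
Definition mR (m : multiplier) : bhom H H := (val m).2.

Lemma multP m f g : [/\ mL m (f ** g) = mL m f ** g,
  mR m (f ** g) = f ** mR m g & f ** mL m g = mR m f ** g].
Proof. by case: m => -[L M] mP; exact: (set_mem mP f g). Qed.

Definition mult_small : set (set multiplier) :=
  [set B | small (mL @` B) /\ small (mR @` B)].

Lemma mult_small_set1 m : mult_small [set m].
Proof. by split; rewrite image_set1; exact: small_set1. Qed.

Lemma mult_small_sub A B : A `<=` B -> mult_small B -> mult_small A.
Proof.
by move=> AB [s1 s2]; split; [apply: smallW s1 _|apply: smallW s2 _];
  exact: image_subset.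
Qed.

Lemma mult_smallU A B : mult_small A -> mult_small B -> mult_small (A `|` B).
Proof. by move=> [? ?] [? ?]; split; rewrite image_setU; exact: smallU. Qed.

Lemma mult_smallD A B : mult_small A -> mult_small B ->
  mult_small [set x | exists a b, [/\ A a, B b & x = a + b]].
Proof.
move=> [a1 a2] [b1 b2]; split.
  apply: smallW (smallD a1 b1) _ => _ [_ [a [b [Aa Bb ->]]] <-].
  by exists (mL a), (mL b); split; [exists a|exists b|].
apply: smallW (smallD a2 b2) _ => _ [_ [a [b [Aa Bb ->]]] <-].
by exists (mR a), (mR b); split; [exists a|exists b|].
Qed.

Lemma mult_smallZ (c : R[i]) A :
  mult_small A -> mult_small [set c *: x | x in A].
Proof.
move=> [a1 a2]; split.
  apply: smallW (smallZ c a1) _ => _ [_ [a Aa <-] <-].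
  by exists (mL a) => //; exists a.
apply: smallW (smallZ c a2) _ => _ [_ [a Aa <-] <-].
by exists (mR a) => //; exists a.
Qed.

Lemma mult_small_hull A : mult_small A -> mult_small (disked_hull A).
Proof.
move=> [a1 a2]; split.
  apply: smallW (small_hull a1) _ => _ [m hm <-] T dT AT.
  apply: (hm [set n | T (mL n)]) => [|n An]; last by apply: AT; exists n.
  split; first by exists 0; exact: (is_disk0 dT).
  by move=> a b g h ab; apply: dT.2.
apply: smallW (small_hull a2) _ => _ [m hm <-] T dT AT.
apply: (hm [set n | T (mR n)]) => [|n An]; last by apply: AT; exists n.
split; first by exists 0; exact: (is_disk0 dT).
by move=> a b g h ab; apply: dT.2.
Qed.

HB.instance Definition _ := Lmodule_isBornological.Build R multiplier
  mult_small_set1 mult_small_sub mult_smallU mult_smallD mult_smallZ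
  mult_small_hull.

Lemma id_bounded : bounded_linear (@idfun H).
Proof. by split=> // A; rewrite image_id. Qed.

Lemma comp_bounded (f g : bhom H H) : bounded_linear (f \o g).
Proof.
split=> [a u v /=|A sA]; first by rewrite (homP g).1 (homP f).1.
by rewrite -image_comp; exact/(homP f).2/(homP g).2.
Qed.

Lemma mul_bounded x : bounded_linear (bmul x) /\ bounded_linear (@bmul R H ^~ x).
Proof.
have [b1 b2 b3] := born_alg_bilinear (balgP H); split; split=> //.
  move=> A sA; apply: smallW (b3 _ _ (small_set1 x) sA) _ => _ [y Ay <-].
  by exists x, y.
move=> A sA; apply: smallW (b3 _ _ sA (small_set1 x)) _ => _ [y Ay <-].
by exists y, x.
Qed.

Fact mone_subproof : (mkhom id_bounded, mkhom id_bounded) \in mult_pred.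
Proof. exact: mem_set. Qed.
Definition mone : multiplier := Multiplier mone_subproof.

Fact mmul_subproof (m n : multiplier) :
  (mkhom (comp_bounded (mL m) (mL n)), mkhom (comp_bounded (mR n) (mR m)))
    \in mult_pred.
Proof.
apply: mem_set => f g /=; split.
- by have [-> _ _] := multP n f g; have [-> _ _] := multP m (mL n f) g.
- by have [_ -> _] := multP m f g; have [_ -> _] := multP n f (mR m g).
- by have [_ _ ->] := multP m f (mL n g); have [_ _ ->] := multP n (mR m f) g.
Qed.
Definition mmul m n : multiplier := Multiplier (mmul_subproof m n).

Fact membed_subproof x :
  (mkhom (mul_bounded x).1, mkhom (mul_bounded x).2) \in mult_pred.
Proof. by apply: mem_set => f g /=; rewrite !(born_alg_mulA (balgP H)). Qed.
Definition membed x : multiplier := Multiplier (membed_subproof x).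

End Multipliers.

Arguments mone {R H}.
Arguments mL {R H}.
Arguments mR {R H}.

Section TensorAlgebras.
Context {R : realType}.

Definition is_tensor_alg (A B AB : bornAlg R) (t : A -> B -> AB) :=
  is_ctensor t /\
  forall a b a' b', bmul (t a b) (t a' b') = t (bmul a a') (bmul b b').

(* u is the multiplier m (x) n of the tensor product algebra. *)
Definition is_mtensor (A B AB : bornAlg R) (t : A -> B -> AB)
    (m : multiplier A) (n : multiplier B) (u : multiplier AB) :=
  forall a b, mL u (t a b) = t (mL m a) (mL n b) /\
              mR u (t a b) = t (mR m a) (mR n b).

Definition essential_hom (H K : bornAlg R) (f : bhom H (multiplier K)) :=
  [/\ forall x y, f (bmul x y) = mmul (f x) (f y),
      @essential_left R H K (fun h k => mL (f h) k) &
      @essential_right R H K (fun k h => mR (f h) k)].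

(* F is the extension of f to a unital homomorphism of multiplier algebras. *)
Definition is_extension (H K : bornAlg R) (f : bhom H (multiplier K))
    (F : bhom (multiplier H) (multiplier K)) :=
  [/\ F mone = mone, forall m n, F (mmul m n) = mmul (F m) (F n) &
      forall x, F (membed x) = f x].

End TensorAlgebras.

Section QuantumGroups.
Context {R : realType} {H HH : bornAlg R}.
Variables (t : H -> H -> HH) (D : bhom H (multiplier HH)).

(* The triple tensor product is an algebra HHH presented both as
   (H (x) H) (x) H, by l, and as H (x) (H (x) H), by r. Dl and Dr are D (x) id
   and id (x) D, and El and Er their extensions to multipliers. *)
Definition coassociative :=
  exists (HHH : bornAlg R) (l : HH -> H -> HHH) (r : H -> HH -> HHH)
    (Dl Dr : bhom HH (multiplier HHH))
    (El Er : bhom (multiplier HH) (multiplier HHH)),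
    [/\ [/\ is_tensor_alg l, is_tensor_alg r &
            forall a b c, l (t a b) c = r a (t b c)],
        [/\ essential_hom Dl, is_extension Dl El &
            forall a b, is_mtensor l (D a) (membed b) (Dl (t a b))],
        [/\ essential_hom Dr, is_extension Dr Er &
            forall a b, is_mtensor r (membed a) (D b) (Dr (t a b))] &
        forall f, El (D f) = Er (D f)].

Definition is_comultiplication := essential_hom D /\ coassociative.

Definition is_gamma_l (g : bhom HH HH) := forall x y, exists2 u,
  is_mtensor t (membed y) mone u & membed (g (t x y)) = mmul (D x) u.
Definition is_gamma_r (g : bhom HH HH) := forall x y, exists2 u,
  is_mtensor t mone (membed y) u & membed (g (t x y)) = mmul (D x) u.
Definition is_rho_l (g : bhom HH HH) := forall x y, exists2 u,
  is_mtensor t (membed x) mone u & membed (g (t x y)) = mmul u (D y).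
Definition is_rho_r (g : bhom HH HH) := forall x y, exists2 u,
  is_mtensor t mone (membed x) u & membed (g (t x y)) = mmul u (D y).

Definition bounded_functional (V : bornType R) (w : V -> R[i]) :=
  (forall a u v, w (a *: u + v) = a * w u + w v) /\
  forall A, small A -> exists r : R[i], forall x, A x -> `|w x| <= r.

Definition faithful (w : H -> R[i]) :=
  (forall f, (forall g, w (bmul f g) = 0) -> f = 0) /\
  (forall g, (forall f, w (bmul f g) = 0) -> g = 0).

(* m is the multiplier (id (x) w) D(f), where s = id (x) w. *)
Definition is_slice (w : H -> R[i]) (f : H) (m : multiplier H) :=
  exists (gl rl : bhom HH HH) (s : bhom HH H),
    [/\ is_gamma_l gl, is_rho_l rl, forall x y, s (t x y) = w y *: x &
        forall g, mL m g = s (gl (t f g)) /\ mR m g = s (rl (t g f))].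

Definition left_invariant (w : H -> R[i]) :=
  forall f, is_slice w f (w f *: mone).

Record is_quantum_group (phi : H -> R[i]) : Prop := {
  qg_essential : essential_alg H ;
  qg_approximation : approximation_property H ;
  qg_tensor : is_tensor_alg t ;
  qg_comultiplication : is_comultiplication ;
  qg_gamma_l : exists2 g, is_isom g & is_gamma_l g ;
  qg_gamma_r : exists2 g, is_isom g & is_gamma_r g ;
  qg_rho_l : exists2 g, is_isom g & is_rho_l g ;
  qg_rho_r : exists2 g, is_isom g & is_rho_r g ;
  qg_bounded : bounded_functional phi ;
  qg_faithful : faithful phi ;
  qg_left_invariant : left_invariant phi }.

End QuantumGroups.

Section Smooth.
Context {R : realType}.
Implicit Types (E F : normedModType R).

(* Iterated directional derivative: the head of vs is applied last. *)
Definition iter_derive E F (vs : seq E) (f : E -> F) : E -> F :=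
  foldr (fun v g => fun x => 'D_v g x) f vs.

Definition smooth_upto E F (n : nat) (U : set E) (f : E -> F) :=
  forall vs, (size vs <= n)%N -> forall x, U x ->
    {for x, continuous (iter_derive vs f)} /\
    forall v, derivable (iter_derive vs f) x v.

(* For finite-dimensional E and open U, this is smoothness on U: all iterated
   (equivalently, partial) derivatives exist and are continuous. *)
Definition smooth_on E F (U : set E) (f : E -> F) :=
  forall vs x, U x ->
    {for x, continuous (iter_derive vs f)} /\
    forall v, derivable (iter_derive vs f) x v.

Lemma smooth_onE E F (U : set E) (f : E -> F) :
  smooth_on U f <-> forall n, smooth_upto n U f.
Proof.
by split=> [fs n vs _ x|fs vs x]; [exact: fs|exact: (fs (size vs) vs)].
Qed.

Lemma iter_derive_rcons E F vs v (f : E -> F) :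
  iter_derive (rcons vs v) f = iter_derive vs (fun x => 'D_v f x).
Proof. by rewrite /iter_derive foldr_rcons. Qed.

Lemma eq_iter_derive E F (U : set E) (f g : E -> F) : open U ->
  (forall x, U x -> f x = g x) ->
  forall vs x, U x -> iter_derive vs f x = iter_derive vs g x.
Proof.
move=> oU fg; elim=> [|v vs IH] x Ux /=; first exact: fg.
apply: near_eq_derive; near=> y; apply: IH; near: y.
exact: open_nbhs_nbhs.
Unshelve. all: by end_near. Qed.

Lemma eq_smooth_upto E F n (U : set E) (f g : E -> F) : open U ->
  (forall x, U x -> f x = g x) -> smooth_upto n U f -> smooth_upto n U g.
Proof.
move=> oU fg fs vs sn x Ux; have [fc fd] := fs vs sn x Ux.
have nfg : {near x, iter_derive vs f =1 iter_derive vs g}.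
  near=> y; apply: (eq_iter_derive oU fg); near: y.
  exact: open_nbhs_nbhs.
split=> [|v]; last exact: near_eq_derivable nfg (fd v).
rewrite /prop_for /continuous_at -(eq_iter_derive oU fg vs Ux).
exact: cvg_trans (near_eq_cvg nfg) fc.
Unshelve. all: by end_near. Qed.

Lemma smooth_uptoW E F m n (U : set E) (f : E -> F) : (m <= n)%N ->
  smooth_upto n U f -> smooth_upto m U f.
Proof. by move=> mn fs vs vm; apply: fs; exact: leq_trans mn. Qed.

Lemma smooth_upto_derive E F n (U : set E) (f : E -> F) v :
  smooth_upto n.+1 U f -> smooth_upto n U (fun x => 'D_v f x).
Proof.
by move=> fs vs vn; rewrite -iter_derive_rcons; apply: fs; rewrite size_rcons.
Qed.

Lemma smooth_uptoS E F n (U : set E) (f : E -> F) : smooth_upto 0 U f ->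
  (forall v, smooth_upto n U (fun x => 'D_v f x)) -> smooth_upto n.+1 U f.
Proof.
move=> f0 fs vs; case: (lastP vs) => [_|ws w]; first exact: f0.
by rewrite size_rcons iter_derive_rcons; apply: fs.
Qed.

Lemma smooth_uptoD E F n (U : set E) (f g : E -> F) : open U ->
  smooth_upto n U f -> smooth_upto n U g -> smooth_upto n U (f \+ g).
Proof.
move=> oU; elim: n f g => [|n IH] f g fs gs.
  case=> // _ x Ux; have [fc fd] := fs [::] isT x Ux.
  have [gc gd] := gs [::] isT x Ux.
  by split=> [|v]; [exact: continuousD|exact: derivableD].
apply: smooth_uptoS.
  case=> // _ x Ux; have [fc fd] := fs [::] isT x Ux.
  have [gc gd] := gs [::] isT x Ux.
  by split=> [|v]; [exact: continuousD|exact: derivableD].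
move=> v; apply: (eq_smooth_upto oU _
  (IH _ _ (smooth_upto_derive v fs) (smooth_upto_derive v gs))).
move=> x Ux /=; rewrite deriveD//; first by have [_] := fs [::] isT x Ux.
by have [_] := gs [::] isT x Ux.
Qed.

Lemma smooth_uptoM E n (U : set E) (f g : E -> R) : open U ->
  smooth_upto n U f -> smooth_upto n U g -> smooth_upto n U (f \* g).
Proof.
move=> oU; elim: n f g => [|n IH] f g fs gs.
  case=> // _ x Ux; have [fc fd] := fs [::] isT x Ux.
  have [gc gd] := gs [::] isT x Ux.
  by split=> [|v]; [exact: continuousM|exact: derivableM].
apply: smooth_uptoS.
  case=> // _ x Ux; have [fc fd] := fs [::] isT x Ux.
  have [gc gd] := gs [::] isT x Ux.
  by split=> [|v]; [exact: continuousM|exact: derivableM].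
move=> v; apply: (eq_smooth_upto oU _ (smooth_uptoD oU
  (IH _ _ (smooth_uptoW (leqnSn n) fs) (smooth_upto_derive v gs))
  (IH _ _ (smooth_uptoW (leqnSn n) gs) (smooth_upto_derive v fs)))).
move=> x Ux /=; rewrite deriveM//; first by have [_] := fs [::] isT x Ux.
by have [_] := gs [::] isT x Ux.
Qed.

Lemma smooth_upto_cst E F n (U : set E) (c : F) : smooth_upto n U (cst c).
Proof.
elim: n c => [|n IH] c.
  by case=> // _ x _; split=> [|v]; [exact: cvg_cst|exact: derivable_cst].
apply: smooth_uptoS.
  by case=> // _ x _; split=> [|v]; [exact: cvg_cst|exact: derivable_cst].
move=> v; rewrite (_ : (fun x => _) = cst 0)//.
by apply/funext => x; rewrite derive_cst.
Qed.

Lemma smooth_onD E F (U : set E) (f g : E -> F) : open U ->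
  smooth_on U f -> smooth_on U g -> smooth_on U (f \+ g).
Proof.
move=> oU /smooth_onE fs /smooth_onE gs; apply/smooth_onE => n.
exact: smooth_uptoD.
Qed.

Lemma smooth_onM E (U : set E) (f g : E -> R) : open U ->
  smooth_on U f -> smooth_on U g -> smooth_on U (f \* g).
Proof.
move=> oU /smooth_onE fs /smooth_onE gs; apply/smooth_onE => n.
exact: smooth_uptoM.
Qed.

Lemma smooth_on_cst E F (U : set E) (c : F) : smooth_on U (cst c).
Proof. by apply/smooth_onE => n; exact: smooth_upto_cst. Qed.

Lemma eq_smooth_on E F (U : set E) (f g : E -> F) : open U ->
  (forall x, U x -> f x = g x) -> smooth_on U f -> smooth_on U g.
Proof.
move=> oU fg /smooth_onE fs; apply/smooth_onE => n.
exact: eq_smooth_upto fg (fs n).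
Qed.

End Smooth.

Section SmoothProduct.
Context {R : realType} {E1 E2 : normedModType R}.

Lemma iter_derive_fst (F : normedModType R) (f : E1 -> F) (vs : seq (E1 * E2)) :
  iter_derive vs (f \o fst) = iter_derive (map fst vs) f \o fst.
Proof. by elim: vs => [|v vs IH] //=; rewrite IH. Qed.

Lemma iter_derive_snd (F : normedModType R) (f : E2 -> F) (vs : seq (E1 * E2)) :
  iter_derive vs (f \o snd) = iter_derive (map snd vs) f \o snd.
Proof. by elim: vs => [|v vs IH] //=; rewrite IH. Qed.

Lemma smooth_on_fst (F : normedModType R) (U : set E1) (f : E1 -> F) :
  smooth_on U f -> smooth_on [set x : E1 * E2 | U x.1] (f \o fst).
Proof.
move=> fs vs [x y] /= Ux; rewrite iter_derive_fst.
have [fc fd] := fs (map fst vs) x Ux; split=> [|[v w]]; last exact: fd v.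
by apply: continuous_comp => //; exact: cvg_fst.
Qed.

Lemma smooth_on_snd (F : normedModType R) (U : set E2) (f : E2 -> F) :
  smooth_on U f -> smooth_on [set x : E1 * E2 | U x.2] (f \o snd).
Proof.
move=> fs vs [x y] /= Uy; rewrite iter_derive_snd.
have [fc fd] := fs (map snd vs) y Uy; split=> [|[v w]]; last exact: fd w.
by apply: continuous_comp => //; exact: cvg_snd.
Qed.

Lemma derive_pair (E F1 F2 : normedModType R) (f : E -> F1) (g : E -> F2) x v :
  derivable f x v -> derivable g x v ->
  derivable (fun y => (f y, g y)) x v /\
  'D_v (fun y => (f y, g y)) x = ('D_v f x, 'D_v g x).
Proof.
move=> fd gd.
pose q (h : R) := h^-1 *: (((fun y => (f y, g y)) \o shift x) (h *: v) - (f x, g x)).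
have h : q h @[h --> 0^'] --> ('D_v f x, 'D_v g x) by apply: cvg_pair fd gd.
split; first by apply/cvg_ex; exists ('D_v f x, 'D_v g x).
by apply: cvg_lim => //.
Qed.

Lemma smooth_on_pair (E F1 F2 : normedModType R) (U : set E)
    (f : E -> F1) (g : E -> F2) : open U ->
  smooth_on U f -> smooth_on U g -> smooth_on U (fun x => (f x, g x)).
Proof.
move=> oU fs gs.
have dE vs : forall x, U x ->
    iter_derive vs (fun x => (f x, g x)) x = (iter_derive vs f x, iter_derive vs g x).
  elim: vs => [|v vs IH] x Ux //=.
  rewrite -(derive_pair ((fs vs x Ux).2 v) ((gs vs x Ux).2 v)).2.
  apply: near_eq_derive; near=> y; apply: IH; near: y.
  exact: open_nbhs_nbhs.
move=> vs x Ux; have [fc fd] := fs vs x Ux; have [gc gd] := gs vs x Ux.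
have nE : {near x, (fun x => (iter_derive vs f x, iter_derive vs g x)) =1
    iter_derive vs (fun x => (f x, g x))}.
  near=> y; apply/esym/dE; near: y; exact: open_nbhs_nbhs.
split=> [|v]; last exact: near_eq_derivable nE (derive_pair (fd v) (gd v)).1.
rewrite /prop_for /continuous_at dE//.
apply: cvg_trans (near_eq_cvg nE) _; exact: cvg_pair.
Unshelve. all: by end_near. Qed.

Lemma smooth_onW (E F : normedModType R) (U V : set E) (f : E -> F) :
  V `<=` U -> smooth_on U f -> smooth_on V f.
Proof. by move=> VU fs vs x /VU; exact: fs. Qed.

End SmoothProduct.

(* The inverse cpsi is total, but only relevant on the image of cdom. *)
Record chart (R : realType) (M : topologicalType) (E : normedModType R) := Chart {
  cdom : set M ;
  cphi : M -> E ;
  cpsi : E -> M ;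
  cdom_open : open cdom ;
  cimg_open : open (cphi @` cdom) ;
  cphiK : forall x, cdom x -> cpsi (cphi x) = x ;
  cphi_continuous : forall x, cdom x -> {for x, continuous cphi} ;
  cpsi_continuous : forall y, (cphi @` cdom) y -> {for y, continuous cpsi} }.

(* Manifolds are modelled on a finite-dimensional real normed space and are
   Hausdorff and second countable; the atlas need not be maximal. *)
Record smoothStructure (R : realType) (M : topologicalType) := SmoothStructure {
  model : normedModType R ;
  model_fin : exists n (e : 'I_n -> model), forall v,
    exists c : 'I_n -> R, v = \sum_(k < n) c k *: e k ;
  smooth_hausdorff : hausdorff_space M ;
  smooth_countable : @second_countable M ;
  atlas : set (chart M model) ;
  atlas_cover : forall x, exists2 c, atlas c & cdom c x ;
  atlas_smooth : forall c d, atlas c -> atlas d ->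
    smooth_on (cphi c @` (cdom c `&` cdom d)) (cphi d \o cpsi c) }.

Arguments model {R M}.
Arguments atlas {R M}.

Definition smooth_map (R : realType) (M N : topologicalType)
    (S : smoothStructure R M) (T : smoothStructure R N) (f : M -> N) :=
  continuous f /\ forall c d, atlas S c -> atlas T d ->
    smooth_on (cphi c @` (cdom c `&` f @^-1` cdom d)) (cphi d \o f \o cpsi c).

Lemma chart_open (R : realType) (M : topologicalType) (E : normedModType R)
  (c : chart M E) (U : set M) : open U -> open (cphi c @` (cdom c `&` U)).
Proof.
move=> oU; rewrite openE => _ [x [dx Ux] <-].
have ix : (cphi c @` cdom c) (cphi c x) by exists x.
have h1 : nbhs (cphi c x) (cphi c @` cdom c).
  exact: (open_nbhs_nbhs (conj (cimg_open c) ix)).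
have h2 : nbhs (cphi c x) (cpsi c @^-1` U).
  by apply: (cpsi_continuous ix); rewrite cphiK//; exact: open_nbhs_nbhs.
apply: filterS2 h1 h2 => _ [z dz <-] /=; rewrite cphiK// => Uz.
by exists z.
Qed.

Lemma open_prod (M N : topologicalType) (A : set M) (B : set N) : open A -> open B -> open (A `*` B).
Proof.
rewrite !openE => oA oB [x y] [/= Ax By].
by exists (A, B) => //; split; [exact: oA|exact: oB].
Qed.

Section ProductStructure.
Context {R : realType} {M N : topologicalType}.

Lemma prod_hausdorff :
  hausdorff_space M -> hausdorff_space N -> hausdorff_space (M * N)%type.
Proof.
move=> hM hN [x y] [x' y'] c; congr pair.
  apply: hM => A B Ax Bx'.
  have [||[a b] [Aa Ba]] := c (A `*` setT) (B `*` setT).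
  - by exists (A, setT) => //; split=> //; exact: filterT.
  - by exists (B, setT) => //; split=> //; exact: filterT.
  - by exists a; split; [exact: Aa.1|exact: Ba.1].
apply: hN => A B Ay By'.
have [||[a b] [Ab Bb]] := c (setT `*` A) (setT `*` B).
- by exists (setT, A) => //; split=> //; exact: filterT.
- by exists (setT, B) => //; split=> //; exact: filterT.
- by exists b; split; [exact: Ab.2|exact: Bb.2].
Qed.

Lemma prod_second_countable : @second_countable M -> @second_countable N ->
  @second_countable (M * N)%type.
Proof.
move=> [B cB [oB bB]] [C cC [oC bC]].
exists ((fun bc => bc.1 `*` bc.2) @` (B `*` C)).
  apply: sub_countable (card_image_le _ _) _; exact: countableX.
split=> [_ [[b c] /= [Bb Cc] <-]|[x y] D [[U V] /= [xU yV] UVD]].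
  by apply: open_prod; [exact: oB|exact: oC].
have [b [Bb bx] bU] := bB x _ xU; have [c [Cc cy] cV] := bC y _ yV.
exists (b `*` c); first by split=> //; exists (b, c).
by move=> [z t] [/= bz ct]; apply: UVD; split; [exact: bU|exact: cV].
Qed.

Section ProductChart.
Context {E F : normedModType R} (c : chart M E) (d : chart N F).

Definition prod_phi (x : M * N) : E * F := (cphi c x.1, cphi d x.2).
Definition prod_psi (x : E * F) : M * N := (cpsi c x.1, cpsi d x.2).

Lemma prod_phi_image (A : set M) (B : set N) :
  prod_phi @` (A `*` B) = (cphi c @` A) `*` (cphi d @` B).
Proof.
apply/seteqP; split=> [_ [[x y] [/= Ax By] <-]|[_ _] [/= [x Ax <-] [y By <-]]].
  by split; [exists x|exists y].
by exists (x, y).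
Qed.

Definition prod_dom : set (M * N) := cdom c `*` cdom d.

Lemma prod_dom_open : open prod_dom.
Proof. by apply: open_prod; exact: cdom_open. Qed.

Lemma prod_img_open : open (prod_phi @` prod_dom).
Proof.
rewrite prod_phi_image openE => -[x y] [/= cx dy].
exists (cphi c @` cdom c, cphi d @` cdom d) => //; split.
  exact: (open_nbhs_nbhs (conj (cimg_open c) cx)).
exact: (open_nbhs_nbhs (conj (cimg_open d) dy)).
Qed.

Lemma prod_phiK x : prod_dom x -> prod_psi (prod_phi x) = x.
Proof.
by move: x => [x y] [/= cx dy]; rewrite /prod_psi /= !cphiK.
Qed.

Lemma prod_phi_continuous x : prod_dom x -> {for x, continuous prod_phi}.
Proof.
move: x => [x y] [/= cx dy]; have h1 : {for (x, y), continuous (cphi c \o fst)}.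
  by apply: continuous_comp; [exact: cvg_fst|exact: cphi_continuous cx].
have h2 : {for (x, y), continuous (cphi d \o snd)}.
  by apply: continuous_comp; [exact: cvg_snd|exact: cphi_continuous dy].
exact: cvg_pair h1 h2.
Qed.

Lemma prod_psi_continuous y :
  (prod_phi @` prod_dom) y -> {for y, continuous prod_psi}.
Proof.
move: y; rewrite prod_phi_image => -[x y] [/= cx dy]; have h1 : {for (x, y), continuous (cpsi c \o fst)}.
  by apply: continuous_comp; [exact: cvg_fst|exact: cpsi_continuous cx].
have h2 : {for (x, y), continuous (cpsi d \o snd)}.
  by apply: continuous_comp; [exact: cvg_snd|exact: cpsi_continuous dy].
exact: cvg_pair h1 h2.
Qed.

Definition prod_chart : chart (M * N)%type (E * F)%type :=
  Chart prod_dom_open prod_img_open prod_phiK prod_phi_continuous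
    prod_psi_continuous.

End ProductChart.

Context (S : smoothStructure R M) (T : smoothStructure R N).

Lemma prod_model_fin : exists n (e : 'I_n -> model S * model T), forall v,
  exists c : 'I_n -> R, v = \sum_(k < n) c k *: e k.
Proof.
have [m [e eP]] := model_fin S; have [n [f fP]] := model_fin T.
exists (m + n)%N, (fun k =>
  match fintype.split k with inl i => (e i, 0) | inr j => (0, f j) end).
move=> [v w]; have [c ->] := eP v; have [d ->] := fP w.
exists (fun k => match fintype.split k with inl i => c i | inr j => d j end).
rewrite big_split_ord /=.
rewrite (eq_bigr (fun k => c k *: (e k, 0))); last first.
  by move=> k _; rewrite (unsplitK (inl k)).
rewrite [X in _ + X](eq_bigr (fun k => d k *: (0, f k))); last first.
  by move=> k _; rewrite (unsplitK (inr k)).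
apply/eqP; rewrite xpair_eqE; apply/andP; split; apply/eqP.
  rewrite [RHS](raddfD (@fst _ _)) !raddf_sum /= [X in _ + X]big1 ?addr0//.
  by move=> i _; rewrite scaler0.
rewrite [RHS](raddfD (@snd _ _)) !raddf_sum /= [X in X + _]big1 ?add0r//.
by move=> i _; rewrite scaler0.
Qed.

Definition prod_atlas : set (chart (M * N)%type (model S * model T)%type) :=
  [set prod_chart c d | c in atlas S & d in atlas T].

Lemma prod_atlas_cover x : exists2 c, prod_atlas c & cdom c x.
Proof.
have [c Ac cx] := atlas_cover S x.1; have [d Ad dx] := atlas_cover T x.2.
by exists (prod_chart c d) => //; exists c => //; exists d.
Qed.

Lemma prod_atlas_smooth c d : prod_atlas c -> prod_atlas d ->
  smooth_on (cphi c @` (cdom c `&` cdom d)) (cphi d \o cpsi c).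
Proof.
move=> [c1 Ac1 [c2 Ac2 <-]] [d1 Ad1 [d2 Ad2 <-]].
set U1 := cphi c1 @` (cdom c1 `&` cdom d1).
set U2 := cphi c2 @` (cdom c2 `&` cdom d2).
have o1 : open U1 by apply: chart_open; exact: cdom_open.
have o2 : open U2 by apply: chart_open; exact: cdom_open.
apply: (@smooth_onW _ _ _ (U1 `*` U2)).
  move=> _ [[x y] [[/= cx cy] [/= dx dy]] <-].
  by split; [exists x|exists y].
apply: smooth_on_pair; first exact: open_prod.
  apply: smooth_onW (smooth_on_fst (atlas_smooth Ac1 Ad1)).
  by move=> [x y] [].
apply: smooth_onW (smooth_on_snd (atlas_smooth Ac2 Ad2)).
by move=> [x y] [].
Qed.

Definition prodStructure : smoothStructure R (M * N)%type :=
  SmoothStructure prod_model_fin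
    (prod_hausdorff (smooth_hausdorff S) (smooth_hausdorff T))
    (prod_second_countable (smooth_countable S) (smooth_countable T))
    prod_atlas_cover prod_atlas_smooth.

End ProductStructure.

Section TestFunctions.
Context {R : realType} {M : topologicalType} (S : smoothStructure R M).

Definition smooth_fun (f : M -> R[i]) := forall c, atlas S c ->
  smooth_on (cphi c @` cdom c) (fun y => complex.Re (f (cpsi c y))) /\
  smooth_on (cphi c @` cdom c) (fun y => complex.Im (f (cpsi c y))).

Definition supp (f : M -> R[i]) : set M := closure [set x | f x != 0].

Definition Cc_pred : {pred M -> R[i]} :=
  mem [set f | smooth_fun f /\ compact (supp f)].

Lemma supp_sub (f g : M -> R[i]) : (forall x, f x = 0 -> g x = 0) ->
  compact (supp f) -> compact (supp g).
Proof.
move=> fg cf; apply: subclosed_compact cf _; first exact: closed_closure.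
by apply: closureS => x; apply: contra_neq => /fg.
Qed.

Lemma smooth_funZD a (f g : M -> R[i]) :
  smooth_fun f -> smooth_fun g -> smooth_fun (a *: f + g).
Proof.
move=> fs gs c Ac; have [f1 f2] := fs c Ac; have [g1 g2] := gs c Ac.
have oU := cimg_open c; split.
  apply: (eq_smooth_on oU _ (smooth_onD oU (smooth_onD oU
    (smooth_onM oU (@smooth_on_cst _ _ _ _ (complex.Re a)) f1)
    (smooth_onM oU (@smooth_on_cst _ _ _ _ (- complex.Im a)) f2)) g1)).
  move=> x _ /=; rewrite !fctE; case: (f _) => u v; case: (g _) => w z.
  by case: a => p q /=; rewrite mulNr.
apply: (eq_smooth_on oU _ (smooth_onD oU (smooth_onD oU
  (smooth_onM oU (@smooth_on_cst _ _ _ _ (complex.Re a)) f2)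
  (smooth_onM oU (@smooth_on_cst _ _ _ _ (complex.Im a)) f1)) g2)).
move=> x _ /=; rewrite !fctE; case: (f _) => u v; case: (g _) => w z.
by case: a => p q /=.
Qed.

Lemma smooth_funM (f g : M -> R[i]) :
  smooth_fun f -> smooth_fun g -> smooth_fun (fun x => f x * g x).
Proof.
move=> fs gs c Ac; have [f1 f2] := fs c Ac; have [g1 g2] := gs c Ac.
have oU := cimg_open c; split.
  apply: (eq_smooth_on oU _ (smooth_onD oU (smooth_onM oU f1 g1)
    (smooth_onM oU (@smooth_on_cst R _ R _ (- 1)) (smooth_onM oU f2 g2)))).
  move=> x _ /=; case: (f _) => u v; case: (g _) => w z.
  by rewrite /= mulN1r.
apply: (eq_smooth_on oU _ (smooth_onD oU (smooth_onM oU f1 g2)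
  (smooth_onM oU f2 g1))).
by move=> x _ /=; case: (f _) => u v; case: (g _).
Qed.

Lemma Cc_submod_closed : submod_closed Cc_pred.
Proof.
split=> [|a f g]; rewrite !inE /=.
  split=> [c Ac|]; first by split; exact: smooth_on_cst.
  rewrite /supp (_ : [set x | _] = set0) ?closure0; first exact: compact0.
  by apply/seteqP; split=> x //=; rewrite eqxx.
move=> [fs fc] [gs gc]; split; first exact: smooth_funZD.
apply: subclosed_compact (compactU fc gc) _; first exact: closed_closure.
rewrite /supp -closureU; apply: closureS => x /= n0.
apply/orP; apply: contraNT n0; rewrite negb_or !negbK => /andP[/eqP fx /eqP gx].
by rewrite !fctE fx gx scaler0 addr0.
Qed.
HB.instance Definition _ := GRing.isSubmodClosed.Build R[i] (M -> R[i]) Cc_pred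
  Cc_submod_closed.

Record Cc := MkCc { Cc_fun :> M -> R[i] ; _ : Cc_fun \in Cc_pred }.
HB.instance Definition _ := [isSub for Cc_fun].
HB.instance Definition _ := [Choice of Cc by <:].
HB.instance Definition _ := [SubChoice_isSubLmodule of Cc by <:].

Lemma CcP (f : Cc) : smooth_fun f /\ compact (supp f).
Proof. by case: f => f fP; exact: (set_mem fP). Qed.

Fact Cc_mul_subproof (f g : Cc) : (fun x => f x * g x) \in Cc_pred.
Proof.
have [fs fc] := CcP f; have [gs gc] := CcP g.
apply: mem_set; split; first exact: smooth_funM.
by apply: supp_sub fc => x ->; rewrite mul0r.
Qed.
Definition Cc_mul (f g : Cc) : Cc := MkCc (Cc_mul_subproof f g).

(* The Frechet topology of the functions supported in a compact set is given by
   the seminorms chart_seminorm c L vs for charts c of the atlas and compact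
   sets L in the domain of c. *)
Definition chart_seminorm (c : chart M (model S)) (L : set M)
    (vs : seq (model S)) (f : Cc) : R :=
  sup [set Normc.normc
         (iter_derive vs (fun y => complex.Re (f (cpsi c y))) (cphi c x) +i*
          iter_derive vs (fun y => complex.Im (f (cpsi c y))) (cphi c x)) | x in L].

Definition is_seminorm (p : Cc -> R) :=
  (forall (a : R[i]) f, p (a *: f) = Normc.normc a * p f) /\
  (forall f g, p (f + g) <= p f + p g).

(* Continuity for the LF topology: the restriction to functions with support in
   any given compact set is continuous for the Frechet topology. *)
Definition LF_continuous (p : Cc -> R) := forall K : set M, compact K ->
  exists (C : R) n (c : 'I_n -> chart M (model S)) (L : 'I_n -> set M)
    (vs : 'I_n -> seq (model S)),
    (forall k, [/\ atlas S (c k), compact (L k) & L k `<=` cdom (c k)]) /\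
    forall f : Cc, supp f `<=` K ->
      p f <= C * \sum_(k < n) chart_seminorm (c k) (L k) (vs k) f.

(* Bounded subsets of the locally convex space with the LF topology. *)
Definition Cc_small : set (set Cc) :=
  [set B | forall p, is_seminorm p -> LF_continuous p ->
     exists r, forall f, B f -> p f <= r].

Lemma Cc_small_set1 f : Cc_small [set f].
Proof. by move=> p _ _; exists (p f) => g ->. Qed.

Lemma Cc_small_sub A B : A `<=` B -> Cc_small B -> Cc_small A.
Proof.
by move=> AB sB p sp cp; have [r rP] := sB p sp cp; exists r => f /AB/rP.
Qed.

Lemma Cc_smallU A B : Cc_small A -> Cc_small B -> Cc_small (A `|` B).
Proof.
move=> sA sB p sp cp; have [r rP] := sA p sp cp; have [q qP] := sB p sp cp.
by exists (Num.max r q) => f [/rP|/qP] h; rewrite le_max h ?orbT.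
Qed.

Lemma Cc_smallD A B : Cc_small A -> Cc_small B ->
  Cc_small [set x | exists a b, [/\ A a, B b & x = a + b]].
Proof.
move=> sA sB p sp cp; have [r rP] := sA p sp cp; have [q qP] := sB p sp cp.
exists (r + q) => _ [a [b [/rP pa /qP pb ->]]].
by rewrite (le_trans (sp.2 _ _))// lerD.
Qed.

Lemma normc_ge0 (a : R[i]) : 0 <= Normc.normc a.
Proof. by rewrite -ler0c -[X in _ <= X]/(`|a|). Qed.

Lemma Cc_smallZ (c : R[i]) A : Cc_small A -> Cc_small [set c *: x | x in A].
Proof.
move=> sA p sp cp; have [r rP] := sA p sp cp.
exists (Normc.normc c * r) => _ [a /rP pa <-].
by rewrite sp.1 ler_wpM2l// normc_ge0.
Qed.

Lemma Cc_small_hull A : Cc_small A -> Cc_small (disked_hull A).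
Proof.
move=> sA p sp cp; have [r rP] := sA p sp cp.
exists (Num.max r 0) => f hf; apply: (hf [set f | p f <= Num.max r 0]).
  split; first by exists 0; rewrite /= -(scale0r 0) sp.1 Normc.normc0 mul0r le_max lexx orbT.
  move=> a b x y ab /= px py; rewrite (le_trans (sp.2 _ _))// !sp.1.
  have m0 : 0 <= Num.max r 0 by rewrite le_max lexx orbT.
  apply: (@le_trans _ _ ((Normc.normc a + Normc.normc b) * Num.max r 0)).
    by rewrite mulrDl lerD// ler_wpM2l// normc_ge0.
  by rewrite ler_piMl// -lecR rmorphD.
by move=> g /rP pg /=; rewrite le_max pg.
Qed.

HB.instance Definition _ := Lmodule_isBornological.Build R Cc
  Cc_small_set1 Cc_small_sub Cc_smallU Cc_smallD Cc_smallZ Cc_small_hull.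

End TestFunctions.

Section ExternalProduct.
Context {R : realType} {M N : topologicalType}.
Context (S : smoothStructure R M) (T : smoothStructure R N).

Fact Cc_ext_subproof (f : Cc S) (g : Cc T) :
  (fun x => f x.1 * g x.2) \in Cc_pred (prodStructure S T).
Proof.
have [fs fc] := CcP f; have [gs gc] := CcP g; apply: mem_set; split.
  apply: (@smooth_funM _ _ _ (fun x => f x.1) (fun x => g x.2)) => _ [c Ac [d Ad <-]].
    have [f1 f2] := fs c Ac; rewrite /= prod_phi_image; split.
      by apply: smooth_onW (smooth_on_fst f1) => -[x y] [].
    by apply: smooth_onW (smooth_on_fst f2) => -[x y] [].
  have [g1 g2] := gs d Ad; rewrite /= prod_phi_image; split.
    by apply: smooth_onW (smooth_on_snd g1) => -[x y] [].
  by apply: smooth_onW (smooth_on_snd g2) => -[x y] [].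
apply: subclosed_compact (compact_setX fc gc) _; first exact: closed_closure.
move=> [x y] cxy; split=> /= [A Ax|A Ay].
  have [|[a b] [/= n0 [/= Aa _]]] := cxy (A `*` setT).
    by exists (A, setT) => //; split=> //; exact: filterT.
  by exists a; split=> //=; apply: contraNneq n0 => ->; rewrite mul0r.
have [|[a b] [/= n0 [/= _ Ab]]] := cxy (setT `*` A).
  by exists (setT, A) => //; split=> //; exact: filterT.
by exists b; split=> //=; apply: contraNneq n0 => ->; rewrite mulr0.
Qed.
Definition Cc_ext (f : Cc S) (g : Cc T) : Cc (prodStructure S T) :=
  MkCc (Cc_ext_subproof f g).

End ExternalProduct.

#[short(type="topGroupType")]
HB.structure Definition TopGroup := {G of Topological G & Group G}.

Record lieGroup (R : realType) := LieGroup {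
  lie_sort :> topGroupType ;
  lie_smooth : smoothStructure R lie_sort ;
  lie_mul_smooth : smooth_map (prodStructure lie_smooth lie_smooth) lie_smooth
    (fun x : lie_sort * lie_sort => (x.1 * x.2)%g) ;
  lie_inv_smooth : smooth_map lie_smooth lie_smooth
    (fun x : lie_sort => (x^-1)%g) }.

(* Measurable types are pointed: a group is pointed by 1. *)
Definition group_pointed (G : topGroupType) : Type := G.
HB.instance Definition _ (G : topGroupType) := Choice.on (group_pointed G).
HB.instance Definition _ (G : topGroupType) :=
  isPointed.Build (group_pointed G) (1%g : G).

Definition borel (G : topGroupType) :=
  g_sigma_algebraType (@open G : set (set (group_pointed G))).

Section Haar.
Context {R : realType} {G : topGroupType}.
Variable mu : {measure set (borel G) -> \bar R}.

Definition is_left_haar :=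
  [/\ mu [set: G] != 0%E, forall K : set G, compact K -> (mu K < +oo)%E &
      forall (x : G) (A : set G), measurable (A : set (borel G)) ->
        mu [set (x * y)%g | y in A] = mu A].

Definition haar_integral (f : G -> R[i]) : R[i] :=
  (\int[mu]_(x in [set: borel G]) complex.Re (f x)) +i*
  (\int[mu]_(x in [set: borel G]) complex.Im (f x)).

End Haar.

(* Main.v *)
From HB Require Import structures.
Require Import Defs.
From mathcomp Require Import all_boot all_order all_algebra.
From mathcomp Require Import all_classical all_reals all_analysis.
From mathcomp Require Import measurable_realfun complex ring lra zify.

Set Implicit Arguments.
Unset Strict Implicit.
Unset Printing Implicit Defensive.

Import Order.TTheory GRing.Theory Num.Theory.
Import numFieldNormedType.Exports.
Local Open Scope classical_set_scope.
Local Open Scope ring_scope.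
Local Open Scope complex_scope.

(* Smooth functions are expanded on chart cubes.  With coordinates x_i = cos t_i
   on a cube, f becomes an even periodic function of t and has a cosine
   expansion; its coefficients A_k(f) decay faster than any power of k,
   uniformly on bounded sets, while the functions psi e_k (psi a cutoff in the
   cube, e_k a product of Chebyshev polynomials) grow polynomially.  On a product
   cube e_k is an external product, so for a bounded bilinear map b the series
   sum_k A_k(F) b(psi e_k', psi' e_k'') converges and is bounded in F.  Partitions
   of unity turn this into Cc(M) (x) Cc(N) = Cc(M x N), and the truncated
   expansions into the approximation property.

   For a smooth map X -> M, Cc(X) is an essential Cc(M)-module: the product map
   Cc(M) (x) Cc(X) -> Cc(X) is split, on functions supported in a compact set,
   by F |-> chi (x) F with chi = 1 on the image of that set.  Multipliers of Cc(X)
   are the smooth functions on X.  Hence comultiplication, coassociativity and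
   the Galois maps are all pullbacks along smooth maps, the Galois maps along
   diffeomorphisms of G x G.  Haar measure comes from ratios of covering numbers;
   both sides of left invariance are bounded linear maps on Cc(G x G) that agree on
   elementary tensors. *)

(** * Limits in complete bornological spaces *)

(** A smooth function on a cube is not periodic, and periodising it with a cutoff would put the
    cutoff into the coefficients. The substitution x = cos t makes every function on the closed cube
    even and periodic in t at no cost; acos, which is not smooth at the faces, enters only through
    the vectors e_k, and these carry a cutoff supported in the open cube. Hence the coefficients of
    an external product factor exactly. They are limits of sums over grids instead of integrals: on
    a grid, inversion and factorisation are finite algebra, decay is summation by parts, and the
    limit along an ultrafilter exists for every bounded sequence and is additive and multiplicative.
    The same limits give the completeness of the space of test functions and the additivity of the
    Haar content. Bornological convergence asks for one disk in which the errors become small, so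
    limits are mostly taken with an explicit rate in a fixed disk; uniformity over a small set is
    then a matter of the order of quantifiers. No single cutoff serves all of Cc(M), so maps on it
    are built for one compact support at a time and glued. *)

Section UltraLimit.
Context {R : realType}.

(* A free ultrafilter on nat: limits along it give a multiplicative linear
   functional on bounded sequences that extends the usual limit. *)
Definition free_ultra : set_system nat :=
  xget eventually [set G | UltraFilter G /\ eventually `<=` G].

Lemma free_ultraP : UltraFilter free_ultra /\ eventually `<=` free_ultra.
Proof.
have [G [GU sG]] := ultraFilterLemma eventually_filter.
by apply: (@xgetPex _ eventually [set G | UltraFilter G /\ eventually `<=` G]); exists G.
Qed.

Instance free_ultra_ultra : UltraFilter free_ultra := free_ultraP.1.
Instance free_ultra_proper : ProperFilter free_ultra := ultra_proper.

Definition ulim (u : nat -> R) : R := lim (u @ free_ultra).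

Definition bseq (u : nat -> R) := exists C, forall n, `|u n| <= C.

(** The sequence lives in a compact segment, so its image under the ultrafilter has a cluster point;
    a neighbourhood of that point or its complement belongs to the ultrafilter, and clustering
    excludes the complement. *)
Lemma ulim_cvg u : bseq u -> u @ free_ultra --> ulim u.
Proof.
move=> [C uC].
have uF : (u @ free_ultra) `[- C, C]%classic.
  rewrite /= nbhs_simpl /=; apply: (@filterS _ free_ultra _ setT) filterT => n _.
  by rewrite /= in_itv /=; have := uC n; rewrite ler_norml.
have [l [_ ul]] := @segment_compact _ (- C) C (u @ free_ultra) _ uF.
apply/cvg_ex; exists l => A lA.
have [//|uA] := in_ultra_setVsetC (u @^-1` A) free_ultra_ultra.
by have [y []] := ul (~` A) A uA lA.
Qed.

Lemma ulimE u (l : R) : u @ free_ultra --> l -> ulim u = l.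
Proof. by move=> ul; apply: cvg_lim. Qed.

Lemma ulim_lim u (l : R) : u @ \oo --> l -> ulim u = l.
Proof. by move=> ul; apply: ulimE => A /ul; exact: free_ultraP.2. Qed.

Lemma ulim_cst (c : R) : ulim (fun=> c) = c.
Proof. by apply: ulimE; exact: cvg_cst. Qed.

Lemma bseq_cst (c : R) : bseq (fun=> c).
Proof. by exists `|c|. Qed.

Lemma bseqD u v : bseq u -> bseq v -> bseq (fun n => u n + v n).
Proof.
move=> [C uC] [D vD]; exists (C + D) => n.
by rewrite (le_trans (ler_normD _ _))// lerD.
Qed.

Lemma bseqM u v : bseq u -> bseq v -> bseq (fun n => u n * v n).
Proof.
move=> [C uC] [D vD]; exists (C * D) => n.
by rewrite normrM ler_pM.
Qed.

Lemma bseqN u : bseq u -> bseq (fun n => - u n).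
Proof. by move=> [C uC]; exists C => n; rewrite normrN. Qed.

Lemma bseqB u v : bseq u -> bseq v -> bseq (fun n => u n - v n).
Proof. by move=> bu bv; apply: bseqD => //; exact: bseqN. Qed.

Lemma ulimD u v : bseq u -> bseq v ->
  ulim (fun n => u n + v n) = ulim u + ulim v.
Proof. by move=> /ulim_cvg bu /ulim_cvg bv; apply: ulimE; exact: cvgD. Qed.

Lemma ulimM u v : bseq u -> bseq v ->
  ulim (fun n => u n * v n) = ulim u * ulim v.
Proof. by move=> /ulim_cvg bu /ulim_cvg bv; apply: ulimE; exact: cvgM. Qed.

Lemma ulimZ c u : bseq u -> ulim (fun n => c * u n) = c * ulim u.
Proof. by move=> bu; rewrite ulimM ?ulim_cst//; exact: bseq_cst. Qed.

Lemma ulimN u : bseq u -> ulim (fun n => - u n) = - ulim u.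
Proof. by move=> /ulim_cvg bu; apply: ulimE; exact: cvgN. Qed.

Lemma ulimB u v : bseq u -> bseq v ->
  ulim (fun n => u n - v n) = ulim u - ulim v.
Proof. by move=> bu bv; rewrite ulimD ?ulimN//; exact: bseqN. Qed.

Lemma bseq_sum (I : Type) (s : seq I) (P : pred I) (u : I -> nat -> R) :
  (forall i, bseq (u i)) -> bseq (fun n => \sum_(i <- s | P i) u i n).
Proof.
move=> bu; elim: s => [|i s IH].
  by under [X in bseq X]funext do rewrite big_nil; exact: bseq_cst.
under [X in bseq X]funext do rewrite big_cons.
by case: (P i) => //; exact: bseqD.
Qed.

Lemma ulim_sum (I : Type) (s : seq I) (P : pred I) (u : I -> nat -> R) :
  (forall i, bseq (u i)) ->
  ulim (fun n => \sum_(i <- s | P i) u i n) = \sum_(i <- s | P i) ulim (u i).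
Proof.
move=> bu; elim: s => [|i s IH].
  by under [X in ulim X]funext do rewrite big_nil; rewrite big_nil ulim_cst.
under [X in ulim X]funext do rewrite big_cons.
rewrite big_cons; case: (P i) => //; rewrite ulimD ?IH//; exact: bseq_sum.
Qed.

Lemma ulim_le u v : bseq u -> bseq v -> (\forall n \near \oo, u n <= v n) ->
  ulim u <= ulim v.
Proof.
move=> /ulim_cvg bu /ulim_cvg bv uv.
apply: ler_cvg_to bu bv _; exact: free_ultraP.2.
Qed.

Lemma eq_ulim u v : (\forall n \near \oo, u n = v n) -> ulim u = ulim v.
Proof.
move=> uv; rewrite /ulim; congr (lim _); apply/seteqP.
have fuv : \forall n \near free_ultra, u n = v n by exact: free_ultraP.2.
split=> A /=; rewrite !nbhs_simpl /=; apply: filterS2 fuv => n /= -> //.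
Qed.

Lemma ulim_norm u C : bseq u -> (\forall n \near \oo, `|u n| <= C) ->
  `|ulim u| <= C.
Proof.
move=> bu uC; rewrite ler_norml; apply/andP; split.
  rewrite -(ulim_cst (- C)); apply: ulim_le => //; first exact: bseq_cst.
  by apply: filterS uC => n; rewrite ler_norml => /andP[].
rewrite -[leRHS](ulim_cst C); apply: ulim_le => //; first exact: bseq_cst.
by apply: filterS uC => n; rewrite ler_norml => /andP[].
Qed.

Lemma ulim_normC u C : (forall n, `|u n| <= C) -> `|ulim u| <= C.
Proof. by move=> uC; apply: ulim_norm; [exists C|exact: nearW]. Qed.

End UltraLimit.

(** Replaces the estimate [gauge T x <= r]: the gauge is an infimum that need not be attained and is
    meaningful only on the span, whereas membership in the dilate of [T] by [r] adds and scales
    directly. *)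
Definition scaled_in (R : realType) (V : lmodType R[i]) (T : set V) (r : R)
  (x : V) := exists2 t, T t & x = r%:C *: t.

Section ScaledDisks.
Context {R : realType} {V : lmodType R[i]}.
Implicit Types (T A : set V) (x y : V) (r q : R).

Lemma realC_neq0 r : 0 < r -> r%:C != 0 :> R[i].
Proof. by move=> r0; rewrite (inj_eq (@complexI R)) gt_eqF. Qed.

Lemma scaled_in1 T x : T x -> scaled_in T 1 x.
Proof. by move=> Tx; exists x => //; rewrite scale1r. Qed.

Lemma scaled_in_sub T A r x : T `<=` A -> scaled_in T r x -> scaled_in A r x.
Proof. by move=> TA [t /TA At ->]; exists t. Qed.

Lemma scaled_in0 T r : is_disk T -> scaled_in T r 0.
Proof. by move=> /is_disk0 T0; exists 0 => //; rewrite scaler0. Qed.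

Lemma scaled_in_le T r q x : is_disk T -> 0 <= r -> r <= q ->
  scaled_in T r x -> scaled_in T q x.
Proof.
move=> dT r0 rq [t Tt ->]; have [q0|q0] := ltP 0 q; last first.
  have -> : r = 0 by apply/eqP; rewrite eq_le r0 (le_trans rq).
  by rewrite scale0r; exact: scaled_in0.
exists ((r%:C / q%:C) *: t); last by rewrite scalerA mulrC divfK// realC_neq0.
apply: is_diskZ => //; rewrite normrM normfV !norm_realC ?(ltW q0)//.
by rewrite ler_pdivrMr ?ltcR// mul1r lecR.
Qed.

Lemma scaled_inD T r q x y : is_disk T -> 0 <= r -> 0 <= q ->
  scaled_in T r x -> scaled_in T q y -> scaled_in T (r + q) (x + y).
Proof.
move=> dT r0 q0 [t Tt ->] [s Ts ->].
have [rq|rq] := ltP 0 (r + q); last first.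
  have r00 : r = 0.
    by apply/eqP; rewrite eq_le r0 (le_trans _ rq)// lerDl.
  have q00 : q = 0.
    by apply/eqP; rewrite eq_le q0 (le_trans _ rq)// lerDr.
  by rewrite r00 q00 !scale0r !addr0; exact: scaled_in0.
have n0 := realC_neq0 rq.
exists ((r%:C / (r + q)%:C) *: t + (q%:C / (r + q)%:C) *: s); last first.
  by rewrite scalerDr !scalerA ![_ * (_ / _)]mulrC !divfK.
apply: dT.2 => //; rewrite !normrM !normfV !norm_realC ?(ltW rq)//.
by rewrite -mulrDl -rmorphD divff.
Qed.

Lemma scaled_inZ T (a : R[i]) c r x : is_disk T -> 0 <= r ->
  `|a| <= c%:C -> scaled_in T r x -> scaled_in T (c * r) (a *: x).
Proof.
move=> dT r0 ac [t Tt ->]; have [c0|c0] := ltP 0 c; last first.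
  have a0 : a = 0.
    by apply/eqP; rewrite -normr_le0 (le_trans ac)// lecR.
  by rewrite a0 scale0r; exact: scaled_in0.
have n0 := realC_neq0 c0.
exists ((a / c%:C) *: t).
  apply: is_diskZ => //; rewrite normrM normfV norm_realC ?(ltW c0)//.
  by rewrite ler_pdivrMr ?ltcR// mul1r.
rewrite !scalerA rmorphM /=; congr (_ *: _).
by rewrite mulrAC [_ * (a / _)]mulrC divfK.
Qed.

Lemma scaled_inN T r x : is_disk T -> 0 <= r ->
  scaled_in T r x -> scaled_in T r (- x).
Proof.
move=> dT r0 /(@scaled_inZ _ (-1) 1 _ _ dT r0).
by rewrite mul1r scaleN1r normrN normr1; apply.
Qed.

Lemma scaled_inB T r q x y : is_disk T -> 0 <= r -> 0 <= q ->
  scaled_in T r x -> scaled_in T q y -> scaled_in T (r + q) (x - y).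
Proof. by move=> dT r0 q0 Tx Ty; apply: scaled_inD => //; exact: scaled_inN. Qed.

Lemma scaled_in_sum T (I : Type) (s : seq I) (P : pred I) (r : I -> R)
    (x : I -> V) : is_disk T -> (forall i, P i -> 0 <= r i) ->
  (forall i, P i -> scaled_in T (r i) (x i)) ->
  scaled_in T (\sum_(i <- s | P i) r i) (\sum_(i <- s | P i) x i).
Proof.
move=> dT r0 rx.
suff [] : 0 <= \sum_(i <- s | P i) r i /\
  scaled_in T (\sum_(i <- s | P i) r i) (\sum_(i <- s | P i) x i) by [].
elim/big_ind2 : _ => [|a q y p [a0 ax] [p0 py]|i Pi].
- by split => //; exact: scaled_in0.
- by split; [exact: addr_ge0|exact: scaled_inD].
- by split; [exact: r0|exact: rx].
Qed.

Lemma scaled_in_lspan T r x : scaled_in T r x -> lspan T x.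
Proof.
move=> [t Tt ->]; exists 1%N, (fun=> r%:C), (fun=> t); split => //.
by rewrite big_ord1.
Qed.

Lemma sub_lspan T : T `<=` lspan T.
Proof. by move=> x /scaled_in1/scaled_in_lspan. Qed.

Lemma lspanD T x y : lspan T x -> lspan T y -> lspan T (x + y).
Proof.
have [_ /(_ 1 x y)] := lspan_submod_closed T.
by rewrite !inE scale1r.
Qed.

Lemma lspan0 T : lspan T 0.
Proof. by have [+ _] := lspan_submod_closed T; rewrite !inE. Qed.

Lemma lspanZ T a x : lspan T x -> lspan T (a *: x).
Proof.
have [_ /(_ a x 0)] := lspan_submod_closed T.
by rewrite !inE addr0 => h Tx; apply: h => //; exact: lspan0.
Qed.

Lemma lspanB T x y : lspan T x -> lspan T y -> lspan T (x - y).
Proof. by move=> Tx Ty; rewrite -scaleN1r; apply: lspanD => //; exact: lspanZ. Qed.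

Lemma lspanS T A : T `<=` A -> lspan T `<=` lspan A.
Proof.
by move=> TA _ [n [c [x [Tx ->]]]]; exists n, c, x; split => // k; apply: TA.
Qed.

Lemma lspan_scaled T x : is_disk T -> lspan T x ->
  exists2 r, 0 < r & scaled_in T r x.
Proof.
by move=> dT /(@lspan_diskP _ _ (Disk dT))[r r0 [t Tt ->]]; exists r => //; exists t.
Qed.

Lemma gauge_lt_scaled T x r : is_disk T -> lspan T x -> gauge T x < r ->
  scaled_in T r x.
Proof. by move=> dT Tx /(@gauge_lt _ _ (Disk dT) _ _ Tx)[t Tt ->]; exists t. Qed.

Lemma scaled_gauge T x r : is_disk T -> 0 < r -> scaled_in T r x ->
  gauge T x <= r.
Proof. by move=> dT r0 [t Tt ->]; exact: (@gauge_le _ _ (Disk dT)). Qed.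

Lemma gauge_ge0 T x : 0 <= gauge T x.
Proof.
rewrite /gauge; set S := [set r | _]; have [->|/set0P S0] := eqVneq S set0.
  by rewrite inf0.
by apply: lb_le_inf => // r [/ltW].
Qed.

Lemma is_diskZset T (c : R[i]) : is_disk T -> is_disk [set c *: x | x in T].
Proof.
move=> dT; split; first by exists (c *: 0), 0 => //; exact: is_disk0.
move=> a b _ _ ab [x Tx <-] [y Ty <-]; exists (a *: x + b *: y).
  exact: dT.2.
by rewrite scalerDr !scalerA ![c * _]mulrC.
Qed.

(** Trades a constant in the radius for a larger disk. This is how constants are absorbed, the rate
    in [fast_cvg] being fixed. *)
Lemma scaled_in_scale T c r x : is_disk T ->
  scaled_in T (c * r) x -> scaled_in [set c%:C *: x | x in T] r x.
Proof.
move=> dT [t Tt ->]; exists (c%:C *: t); first by exists t.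
by rewrite scalerA rmorphM mulrC.
Qed.

End ScaledDisks.

Lemma scaled_in_linear (R : realType) (V W : lmodType R[i]) (f : V -> W) T r x :
  linear f -> scaled_in T r x -> scaled_in (f @` T) r (f x).
Proof.
move=> fl [t Tt ->]; exists (f t); first by exists t.
have f0 : f 0 = 0.
  by have := fl (-1) 0 0; rewrite scaler0 addr0 scaleN1r addNr.
by rewrite -[X in f X]addr0 fl f0 addr0.
Qed.

Lemma is_disk_image (R : realType) (V W : lmodType R[i]) (f : V -> W) T :
  linear f -> is_disk T -> is_disk (f @` T).
Proof.
move=> fl dT; split; first by exists (f 0), 0 => //; exact: is_disk0.
move=> a b _ _ ab [x Tx <-] [y Ty <-]; exists (a *: x + b *: y).
  exact: dT.2.
have f0 : f 0 = 0.
  by have := fl (-1) 0 0; rewrite scaler0 addr0 scaleN1r addNr.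
by rewrite fl -[b *: y]addr0 fl f0 addr0.
Qed.

Lemma small0 (R : realType) (V : bornType R) : small (set0 : set V).
Proof. by apply: smallW (small_set1 0) _. Qed.

Section FastConvergence.
Context {R : realType}.

Definition rate (n : nat) : R := n.+1%:R^-1.

Lemma rate_gt0 n : 0 < rate n. Proof. by rewrite invr_gt0 ltr0Sn. Qed.
Lemma rate_ge0 n : 0 <= rate n. Proof. exact/ltW/rate_gt0. Qed.
Hint Resolve rate_gt0 rate_ge0 : core.

Lemma rate_le m n : (m <= n)%N -> rate n <= rate m.
Proof. by move=> mn; rewrite lef_pV2 ?posrE ?ltr0Sn// ler_nat. Qed.

Lemma rate_lt (e : R) : 0 < e -> exists N, forall n, (N <= n)%N -> rate n < e.
Proof.
move=> e0; have [N Ne] : exists N, rate N < e.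
  have /cvgrPdist_lt/(_ e e0)[N _ /(_ N (leqnn N)) /=] :=
    @cvg_harmonic R.
  by rewrite sub0r normrN gtr0_norm// => h; exists N.
by exists N => n Nn; apply: le_lt_trans Ne; exact: rate_le.
Qed.

(* The factor 1/(n+1) costs no generality for the series considered here, and
   constants are absorbed in the disk. *)
Definition fast_cvg (V : bornType R) (u : nat -> V) (l : V) :=
  exists A, [/\ is_disk A, small A & forall n, scaled_in A (rate n) (u n - l)].

Definition ufast_cvg (V X : bornType R) (u : nat -> V -> X) (l : V -> X) :=
  forall B, small B -> exists A, [/\ is_disk A, small A &
    forall x n, B x -> scaled_in A (rate n) (u n x - l x)].

Lemma ufast_fast (V X : bornType R) (u : nat -> V -> X) (l : V -> X) x :
  ufast_cvg u l -> fast_cvg (u ^~ x) (l x).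
Proof.
by move=> /(_ _ (small_set1 x))[A [dA sA Au]]; exists A; split=> // n; apply: Au.
Qed.

Lemma fast_born_cvg (V : bornType R) (u : nat -> V) l : fast_cvg u l -> born_cvg u l.
Proof.
(* [A] controls only the differences, while [born_cvg] also wants the sequence and its limit in the
   span; hence [l] is added to the disk. *)
move=> [A [dA sA Au]]; pose T := disked_hull (A `|` [set l]).
have dT : is_disk T by exact: is_disk_hull.
have AT : A `<=` T by move=> x Ax; apply: sub_disked_hull; left.
have Tl : T l by apply: sub_disked_hull; right.
exists T; split => //.
- by apply: small_hull; apply: smallU => //; exact: small_set1.
- move=> n; rewrite -[u n](subrK l); apply: lspanD; last exact: sub_lspan.
  by apply: scaled_in_lspan (scaled_in_sub AT (Au n)).
- exact: sub_lspan.
apply/cvgrPdist_lt => e /rate_lt[N Ne]; exists N => // n /= /Ne ne.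
rewrite sub0r normrN ger0_norm ?gauge_ge0//; apply: le_lt_trans ne.
by apply: scaled_gauge => //; exact: scaled_in_sub AT (Au n).
Qed.

Lemma small_disk_sub2 (V : bornType R) (A B : set V) : small A -> small B ->
  exists T, [/\ is_disk T, small T, A `<=` T & B `<=` T].
Proof.
move=> sA sB; exists (disked_hull (A `|` B)); split.
- exact: is_disk_hull.
- by apply: small_hull; exact: smallU.
- by move=> x Ax; apply: sub_disked_hull; left.
- by move=> x Ax; apply: sub_disked_hull; right.
Qed.

Lemma born_cvg_scaled (V : bornType R) (u : nat -> V) l : born_cvg u l ->
  exists T, [/\ is_disk T, small T & forall e, 0 < e ->
    exists N, forall n, (N <= n)%N -> scaled_in T e (u n - l)].
Proof.
move=> [T [dT sT Tu Tl ul]]; exists T; split => // e e0.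
move/cvgrPdist_lt : ul => /(_ e e0)[N _ Ne]; exists N => n /Ne /=.
rewrite sub0r normrN ger0_norm ?gauge_ge0// => ne.
by apply: gauge_lt_scaled => //; exact: lspanB.
Qed.

(** By completeness the small set lies in a disk whose gauge is a norm, and the norm of [x] is below
    every [e]. Uniqueness of limits rests on this. *)
Lemma small_scaled_eq0 (V : bornType R) (A : set V) x : complete_born V ->
  small A -> (forall e, 0 < e -> scaled_in A e x) -> x = 0.
Proof.
move=> cV /cV[T [AT sT [dT g0 _]]] Ax.
have Tx e : 0 < e -> scaled_in T e x.
  by move=> /Ax; exact: scaled_in_sub.
apply: g0; first exact: scaled_in_lspan (Tx _ ltr01).
apply/eqP; rewrite eq_le gauge_ge0 andbT; apply/ler_addgt0Pl => e e0.
by rewrite addr0; apply: scaled_gauge => //; exact: Tx.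
Qed.

Lemma born_cvg_unique (V : bornType R) (u : nat -> V) l k : complete_born V ->
  born_cvg u l -> born_cvg u k -> l = k.
Proof.
move=> cV /born_cvg_scaled[A [dA sA Au]] /born_cvg_scaled[B [dB sB Bu]].
have [T [dT sT AT BT]] := small_disk_sub2 sA sB.
apply/eqP; rewrite -subr_eq0; apply/eqP; apply: (small_scaled_eq0 cV sT) => e e0.
have e2 : 0 < e / 2 by exact: divr_gt0.
have [M Me] := Au _ e2; have [N Ne] := Bu _ e2.
have -> : l - k = (u (maxn M N) - k) - (u (maxn M N) - l).
  by rewrite opprB [RHS]addrC subrKA.
rewrite (splitr e); apply: scaled_inB => //; try exact: ltW.
  by apply: scaled_in_sub BT (Ne _ _); exact: leq_maxr.
by apply: scaled_in_sub AT (Me _ _); exact: leq_maxl.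
Qed.

Lemma fast_cvg_unique (V : bornType R) (u : nat -> V) l k : complete_born V ->
  fast_cvg u l -> fast_cvg u k -> l = k.
Proof. by move=> cV /fast_born_cvg ul /fast_born_cvg; exact: born_cvg_unique. Qed.

Lemma fast_cvg_comp (V W : bornType R) (f : V -> W) u l : bounded_linear f ->
  fast_cvg u l -> fast_cvg (f \o u) (f l).
Proof.
move=> [fl fb] [A [dA sA Au]]; exists (f @` A); split.
- exact: is_disk_image.
- exact: fb.
- move=> n /=; have := scaled_in_linear fl (Au n).
  by rewrite -scaleN1r addrC fl scaleN1r addrC.
Qed.

Lemma born_cvg_comp (V W : bornType R) (f : V -> W) u l : bounded_linear f ->
  born_cvg u l -> born_cvg (f \o u) (f l).
Proof.
move=> [fl fb] uBl; have [T [dT sT Tu Tl ul]] := uBl.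
have fB x y : f (x - y) = f x - f y.
  by rewrite -scaleN1r addrC fl scaleN1r addrC.
have flspan x : lspan T x -> lspan (f @` T) (f x).
  by move=> /(lspan_scaled dT)[r _ /(scaled_in_linear fl)/scaled_in_lspan].
have dfT := is_disk_image fl dT.
exists (f @` T); split => //; first exact: fb.
- by move=> n; exact: flspan.
- exact: flspan.
apply/cvgrPdist_le => e e0; move/cvgrPdist_lt : ul => /(_ e e0)[N _ Ne].
exists N => // n /Ne /=.
rewrite sub0r normrN ger0_norm ?gauge_ge0// => ne.
rewrite sub0r normrN ger0_norm ?gauge_ge0//.
apply: scaled_gauge => //; rewrite -fB; apply: scaled_in_linear => //.
by apply: gauge_lt_scaled => //; exact: lspanB.
Qed.

Lemma fast_cvg_lin (V : bornType R) (a : R[i]) (u v : nat -> V) l k :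
  fast_cvg u l -> fast_cvg v k -> fast_cvg (fun n => a *: u n + v n) (a *: l + k).
Proof.
move=> [A [dA sA Au]] [B [dB sB Bu]].
have [T [dT sT AT BT]] := small_disk_sub2 (smallZ a sA) sB.
exists [set (2 : R)%:C *: x | x in T]; split.
- exact: is_diskZset.
- exact: smallZ.
move=> n; apply: scaled_in_scale => //; rewrite mulr_natl mulr2n.
have -> : a *: u n + v n - (a *: l + k) = a *: (u n - l) + (v n - k).
  by rewrite scalerBr opprD addrACA.
apply: scaled_inD => //; last exact: scaled_in_sub BT (Bu n).
have [t At ->] := Au n; exists (a *: t); last by rewrite !scalerA mulrC.
by apply: AT; exists t.
Qed.

Lemma fast_cvgD (V : bornType R) (u v : nat -> V) l k :
  fast_cvg u l -> fast_cvg v k -> fast_cvg (fun n => u n + v n) (l + k).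
Proof.
move=> ul vk; have := fast_cvg_lin 1 ul vk.
by under eq_fun do rewrite scale1r; rewrite scale1r.
Qed.

Lemma fast_cvg_cst (V : bornType R) (l : V) : fast_cvg (fun=> l) l.
Proof.
exists (disked_hull set0); split; first exact: is_disk_hull.
  by apply: small_hull; exact: small0.
by move=> n; rewrite subrr; apply: scaled_in0; exact: is_disk_hull.
Qed.

Lemma fast_cvg_sum (V : bornType R) (I : Type) (s : seq I) (u : I -> nat -> V) l :
  (forall i, fast_cvg (u i) (l i)) ->
  fast_cvg (fun n => \sum_(i <- s) u i n) (\sum_(i <- s) l i).
Proof.
move=> ul; elim: s => [|i s IH].
  by under eq_fun do rewrite big_nil; rewrite big_nil; exact: fast_cvg_cst.
by under eq_fun do rewrite big_cons; rewrite big_cons; exact: fast_cvgD.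
Qed.

Lemma fast_cvg_bilin (V W X : bornType R) (b : V -> W -> X) u v l k :
  bounded_bilinear b -> fast_cvg u l -> fast_cvg v k ->
  fast_cvg (fun n => b (u n) (v n)) (b l k).
Proof.
move=> [bl br bb] [A [dA sA Au]] [B [dB sB Bu]].
have [A' [dA' sA' AA' lA']] := small_disk_sub2 sA (small_set1 l).
have [B' [dB' sB' BB' kB']] := small_disk_sub2 sB (small_set1 k).
pose T := disked_hull [set x | exists v w, [/\ A' v, B' w & x = b v w]].
have dT : is_disk T by exact: is_disk_hull.
have Tb x y r : A' x -> scaled_in B' r y -> scaled_in T r (b x y).
  move=> Ax [z Bz ->]; exists (b x z); first by apply: sub_disked_hull; exists x, z.
  have b0 : b x 0 = 0 by have := br x (-1) 0 0; rewrite scaler0 addr0 scaleN1r addNr.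
  by rewrite -[X in b x X]addr0 br b0 addr0.
have Tb' x y r : scaled_in A' r x -> B' y -> scaled_in T r (b x y).
  move=> [z Bz ->] Ay; exists (b z y); first by apply: sub_disked_hull; exists z, y.
  have b0 : b 0 y = 0 by have := bl y (-1) 0 0; rewrite scaler0 addr0 scaleN1r addNr.
  by rewrite -[X in b X y]addr0 bl b0 addr0.
(* One unit for each of the three terms into which the difference is expanded below. The term with
   both errors is quadratically small, and one of its factors is spent as [rate n <= 1]. *)
exists [set (3 : R)%:C *: x | x in T]; split.
- exact: is_diskZset.
- by apply: smallZ; apply: small_hull; exact: bb.
move=> n; apply: scaled_in_scale => //.
have bBl x y z : b (x - y) z = b x z - b y z.
  by rewrite -scaleN1r addrC bl scaleN1r addrC.
have bBr x y z : b x (y - z) = b x y - b x z.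
  by rewrite -scaleN1r addrC br scaleN1r addrC.
have -> : b (u n) (v n) - b l k =
    b (u n - l) (v n - k) + b (u n - l) k + b l (v n - k).
  by rewrite !bBl !bBr addrAC subrK subrKA.
have -> : (3 : R) * rate n = rate n + rate n + rate n by ring.
have un : scaled_in A' (rate n) (u n - l) by exact: scaled_in_sub AA' (Au n).
have vn : scaled_in B' (rate n) (v n - k) by exact: scaled_in_sub BB' (Bu n).
apply: scaled_inD => //; first exact: addr_ge0.
  apply: scaled_inD => //; last by apply: Tb' => //; exact: kB'.
  have [t At ->] := un.
  apply: (@scaled_in_le _ _ _ (1 * rate n)) => //; first by rewrite mul1r.
    by rewrite mul1r.
  have -> : b ((rate n)%:C *: t) (v n - k) = (rate n)%:C *: b t (v n - k).
    have b0 : b 0 (v n - k) = 0.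
      by have := bl (v n - k) (-1) 0 0; rewrite scaler0 addr0 scaleN1r addNr.
    by rewrite -[X in b X _]addr0 bl b0 addr0.
  rewrite mulrC; apply: scaled_inZ => //; first by rewrite norm_realC.
  apply: (@scaled_in_le _ _ _ (rate n)) => //; last exact: Tb.
  by rewrite invf_le1 ?ltr0Sn// ler1n.
by apply: Tb => //; exact: lA'.
Qed.

(** The disk is chosen before the sequence: it depends on [A] alone, and this is what makes limits
    of operators uniform on small sets. *)
Lemma complete_fast_lim (X : bornType R) (A : set X) : complete_born X ->
  is_disk A -> small A -> exists T, [/\ is_disk T, small T &
  forall u : nat -> X,
    (forall m n, (m <= n)%N -> scaled_in A (rate m) (u n - u m)) ->
    exists l, forall n, scaled_in T (rate n) (u n - l)].
Proof.
move=> cX dA sA; have [T [AT sT [dT _ Tc]]] := cX A sA.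
(* The error at [n] is split at a late index [m]: the distance from [m] to the limit and the
   distance from [m] to [n], each of size [rate n]. *)
exists [set (2 : R)%:C *: x | x in T]; split.
- exact: is_diskZset.
- exact: smallZ.
move=> u uA.
have uT m n : (m <= n)%N -> scaled_in T (rate m) (u n - u m).
  by move=> /uA; exact: scaled_in_sub.
(* Only differences of the sequence are known to lie in the span of [T], so the limit is taken after
   subtracting the first term. *)
have [||k Tk ck] := Tc (fun n => u n - u 0%N).
- by move=> n; apply: scaled_in_lspan (uT 0%N n _).
- move=> e e0; have e2 : 0 < e / 2 by exact: divr_gt0.
  have [N Ne] := rate_lt e2; exists N => m n Nm Nn.
  have -> : u m - u 0%N - (u n - u 0%N) = u m - u N - (u n - u N).
    by rewrite ![- (u n - _)]opprB !subrKA.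
  have h : scaled_in T (rate N + rate N) (u m - u N - (u n - u N)).
    by apply: scaled_inB => //; exact: uT.
  apply: le_lt_trans (scaled_gauge dT _ h) _; first exact: addr_gt0.
  by rewrite (splitr e) ltrD// Ne.
exists (k + u 0%N) => n; apply: scaled_in_scale => //.
have [N Ne] : exists N, forall m, (N <= m)%N ->
    gauge T (u m - u 0%N - k) < rate n.
  move/cvgrPdist_lt : ck => /(_ _ (rate_gt0 n))[N _ Ne]; exists N => m /Ne /=.
  by rewrite sub0r normrN ger0_norm ?gauge_ge0.
pose m := maxn N n.
have -> : u n - (k + u 0%N) = (u m - u 0%N - k) - (u m - u n).
  by rewrite opprB [RHS]addrC -[u m - _ - k]addrA subrKA opprD [- k - _]addrC.
rewrite mulr_natl mulr2n; apply: scaled_inB => //; last by apply: uT; exact: leq_maxr.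
apply: gauge_lt_scaled => //; last by apply: Ne; exact: leq_maxl.
by apply: lspanB => //; apply: scaled_in_lspan (uT 0%N m _).
Qed.

(** The limit is chosen point by point; by uniqueness it agrees with the limit provided by the
    common disk of any small set containing the point, so the choice is automatically linear and
    uniform. *)
Lemma bhom_fast_lim (V X : bornType R) (P : nat -> V -> X) :
  complete_born X -> (forall n, bounded_linear (P n)) ->
  (forall B, small B -> exists A, [/\ is_disk A, small A & forall x m n, B x ->
     (m <= n)%N -> scaled_in A (rate m) (P n x - P m x)]) ->
  exists2 L : V -> X, bounded_linear L & ufast_cvg P L.
Proof.
move=> cX Pb Pc.
have ex B : small B -> exists A, [/\ is_disk A, small A & forall x, B x ->
    exists l, forall n, scaled_in A (rate n) (P n x - l)].
  move=> /Pc[A [dA sA AP]]; have [T [dT sT Tl]] := complete_fast_lim cX dA sA.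
  exists T; split => // x Bx; apply: (Tl (P ^~ x)) => m n; exact: AP.
have exl x : exists l, fast_cvg (P ^~ x) l.
  have [A [dA sA /(_ x erefl)[l Al]]] := ex _ (small_set1 x).
  by exists l, A.
pose L x := projT1 (cid (exl x)).
have LP x : fast_cvg (P ^~ x) (L x) by exact: (projT2 (cid (exl x))).
have uL : ufast_cvg P L.
  move=> B /ex[A [dA sA Al]]; exists A; split => // x n Bx.
  have [l lA] := Al x Bx.
  rewrite (@fast_cvg_unique _ (P ^~ x) (L x) l)//.
  by exists A.
exists L => //; split.
  move=> a x y; apply: (fast_cvg_unique cX (LP _)).
  have := fast_cvg_lin a (LP x) (LP y).
  by under eq_fun do rewrite -(Pb _).1.
(* Since [rate 0] is 1, on [B] the limit differs from [P 0] by elements of the single small set [A];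
   so its image is small. *)
move=> B sB; have [A [dA sA AL]] := uL B sB.
apply: smallW (smallD ((Pb 0%N).2 _ sB) (smallZ (-1) sA)) _ => _ [x Bx <-].
have [t At e] := AL x 0%N Bx.
exists (P 0%N x), (-1 *: t); split; [by exists x|by exists t|].
have -> : t = P 0%N x - L x by rewrite e /rate invr1 scale1r.
by rewrite scaleN1r opprB addrC subrK.
Qed.

End FastConvergence.
#[global] Hint Resolve rate_gt0 rate_ge0 : core.

Lemma cvg_sumv (R : realType) (E : normedModType R) T (F : set_system T)
    {FF : Filter F} (I : Type) (r : seq I) (u : I -> T -> E) (l : I -> E) :
  (forall i, u i x @[x --> F] --> l i) ->
  \sum_(i <- r) u i x @[x --> F] --> \sum_(i <- r) l i.
Proof.
move=> ul; elim: r => [|i r IH].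
  by under eq_fun do rewrite big_nil; rewrite big_nil; exact: cvg_cst.
by under eq_fun do rewrite big_cons; rewrite big_cons; exact: cvgD.
Qed.

(** * Families of smooth functions *)

Section DirectionalDerivatives.
Context {R : realType} {E : normedModType R}.
Implicit Types (f : E -> R) (x y u v : E).

Lemma line_quotient (F : normedModType R) (f : E -> F) x v (s : R) :
  (fun h : R => h^-1 *: (((fun t : R => f (x + t *: v)) \o shift s) (h *: (1 : R))
     - f (x + s *: v))) =
  (fun h => h^-1 *: ((f \o shift (x + s *: v)) (h *: v) - f (x + s *: v))).
Proof.
apply/funext => h /=; congr (_ *: (f _ - _)).
by rewrite scalerDl addrCA -[h *: 1]/(h * 1) mulr1.
Qed.

Lemma derive_line (F : normedModType R) (f : E -> F) x v s :
  'D_(1 : R) (fun t : R => f (x + t *: v)) s = 'D_v f (x + s *: v).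
Proof. by rewrite /derive line_quotient. Qed.

Lemma derivable_line (F : normedModType R) (f : E -> F) x v s :
  derivable (fun t : R => f (x + t *: v)) s 1 <-> derivable f (x + s *: v) v.
Proof. by rewrite /derivable line_quotient. Qed.

Lemma is_derive_line f x v s : derivable f (x + s *: v) v ->
  is_derive s 1 (fun t : R => f (x + t *: v)) ('D_v f (x + s *: v)).
Proof.
by move=> fd; apply: DeriveDef; [exact/derivable_line|exact: derive_line].
Qed.

Lemma is_derive_scale f x v (h : R) : derivable f x v ->
  derivable f x (h *: v) /\ 'D_(h *: v) f x = h * 'D_v f x.
Proof.
move=> fd; have fd0 : derivable f (x + 0 *: v) v by rewrite scale0r addr0.
have d1 : is_derive (h * 0) 1 (fun t : R => f (x + t *: v)) ('D_v f x).
  by rewrite mulr0; have := is_derive_line fd0; rewrite scale0r addr0.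
have d2 : is_derive (0 : R) 1 (fun t : R => h * t) h.
  have : is_derive (0 : R) 1 (h *: @id R) (h *: (1 : R)) by exact: is_deriveZ.
  by rewrite -[h *: 1]/(h * 1) mulr1.
have d3 := is_derive1_comp d1 d2.
have e : (fun t : R => f (x + t *: v)) \o (fun t : R => h * t) =
    (fun t : R => f (x + t *: (h *: v))).
  by apply/funext => t /=; rewrite scalerA mulrC.
rewrite e in d3; split.
  by have := @ex_derive _ _ _ _ _ _ _ d3; move/derivable_line; rewrite scale0r addr0.
have := @derive_val _ _ _ _ _ _ _ d3; rewrite derive_line scale0r addr0 => ->.
by rewrite mulrC.
Qed.

Lemma MVT_line f x v : (forall s : R, 0 <= s <= 1 -> derivable f (x + s *: v) v) ->
  exists2 s : R, 0 <= s <= 1 & f (x + v) - f x = 'D_v f (x + s *: v).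
Proof.
move=> fd.
have [||s] := @MVT_segment R (fun t => f (x + t *: v))
    (fun t => 'D_v f (x + t *: v)) 0 1 ler01.
- by move=> s; rewrite in_itv /= => /andP[/ltW s0 /ltW s1];
    apply: is_derive_line; apply: fd; rewrite s0.
- apply: derivable_within_continuous => s; rewrite in_itv /= => s01.
  exact/derivable_line/fd.
rewrite in_itv /= => s01; rewrite scale1r scale0r addr0 subr0 mulr1 => ->.
by exists s.
Qed.

(** Continuity of each directional derivative is assumed, not differentiability; linearity in the
    direction is derived from it in [deriveDv]. *)
Definition C1_on (U : set E) f := forall y, U y -> forall v,
  derivable f y v /\ {for y, continuous ('D_v f)}.

Lemma open_seg (U : set E) x : open U -> U x ->
  exists2 d : R, 0 < d & forall u, `|u| < d ->
    forall s : R, 0 <= s <= 1 -> U (x + s *: u).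
Proof.
move=> oU Ux; have /nbhs_ballP[d /= d0 dU] : nbhs x U by exact: open_nbhs_nbhs.
exists d => // u ud s /andP[s0 s1]; apply: dU; rewrite -ball_normE /=.
rewrite opprD addrA subrr sub0r normrN normrZ ger0_norm//.
by rewrite (le_lt_trans _ ud)// ler_piMl.
Qed.

(** Directional derivatives need not be additive in the direction by themselves. The increment along
    [u + v] is split at [x + h u]; the mean value theorem turns the second leg into a derivative
    along [v] at a nearby point, and continuity of that derivative finishes. *)
Lemma deriveDv (U : set E) f x u v : open U -> C1_on U f -> U x ->
  'D_(u + v) f x = 'D_u f x + 'D_v f x.
Proof.
move=> oU fC Ux; have [d d0 dU] := open_seg oU Ux.
have [duv _] := fC x Ux (u + v); have [du _] := fC x Ux u.
have [_ cv] := fC x Ux v.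
apply: (@cvg_unique _ _ (h^-1 *: ((f \o shift x) (h *: (u + v)) - f x) @[h --> 0^'])).
  exact: norm_hausdorff.
  exact: duv.
apply/cvgrPdist_lt => e e0; have e2 : 0 < e / 2 by exact: divr_gt0.
move/cvgrPdist_lt : du => /(_ _ e2) nu.
have /cvgrPdist_lt/(_ _ e2)/nbhs_ballP[r /= r0 nv] := cv.
pose M := `|u| + `|v| + 1.
have M0 : 0 < M by rewrite /M ltr_wpDl// addr_ge0.
have nh : \forall h \near (0 : R)^', `|h| < Num.min d r / M.
  apply: cvg_within; apply/nbhs_ballP; exists (Num.min d r / M) => /=.
    by rewrite divr_gt0// lt_min d0.
  by move=> h; rewrite -ball_normE /= sub0r normrN.
near=> h.
have h0 : h != 0 by near: h; exact: nbhs_dnbhs_neq.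
have hM : `|h| < Num.min d r / M by near: h.
have bnd s : 0 <= s <= 1 -> `|h *: u + s *: (h *: v)| < Num.min d r.
  move=> /andP[s0 s1]; apply: le_lt_trans (ler_normD _ _) _.
  rewrite !normrZ (ger0_norm s0); move: hM; rewrite ltr_pdivlMr//.
  apply: le_lt_trans; rewrite /M !mulrDr mulr1.
  apply: (@le_trans _ _ (`|h| * `|u| + `|h| * `|v|)); last by rewrite lerDl.
  by rewrite lerD2l ler_piMl// mulr_ge0.
have Us s : 0 <= s <= 1 -> U (x + h *: u + s *: (h *: v)).
  move=> s01; have := bnd s s01; rewrite lt_min => /andP[bd _].
  by rewrite -addrA; have := dU _ bd 1; rewrite ler01 lexx scale1r; apply.
have [s s01] : exists2 s : R, 0 <= s <= 1 &
    f (x + h *: u + h *: v) - f (x + h *: u) =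
    'D_(h *: v) f (x + h *: u + s *: (h *: v)).
  by apply: MVT_line => s /Us /fC/(_ (h *: v))[].
have [dv _] := fC _ (Us s s01) v.
rewrite (is_derive_scale h dv).2 => fs.
have -> : h^-1 *: ((f \o shift x) (h *: (u + v)) - f x) =
    'D_v f (x + h *: u + s *: (h *: v)) + h^-1 *: ((f \o shift x) (h *: u) - f x).
  rewrite /= [h *: (u + v)]scalerDr [h *: u + h *: v + x]addrC addrA [h *: u + x]addrC.
  rewrite -(subrK (f (x + h *: u)) (f (x + _ + _))) fs -addrA scalerDr.
  by rewrite -[h^-1 *: (h * _)]/(h^-1 * (h * _)) mulKf.
rewrite [X in `|_ + _ - X|]addrC opprD addrACA (splitr e).
apply: le_lt_trans (ler_normD _ _) _; apply: ltrD; first by near: h.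
apply: nv; rewrite -ball_normE /= -addrA opprD addrA subrr sub0r normrN.
by have := bnd s s01; rewrite lt_min => /andP[].
Unshelve. all: by end_near. Qed.

Lemma derive_sumv (U : set E) f x (I : Type) (r : seq I) (c : I -> R) (b : I -> E) :
  open U -> C1_on U f -> U x ->
  'D_(\sum_(i <- r) c i *: b i) f x = \sum_(i <- r) c i * 'D_(b i) f x.
Proof.
move=> oU fC Ux; elim: r => [|i r IH]; first by rewrite !big_nil derive0.
rewrite !big_cons (deriveDv _ _ oU fC Ux) IH; congr (_ + _).
by rewrite (is_derive_scale _ (fC x Ux (b i)).1).2.
Qed.

End DirectionalDerivatives.

(** * Finite-dimensional spaces and the chain rule *)

Section Basis.
Context {R : realType}.

(** The bound [bcoo_bnd] is part of the data: it carries the equivalence of norms in finite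
    dimension and makes coordinates continuous. *)
Record basis (E : normedModType R) := Basis {
  bidx : finType ;
  bvec : bidx -> E ;
  bcoo : bidx -> E -> R ;
  bcoo_lin : forall i a u v, bcoo i (a *: u + v) = a * bcoo i u + bcoo i v ;
  bcoo_sum : forall v, v = \sum_i bcoo i v *: bvec i ;
  bcoo_vec : forall i j, bcoo i (bvec j) = (i == j)%:R ;
  bcoo_bnd : exists2 C : R, 0 < C & forall i v, `|bcoo i v| <= C * `|v| }.

(** The norm of the combination is continuous on the compact unit sphere of coefficients, so it
    attains a minimum there; freeness makes the minimum positive, and homogeneity spreads the
    bound. *)
Lemma spanning_lower_bound (E : normedModType R) n (b : 'I_n -> E) :
  (forall c : 'I_n -> R, \sum_k c k *: b k = 0 -> forall k, c k = 0) ->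
  exists2 m : R, 0 < m & forall (c : 'I_n -> R) i, m * `|c i| <= `|\sum_k c k *: b k|.
Proof.
move=> bfree; pose N (c : 'rV[R]_n) := `|\sum_k c ord0 k *: b k|.
have cN : continuous N.
  have h : continuous (fun c : 'rV[R]_n => \sum_k c ord0 k *: b k).
    move=> c; apply: (@cvg_sumv _ _ _ (nbhs c)) => k.
    by apply: cvgZr_tmp; exact: coord_continuous.
  by move=> c; apply: continuous_comp; [exact: h|exact: norm_continuous].
pose S := [set c : 'rV[R]_n | `|c| = 1].
have cS : compact S.
  apply: bounded_closed_compact.
    exists 1; split => // x x1 c /= ->; exact: ltW.
  apply: (@closed_comp _ _ (fun c : 'rV[R]_n => `|c|) [set (1 : R)]).
    by move=> c _; exact: norm_continuous.
  exact: closed_eq.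
have coordle (c : 'rV[R]_n) i : `|c ord0 i| <= `|c|.
  rewrite [leRHS]/Num.Def.normr /= mx_normrE; apply/bigmax_geP; right => /=.
  by exists (ord0, i).
have [m m0 mN] : exists2 m, 0 < m & forall c, S c -> m <= N c.
  (* The sphere is empty when there are no vectors; any positive constant then serves. *)
  have [S0|/set0P S0] := eqVneq S set0.
    by exists 1 => // c; rewrite S0.
  have [c cS' cm] := compact_EVT_min S0 cS (continuous_subspaceT cN).
  exists (N c); last by move=> t St; apply: cm; exact/mem_set.
  rewrite normr_gt0; apply/eqP => Nc0.
  have c0 : c = 0.
    by apply/matrixP => i k; rewrite ord1 mxE; exact: (bfree (c ord0) Nc0).
  by move: cS'; rewrite inE /S /= c0 normr0 => /eqP; rewrite eq_sym oner_eq0.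
exists m => // c i; pose v : 'rV[R]_n := \row_k c k.
have -> : \sum_k c k *: b k = \sum_k v ord0 k *: b k.
  by apply: eq_bigr => k _; rewrite mxE.
have -> : c i = v ord0 i by rewrite mxE.
have [v0|v0] := eqVneq v 0.
  by rewrite v0 mxE normr0 mulr0.
have nv : 0 < `|v| by rewrite normr_gt0.
apply: (@le_trans _ _ (m * `|v|)); first by rewrite ler_pM2l// coordle.
have : S (`|v|^-1 *: v).
  by rewrite /S /= normrZ normfV normr_id mulVf// gt_eqF.
move/mN; rewrite /N.
have -> : \sum_k (`|v|^-1 *: v) ord0 k *: b k = `|v|^-1 *: \sum_k v ord0 k *: b k.
  by rewrite scaler_sumr; apply: eq_bigr => k _; rewrite mxE scalerA.
by rewrite normrZ normfV normr_id ler_pdivlMl// mulrC.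
Qed.

Lemma basis_exists (E : normedModType R) :
  (exists n (e : 'I_n -> E), forall v,
    exists c : 'I_n -> R, v = \sum_(k < n) c k *: e k) ->
  exists B : basis E, True.
Proof.
move=> Efin.
have ex0 : exists n, `[< exists e : 'I_n -> E, forall v,
    exists c : 'I_n -> R, v = \sum_(k < n) c k *: e k >].
  by have [n he] := Efin; exists n; exact/asboolP.
case: (ex_minnP ex0) => n /asboolP[b bs] nmin.
(* A spanning family of minimal size is free: a nontrivial relation would eliminate one of its
   vectors. *)
have bfree (c : 'I_n -> R) : \sum_k c k *: b k = 0 -> forall k, c k = 0.
  move=> c0 k; apply: contrapT => /eqP ck; move: bs nmin c0; clear ex0.
  case: n b c k ck => [b c []//|n b c k ck bs nmin c0].
  suff /nmin : `[< exists e : 'I_n -> E, forall v,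
      exists c : 'I_n -> R, v = \sum_(k < n) c k *: e k >] by rewrite ltnn.
  apply/asboolP; exists (fun i => b (lift k i)) => v.
  have [d ->] := bs v.
  exists (fun i => d (lift k i) - d k / c k * c (lift k i)).
  move: c0; rewrite (bigD1_ord k)//= => /eqP; rewrite addr_eq0 => /eqP c0.
  rewrite (bigD1_ord k)//=.
  have -> : b k = - ((c k)^-1 *: \sum_(i < n) c (lift k i) *: b (lift k i)).
    by rewrite -[\sum_(i < n) _]opprK -c0 scalerN opprK scalerA mulVf// scale1r.
  rewrite scalerN scalerA scaler_sumr -sumrN -big_split /=; apply: eq_bigr => i _.
  by rewrite scalerBl scalerA addrC.
have [m m0 mb] := spanning_lower_bound bfree.
pose coo v := projT1 (cid (bs v)).
have cooE v : v = \sum_k coo v k *: b k by exact: (projT2 (cid (bs v))).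
have coou v c : v = \sum_k c k *: b k -> forall k, coo v k = c k.
  move=> vc k; apply/eqP; rewrite -subr_eq0; apply/eqP.
  apply: (bfree (fun k => coo v k - c k)).
  under eq_bigr do rewrite scalerBl.
  by rewrite sumrB -cooE -vc subrr.
unshelve eexists; last exact: I.
unshelve eapply (@Basis E 'I_n b (fun i v => coo v i)).
- move=> i a u v /=; apply: (coou _ (fun k => a * coo u k + coo v k)) => //.
  rewrite {1}(cooE u) {1}(cooE v) scaler_sumr -big_split /=.
  by apply: eq_bigr => k _; rewrite scalerDl scalerA.
- exact: cooE.
- move=> i j /=; apply: (coou _ (fun k => (k == j)%:R)).
  rewrite (bigD1 j)//= eqxx scale1r big1 ?addr0// => k /negPf ->.
  by rewrite scale0r.
- exists m^-1; first by rewrite invr_gt0.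
  by move=> i v /=; rewrite mulrC ler_pdivlMr// mulrC {2}(cooE v); exact: mb.
Qed.

End Basis.

Arguments bcoo {R E} b.

Section ChainRule.
Context {R : realType} {E E' : normedModType R} (B : basis E').

Lemma bcooB i u v : bcoo B i (u - v) = bcoo B i u - bcoo B i v.
Proof. by rewrite -scaleN1r addrC bcoo_lin mulN1r addrC. Qed.

Lemma bcooD i u v : bcoo B i (u + v) = bcoo B i u + bcoo B i v.
Proof. by rewrite -[u]scale1r bcoo_lin scale1r mul1r. Qed.

Lemma bcoo0 i : bcoo B i 0 = 0.
Proof. by rewrite -(subrr 0) bcooB subrr. Qed.

Lemma bcooZ i a u : bcoo B i (a *: u) = a * bcoo B i u.
Proof. by rewrite -[a *: u]addr0 bcoo_lin bcoo0 addr0. Qed.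

Lemma derivable_near_line (f : E -> R) x v : derivable f x v ->
  f (h *: v + x) @[h --> (0 : R)^'] --> f x.
Proof.
move=> fd; have fd0 : derivable f (x + 0 *: v) v by rewrite scale0r addr0.
have /derivable1_diffP/differentiable_continuous h := (derivable_line f x v 0).2 fd0.
apply: cvg_within_filter.
have := h; rewrite /prop_for /continuous_at /= scale0r addr0.
by under eq_fun do rewrite addrC.
Qed.

Lemma is_derive_chain (U : set E') (f : E' -> R) (g : E -> E') x v :
  open U -> C1_on U f -> U (g x) ->
  (forall i, derivable (bcoo B i \o g) x v) ->
  is_derive x v (f \o g)
    (\sum_i 'D_v (bcoo B i \o g) x * 'D_(bvec i) f (g x)).
Proof.
move=> oU fC Ux gd; set y := g x.
have [d d0 dU] := open_seg oU Ux.
pose D h := g (h *: v + x) - y.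
(* When the increment is too large for the segment to stay in [U], the value [y] is a mere default
   that keeps the choice total; it does not occur for small [h]. *)
have exi h : exists z, `|z - y| <= `|D h| /\
    (`|D h| < d -> U z /\ f (g (h *: v + x)) - f y = 'D_(D h) f z).
  have [Dd|Dd] := ltP `|D h| d; last by exists y; rewrite subrr normr0.
  have Us := dU _ Dd; have [s s01 fs] : exists2 s : R, 0 <= s <= 1 &
      f (y + D h) - f y = 'D_(D h) f (y + s *: D h).
    by apply: MVT_line => s /Us /fC/(_ (D h))[].
  exists (y + s *: D h); split.
    move: s01 => /andP[s0 s1].
    by rewrite addrAC subrr add0r normrZ ger0_norm// ler_piMl.
  by move=> _; split; [exact: Us|rewrite -fs /D [y + _]addrC subrK].
have /choice[xi xiP] := exi.
have gi i : bcoo B i (g (h *: v + x)) @[h --> (0 : R)^'] --> bcoo B i y.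
  exact: derivable_near_line (gd i).
have D0 : D h @[h --> (0 : R)^'] --> (0 : E').
  rewrite -(subrr y); apply: cvgB; last exact: cvg_cst.
  rewrite [X in _ --> X](bcoo_sum B).
  under eq_fun do rewrite [g _](bcoo_sum B).
  by apply: cvg_sumv => i; apply: cvgZr_tmp; exact: gi.
have xiy : xi h @[h --> (0 : R)^'] --> y.
  apply/cvgrPdist_le => e e0; move/cvgrPdist_le : D0 => /(_ e e0).
  apply: filterS => h; rewrite sub0r normrN => De.
  by rewrite distrC (le_trans (xiP h).1).
have cvgq : h^-1 *: (((f \o g) \o shift x) (h *: v) - (f \o g) x)
    @[h --> (0 : R)^'] -->
    \sum_i 'D_v (bcoo B i \o g) x * 'D_(bvec i) f y.
  have Dd : \forall h \near (0 : R)^', `|D h| < d.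
    move/cvgrPdist_lt : D0 => /(_ d d0); apply: filterS => h.
    by rewrite sub0r normrN.
  suff cq : \sum_i (h^-1 *: ((bcoo B i \o g) (h *: v + x) - (bcoo B i \o g) x))
      * 'D_(bvec i) f (xi h) @[h --> (0 : R)^'] -->
      \sum_i 'D_v (bcoo B i \o g) x * 'D_(bvec i) f y.
    apply: cvg_trans cq; apply: near_eq_cvg.
    apply: filterS Dd => h /(xiP h).2[Uxi /= fE]; rewrite fE.
    rewrite [D h](bcoo_sum B) (derive_sumv _ _ _ oU fC Uxi).
    rewrite scaler_sumr; apply: eq_bigr => i _.
    by rewrite bcooB -[LHS]mulrA.
  apply: cvg_sumv => i; apply: cvgM; first exact: gd.
  have [_ ci] := fC y Ux (bvec i).
  exact: (@cvg_comp _ _ _ xi ('D_(bvec i) f) _ (nbhs y) _ xiy ci).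
by apply: DeriveDef; [apply/cvg_ex; eexists; exact: cvgq|exact: cvg_lim cvgq].
Qed.

End ChainRule.

Section LinearFunctionals.
Context {R : realType} {E : normedModType R}.

Lemma linfun_continuous (F : normedModType R) (l : F -> R) (C : R) :
  (forall u v, l (u - v) = l u - l v) -> (forall v, `|l v| <= C * `|v|) ->
  continuous l.
Proof.
move=> lB lC x; apply/cvgrPdist_lt => e e0.
have C1 : 0 < `|C| + 1 by rewrite ltr_wpDl.
near=> y; rewrite -lB; apply: le_lt_trans (lC _) _.
apply: (@le_lt_trans _ _ ((`|C| + 1) * `|x - y|)).
  by rewrite ler_wpM2r// (le_trans (ler_norm C))// lerDl.
rewrite -ltr_pdivlMl// mulrC; near: y.
apply: (@cvgr_dist_lt _ _ _ (nbhs x) _ id); first exact: cvg_id.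
exact: divr_gt0.
Unshelve. all: by end_near. Qed.

Lemma bcoo_continuous (B : basis E) i : continuous (bcoo B i).
Proof.
have [C _ BC] := bcoo_bnd B.
by apply: (@linfun_continuous _ _ C) => // u v; exact: bcooB.
Qed.

End LinearFunctionals.

Section LinearFunctionals2.
Context {R : realType} {E E' : normedModType R} (B : basis E').

Lemma is_derive_bcoo_comp i (g : E -> E') x v : derivable g x v ->
  is_derive x v (bcoo B i \o g) (bcoo B i ('D_v g x)).
Proof.
move=> gd.
have cvgq : h^-1 *: (((bcoo B i \o g) \o shift x) (h *: v) - (bcoo B i \o g) x)
    @[h --> (0 : R)^'] --> bcoo B i ('D_v g x).
  have h : bcoo B i (h^-1 *: ((g \o shift x) (h *: v) - g x))
      @[h --> (0 : R)^'] --> bcoo B i ('D_v g x).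
    exact: cvg_comp _ _ gd (@bcoo_continuous R E' B i ('D_v g x)).
  apply: cvg_trans h; apply: near_eq_cvg; apply: nearW => h.
  by rewrite bcooZ bcooB.
by apply: DeriveDef; [apply/cvg_ex; eexists; exact: cvgq|exact: cvg_lim cvgq].
Qed.

Lemma smooth_on_bcoo_comp i (U : set E) (g : E -> E') : open U ->
  smooth_on U g -> smooth_on U (bcoo B i \o g).
Proof.
move=> oU gs.
have dE vs : forall x, U x ->
    iter_derive vs (bcoo B i \o g) x = bcoo B i (iter_derive vs g x).
  elim: vs => [|v vs IH] x Ux //=.
  have := is_derive_bcoo_comp i ((gs vs x Ux).2 v) => /@derive_val <-.
  apply: near_eq_derive; near=> y; apply: IH; near: y.
  exact: open_nbhs_nbhs.
move=> vs x Ux; have [gc gd] := gs vs x Ux.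
have nE : {near x, (bcoo B i \o iter_derive vs g) =1 iter_derive vs (bcoo B i \o g)}.
  near=> y; apply/esym/dE; near: y; exact: open_nbhs_nbhs.
split=> [|v].
  rewrite /prop_for /continuous_at dE//.
  apply: cvg_trans (near_eq_cvg nE) _.
  by apply: continuous_comp => //; exact: bcoo_continuous.
apply: near_eq_derivable nE _.
exact: (@ex_derive _ _ _ _ _ _ _ (is_derive_bcoo_comp i (gd v))).
Unshelve. all: by end_near. Qed.

End LinearFunctionals2.

Lemma smooth_on_linfun (R : realType) (E : normedModType R) (U : set E)
    (l : E -> R) (C : R) : (forall a u v, l (a *: u + v) = a * l u + l v) ->
  (forall v, `|l v| <= C * `|v|) -> smooth_on U l.
Proof.
move=> ll lC.
have l0 : l 0 = 0.
  by apply/eqP; have := lC 0; rewrite normr0 mulr0 normr_le0.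
have lB u v : l (u - v) = l u - l v by rewrite -scaleN1r addrC ll mulN1r addrC.
have cl := linfun_continuous lB lC.
have dl x v : is_derive x v l (l v).
  have cvgq : h^-1 *: ((l \o shift x) (h *: v) - l x)
      @[h --> (0 : R)^'] --> l v.
    apply: (@cvg_trans _ (l v @[h --> (0 : R)^'])); last exact: cvg_cst.
    apply: near_eq_cvg; near=> h; rewrite /= ll addrK.
    rewrite -[RHS]/(h^-1 * (h * _)) mulKf//; near: h; exact: nbhs_dnbhs_neq.
  by apply: DeriveDef; [apply/cvg_ex; eexists; exact: cvgq|exact: cvg_lim cvgq].
apply/smooth_onE => -[|n].
  by case=> // _ x _; split; [exact: cl|move=> v; exact: ex_derive].
apply: smooth_uptoS.
  by case=> // _ x _; split; [exact: cl|move=> v; exact: ex_derive].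
move=> v; rewrite (_ : (fun x => _) = cst (l v)); first exact: smooth_upto_cst.
by apply/funext => x; exact: derive_val.
Unshelve. all: by end_near. Qed.

Lemma smooth_on_bcoo (R : realType) (E : normedModType R) (U : set E)
  (B : basis E) i : smooth_on U (bcoo B i).
Proof.
have [C _ BC] := bcoo_bnd B.
by apply: (@smooth_on_linfun _ _ _ _ C) => // a u v; exact: bcoo_lin.
Qed.

Section Families.
Context {R : realType} {J : Type} (A : set J) (w : J -> R).
Hypothesis w1 : forall j, A j -> 1 <= w j.

(* Families of functions whose derivatives grow at most polynomially in the
   weight w, uniformly on Q; for w = 1 these are the bounded families. *)
Definition mfam (E : normedModType R) (U Q : set E) n (f : J -> E -> R) :=
  (forall j, A j -> smooth_upto n U (f j)) /\ forall vs, (size vs <= n)%N -> exists C m, 0 <= C /\ forall j x, A j -> Q x ->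
    `|iter_derive vs (f j) x| <= C * w j ^+ m.

Section OneSpace.
Context {E : normedModType R} (U Q : set E).
Hypothesis oU : open U.
Hypothesis QU : Q `<=` U.
Implicit Types f g : J -> E -> R.

Lemma growthD C D m n j : 0 <= C -> 0 <= D -> A j ->
  C * w j ^+ m + D * w j ^+ n <= (C + D) * w j ^+ maxn m n.
Proof.
move=> C0 D0 Aj; rewrite mulrDl lerD// ler_wpM2l// ler_weXn2l//.
- by rewrite w1.
- exact: leq_maxl.
- by rewrite w1.
- exact: leq_maxr.
Qed.

Lemma eq_mfam n f g : (forall j x, A j -> U x -> f j x = g j x) ->
  mfam U Q n f -> mfam U Q n g.
Proof.
move=> fg [fs fb]; split=> [j Aj|vs /fb[C [m [C0 h]]]].
  by apply: (eq_smooth_upto oU _ (fs j Aj)) => x; exact: fg.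
exists C, m; split => // j x Aj Qx.
rewrite -(eq_iter_derive oU (fun x Ux => fg j x Aj Ux))//; first exact: h.
exact: QU.
Qed.

Lemma mfamW m n f : (m <= n)%N -> mfam U Q n f -> mfam U Q m f.
Proof.
move=> mn [fs fb]; split=> [j Aj|vs vm]; first exact: smooth_uptoW mn (fs j Aj).
exact/fb/(leq_trans vm).
Qed.

Lemma mfam_derive n f v : mfam U Q n.+1 f -> mfam U Q n (fun j x => 'D_v (f j) x).
Proof.
move=> [fs fb]; split=> [j Aj|vs vn]; first exact: smooth_upto_derive (fs j Aj).
have [|C [m [C0 h]]] := fb (rcons vs v); first by rewrite size_rcons.
by exists C, m; split => // j x Aj Qx; rewrite -iter_derive_rcons; exact: h.
Qed.

(** Inductions on the order peel off the derivative that is applied first, the last entry of the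
    list, because that is where the Leibniz and chain rules act. *)
Lemma mfamS n f : mfam U Q 0 f ->
  (forall v, mfam U Q n (fun j x => 'D_v (f j) x)) -> mfam U Q n.+1 f.
Proof.
move=> f0 fS; split=> [j Aj|vs].
  by apply: smooth_uptoS; [exact: f0.1|move=> v; exact: (fS v).1].
case: (lastP vs) => [_|ws v]; first exact: f0.2.
rewrite size_rcons ltnS => wsn; have [C [m [C0 h]]] := (fS v).2 ws wsn.
by exists C, m; split => // j x Aj Qx; rewrite iter_derive_rcons; exact: h.
Qed.

Lemma mfam0 f : (forall j, A j -> smooth_upto 0 U (f j)) ->
  (exists C m, 0 <= C /\ forall j x, A j -> Q x -> `|f j x| <= C * w j ^+ m) ->
  mfam U Q 0 f.
Proof. by move=> fs fb; split => //; case. Qed.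

Lemma mfam_bnd n f : mfam U Q n f ->
  exists C m, 0 <= C /\ forall j x, A j -> Q x -> `|f j x| <= C * w j ^+ m.
Proof. by move=> [_ /(_ [::] isT)]. Qed.

Lemma mfam_derivable n f j x v : mfam U Q n f -> A j -> U x -> derivable (f j) x v.
Proof. by move=> [fs _] Aj Ux; exact: (fs j Aj [::] isT x Ux).2. Qed.

Lemma mfamD n f g : mfam U Q n f -> mfam U Q n g -> mfam U Q n (fun j => f j \+ g j).
Proof.
elim: n f g => [|n IH] f g ff gg.
  apply: mfam0 => [j Aj|]; first exact: smooth_uptoD (ff.1 j Aj) (gg.1 j Aj).
  have [C [m [C0 fC]]] := mfam_bnd ff; have [D [k [D0 gD]]] := mfam_bnd gg.
  exists (C + D), (maxn m k); split; first exact: addr_ge0.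
  move=> j x Aj Qx; apply: le_trans (ler_normD _ _) _.
  by apply: le_trans (growthD _ _ C0 D0 Aj); rewrite lerD ?fC ?gD.
apply: mfamS; first by apply: (mfamW (leq0n n)); apply: IH; exact: mfamW (leqnSn n) _.
move=> v; apply: eq_mfam (IH _ _ (mfam_derive v ff) (mfam_derive v gg)).
move=> j x Aj Ux /=; rewrite deriveD//; first exact: mfam_derivable ff Aj Ux.
exact: mfam_derivable gg Aj Ux.
Qed.

Lemma mfamM n f g : mfam U Q n f -> mfam U Q n g -> mfam U Q n (fun j => f j \* g j).
Proof.
elim: n f g => [|n IH] f g ff gg.
  apply: mfam0 => [j Aj|]; first exact: smooth_uptoM (ff.1 j Aj) (gg.1 j Aj).
  have [C [m [C0 fC]]] := mfam_bnd ff; have [D [k [D0 gD]]] := mfam_bnd gg.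
  exists (C * D), (m + k)%N; split; first exact: mulr_ge0.
  move=> j x Aj Qx; rewrite normrM exprD mulrACA.
  by apply: ler_pM => //; [exact: fC|exact: gD].
have fn := mfamW (leqnSn n) ff; have gn := mfamW (leqnSn n) gg.
apply: mfamS; first by apply: (mfamW (leq0n n)); exact: IH.
move=> v; apply: eq_mfam (mfamD (IH _ _ fn (mfam_derive v gg))
  (IH _ _ gn (mfam_derive v ff))).
move=> j x Aj Ux /=; rewrite deriveM//; first exact: mfam_derivable ff Aj Ux.
exact: mfam_derivable gg Aj Ux.
Qed.

Lemma mfam_cst n (c : J -> R) C m : (forall j, A j -> `|c j| <= C * w j ^+ m) ->
  mfam U Q n (fun j _ => c j).
Proof.
move=> cC; split=> [j Aj|vs _]; first exact: smooth_upto_cst.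
exists `|C|, m; split => // j x Aj _.
have wm : 0 <= w j ^+ m by rewrite exprn_ge0// (le_trans ler01) ?w1.
apply: (@le_trans _ _ `|c j|).
  case/lastP: vs => [//|vs v]; rewrite iter_derive_rcons.
  have -> : (fun x : E => 'D_v (fun=> c j) x) = cst 0 :> (E -> R).
    by apply/funext => y; exact: derive_cst.
  elim: vs x => [|u vs IH] x; first by rewrite /= normr0.
  have -> : iter_derive (u :: vs) (cst (0 : R)) x = 0 :> R.
    rewrite /= (_ : iter_derive vs (cst 0) = cst 0) ?derive_cst//.
    elim: vs {IH} => [//|v' vs /= ->].
    by apply/funext => y; rewrite derive_cst.
  by rewrite normr0.
by apply: le_trans (cC j Aj) _; rewrite ler_wpM2r// ler_norm.
Qed.

Lemma mfam_sum (I : Type) (s : seq I) n (f : I -> J -> E -> R) :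
  (forall i, mfam U Q n (f i)) -> mfam U Q n (fun j x => \sum_(i <- s) f i j x).
Proof.
move=> ff; elim: s => [|i s IH].
  apply: (eq_mfam (f := fun _ _ => 0)) => [j x _ _|]; first by rewrite big_nil.
  by apply: (@mfam_cst _ _ 0 0) => j _; rewrite normr0 mul0r.
apply: (eq_mfam (f := fun j => f i j \+ (fun x => \sum_(k <- s) f k j x))).
  by move=> j x _ _; rewrite big_cons.
exact: mfamD.
Qed.

Lemma mfam_prod (I : Type) (s : seq I) n (f : I -> J -> E -> R) :
  (forall i, mfam U Q n (f i)) -> mfam U Q n (fun j x => \prod_(i <- s) f i j x).
Proof.
move=> ff; elim: s => [|i s IH].
  apply: (eq_mfam (f := fun _ _ => 1)) => [j x _ _|]; first by rewrite big_nil.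
  by apply: (@mfam_cst _ _ 1 0) => j _; rewrite normr1 mulr1.
apply: (eq_mfam (f := fun j => f i j \* (fun x => \prod_(k <- s) f k j x))).
  by move=> j x _ _; rewrite big_cons.
exact: mfamM.
Qed.

Lemma mfam_fixed n (f : E -> R) : smooth_on U f -> compact Q ->
  mfam U Q n (fun=> f).
Proof.
move=> fs cQ; split=> [j _|vs _]; first by move/smooth_onE : fs; apply.
have : compact (iter_derive vs f @` Q).
  apply: continuous_compact => //.
  by apply: continuous_in_subspaceT => x /set_mem/QU /(fs vs)[].
move=> /compact_bounded/ex_strict_bound_gt0[M M0 /= fM].
exists M, 0%N; split; first exact: ltW.
by move=> j x Aj Qx; rewrite expr0 mulr1; apply/ltW/fM; exists x.
Qed.

End OneSpace.

(** A derivative of [f j \o g] is a sum of products of a derivative of a coordinate of [g] with a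
    partial derivative of [f j] composed with [g]; the latter is again a composition of the same
    kind, so the induction on [n] runs over all families [f] at once. *)
Lemma mfam_comp (E E' : normedModType R) (B : basis E') (U Q : set E)
    (U' Q' : set E') (g : E -> E') (f : J -> E' -> R) n :
  open U -> Q `<=` U -> open U' -> Q' `<=` U' ->
  (forall n, mfam U' Q' n f) ->
  (forall i n, mfam U Q n (fun=> bcoo B i \o g)) ->
  (forall x, U x -> U' (g x)) -> (forall x, Q x -> Q' (g x)) ->
  mfam U Q n (fun j => f j \o g).
Proof.
move=> oU QU oU' QU' + gf gU gQ.
have gc j x : A j -> U x -> {for x, continuous g}.
  move=> Aj Ux.
  have h : (\sum_i bcoo B i (g y) *: bvec i) @[y --> x] -->
      \sum_i bcoo B i (g x) *: bvec i.
    apply: (@cvg_sumv _ _ _ (nbhs x)) => i; apply: cvgZr_tmp.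
    exact: ((gf i 0%N).1 j Aj [::] isT x Ux).1.
  rewrite /prop_for /continuous_at [X in _ --> X](bcoo_sum B).
  apply: cvg_trans h; apply: near_eq_cvg; apply: nearW => y.
  by rewrite [RHS](bcoo_sum B).
have C1f f' j : (forall n, mfam U' Q' n f') -> A j -> C1_on U' (f' j).
  move=> ff Aj y Uy v; split; first by apply: mfam_derivable (ff 0%N) Aj Uy.
  exact: ((ff 1%N).1 j Aj [:: v] isT y Uy).1.
have dch f' j x v : (forall n, mfam U' Q' n f') -> A j -> U x ->
    is_derive x v (f' j \o g)
      (\sum_i 'D_v (bcoo B i \o g) x * 'D_(bvec i) (f' j) (g x)).
  move=> ff Aj Ux; apply: is_derive_chain oU' (C1f _ _ ff Aj) (gU x Ux) _ => i.
  by apply: mfam_derivable (gf i 0%N) Aj Ux.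
have base f' : (forall n, mfam U' Q' n f') -> mfam U Q 0 (fun j => f' j \o g).
  move=> ff; apply: mfam0 => [j Aj|].
    case=> // _ x Ux; split=> [|v].
      apply: continuous_comp; first exact: gc Aj Ux.
      exact: ((ff 0%N).1 j Aj [::] isT (g x) (gU x Ux)).1.
    exact: (@ex_derive _ _ _ _ _ _ _ (dch f' j x v ff Aj Ux)).
  have [C [m [C0 h]]] := mfam_bnd (ff 0%N).
  by exists C, m; split => // j x Aj Qx; apply: h => //; exact: gQ.
elim: n f => [|n IH] f ff; first exact: base.
apply: mfamS; first exact: base.
move=> v; pose F i j : E -> R := ('D_v (bcoo B i \o g)) \* ('D_(bvec i) (f j) \o g).
apply: (eq_mfam oU QU (f := fun j x => \sum_i F i j x)).
  by move=> j x Aj Ux /=; rewrite (@derive_val _ _ _ _ _ _ _ (dch f j x v ff Aj Ux)).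
apply: (mfam_sum oU QU) => i; rewrite /F.
apply: (mfamM oU QU (f := fun=> 'D_v (bcoo B i \o g))
  (g := fun j => 'D_(bvec i) (f j) \o g)).
  exact: (mfam_derive v (gf i n.+1)).
by apply: (IH (fun j => 'D_(bvec i) (f j))) => k; exact: mfam_derive.
Qed.

End Families.

Lemma smooth_on_comp (R : realType) (E E' : normedModType R) (B : basis E')
    (U : set E) (U' : set E') (g : E -> E') (f : E' -> R) :
  open U -> open U' -> smooth_on U' f -> smooth_on U g ->
  (forall x, U x -> U' (g x)) -> smooth_on U (f \o g).
Proof.
move=> oU oU' fs gs gU; apply/smooth_onE => n.
have w1 (j : unit) : [set: unit] j -> 1 <= 1 :> R by [].
have s0 (F : normedModType R) (V : set F) : set0 `<=` V by [].
(* For one index and an empty [Q] the bounds are void, and the smoothness half of [mfam_comp]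
   remains. *)
have [/(_ tt I)//] : mfam [set: unit] (fun=> (1 : R)) U set0 n (fun=> f \o g).
apply: (mfam_comp (w := fun=> 1) w1 (B := B) (g := g) (f := fun=> f) n oU (s0 _ _)
  oU' (s0 _ _)) => //.
  by move=> k; apply: mfam_fixed => //; exact: compact0.
move=> i k; apply: mfam_fixed => //; last exact: compact0.
exact: smooth_on_bcoo_comp.
Qed.

Section UltraLimitSmooth.
Context {R : realType} {E : normedModType R} (B : basis E).

Lemma near_open (T : topologicalType) (x : T) (P : T -> Prop) :
  (\forall y \near x, P y) -> exists V, [/\ open V, V x & forall y, V y -> P y].
Proof. by rewrite /prop_near1 /= nbhsE => -[V [oV Vx] VP]; exists V. Qed.

Lemma MVT_scaled (f : E -> R) x v h :
  (forall s : R, 0 <= s <= 1 -> derivable f (x + s *: (h *: v)) v) ->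
  exists2 s : R, 0 <= s <= 1 &
    f (x + h *: v) - f x = h * 'D_v f (x + s *: (h *: v)).
Proof.
move=> fd; have [s s01|s s01 ->] := @MVT_line R E f x (h *: v).
  exact: (is_derive_scale h (fd s s01)).1.
by exists s => //; rewrite (is_derive_scale h (fd s s01)).2.
Qed.

(** Two applications of the mean value theorem bound the difference between quotient and derivative
    by [C] times the size of [h], uniformly in [n]. Such an estimate survives the ultralimit, so
    limit and derivative are exchanged. *)
Lemma ulim_is_derive (U : set E) (f : nat -> E -> R) x v C : open U -> U x ->
  (forall n y, U y -> [/\ derivable (f n) y v, derivable ('D_v (f n)) y v,
    `|f n y| <= C, `|'D_v (f n) y| <= C & `|'D_v ('D_v (f n)) y| <= C]) ->
  is_derive x v (fun y => ulim (f ^~ y)) (ulim (fun n => 'D_v (f n) x)).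
Proof.
move=> oU Ux fU; have [d d0 dU] := open_seg oU Ux.
pose F y := ulim (f ^~ y); pose L := ulim (fun n => 'D_v (f n) x).
have bf y : U y -> bseq (f ^~ y) by move=> Uy; exists C => n; have [] := fU n y Uy.
have bD : bseq (fun n => 'D_v (f n) x) by exists C => n; have [] := fU n x Ux.
have est h : h != 0 -> `|h *: v| < d ->
    `|L - h^-1 *: (F (h *: v + x) - F x)| <= `|h| * C.
  move=> h0 hd; have Us := dU _ hd.
  have Uh : U (h *: v + x).
    by have := Us 1; rewrite ler01 lexx scale1r addrC; apply.
  rewrite -[h^-1 *: _]/(h^-1 * _) distrC -ulimB; [|exact: bf|exact: bf].
  rewrite -ulimZ; last by apply: bseqB; exact: bf.
  rewrite -ulimB //; last by apply: bseqM; [exact: bseq_cst|apply: bseqB; exact: bf].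
  apply: ulim_normC => n.
  have [s s01] : exists2 s : R, 0 <= s <= 1 &
      f n (x + h *: v) - f n x = h * 'D_v (f n) (x + s *: (h *: v)).
    by apply: (@MVT_scaled (f n) x v h) => s /Us /(fU n)[].
  rewrite [h *: v + x]addrC => ->; rewrite mulKf// scalerA.
  have [t t01] : exists2 t : R, 0 <= t <= 1 &
      'D_v (f n) (x + (s * h) *: v) - 'D_v (f n) x =
      (s * h) * 'D_v ('D_v (f n)) (x + t *: ((s * h) *: v)).
    apply: (@MVT_scaled ('D_v (f n)) x v (s * h)) => t /andP[t0 t1].
    rewrite -scalerA scalerA.
    have /Us /(fU n)[//] : 0 <= t * s <= 1.
    by move: s01 => /andP[s0 s1]; rewrite mulr_ge0//= mulr_ile1.
  move=> ->; rewrite normrM.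
  have /Us /(fU n)[_ _ _ _] : 0 <= t * s <= 1.
    by move: s01 t01 => /andP[s0 s1] /andP[t0 t1]; rewrite mulr_ge0//= mulr_ile1.
  rewrite -[in X in X -> _]scalerA [s *: _]scalerA => bC.
  apply: ler_pM => //; rewrite normrM; move: s01 => /andP[s0 s1].
  by rewrite ger0_norm// ler_piMl.
have cvgq : h^-1 *: ((F \o shift x) (h *: v) - F x) @[h --> (0 : R)^'] --> L.
  apply/cvgrPdist_lt => e e0.
  have M0 : 0 < `|v| + `|C| + 1 by rewrite ltr_wpDl// addr_ge0.
  have nh : \forall h \near (0 : R)^', `|h| < Num.min d e / (`|v| + `|C| + 1).
    apply: cvg_within; apply/nbhs_ballP; exists (Num.min d e / (`|v| + `|C| + 1)) => /=.
      by rewrite divr_gt0// lt_min d0.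
    by move=> h; rewrite -ball_normE /= sub0r normrN.
  near=> h.
  have h0 : h != 0 by near: h; exact: nbhs_dnbhs_neq.
  have hM : `|h| < Num.min d e / (`|v| + `|C| + 1) by near: h.
  move: hM; rewrite ltr_pdivlMr// lt_min => /andP[hd he].
  apply: le_lt_trans (est h h0 _) _.
    rewrite normrZ; apply: le_lt_trans hd; rewrite ler_wpM2l//.
    by rewrite -addrA lerDl addr_ge0.
  apply: le_lt_trans he; rewrite ler_wpM2l//.
  rewrite (le_trans (ler_norm C))// addrAC lerDr addr_ge0//.
by apply: DeriveDef; [apply/cvg_ex; eexists; exact: cvgq|exact: cvg_lim cvgq].
Unshelve. all: by end_near. Qed.

(** Locally uniform bounds on all derivatives suffice, without any convergence of the sequence: each
    bound on higher derivatives makes the lower ones uniformly Lipschitz, and this passes to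
    ultralimits. *)
Lemma ulim_smooth (U : set E) (f : nat -> E -> R) : open U ->
  (forall n, smooth_on U (f n)) ->
  (forall vs x, U x -> exists C, \forall y \near x, forall n,
     `|iter_derive vs (f n) y| <= C) ->
  smooth_on U (fun x => ulim (f ^~ x)) /\
  forall vs x, U x -> iter_derive vs (fun x => ulim (f ^~ x)) x =
    ulim (fun n => iter_derive vs (f n) x).
Proof.
move=> oU fs fb.
have isd vs x v : U x -> is_derive x v (fun y => ulim (fun n => iter_derive vs (f n) y))
    (ulim (fun n => 'D_v (iter_derive vs (f n)) x)).
  move=> Ux; have [C0 n0] := fb vs x Ux; have [C1 n1] := fb (v :: vs) x Ux.
  have [C2 n2] := fb (v :: v :: vs) x Ux.
  pose C := Num.max C0 (Num.max C1 C2).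
  have nU : \forall y \near x, U y by exact: open_nbhs_nbhs.
  have : \forall y \near x, U y /\ forall n, [/\ `|iter_derive vs (f n) y| <= C,
      `|'D_v (iter_derive vs (f n)) y| <= C &
      `|'D_v ('D_v (iter_derive vs (f n))) y| <= C].
    near=> y; split; first by near: y.
    have b0 : forall n, `|iter_derive vs (f n) y| <= C0 by near: y.
    have b1 : forall n, `|'D_v (iter_derive vs (f n)) y| <= C1 by near: y.
    have b2 : forall n, `|'D_v ('D_v (iter_derive vs (f n))) y| <= C2 by near: y.
    move=> n; split; rewrite /C !le_max.
    - by rewrite (b0 n).
    - by rewrite (b1 n) orbT.
    - by rewrite (b2 n) !orbT.
  move=> /near_open[V [oV Vx VP]].
  apply: (ulim_is_derive oV Vx (C := C)) => n y Vy.
  have [Uy yC] := VP y Vy; have [h0 h1 h2] := yC n; split => //.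
    exact: (fs n vs y Uy).2.
  exact: (fs n (v :: vs) y Uy).2.
have bU vs x : U x -> bseq (fun n => iter_derive vs (f n) x).
  by move=> /(fb vs)[C /nbhs_singleton fC]; exists C.
(* Continuity is not a consequence of directional differentiability; it comes from a Lipschitz bound
   obtained by expanding the derivative along [u] in the finitely many basis directions. *)
have cont vs x : U x ->
    {for x, continuous (fun y => ulim (fun n => iter_derive vs (f n) y))}.
  move=> Ux; have exC (i : bidx B) : exists C : R, \forall y \near x, forall n,
      `|iter_derive (bvec i :: vs) (f n) y| <= C.
    exact: (fb (@bvec _ _ B i :: vs)).
  have [C nC] := choice exC.
  have : \forall y \near x, U y /\ forall i n,
      `|iter_derive (bvec i :: vs) (f n) y| <= C i.
    near=> y; split; first by near: y; exact: open_nbhs_nbhs.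
    by near: y; apply: filter_forall; exact: nC.
  move=> /near_open[V [oV Vx VP]].
  have [d d0 dV] := open_seg oV Vx; have [M M0 BM] := bcoo_bnd B.
  pose K := \sum_i M * `|C i|.
  have K0 : 0 <= K by apply: sumr_ge0 => i _; apply: mulr_ge0 => //; exact: ltW.
  have est u : `|u| < d -> `|ulim (fun n => iter_derive vs (f n) (x + u)) -
      ulim (fun n => iter_derive vs (f n) x)| <= K * `|u|.
    move=> ud; have Vs := dV _ ud.
    have Uu : U (x + u).
      by have := Vs 1; rewrite ler01 lexx scale1r => /(_ isT) /VP [].
    rewrite -ulimB; [|exact: bU|exact: bU].
    apply: ulim_normC => n.
    have C1 : C1_on U (iter_derive vs (f n)).
      move=> y Uy v; split; first exact: (fs n vs y Uy).2.
      exact: (fs n (v :: vs) y Uy).1.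
    have [s s01 ->] : exists2 s : R, 0 <= s <= 1 &
        iter_derive vs (f n) (x + u) - iter_derive vs (f n) x =
        'D_u (iter_derive vs (f n)) (x + s *: u).
      by apply: MVT_line => s /Vs /VP[Uy _]; exact: (C1 _ Uy u).1.
    have [Uy yC] := VP _ (Vs s s01).
    have -> : 'D_u (iter_derive vs (f n)) (x + s *: u) =
        \sum_i bcoo B i u * 'D_(bvec i) (iter_derive vs (f n)) (x + s *: u).
      by rewrite -(derive_sumv _ _ _ oU C1 Uy) -bcoo_sum.
    apply: le_trans (ler_norm_sum _ _ _) _; rewrite /K mulr_suml.
    apply: ler_sum => i _; rewrite normrM mulrAC; apply: ler_pM => //.
    by apply: le_trans (yC i n) _; exact: ler_norm.
  apply/cvgrPdist_lt => e e0; have K1 : 0 < K + 1 by rewrite ltr_wpDl.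
  apply/nbhs_ballP; exists (Num.min d (e / (K + 1))) => /=.
    by rewrite lt_min d0 divr_gt0.
  move=> y; rewrite -ball_normE /= lt_min distrC => /andP[yd ye].
  have := est _ yd; rewrite [x + _]addrC subrK => Fy.
  rewrite distrC; apply: le_lt_trans Fy _.
  apply: (@le_lt_trans _ _ ((K + 1) * `|y - x|)); first by rewrite ler_wpM2r// lerDl.
  by rewrite -ltr_pdivlMl// mulrC.
have dE vs : forall x, U x -> iter_derive vs (fun x => ulim (f ^~ x)) x =
    ulim (fun n => iter_derive vs (f n) x).
  elim: vs => [//|v vs IH] x Ux /=.
  rewrite -(@derive_val _ _ _ _ _ _ _ (isd vs x v Ux)).
  apply: near_eq_derive; near=> y; apply: IH; near: y.
  exact: open_nbhs_nbhs.
split => // vs x Ux.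
have nE : {near x, (fun y => ulim (fun n => iter_derive vs (f n) y)) =1
    iter_derive vs (fun x => ulim (f ^~ x))}.
  near=> y; apply/esym/dE; near: y; exact: open_nbhs_nbhs.
split=> [|v].
  rewrite /prop_for /continuous_at dE//.
  by apply: cvg_trans (near_eq_cvg nE) _; exact: cont.
apply: near_eq_derivable nE _.
exact: (@ex_derive _ _ _ _ _ _ _ (isd vs x v Ux)).
Unshelve. all: by end_near. Qed.

End UltraLimitSmooth.

Section Boxes.
Context {R : realType} {E : normedModType R} (B : basis E).

Definition box (a : E) (r : R) := [set y | forall i, `|bcoo B i (y - a)| <= r].

Lemma compact_box a r : compact (box a r).
Proof.
pose n := #|bidx B|; pose S := [set t : 'rV[R]_n | forall i, t ord0 i \in `[- r, r]].
have cS : compact S.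
  apply: (@rV_compact _ _ (fun=> `[- r, r]%classic)) => _.
  exact: segment_compact.
pose g (t : 'rV[R]_n) := a + \sum_i t ord0 (enum_rank i) *: @bvec _ _ B i.
have -> : box a r = g @` S.
  apply/seteqP; split=> [y yr|_ [t St <-] i].
    exists (\row_k bcoo B (enum_val k) (y - a)).
      by move=> k; rewrite mxE in_itv /= -ler_norml.
    rewrite /g; under eq_bigr do rewrite mxE enum_rankK.
    by rewrite -bcoo_sum addrC subrK.
  rewrite /g [a + _]addrC addrK.
  have -> : bcoo B i (\sum_j t ord0 (enum_rank j) *: bvec j) = t ord0 (enum_rank i).
    have h (s : seq (bidx B)) : bcoo B i (\sum_(j <- s) t ord0 (enum_rank j) *: bvec j)
        = \sum_(j <- s) t ord0 (enum_rank j) * (i == j)%:R.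
      elim: s => [|j s IH]; first by rewrite !big_nil bcoo0.
      by rewrite !big_cons bcoo_lin IH bcoo_vec.
    rewrite h (bigD1 i)//= eqxx mulr1 big1 ?addr0// => j /negPf.
    by rewrite eq_sym => ->; rewrite mulr0.
  by have := St (enum_rank i); rewrite in_itv /= -ler_norml.
have cg : continuous g.
  move=> t; apply: (@cvgD _ _ _ (nbhs t) _ (fun=> a)); first exact: cvg_cst.
  by apply: (@cvg_sumv _ _ _ (nbhs t)) => i; apply: cvgZr_tmp; exact: coord_continuous.
by apply: continuous_compact => //; exact: continuous_subspaceT.
Qed.

Lemma nbhs_box a r : 0 < r -> nbhs a (box a r).
Proof.
move=> r0; have [C C0 BC] := bcoo_bnd B.
apply/nbhs_ballP; exists (r / C) => /=; first exact: divr_gt0.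
move=> y; rewrite -ball_normE /= distrC => ya i.
by apply: le_trans (BC i _) _; rewrite mulrC -ler_pdivlMr// ltW.
Qed.

Lemma box_sub (U : set E) a : open U -> U a -> exists2 r, 0 < r & box a r `<=` U.
Proof.
move=> oU Ua; have /nbhs_ballP[d /= d0 dU] : nbhs a U by exact: open_nbhs_nbhs.
pose K := \sum_i `|@bvec _ _ B i| + 1.
have K0 : 0 < K by rewrite ltr_wpDl// sumr_ge0.
exists (d / 2 / K); first by rewrite !divr_gt0.
move=> y ya; apply: dU; rewrite -ball_normE /= distrC.
apply: (@le_lt_trans _ _ (d / 2)); last by rewrite ltr_pdivrMr// mulr_natr mulr2n ltrDl.
rewrite (bcoo_sum B (y - a)); apply: le_trans (ler_norm_sum _ _ _) _.
apply: (@le_trans _ _ (\sum_i d / 2 / K * `|@bvec _ _ B i|)).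
  by apply: ler_sum => i _; rewrite normrZ ler_wpM2r.
rewrite -mulr_sumr -mulrA ler_piMr//; first by rewrite divr_ge0// ltW.
by rewrite mulrC ler_pdivrMr// mul1r lerDl.
Qed.

End Boxes.

(** The scalars as a one-dimensional space, so that the chain rule also covers scalar inner
    functions. *)
Definition basisR (R : realType) : basis R.
Proof.
unshelve eapply (@Basis R R unit (fun=> 1) (fun _ => id)) => //.
- by move=> v; rewrite (big_pred1 tt) => [|[]]//; rewrite -[RHS]/(v * 1) mulr1.
- by exists 1; [exact: ltr01|move=> _ v; rewrite mul1r].
Defined.

Section CompactInduction.
Context {M : topologicalType}.

(** The sets whose complement in [L] satisfies [P] form a filter, proper if [P L] fails. It would
    then have a cluster point in [L], against a neighbourhood of that point satisfying [P]. *)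
Lemma compact_induction (L : set M) (P : set M -> Prop) : compact L ->
  P set0 -> (forall A B, A `<=` B -> P B -> P A) ->
  (forall A B, P A -> P B -> P (A `|` B)) ->
  (forall x, L x -> exists2 W, nbhs x W & P W) -> P L.
Proof.
move=> cL P0 PS PU Ploc; apply: contrapT => nPL.
pose F : set_system M := [set A | P (L `\` A)].
have FF : ProperFilter F.
  split; first by rewrite /F /= setD0.
  split.
  - by rewrite /F /= setDT.
  - by move=> A B FA FB; rewrite /F /= setDIr; exact: PU.
  - by move=> A B AB; apply: PS => x [Lx nB]; split => // /AB.
have [|x [Lx xF]] := cL F FF; first by rewrite /F /= setDv.
have [W xW PW] := Ploc x Lx.
have [|y [nWy Wy]] := xF (~` W) W _ xW; last exact: nWy.
by rewrite /F /= setDE setCK; apply: PS PW => y [].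
Qed.

Lemma compact_finite_cover (L : set M) (W : M -> set M) : compact L ->
  (forall x, L x -> nbhs x (W x)) -> exists n (x : 'I_n -> M),
  (forall k, L (x k)) /\ L `<=` \bigcup_k W (x k).
Proof.
move=> cL LW; pose P (A : set M) := exists n (x : 'I_n -> M),
  (forall k, L (x k)) /\ A `<=` \bigcup_k W (x k).
apply: (@compact_induction L P) => //.
- exists 0%N, (fun k : 'I_0 => False_rect M (notF (ltn_ord k))).
  by split => // -[].
- by move=> A B AB [n [x [Lx Bx]]]; exists n, x; split => // y /AB /Bx.
- move=> A B [n [x [Lx Ax]]] [m [y [Ly By]]]; exists (n + m)%N.
  exists (fun k => match fintype.split k with inl i => x i | inr j => y j end).
  split; first by move=> k; case: fintype.split.
  move=> z [/Ax[k _ Wk]|/By[k _ Wk]].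
    by exists (unsplit (inl k)) => //; rewrite (unsplitK (inl k)).
  by exists (unsplit (inr k)) => //; rewrite (unsplitK (inr k)).
- move=> x Lx; exists (W x); first exact: LW.
  by exists 1%N, (fun=> x); split => // y Wy; exists ord0.
Qed.

End CompactInduction.

Section ComplexParts.
Context {R : realType}.
Local Notation C := R[i].

(** Real and imaginary part under one index, so that real-valued arguments are given once for
    both. *)
Definition cpart (b : bool) (z : C) : R := if b then complex.Re z else complex.Im z.

Lemma cpartD b (z t : C) : cpart b (z + t) = cpart b z + cpart b t.
Proof. by case: b z t => [] [a c] [d e]. Qed.

Lemma cpartB b (z t : C) : cpart b (z - t) = cpart b z - cpart b t.
Proof. by case: b z t => [] [a c] [d e]. Qed.

Lemma cpart0 b : cpart b 0 = 0. Proof. by case: b. Qed.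

Lemma cpartRM b (r : R) (z : C) : cpart b (r%:C * z) = r * cpart b z.
Proof. by case: b z => [] [a c] /=; rewrite mul0r ?subr0 ?addr0. Qed.

Lemma cpart_eq (z t : C) : (forall b, cpart b z = cpart b t) -> z = t.
Proof. by case: z t => [a c] [d e] h; congr Complex; [exact: (h true)|exact: (h false)]. Qed.

Lemma cpart_sum b (I : Type) (s : seq I) (P : pred I) (z : I -> C) :
  cpart b (\sum_(i <- s | P i) z i) = \sum_(i <- s | P i) cpart b (z i).
Proof.
by elim/big_rec2 : _ => [|i y x _ <-]; [exact: cpart0|exact: cpartD].
Qed.

Lemma cpart_le b (z : C) : `|cpart b z| <= ComplexField.Normc.normc z.
Proof.
case: z b => [a c] b /=; rewrite -(sqrtr_sqr (cpart b _)).
by case: b => /=; rewrite ler_wsqrtr// ?lerDl ?lerDr sqr_ge0.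
Qed.

Lemma normc_le_parts (z : C) :
  ComplexField.Normc.normc z <= `|cpart true z| + `|cpart false z|.
Proof.
case: z => [a c] /=; rewrite -(ler_pXn2r (_ : 0 < 2)%N)// ?nnegrE ?sqrtr_ge0 ?addr_ge0//.
rewrite sqr_sqrtr ?addr_ge0 ?sqr_ge0// sqrrD !real_normK ?num_real//.
by rewrite -addrA lerD2l lerDr mulrn_wge0// mulr_ge0.
Qed.

Lemma normcE' (z : C) : `|z| = (ComplexField.Normc.normc z)%:C.
Proof. by []. Qed.

End ComplexParts.

(** * The space of test functions *)

Section ManifoldFamilies.
Context {R : realType} {M : topologicalType} (S : smoothStructure R M).

Definition mbasis : basis (model S) := projT1 (cid (basis_exists (model_fin S))).

(** Local compactness of a manifold: closed coordinate boxes are compact because the model is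
    finite-dimensional, and the inverse chart carries them over. *)
Lemma chart_nbhs (c : chart M (model S)) x (U : set M) : cdom c x -> open U -> U x ->
  exists K, [/\ compact K, nbhs x K, K `<=` U & K `<=` cdom c].
Proof.
move=> cx oU Ux; have oV := chart_open c oU.
have [|r r0 rV] := box_sub mbasis oV (a := cphi c x); first by exists x.
have Vsub y : (cphi c @` (cdom c `&` U)) y -> (cphi c @` cdom c) y.
  by move=> [z [cz _] <-]; exists z.
exists (cpsi c @` box mbasis (cphi c x) r); split.
- apply: continuous_compact; last exact: compact_box.
  apply: continuous_in_subspaceT => y /set_mem/rV/Vsub; exact: cpsi_continuous.
- have h1 : nbhs x (cdom c) by apply: open_nbhs_nbhs; split => //; exact: cdom_open.
  have h2 : nbhs x (cphi c @^-1` box mbasis (cphi c x) r).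
    by apply: (cphi_continuous cx); exact: nbhs_box.
  by apply: filterS2 h1 h2 => y cy yb; exists (cphi c y) => //; exact: cphiK.
- by move=> _ [y /rV[z [cz Uz] <-] <-]; rewrite cphiK.
- by move=> _ [y /rV[z [cz Uz] <-] <-]; rewrite cphiK.
Qed.

Lemma cphi_sub (c : chart M (model S)) (V : set M) : V `<=` cdom c ->
  cphi c @` V = cphi c @` (cdom c `&` V).
Proof.
by move=> Vc; rewrite setIidr.
Qed.

(** For weight 1 this is boundedness of all derivatives, uniformly over the family, on compact parts
    of charts; with a common compact support it characterises the small sets, see [Cc_smallP]. *)
Definition cfam (J : Type) (A : set J) (w : J -> R) (f : J -> M -> R[i]) :=
  forall c, atlas S c -> forall L, compact L -> L `<=` cdom c -> forall b n,
  mfam A w (cphi c @` cdom c) (cphi c @` L) n (fun j y => cpart b (f j (cpsi c y))).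

Section Fixed.
Context {J : Type} (A : set J) (w : J -> R).
Hypothesis w1 : forall j, A j -> 1 <= w j.
Implicit Type f : J -> M -> R[i].

Definition cfam_at f (x : M) := exists c V K,
  [/\ atlas S c, open V /\ V `<=` cdom c, compact K /\ nbhs x K, K `<=` V &
  forall b n, mfam A w (cphi c @` V) (cphi c @` K) n
    (fun j y => cpart b (f j (cpsi c y)))].

(** One chart near each point is enough: transition maps are smooth, so by [mfam_comp] the bounds
    pass to every other chart on a small compact neighbourhood, and compactness joins finitely many
    bounds. *)
Lemma cfam_local f : (forall x, cfam_at f x) -> cfam A w f.
Proof.
move=> floc d Ad L cL Ld b.
have loc x : cdom d x -> exists U K, [/\ U (cphi d x), nbhs x K, K `<=` cdom d &
    forall n, mfam A w U (cphi d @` K) n (fun j y => cpart b (f j (cpsi d y)))].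
  move=> dx; have [c [V [K [Ac [oV Vc] [cK xK] KV fK]]]] := floc x.
  have Vx := KV x (nbhs_singleton xK).
  have [K' [cK' xK' K'I K'd]] := chart_nbhs dx (open_interior K)
    (nbhs_singleton (nbhs_interior xK)).
  have K'K : K' `<=` K by move=> y /K'I/interior_subset.
  have K'V : K' `<=` V by move=> y /K'K/KV.
  pose U := cphi d @` (cdom d `&` V).
  have oU : open U by exact: chart_open.
  exists U, K'; split => //; first by exists x.
  move=> n.
  have QU : cphi d @` K' `<=` U.
    by move=> _ [y K'y <-]; exists y => //; split; [exact: K'd|exact: K'V].
  have oV' : open (cphi c @` V) by rewrite cphi_sub//; exact: chart_open.
  have h := mfam_comp (w := w) w1 (B := mbasis) (U := U) (Q := cphi d @` K')
    (g := cphi c \o cpsi d) n oU QU oV' (image_subset (cphi c) KV) (fK b).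
  apply: (eq_mfam oU QU (f := fun j =>
      (fun y => cpart b (f j (cpsi c y))) \o (cphi c \o cpsi d))).
    by move=> j _ Aj [y [dy Vy] <-] /=; rewrite (cphiK dy) cphiK//; exact: Vc.
  apply: h.
  - move=> i k; apply: mfam_fixed => //; last first.
      apply: continuous_compact => //; apply: continuous_in_subspaceT => y.
      by move=> /set_mem/K'd; exact: cphi_continuous.
    apply: smooth_on_bcoo_comp => //; apply: smooth_onW (atlas_smooth Ad Ac).
    by move=> _ [y [dy Vy] <-]; exists y => //; split => //; exact: Vc.
  - by move=> _ [y [dy Vy] <-] /=; rewrite cphiK//; exists y.
  - by move=> _ [y K'y <-] /=; rewrite cphiK//; [exists y => //; exact: K'K|exact: K'd].
move=> n; split.
  move=> j Aj vs vn _ [x dx <-]; have [U [K [Ux _ _ h]]] := loc x dx.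
  exact: ((h n).1 j Aj vs vn).
(* The bound with unspecified constant and exponent is inherited by subsets and finite unions, as
   [compact_induction] requires. *)
move=> vs vn; pose P (W : set M) := exists (D : R) (m : nat), 0 <= D /\
  forall j x, A j -> W x ->
  `|iter_derive vs (fun y => cpart b (f j (cpsi d y))) (cphi d x)| <= D * w j ^+ m.
suff [D [m [D0 h]]] : P L by exists D, m; split => // j _ Aj [x Lx <-]; exact: h.
apply: compact_induction => //.
- by exists 0, 0%N.
- by move=> U V UV [D [m [D0 h]]]; exists D, m; split => // j x Aj /UV; exact: h.
- move=> U V [D [m [D0 h]]] [D' [m' [D'0 h']]]; exists (D + D'), (maxn m m').
  split; first exact: addr_ge0.
  move=> j x Aj UVx; apply: le_trans (growthD w1 m m' D0 D'0 Aj).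
  have wj k : 0 <= w j ^+ k by rewrite exprn_ge0// (le_trans ler01) ?w1.
  case: UVx => [Ux|Vx].
    by apply: le_trans (h _ _ Aj Ux) _; rewrite lerDl mulr_ge0.
  by apply: le_trans (h' _ _ Aj Vx) _; rewrite lerDr mulr_ge0.
move=> x /Ld /loc[U [K [Ux xK Kd h]]]; exists K => //.
have [D [m [D0 hD]]] := (h n).2 vs vn.
by exists D, m; split => // j y Aj Ky; apply: hD => //; exists y.
Qed.

Lemma cfam_smooth f j : cfam A w f -> A j -> smooth_fun S (f j).
Proof.
move=> ff Aj c Ac.
have h b : smooth_on (cphi c @` cdom c) (fun y => cpart b (f j (cpsi c y))).
  apply/smooth_onE => n.
  exact: ((ff c Ac set0 (@compact0 _) (@sub0set _ _) b n).1 j Aj).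
by split; [exact: (h true)|exact: (h false)].
Qed.

Lemma cfam_fixed (f : M -> R[i]) : smooth_fun S f -> cfam A w (fun=> f).
Proof.
move=> fs c Ac L cL Lc b n; apply: mfam_fixed.
- exact: image_subset.
- by have [f1 f2] := fs c Ac; case: b; [exact: f1|exact: f2].
- apply: continuous_compact => //; apply: continuous_in_subspaceT => y.
  by move=> /set_mem/Lc; exact: cphi_continuous.
Qed.

Lemma cfamM f g : cfam A w f -> cfam A w g -> cfam A w (fun j x => f j x * g j x).
Proof.
move=> ff gg c Ac L cL Lc b n; have oU := cimg_open c.
have QU := image_subset (cphi c) Lc.
pose F b j y := cpart b (f j (cpsi c y)); pose G b j y := cpart b (g j (cpsi c y)).
have fb b' : mfam A w (cphi c @` cdom c) (cphi c @` L) n (F b') by exact: ff.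
have gb b' : mfam A w (cphi c @` cdom c) (cphi c @` L) n (G b') by exact: gg.
have FG b1 b2 : mfam A w (cphi c @` cdom c) (cphi c @` L) n
    (fun j => F b1 j \* G b2 j) by exact: mfamM.
case: b.
  have cm : mfam A w (cphi c @` cdom c) (cphi c @` L) n (fun _ _ => -1 : R).
    by apply: (@mfam_cst _ _ _ _ w1 _ _ _ _ _ 1 0) => j _; rewrite normrN normr1 mulr1.
  apply: (eq_mfam oU QU (f := fun j => (F true j \* G true j) \+
     ((fun=> -1) \* (F false j \* G false j)))).
    move=> j x _ _ /=; rewrite /F /G; case: (f j _) (g j _) => [a1 a2] [b1 b2] /=.
    by rewrite mulN1r.
  apply: (mfamD w1 oU QU (f := fun j => F true j \* G true j)
    (g := fun j => (fun=> -1) \* (F false j \* G false j))) => //.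
  by apply: (mfamM w1 oU QU (f := fun j => fun=> -1)
    (g := fun j => F false j \* G false j)).
apply: (eq_mfam oU QU (f := fun j => (F true j \* G false j) \+
   (F false j \* G true j))).
  by move=> j x _ _ /=; rewrite /F /G; case: (f j _) (g j _) => [a1 a2] [b1 b2] /=.
by apply: (mfamD w1 oU QU (f := fun j => F true j \* G false j)
  (g := fun j => F false j \* G true j)).
Qed.

End Fixed.

Lemma cfam_reindex (J J' : Type) (A : set J) (A' : set J') (w : J -> R) (w' : J' -> R)
    (k : J' -> J) (f : J -> M -> R[i]) :
  (forall j, A j -> 1 <= w j) ->
  (forall j, A' j -> A (k j) /\ w (k j) <= w' j) ->
  cfam A w f -> cfam A' w' (fun j => f (k j)).
Proof.
move=> w1 Ak ff c Ac L cL Lc b n; have [fs fb] := ff c Ac L cL Lc b n; split.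
  by move=> j /Ak[Akj _]; exact: fs.
move=> vs /fb[D [m [D0 h]]]; exists D, m; split => // j x A'j Qx.
have [Akj wk] := Ak j A'j.
apply: le_trans (h _ _ Akj Qx) _; rewrite ler_wpM2l// lerXn2r// ?nnegrE.
  by rewrite (le_trans ler01)// w1.
by rewrite (le_trans ler01)// (le_trans _ wk)// w1.
Qed.

End ManifoldFamilies.

(** In charts the pulled back family is the old one composed with one fixed smooth map; [mfam_comp]
    bounds it near each point and [cfam_local] globalises. *)
Lemma cfam_pull (R : realType) (M N : topologicalType) (S : smoothStructure R M)
    (T : smoothStructure R N) (p : N -> M) (J : Type) (A : set J) (w : J -> R)
    (f : J -> M -> R[i]) : (forall j, A j -> 1 <= w j) ->
  smooth_map T S p -> cfam S A w f -> cfam T A w (fun j x => f j (p x)).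
Proof.
move=> w1 [pc ps] ff; apply: cfam_local => // x.
have [c Ac cx] := atlas_cover T x; have [d Ad dx] := atlas_cover S (p x).
pose V := cdom c `&` p @^-1` cdom d.
have opd : open (p @^-1` cdom d).
  by apply: open_comp => [y _|]; [exact: pc|exact: cdom_open].
have oV : open V by apply: openI => //; exact: cdom_open.
have [K [cK xK KV _]] := chart_nbhs cx oV (conj cx dx).
exists c, V, K; split => //; first by split => // y [].
move=> b n; have QU : cphi c @` K `<=` cphi c @` V by exact: image_subset.
have oU : open (cphi c @` V) by exact: chart_open.
have cpK : compact (p @` K).
  by apply: continuous_compact => //; exact: continuous_subspaceT.
have pKd : p @` K `<=` cdom d by move=> _ [y /KV[_ +] <-].
apply: (eq_mfam oU QU (f := fun j =>
    (fun y => cpart b (f j (cpsi d y))) \o (cphi d \o p \o cpsi c))).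
  by move=> j _ Aj [y [cy Vy] <-] /=; rewrite (cphiK cy) cphiK.
apply: (mfam_comp (w := w) w1 (B := mbasis S) (Q' := cphi d @` (p @` K)) n oU QU
  (cimg_open d)).
- exact: image_subset.
- by move=> k; exact: ff.
- move=> i k; apply: mfam_fixed => //.
    by apply: smooth_on_bcoo_comp => //; exact: ps.
  apply: continuous_compact => //; apply: continuous_in_subspaceT => y.
  by move=> /set_mem/KV[cy _]; exact: cphi_continuous.
- by move=> _ [y [cy Vy] <-] /=; rewrite cphiK//; exists (p y).
- move=> _ [y Ky <-] /=; rewrite cphiK//; first by exists (p y) => //; exists y.
  by have [] := KV y Ky.
Qed.

(** * Bounded sets for the LF topology *)

Section SmallSets.
Context {R : realType} {M : topologicalType} (S : smoothStructure R M).
Local Notation normc := ComplexField.Normc.normc.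
Implicit Types (f g : Cc S).

Lemma Cc_ext_eq f g : (forall x, f x = g x) -> f = g.
Proof. by move=> fg; apply: val_inj; apply/funext. Qed.

Lemma Cc_smooth f : smooth_fun S f. Proof. exact: (CcP f).1. Qed.

Lemma Cc_smooth_part f c b : atlas S c ->
  smooth_on (cphi c @` cdom c) (fun y => cpart b (f (cpsi c y))).
Proof.
by move=> Ac; have [f1 f2] := Cc_smooth f Ac; case: b; [exact: f1|exact: f2].
Qed.

Lemma supp_out (f : M -> R[i]) x : ~ supp f x -> f x = 0.
Proof.
by move=> nsx; apply: contrapT => /eqP f0; apply: nsx; exact: subset_closure.
Qed.

Lemma supp_subP (f : M -> R[i]) K : closed K -> (forall x, ~ K x -> f x = 0) ->
  supp f `<=` K.
Proof.
move=> cK fK; rewrite [X in _ `<=` X]((closure_id K).1 cK).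
apply: closureS => x /= f0.
by apply: contrapT => /fK /eqP; exact/negP.
Qed.

Lemma compact_closedM (K : set M) : compact K -> closed K.
Proof. by apply: compact_closed; exact: (smooth_hausdorff S). Qed.

Lemma supp_sub_compact (f : M -> R[i]) K : compact K ->
  (forall x, ~ K x -> f x = 0) -> supp f `<=` K /\ compact (supp f).
Proof.
move=> cK fK; have sK := supp_subP (compact_closedM cK) fK; split => //.
by apply: subclosed_compact cK sK; exact: closed_closure.
Qed.

Definition chart_jet (c : chart M (model S)) (vs : seq (model S))
    (f : M -> R[i]) (x : M) : R[i] :=
  iter_derive vs (fun y => complex.Re (f (cpsi c y))) (cphi c x) +i*
  iter_derive vs (fun y => complex.Im (f (cpsi c y))) (cphi c x).

Lemma cpart_jet b c vs (f : M -> R[i]) x : cpart b (chart_jet c vs f x) =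
  iter_derive vs (fun y => cpart b (f (cpsi c y))) (cphi c x).
Proof. by case: b. Qed.

Lemma iter_derive_lin (E : normedModType R) (U : set E) (f g : E -> R) a vs x :
  open U -> smooth_on U f -> smooth_on U g -> U x ->
  iter_derive vs (fun y => a * f y + g y) x =
  a * iter_derive vs f x + iter_derive vs g x.
Proof.
move=> oU fs gs; elim: vs x => [//|v vs IH] x Ux /=.
have h : {near x, iter_derive vs (fun y => a * f y + g y) =1
    ((a *: iter_derive vs f) \+ iter_derive vs g)}.
  by near=> y; apply: IH; near: y; exact: open_nbhs_nbhs.
have [_ fd] := fs vs x Ux; have [_ gd] := gs vs x Ux.
rewrite (near_eq_derive v h) deriveD//; last exact: derivableZ.
by rewrite deriveZ.
Unshelve. all: by end_near. Qed.

Lemma jet_lin c vs a f g x : atlas S c -> cdom c x ->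
  chart_jet c vs (a *: f + g) x = a * chart_jet c vs f x + chart_jet c vs g x.
Proof.
move=> Ac cx; have oU := cimg_open c.
have Ux : (cphi c @` cdom c) (cphi c x) by exists x.
have F b : smooth_on (cphi c @` cdom c) (fun y => cpart b (f (cpsi c y))).
  exact: Cc_smooth_part.
have G b : smooth_on (cphi c @` cdom c) (fun y => cpart b (g (cpsi c y))).
  exact: Cc_smooth_part.
have Z (k : R) : smooth_on (cphi c @` cdom c) (fun _ : model S => k).
  exact: smooth_on_cst.
case: a => p q; apply: cpart_eq => -[].
  rewrite cpart_jet.
  have -> : (fun y => cpart true ((Complex p q *: f + g) (cpsi c y))) =
     (fun y => p * cpart true (f (cpsi c y)) +
       (- q * cpart false (f (cpsi c y)) + cpart true (g (cpsi c y)))).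
    apply/funext => y /=; rewrite fctE /= !fctE.
    by case: (f _) (g _) => [a1 a2] [b1 b2] /=; ring.
  rewrite (iter_derive_lin _ _ oU)//; last first.
    apply: (smooth_onD oU _ (G true)); exact: (smooth_onM oU (Z (- q)) (F false)).
  rewrite (iter_derive_lin _ _ oU)// -!cpart_jet cpartD.
  by case: (chart_jet c vs f x) (chart_jet c vs g x) => [a1 a2] [b1 b2] /=; ring.
rewrite cpart_jet.
have -> : (fun y => cpart false ((Complex p q *: f + g) (cpsi c y))) =
   (fun y => p * cpart false (f (cpsi c y)) +
     (q * cpart true (f (cpsi c y)) + cpart false (g (cpsi c y)))).
  apply/funext => y /=; rewrite fctE /= !fctE.
  by case: (f _) (g _) => [a1 a2] [b1 b2] /=; ring.
rewrite (iter_derive_lin _ _ oU)//; last first.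
  apply: (smooth_onD oU _ (G false)); exact: (smooth_onM oU (Z (q)) (F true)).
rewrite (iter_derive_lin _ _ oU)// -!cpart_jet cpartD.
by case: (chart_jet c vs f x) (chart_jet c vs g x) => [a1 a2] [b1 b2] /=; ring.
Qed.

Lemma cfam_jet (J : Type) (A : set J) w (F : J -> M -> R[i]) c L vs :
  (forall j, A j -> 1 <= w j) -> cfam S A w F ->
  atlas S c -> compact L -> L `<=` cdom c -> exists C m, 0 <= C /\
  forall j x, A j -> L x -> normc (chart_jet c vs (F j) x) <= C * w j ^+ m.
Proof.
move=> w1 FF Ac cL Lc.
have [C [m [C0 h]]] := (FF c Ac L cL Lc true (size vs)).2 vs (leqnn _).
have [D [n [D0 k]]] := (FF c Ac L cL Lc false (size vs)).2 vs (leqnn _).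
exists (C + D), (maxn m n); split; first exact: addr_ge0.
move=> j x Aj Lx; apply: le_trans (normc_le_parts _) _; rewrite !cpart_jet.
apply: le_trans (growthD w1 m n C0 D0 Aj).
by apply: lerD; [apply: h|apply: k] => //; exists x.
Qed.

Lemma jet_cfam (J : Type) (A : set J) w (F : J -> M -> R[i]) :
  (forall j, A j -> smooth_fun S (F j)) ->
  (forall c, atlas S c -> forall L, compact L -> L `<=` cdom c -> forall vs,
    exists C m, 0 <= C /\
      forall j x, A j -> L x -> normc (chart_jet c vs (F j) x) <= C * w j ^+ m) ->
  cfam S A w F.
Proof.
move=> Fs Fb c Ac L cL Lc b n; split.
  move=> j Aj; have [f1 f2] := Fs j Aj c Ac.
  by case: b; [move/smooth_onE : f1; exact|move/smooth_onE : f2; exact].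
move=> vs _; have [C [m [C0 h]]] := Fb c Ac L cL Lc vs; exists C, m; split => //.
move=> j _ Aj [x Lx <-]; apply: le_trans (h j x Aj Lx).
by rewrite -cpart_jet; exact: cpart_le.
Qed.

Lemma normcE0 (x : R[i]) : 0 <= normc x.
Proof. by rewrite -ler0c -[X in _ <= X]/(`|x|). Qed.

(** The clause [0 <= r] takes care of an empty [L], where the supremum is 0 by convention. *)
Lemma csem_leP c L vs f r : atlas S c -> compact L -> L `<=` cdom c ->
  chart_seminorm c L vs f <= r <->
  0 <= r /\ forall x, L x -> normc (chart_jet c vs f x) <= r.
Proof.
move=> Ac cL Lc.
have [C [m [C0 h]]] := cfam_jet (A := [set: unit]) (w := fun=> 1) vs (fun _ _ => lexx _)
  (cfam_fixed setT (fun=> 1) (Cc_smooth f)) Ac cL Lc.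
have hs : has_ubound [set normc (chart_jet c vs f x) | x in L].
  by exists (C * 1 ^+ m) => _ [x Lx <-]; exact: (h tt).
have [->|/set0P[x0 Lx0]] := eqVneq L set0.
  rewrite /chart_seminorm image_set0 sup0; split=> [r0|[]//].
  by split.
have ub x : L x -> normc (chart_jet c vs f x) <= chart_seminorm c L vs f.
  by move=> Lx; apply: ub_le_sup => //; exists x.
split=> [fr|[r0 fr]].
  split=> [|x Lx]; last exact: le_trans (ub x Lx) fr.
  exact: le_trans (le_trans (normcE0 _) (ub x0 Lx0)) fr.
apply: ge_sup; first by exists (normc (chart_jet c vs f x0)); exists x0.
by move=> _ [x Lx <-]; exact: fr.
Qed.

Lemma csem_ge0 c L vs f : atlas S c -> compact L -> L `<=` cdom c ->
  0 <= chart_seminorm c L vs f.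
Proof. by move=> Ac cL Lc; have [/(_ (lexx _))[]] := csem_leP vs f (chart_seminorm c L vs f) Ac cL Lc. Qed.

Lemma csem_jet c L vs f x : atlas S c -> compact L -> L `<=` cdom c -> L x ->
  normc (chart_jet c vs f x) <= chart_seminorm c L vs f.
Proof.
move=> Ac cL Lc Lx.
by have [/(_ (lexx _))[_ h] _] := csem_leP vs f (chart_seminorm c L vs f) Ac cL Lc; exact: h.
Qed.

Lemma csem_seminorm c L vs : atlas S c -> compact L -> L `<=` cdom c ->
  is_seminorm (@chart_seminorm R M S c L vs).
Proof.
move=> Ac cL Lc.
have sc a f : chart_seminorm c L vs (a *: f) <= normc a * chart_seminorm c L vs f.
  apply/csem_leP => //; split; first by rewrite mulr_ge0 ?normcE0 ?csem_ge0.
  move=> x Lx; have := jet_lin vs a f 0 Ac (Lc x Lx).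
  have j0 : chart_jet c vs 0 x = 0.
    have := jet_lin vs (-1) 0 0 Ac (Lc x Lx).
    by rewrite scaler0 addr0 mulN1r addNr.
  rewrite addr0 j0 addr0 => ->.
  by rewrite Normc.normcM ler_wpM2l ?normcE0// csem_jet.
split=> [a f|f g].
  apply/eqP; rewrite eq_le sc /=; have [->|a0] := eqVneq a 0.
    by rewrite Normc.normc0 mul0r csem_ge0.
  have na : 0 < normc a.
    rewrite lt_neqAle normcE0 andbT eq_sym; apply: contra_neq a0.
    exact: Normc.eq0_normc.
  rewrite -ler_pdivlMl//; have := sc a^-1 (a *: f).
  by rewrite scalerA mulVf// scale1r Normc.normcV.
apply/csem_leP => //; split; first by rewrite addr_ge0 ?csem_ge0.
move=> x Lx; have := jet_lin vs 1 f g Ac (Lc x Lx); rewrite scale1r mul1r => ->.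
by apply: le_trans (le_normcD _ _) _; rewrite lerD ?csem_jet.
Qed.

Lemma csem_LF c L vs : atlas S c -> compact L -> L `<=` cdom c ->
  LF_continuous (@chart_seminorm R M S c L vs).
Proof.
move=> Ac cL Lc K cK; exists 1, 1%N, (fun=> c), (fun=> L), (fun=> vs).
by split => // f _; rewrite mul1r big_ord1.
Qed.

(** The basic open sets that lie in some compact set cover the space by local compactness. They are
    countable, so the unions of the first [n] compact hulls exhaust it. *)
Lemma exhaustion : exists K : nat -> set M, [/\ forall n, compact (K n),
  forall m n, (m <= n)%N -> K m `<=` K n &
  forall L, compact L -> exists n, L `<=` K n].
Proof.
have [B cB [oB bB]] := smooth_countable S.
pose good (b : set M) := B b /\ exists2 C, compact C & b `<=` C.
have goodc x : exists2 b, good b & b x.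
  have [c Ac cx] := atlas_cover S x.
  have [C [cC xC _ _]] := chart_nbhs cx (cdom_open c) cx.
  have [b [Bb bx] bC] := bB x C xC; exists b => //; split => //; by exists C.
have /countable_injP[code codeI] := cB.
have exC i : exists C, compact C /\ forall b, good b -> code b = i -> b `<=` C.
  have [[b [gb bi]]|nb] := pselect (exists b, good b /\ code b = i); last first.
    exists set0; split; first exact: compact0.
    by move=> b gb bi; exfalso; apply: nb; exists b.
  have [Bb [C cC bC]] := gb; exists C; split => // b' [Bb' _] b'i.
  suff -> : b' = b by [].
  by apply: codeI; rewrite ?inE// b'i.
have [C CP] := choice exC.
pose fix K (n : nat) : set M := if n is m.+1 then K m `|` C m else set0.
have KS m n : (m <= n)%N -> K m `<=` K n.
  elim: n => [|n IH]; first by rewrite leqn0 => /eqP ->.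
  by rewrite leq_eqVlt => /predU1P[->//|/IH mn x /mn]; left.
exists K; split => //.
  by elim=> [|n IH] /=; [exact: compact0|apply: compactU => //; exact: (CP n).1].
move=> L cL; apply: (@compact_induction _ L (fun A => exists n, A `<=` K n)) => //.
- by exists 0%N.
- by move=> A A' AA' [n An]; exists n => x /AA' /An.
- move=> A A' [n An] [m Am]; exists (maxn n m) => x [/An|/Am]; apply: KS.
    exact: leq_maxl.
  exact: leq_maxr.
- move=> x Lx; have [b gb bx] := goodc x; exists b.
    by apply: open_nbhs_nbhs; split => //; apply: oB; exact: gb.1.
  by exists (code b).+1 => y yb; right; apply: ((CP (code b)).2 b gb erefl).
Qed.

Lemma csem_point c x f : chart_jet c [::] f x = f (cpsi c (cphi c x)).
Proof. by rewrite /chart_jet /=; case: (f _). Qed.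

(** If the supports escaped every compact set, there would be [f n] in [A] and points [x n] outside
    [K n] with [f n (x n)] nonzero. The seminorm [p], the supremum over [n] of [n] times the ratio
    of the values of [g] and [f n] at [x n], is then finite and LF continuous, because only finitely
    many [x n] lie in any compact set; but it is at least [n] at [f n]. *)
Lemma Cc_small_supp (A : set (Cc S)) : small A ->
  exists2 K, compact K & forall f, A f -> supp f `<=` K.
Proof.
move=> sA; have [K [cK KS KL]] := exhaustion; apply: contrapT => nK.
have ex n : exists fx : Cc S * M, [/\ A fx.1, ~ K n fx.2 & fx.1 fx.2 != 0].
  apply: contrapT => nfx; apply: nK; exists (K n); first exact: cK.
  move=> f Af; apply: supp_subP; first exact: compact_closedM (cK n).
  move=> x nKx; apply: contrapT => /eqP fx; apply: nfx.
  by exists (f, x).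
have [fx fxP] := choice ex; pose f n := (fx n).1; pose x n := (fx n).2.
have fx0 n : 0 < normc (f n (x n)).
  have [_ _ n0] := fxP n; rewrite lt_neqAle normcE0 andbT eq_sym.
  by apply: contra_neq n0; exact: Normc.eq0_normc.
pose T (g : Cc S) n : R := n%:R * (normc (g (x n)) / normc (f n (x n))).
have T0 g n : 0 <= T g n by rewrite mulr_ge0// divr_ge0 ?normcE0// ltW.
have Tsupp N g : supp g `<=` K N -> forall n, (N <= n)%N -> T g n = 0.
  move=> gN n Nn; have [_ nK' _] := fxP n.
  rewrite /T (_ : g (x n) = 0) ?Normc.normc0 ?mul0r ?mulr0//.
  by apply: supp_out => /gN /(KS _ _ Nn).
have Tub g : exists2 r, 0 <= r & forall n, T g n <= r.
  have [N gN] := KL _ (CcP g).2; exists (\sum_(i < N) T g i).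
    by apply: sumr_ge0.
  move=> n; have [nN|nN] := ltnP n N; last first.
    by rewrite (Tsupp N)//; apply: sumr_ge0.
  by rewrite (bigD1 (Ordinal nN))//= lerDl sumr_ge0.
pose p g := sup (range (T g)).
have pP g r : p g <= r <-> forall n, T g n <= r.
  have [q _ Tq] := Tub g.
  have ub : has_ubound (range (T g)) by exists q => _ [n _ <-].
  split=> [pr n|Tr].
    by apply: le_trans pr; apply: ub_le_sup => //; exists n.
  by apply: ge_sup; [exists (T g 0%N), 0%N|move=> _ [n _ <-]].
have pT g n : T g n <= p g by have /(_ (lexx _)) := (pP g (p g)).1.
have p0 g : 0 <= p g by apply: le_trans (pT g 0%N).
have TZ a g n : T (a *: g) n = normc a * T g n.
  by rewrite /T [(a *: g) _]/(a * g (x n)) Normc.normcM; ring.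
have pZ a g : p (a *: g) <= normc a * p g.
  by apply/pP => n; rewrite TZ ler_wpM2l ?normcE0.
have sp : is_seminorm p.
  split=> [a g|g h].
    apply/eqP; rewrite eq_le pZ /=; have [->|a0] := eqVneq a 0.
      by rewrite Normc.normc0 mul0r.
    have na : 0 < normc a.
      rewrite lt_neqAle normcE0 andbT eq_sym; apply: contra_neq a0.
      exact: Normc.eq0_normc.
    rewrite -ler_pdivlMl//; have := pZ a^-1 (a *: g).
    by rewrite scalerA mulVf// scale1r Normc.normcV.
  apply/pP => n; apply: le_trans (lerD (pT g n) (pT h n)).
  rewrite /T -mulrDr -mulrDl ler_wpM2l// ler_wpM2r ?invr_ge0 ?normcE0//.
  exact: le_normcD.
have Lp : LF_continuous p.
  move=> L cL; have [N LN] := KL _ cL.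
  have exc n : exists c, atlas S c /\ cdom c (x n).
    by have [c] := atlas_cover S (x n); exists c.
  have [c cP] := choice exc.
  pose D := \sum_(n < N) n%:R / normc (f n (x n)).
  have D0 (n : 'I_N) : 0 <= n%:R / normc (f n (x n)).
    by rewrite divr_ge0// ltW.
  exists D, N, (fun n => c n), (fun n => [set x n]), (fun=> [::]); split.
    move=> n; split; [exact: (cP n).1|exact: compact_set1|].
    by move=> _ ->; exact: (cP n).2.
  move=> g gL.
  have gN : supp g `<=` K N by move=> y /gL /LN.
  have sn (n : 'I_N) : normc (g (x n)) <= chart_seminorm (c n) [set x n] [::] g.
    have [Ac cx] := cP n.
    have := @csem_jet (c n) [set x n] [::] g (x n) Ac (@compact_set1 _ (x (val n))) _ erefl.
    by rewrite csem_point cphiK//; apply => _ ->.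
  have s0 (n : 'I_N) : 0 <= chart_seminorm (c n) [set x n] [::] g.
    exact: le_trans (normcE0 _) (sn n).
  apply/pP => n; have [nN|nN] := ltnP n N; last first.
    by rewrite (Tsupp N)// mulr_ge0// sumr_ge0.
  rewrite /T mulrA mulrAC.
  pose m := Ordinal nN.
  apply: ler_pM => //.
  - by rewrite divr_ge0 ?normcE0//.
  - exact: normcE0.
  - by rewrite /D (bigD1 m)//= lerDl sumr_ge0.
  - by rewrite (bigD1 m)//=; apply: le_trans (sn m) _; rewrite lerDl sumr_ge0.
have [r rP] := sA p sp Lp.
have [N rN] : exists N : nat, r < N%:R.
  exists (Num.bound `|r|); apply: le_lt_trans (ler_norm _) _; exact: archi_boundP.
have := le_lt_trans (le_trans (pT (f N) N) (rP _ _)) rN.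
have [Af _ _] := fxP N => /(_ Af).
by rewrite /T divff ?mulr1 ?ltxx// gt_eqF.
Qed.

(** The working description of the bornology: a bounded set of the LF space is bounded in one of its
    Frechet steps. Conversely an LF continuous seminorm is dominated on such a step by finitely many
    chart seminorms. *)
Lemma Cc_smallP (A : set (Cc S)) : small A <->
  (exists2 K, compact K & forall f, A f -> supp f `<=` K) /\
  cfam S A (fun=> 1) (fun f => f : M -> R[i]).
Proof.
split=> [sA|[[K cK AK] fA] p sp Lp].
  split; first exact: Cc_small_supp.
  apply: jet_cfam => [f Af|c Ac L cL Lc vs]; first exact: Cc_smooth.
  have [r rP] := sA _ (csem_seminorm vs Ac cL Lc) (csem_LF vs Ac cL Lc).
  exists `|r|, 0%N; split => // f x Af Lx; rewrite expr0 mulr1.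
  apply: le_trans (csem_jet vs f Ac cL Lc Lx) _.
  by apply: le_trans (rP f Af) _; exact: ler_norm.
have [C [n [c [L [vs [cP pC]]]]]] := Lp K cK.
have ex k : exists r, forall f, A f -> chart_seminorm (c k) (L k) (vs k) f <= r.
  have [Ac cL Lc] := cP k.
  have [D [m [D0 h]]] := cfam_jet (vs k) (fun _ _ => lexx _) fA Ac cL Lc.
  exists D => f Af; apply/csem_leP => //; split => // x Lx.
  by have := h f x Af Lx; rewrite expr1n mulr1.
have [r rP] := choice ex; exists (`|C| * \sum_k r k) => f Af.
apply: le_trans (pC f (AK f Af)) _.
have s0 : 0 <= \sum_(k < n) chart_seminorm (c k) (L k) (vs k) f.
  by apply: sumr_ge0 => k _; have [Ac cL Lc] := cP k; exact: csem_ge0.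
apply: (@le_trans _ _ (`|C| * \sum_(k < n) chart_seminorm (c k) (L k) (vs k) f)).
  by rewrite ler_wpM2r// ler_norm.
by rewrite ler_wpM2l//; apply: ler_sum => k _; exact: rP.
Qed.

End SmallSets.

Section Completeness.
Context {R : realType} {M : topologicalType} (S : smoothStructure R M).
Local Notation normc := ComplexField.Normc.normc.
Implicit Types (f g : Cc S).

Lemma CcE (a : R[i]) f g x : (a *: f + g) x = a * f x + g x.
Proof. by []. Qed.

Lemma CcZE (a : R[i]) f x : (a *: f) x = a * f x.
Proof. by []. Qed.

Lemma CcBE f g x : (f - g) x = f x - g x.
Proof. by []. Qed.

Lemma jetB c vs f g x : atlas S c -> cdom c x ->
  chart_jet c vs (f - g) x = chart_jet c vs f x - chart_jet c vs g x.
Proof.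
move=> Ac cx; have := jet_lin vs (-1) g f Ac cx.
by rewrite scaleN1r mulN1r addrC => ->; rewrite addrC.
Qed.

Lemma jetZ c vs a f x : atlas S c -> cdom c x ->
  chart_jet c vs (a *: f) x = a * chart_jet c vs f x.
Proof.
move=> Ac cx; have := jet_lin vs a f 0 Ac cx; rewrite addr0 => ->.
by have := jetB vs f f Ac cx; rewrite !subrr => ->; rewrite addr0.
Qed.

Lemma normc_le_of (a b : R[i]) :
  `|a| + `|b| <= 1 -> normc a + normc b <= 1.
Proof. by rewrite !normcE' -rmorphD -[1]/(1%:C) lecR. Qed.

(** One prescribed bound for every chart, compact set and list of directions at once; such disks are
    Banach, and each small set lies in one. *)
Definition sem_disk (K : set M)
    (r : chart M (model S) -> set M -> seq (model S) -> R) : set (Cc S) :=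
  [set f | (forall x, ~ K x -> f x = 0) /\
    forall c L vs, atlas S c -> compact L -> L `<=` cdom c ->
      forall x, L x -> normc (chart_jet c vs f x) <= r c L vs].

Section SemDisk.
Variables (K : set M) (r : chart M (model S) -> set M -> seq (model S) -> R).
Hypothesis cK : compact K.
Hypothesis r0 : forall c L vs, 0 <= r c L vs.
Local Notation T := (sem_disk K r).

Lemma sem_disk_disk : is_disk T.
Proof.
split.
  exists 0; split => // c L vs Ac cL Lc x Lx.
  have := jetZ vs 0 0 Ac (Lc x Lx); rewrite scale0r mul0r => ->.
  by rewrite Normc.normc0.
move=> a b f g /normc_le_of ab [fK fr] [gK gr]; split.
  by move=> x nKx; rewrite CcE CcZE (fK x nKx) (gK x nKx) !mulr0 addr0.
move=> c L vs Ac cL Lc x Lx; have cx := Lc x Lx.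
rewrite jet_lin// jetZ//; apply: le_trans (le_normcD _ _) _.
rewrite !Normc.normcM.
apply: (@le_trans _ _ ((normc a + normc b) * r c L vs)).
  rewrite mulrDl; apply: lerD; apply: ler_wpM2l => //; try exact: normcE0.
    exact: fr.
  exact: gr.
by rewrite ler_piMl.
Qed.

Lemma sem_disk_small : small T.
Proof.
apply/Cc_smallP; split.
  by exists K => // f [fK _]; apply: supp_subP => //; exact: (compact_closedM S cK).
apply: jet_cfam => [f _|c Ac L cL Lc vs]; first exact: Cc_smooth.
by exists (r c L vs), 0%N; split => // f x [_ fr] Lx; rewrite expr0 mulr1; apply: fr Lx.
Qed.

Lemma scaled_sem_disk e f : 0 <= e -> scaled_in T e f ->
  (forall x, ~ K x -> f x = 0) /\
  forall c L vs, atlas S c -> compact L -> L `<=` cdom c ->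
      forall x, L x -> normc (chart_jet c vs f x) <= e * r c L vs.
Proof.
move=> e0 [t [tK tr] ->]; split.
  by move=> x nKx; rewrite CcZE (tK x nKx) mulr0.
move=> c L vs Ac cL Lc x Lx; rewrite jetZ//; last exact: Lc.
rewrite Normc.normcM; apply: ler_pM; rewrite ?normcE0//; last exact: tr Lx.
by rewrite -lecR -normcE' norm_realC.
Qed.

Lemma sem_disk_scaled e f : 0 < e -> (forall x, ~ K x -> f x = 0) ->
  (forall c L vs, atlas S c -> compact L -> L `<=` cdom c ->
      forall x, L x -> normc (chart_jet c vs f x) <= e * r c L vs) ->
  scaled_in T e f.
Proof.
move=> e0 fK fr; exists ((e%:C)^-1 *: f); last first.
  by rewrite scalerA divff ?scale1r// realC_neq0.
split=> [x nKx|c L vs Ac cL Lc x Lx].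
  by rewrite CcZE (fK x nKx) mulr0.
rewrite jetZ//; last exact: Lc.
rewrite Normc.normcM Normc.normcV.
have -> : normc e%:C = e.
  by apply: (@complexI R); rewrite -normcE' norm_realC// ltW.
by rewrite ler_pdivrMl//; exact: fr Lx.
Qed.

Lemma value_bound x : exists2 D, 0 <= D &
  forall e f, 0 <= e -> scaled_in T e f -> normc (f x) <= e * D.
Proof.
have [c Ac cx] := atlas_cover S x; exists (r c [set x] [::]) => // e f e0.
move=> /(scaled_sem_disk e0)[_] /(_ c [set x] [::] Ac (@compact_set1 _ x)).
rewrite -{4}(cphiK cx) -csem_point; apply=> // _ -> //.
Qed.

(** The limit of a Cauchy sequence is formed by pointwise ultralimits. By [ulim_smooth] it is smooth
    and its derivatives are the ultralimits of the derivatives, so the Cauchy estimates pass to it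
    at every order. *)
Lemma sem_disk_banach : banach_disk T.
Proof.
have dT := sem_disk_disk.
split=> //.
  move=> f Tf gf; apply: Cc_ext_eq => x; have [D D0 fD] := value_bound x.
  apply: Normc.eq0_normc; apply/eqP; rewrite eq_le normcE0 andbT.
  apply/ler_addgt0Pl => e e0; rewrite addr0.
  have D1 : 0 < D + 1 by rewrite ltr_wpDl.
  have ed : 0 < e / (D + 1) by exact: divr_gt0.
  have := fD _ f (ltW ed) (gauge_lt_scaled dT Tf _); rewrite gf => /(_ ed) h.
  apply: le_trans h _; rewrite mulrAC ler_pdivrMr// ler_wpM2l ?(ltW e0)//.
  by rewrite lerDl.
move=> u Tu uc.
have uC e : 0 < e -> exists N, forall m n, (N <= m)%N -> (N <= n)%N ->
    scaled_in T e (u m - u n).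
  move=> /uc[N Ne]; exists N => m n Nm Nn; apply: gauge_lt_scaled => //.
    exact: lspanB.
  exact: Ne.
have [N1 u1] := uC 1 ltr01.
have exq n : exists q, 0 < q /\ scaled_in T q (u n).
  by have [q q0 uq] := lspan_scaled dT (Tu n); exists q.
have [q qP] := choice exq.
(* A single radius holding the whole sequence: the sum covers the terms up to [N1], and the added 1
   the distance of the later ones from [u N1]. *)
pose rho := \sum_(i < N1.+1) q i + 1.
have q0 n : 0 <= q n by apply: ltW; exact: (qP n).1.
have rho0 : 0 < rho by rewrite ltr_wpDl// sumr_ge0.
have qrho n : (n <= N1)%N -> q n + 1 <= rho.
  move=> nN; rewrite /rho lerD2r (bigD1 (Ordinal (n := N1.+1) (m := n) nN))//=.
  by rewrite lerDl sumr_ge0.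
have urho n : scaled_in T rho (u n).
  have [nN|/ltnW nN] := leqP n N1.
    apply: (@scaled_in_le _ _ T (q n)) => //; last exact: (qP n).2.
    by apply: le_trans (qrho n nN); rewrite lerDl.
  apply: (@scaled_in_le _ _ T (q N1 + 1)) => //; first exact: addr_ge0.
    exact: qrho.
  rewrite -(subrK (u N1) (u n)) [_ - _ + _]addrC; apply: scaled_inD => //.
    exact: (qP N1).2.
  exact: u1.
have ujet n := (scaled_sem_disk (ltW rho0) (urho n)).2.
pose l x : R[i] := Complex (ulim (fun n => cpart true (u n x)))
  (ulim (fun n => cpart false (u n x))).
have lE b x : cpart b (l x) = ulim (fun n => cpart b (u n x)) by case: b.
have lK x : ~ K x -> l x = 0.
  move=> nKx; apply: cpart_eq => b; rewrite lE cpart0 -[RHS](ulim_cst 0).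
  congr ulim; apply/funext => n.
  by rewrite ((scaled_sem_disk (ltW rho0) (urho n)).1 x nKx) cpart0.
have lsm c b : atlas S c ->
    smooth_on (cphi c @` cdom c) (fun y => ulim (fun n => cpart b (u n (cpsi c y)))) /\
    forall vs y, (cphi c @` cdom c) y ->
    iter_derive vs (fun y => ulim (fun n => cpart b (u n (cpsi c y)))) y =
    ulim (fun n => iter_derive vs (fun y => cpart b (u n (cpsi c y))) y).
  move=> Ac.
  apply: (ulim_smooth (mbasis S) (f := fun n y => cpart b (u n (cpsi c y)))).
  - exact: cimg_open.
  - by move=> n; exact: Cc_smooth_part.
  move=> vs _ [x cx <-]; have [L [cL xL _ Lc]] := chart_nbhs cx (cdom_open c) cx.
  exists (rho * r c L vs).
  have ix : (cphi c @` cdom c) (cphi c x) by exists x.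
  have h1 : nbhs (cphi c x) (cphi c @` cdom c).
    by apply: open_nbhs_nbhs; split => //; exact: cimg_open.
  have h2 : nbhs (cphi c x) (cpsi c @^-1` L).
    by apply: (cpsi_continuous ix); rewrite cphiK.
  apply: filterS2 h1 h2 => _ [z cz <-] /=; rewrite cphiK// => Lz n.
  rewrite -cpart_jet; apply: le_trans (cpart_le _ _) _.
  exact: ujet Lz.
have lP : l \in Cc_pred S.
  apply: mem_set; split; last exact: (supp_sub_compact S cK lK).2.
  by move=> c Ac; split; [exact: (lsm c true Ac).1|exact: (lsm c false Ac).1].
pose lC := MkCc lP.
have ljet c vs x b : atlas S c -> cdom c x -> cpart b (chart_jet c vs lC x) =
    ulim (fun n => cpart b (chart_jet c vs (u n) x)).
  move=> Ac cx; rewrite cpart_jet.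
  transitivity (iter_derive vs (fun y => ulim (fun n => cpart b (u n (cpsi c y))))
      (cphi c x)).
    by congr (iter_derive vs _ _); apply/funext => y; exact: lE.
  rewrite (lsm c b Ac).2; last by exists x.
  by congr ulim; apply/funext => n; rewrite cpart_jet.
(* The factor 2 appears because real and imaginary part are estimated separately, the ultralimit
   being defined for real sequences. *)
have ulT e : 0 < e -> exists N, forall n, (N <= n)%N -> scaled_in T (2 * e) (u n - lC).
  move=> e0; have [N uN] := uC e e0; exists N => n Nn.
  apply: sem_disk_scaled; first exact: mulr_gt0.
    move=> x nKx; rewrite CcBE [X in _ - X](lK x nKx).
    by rewrite ((scaled_sem_disk (ltW rho0) (urho n)).1 x nKx) subr0.
  move=> c L vs Ac cL Lc x Lx; have cx := Lc x Lx.
  rewrite jetB//; apply: le_trans (normc_le_parts _) _.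
  suff h b : `|cpart b (chart_jet c vs (u n) x - chart_jet c vs lC x)| <= e * r c L vs.
    by rewrite -mulrA mulr_natl mulr2n lerD.
  have bu : bseq (fun n => cpart b (chart_jet c vs (u n) x)).
    exists (rho * r c L vs) => m; apply: le_trans (cpart_le _ _) _.
    exact: ujet Lx.
  rewrite cpartB ljet// -(ulim_cst (cpart b (chart_jet c vs (u n) x))).
  rewrite -ulimB//; last exact: bseq_cst.
  apply: ulim_norm; first by apply: bseqB => //; exact: bseq_cst.
  exists N => // m /= Nm; rewrite -cpartB -jetB//.
  apply: le_trans (cpart_le _ _) _.
  exact: (scaled_sem_disk (ltW e0) (uN n m Nn Nm)).2 Lx.
have Tl : lspan T lC.
  have [N /(_ N (leqnn N)) h] := ulT 1 ltr01.
  have -> : lC = u N - (u N - lC) by rewrite opprB addrC subrK.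
  by apply: lspanB => //; exact: scaled_in_lspan h.
exists lC => //; apply/cvgrPdist_le => e e0.
have [N uN] := ulT (e / 2) (divr_gt0 e0 (ltr0Sn _ 1)).
exists N => // n /= /uN; rewrite mulrC divfK// => h.
rewrite sub0r normrN ger0_norm ?gauge_ge0//.
exact: scaled_gauge.
Qed.

End SemDisk.

Lemma Cc_complete : complete_born (Cc S).
Proof.
move=> A /Cc_smallP[[K cK AK] fA].
(* The bound is chosen for all triples; 0 is the default where the chart is not in the atlas or the
   set is not a compact part of its domain. *)
have ex (q : chart M (model S) * set M * seq (model S)) : exists r, 0 <= r /\
    (atlas S q.1.1 -> compact q.1.2 -> q.1.2 `<=` cdom q.1.1 ->
     forall f x, A f -> q.1.2 x -> normc (chart_jet q.1.1 q.2 f x) <= r).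
  case: q => -[c L] vs /=.
  have [[Ac [cL Lc]]|n] := pselect (atlas S c /\ compact L /\ L `<=` cdom c).
    have [D [m [D0 h]]] := cfam_jet vs (fun _ _ => lexx _) fA Ac cL Lc.
    exists D; split => // _ _ _ f x Af Lx.
    by have := h f x Af Lx; rewrite expr1n mulr1.
  by exists 0; split => // Ac cL Lc; exfalso; apply: n.
have [r rP] := choice ex; pose r' c L vs := r (c, L, vs).
exists (sem_disk K r'); split.
- move=> f Af; split.
    by move=> x nKx; apply: supp_out => /(AK f Af).
  by move=> c L vs Ac cL Lc x Lx; apply: ((rP (c, L, vs)).2 Ac cL Lc).
- by apply: sem_disk_small => // c L vs; exact: (rP (c, L, vs)).1.
- by apply: sem_disk_banach => // c L vs; exact: (rP (c, L, vs)).1.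
Qed.

Lemma small_image_cfam (J : Type) (A : set J) (F : J -> Cc S) K : compact K ->
  (forall j x, A j -> ~ K x -> F j x = 0) ->
  cfam S A (fun=> 1) (fun j => F j : M -> R[i]) -> small (F @` A).
Proof.
move=> cK FK fF; apply/Cc_smallP; split.
  exists K => // _ [j Aj <-]; apply: supp_subP; first exact: (compact_closedM S cK).
  by move=> x nKx; exact: FK.
apply: jet_cfam => [f _|c Ac L cL Lc vs]; first exact: Cc_smooth.
have [D [m [D0 h]]] := cfam_jet vs (fun _ _ => lexx _) fF Ac cL Lc.
exists D, m; split => // _ x [j Aj <-] Lx; exact: h.
Qed.

End Completeness.

Section Multiplication.
Context {R : realType} {M : topologicalType} (S : smoothStructure R M).

Fact smulC_subproof (phi : M -> R[i]) (phis : smooth_fun S phi) (f : Cc S) :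
  (fun x => phi x * f x) \in Cc_pred S.
Proof.
have [fs fc] := CcP f; apply: mem_set; split; first exact: smooth_funM.
by apply: supp_sub fc => x ->; rewrite mulr0.
Qed.
Definition smulC phi phis (f : Cc S) : Cc S := MkCc (@smulC_subproof phi phis f).

Lemma smulCE phi phis f x : @smulC phi phis f x = phi x * f x.
Proof. by []. Qed.

Lemma smulC_bounded phi (phis : smooth_fun S phi) : bounded_linear (smulC phis).
Proof.
split=> [a f g|A /Cc_smallP[[K cK AK] fA]].
  by apply: Cc_ext_eq => x; rewrite CcE !smulCE CcE mulrDr mulrCA.
apply: (small_image_cfam cK) => [f x Af nKx|].
  by rewrite /= (supp_out (f := f)) ?mulr0// => /(AK f Af).
apply: cfamM => //; exact: cfam_fixed.
Qed.

End Multiplication.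

Section Action.
Context {R : realType} {M N : topologicalType}.
Context (S : smoothStructure R M) (T : smoothStructure R N).
Variable p : N -> M.
Hypothesis ps : smooth_map T S p.

Lemma smooth_fun_pull (phi : M -> R[i]) : smooth_fun S phi ->
  smooth_fun T (fun x => phi (p x)).
Proof.
move=> phis; have w1 (j : unit) : [set: unit] j -> 1 <= (1 : R) by [].
have h := cfam_pull w1 ps (cfam_fixed setT (fun=> 1) phis).
exact: (cfam_smooth (j := tt) h I).
Qed.

(** The function [h \o p] need not have compact support, so [h] acts through multiplication by a
    smooth function and the support comes from [v]. *)
Definition pact (h : Cc S) (v : Cc T) : Cc T :=
  smulC (smooth_fun_pull (CcP h).1) v.

Lemma pactE h v x : pact h v x = h (p x) * v x. Proof. by []. Qed.

Lemma pact_bounded : bounded_bilinear pact.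
Proof.
split.
- by move=> v a f g; apply: Cc_ext_eq => x; rewrite CcE !pactE CcE mulrDl mulrA.
- by move=> h a f g; apply: Cc_ext_eq => x; rewrite CcE !pactE CcE mulrDr mulrCA.
move=> A B /Cc_smallP[[K cK AK] fA] /Cc_smallP[[L cL BL] fB].
pose A' := [set hv : Cc S * Cc T | A hv.1 /\ B hv.2].
suff s : small [set pact hv.1 hv.2 | hv in A'].
  by apply: smallW s _ => _ [h [v [Ah Bv ->]]]; exists (h, v).
apply: (small_image_cfam cL) => [[h v] x [_ /= Bv] nLx|].
  by rewrite /= (supp_out (f := v)) ?mulr0// => /(BL v Bv).
have w1 (j : Cc S * Cc T) : A' j -> 1 <= (1 : R) by [].
have fA' : cfam S A' (fun=> 1) (fun hv => hv.1 : M -> R[i]).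
  by apply: (cfam_reindex (k := fst) _ _ fA) => // j [].
have fB' : cfam T A' (fun=> 1) (fun hv => hv.2 : N -> R[i]).
  by apply: (cfam_reindex (k := snd) _ _ fB) => // j [].
exact: (cfamM w1 (cfam_pull w1 ps fA') fB').
Qed.

End Action.

(** * Cutoffs and smooth maps *)

Section FlatFunction.
Context {R : realType}.

(** The power of the inverse in front of the exponential makes the family closed under
    differentiation, see [flat_derive]; smoothness then follows by induction on the order for all
    [m] together. *)
Definition flat (m : nat) (x : R) : R :=
  if 0 < x then x^-1 ^+ m * expR (- x^-1) else 0.

Lemma flat_ge0 m x : 0 <= flat m x.
Proof.
rewrite /flat; case: ifP => // x0.
by rewrite mulr_ge0 ?expR_ge0// exprn_ge0// invr_ge0 ltW.
Qed.

Lemma flat_gt0 m x : 0 < x -> 0 < flat m x.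
Proof.
by move=> x0; rewrite /flat x0 mulr_gt0 ?expR_gt0// exprn_gt0// invr_gt0.
Qed.

Lemma flat_le0 m x : x <= 0 -> flat m x = 0.
Proof. by move=> x0; rewrite /flat ltNge x0. Qed.

Lemma flatS m x : 0 < x -> flat m.+1 x = x^-1 * flat m x.
Proof. by move=> x0; rewrite /flat x0 exprS mulrA. Qed.

(** One term of the exponential series of the inverse of [x] dominates the power in front and leaves
    a factor quadratic in [x]. This gives derivative 0 at the origin. *)
Lemma flat_sq m : exists2 C : R, 0 <= C & forall x, `|flat m x| <= C * x ^+ 2.
Proof.
exists m.+2`!%:R => // x; rewrite ger0_norm ?flat_ge0// /flat.
case: ifPn => [x0|_]; last by rewrite mulr_ge0// sqr_ge0.
have f0 : 0 < m.+2`!%:R :> R by rewrite ltr0n fact_gt0.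
have h : x^-1 ^+ m.+2 / m.+2`!%:R <= expR x^-1.
  by apply: le_trans (expR_ge1Dxn m.+1 _); rewrite ?lerDr// invr_ge0 ltW.
rewrite expRN ler_pdivrMr ?expR_gt0// mulrC -ler_pdivrMr ?mulr_gt0 ?exprn_gt0//.
apply: le_trans h; rewrite le_eqVlt; apply/orP; left; apply/eqP.
by rewrite -addn2 exprD invfM !exprVn -exprVn; field; rewrite !gt_eqF// exprn_gt0.
Qed.

Lemma is_derive_inv (x : R) : x != 0 -> is_derive x 1 (fun y : R => y^-1) (- x^-1 ^+ 2).
Proof.
move=> x0; have d : derivable (fun y : R => y) x 1 by exact: derivable_id.
apply: DeriveDef; first exact: derivableV.
rewrite (deriveV x0 d) derive_id exprVn.
by rewrite -[_ *: 1]/(_ * 1) mulr1.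
Qed.

Lemma flat_derive m (x : R) : is_derive x 1 (flat m)
  (- m%:R * flat m.+1 x + flat m.+2 x).
Proof.
have [x0|x0|->] := ltgtP x 0.
- rewrite !(flat_le0 _ (ltW x0)) mulr0 addr0.
  apply: (@near_eq_is_derive _ _ _ (cst 0) (flat m)).
  by near=> y; rewrite flat_le0//; apply: ltW; near: y; exact: lt_nbhsl.
- elim: m => [|m IH].
    have d1 := is_derive_inv (lt0r_neq0 x0).
    have d2 : is_derive x 1 (fun y : R => - y^-1) (x^-1 ^+ 2).
      by have := is_deriveN d1; rewrite opprK.
    have d3 := @is_derive1_comp _ expR (fun y => - y^-1) x _ _ (is_derive_expR _) d2.
    have f0 : flat 0 x = expR (- x^-1) by rewrite /flat x0 expr0 mul1r.
    rewrite mulr0n oppr0 mul0r add0r !(flatS _ x0) f0 mulrA -expr2 mulrC.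
    apply: near_eq_is_derive d3; near=> y; rewrite /flat /=.
    have -> : 0 < y by near: y; exact: lt_nbhsr.
    by rewrite expr0 mul1r.
  have d := is_deriveM (is_derive_inv (lt0r_neq0 x0)) IH.
  have -> : - m.+1%:R * flat m.+2 x + flat m.+3 x =
      x^-1 *: (- m%:R * flat m.+1 x + flat m.+2 x) + flat m x *: (- x^-1 ^+ 2).
    rewrite -[_ *: _]/(_ * _) -[X in _ = _ + X]/(_ * _) !(flatS _ x0) -natr1; ring.
  apply: near_eq_is_derive d; near=> y; rewrite /=.
  by rewrite flatS//; near: y; exact: lt_nbhsr.
- have z k : flat k 0 = 0 by rewrite flat_le0.
  rewrite !z mulr0 addr0; have [C C0 fC] := flat_sq m.
  have cvgq : h^-1 *: ((flat m \o shift 0) (h *: (1 : R)) - flat m 0)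
      @[h --> (0 : R)^'] --> (0 : R).
    apply/cvgrPdist_lt => e e0.
    have C1 : 0 < C + 1 by rewrite ltr_wpDl.
    have nh : \forall h \near (0 : R)^', `|h| < e / (C + 1).
      apply: cvg_within; apply/nbhs_ballP; exists (e / (C + 1)) => /=.
        exact: divr_gt0.
      by move=> h; rewrite -ball_normE /= sub0r normrN.
    near=> h; have h0 : h != 0 by near: h; exact: nbhs_dnbhs_neq.
    rewrite sub0r normrN z subr0 /= addr0 -[h *: 1]/(h * 1) mulr1 normrM normfV.
    have nh0 : 0 < `|h| by rewrite normr_gt0.
    rewrite ltr_pdivrMl//; apply: le_lt_trans (fC h) _.
    apply: (@le_lt_trans _ _ (`|h| * ((C + 1) * `|h|))).
      by rewrite -real_normK ?num_real// expr2 mulrCA ler_wpM2l// ler_wpM2r// lerDl.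
    rewrite ltr_pM2l// mulrC -ltr_pdivlMr//; near: h; exact: nh.
  by apply: DeriveDef; [apply/cvg_ex; eexists; exact: cvgq|exact: cvg_lim cvgq].
Unshelve. all: by end_near. Qed.

Lemma is_derive_dir (f : R -> R) (x : R) df v : is_derive x 1 f df ->
  derivable f x v /\ 'D_v f x = v * df.
Proof.
move=> fd; have [d <-] := fd.
by have := is_derive_scale v d; rewrite -[v *: 1]/(v * 1) mulr1.
Qed.

Lemma is_derive_continuous (f : R -> R) (x : R) df : is_derive x 1 f df ->
  {for x, continuous f}.
Proof.
by move=> [/derivable1_diffP/differentiable_continuous].
Qed.

Lemma smooth_upto0_derive (U : set R) (f df : R -> R) :
  (forall x : R, U x -> is_derive x 1 f (df x)) -> smooth_upto 0 U f.
Proof.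
move=> fd; case=> // _ x Ux; split; first exact: is_derive_continuous (fd x Ux).
by move=> v; exact: (is_derive_dir v (fd x Ux)).1.
Qed.

Lemma smooth_uptoS_derive (U : set R) (f df : R -> R) n : open U ->
  (forall x : R, U x -> is_derive x 1 f (df x)) -> smooth_upto n U df ->
  smooth_upto n.+1 U f.
Proof.
move=> oU fd dfs; apply: smooth_uptoS; first exact: smooth_upto0_derive fd.
move=> v; apply: (eq_smooth_upto oU _
  (smooth_uptoM oU (@smooth_upto_cst R R R n U v) dfs)).
by move=> x Ux /=; rewrite (is_derive_dir v (fd x Ux)).2.
Qed.

Lemma flat_smooth m : smooth_on setT (flat m).
Proof.
apply/smooth_onE => n; elim: n m => [|n IH] m.
  by apply: smooth_upto0_derive => x _; exact: flat_derive.
apply: (smooth_uptoS_derive (df := fun x => - m%:R * flat m.+1 x + flat m.+2 x)).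
- exact: openT.
- by move=> x _; exact: flat_derive.
have c := @smooth_upto_cst R R R n setT (- m%:R).
exact: (smooth_uptoD openT (smooth_uptoM openT c (IH m.+1)) (IH m.+2)).
Qed.

Lemma smooth_on_inv (E : normedModType R) (U : set E) (f : E -> R) : open U ->
  (forall x, U x -> f x != 0) -> smooth_on U f -> smooth_on U (fun x => (f x)^-1).
Proof.
move=> oU f0 fs; apply/smooth_onE => n.
have base : smooth_upto 0 U (fun x => (f x)^-1).
  case=> // _ x Ux; have [fc fd] := fs [::] x Ux; split.
    by apply: cvgV; [exact: f0|exact: fc].
  by move=> v; apply: derivableV; [exact: f0|exact: fd].
elim: n => [|n IH]; first exact: base.
apply: smooth_uptoS; first exact: base.
move=> v.
have Df : smooth_upto n U (fun x => 'D_v f x).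
  by apply: smooth_upto_derive; move/smooth_onE : fs; apply.
have m1 : smooth_upto n U (fun _ : E => -1 : R) by exact: smooth_upto_cst.
apply: (eq_smooth_upto oU _ (smooth_uptoM oU m1
  (smooth_uptoM oU (smooth_uptoM oU IH IH) Df))).
move=> x Ux /=; rewrite deriveV; [|exact: f0|exact: (fs [::] x Ux).2].
by rewrite -[_ *: _]/(_ * _) mulN1r -mulNr -expr2 exprVn.
Qed.

Lemma smooth_on_comp1 (E : normedModType R) (U : set E) (g : E -> R) (f : R -> R) :
  open U -> smooth_on setT f -> smooth_on U g -> smooth_on U (f \o g).
Proof.
by move=> oU fs gs; apply: (smooth_on_comp (basisR R) oU openT fs gs).
Qed.

Lemma smooth_on_affine (E : normedModType R) (U : set E) (g : E -> R) (a b : R) :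
  open U -> smooth_on U g -> smooth_on U (fun x => a + b * g x).
Proof.
move=> oU gs.
have ca := @smooth_on_cst R E R U a; have cb := @smooth_on_cst R E R U b.
exact: (smooth_onD oU ca (smooth_onM oU cb gs)).
Qed.

Lemma smooth_on_id (U : set R) : smooth_on U (fun x : R => x).
Proof. by apply: (@smooth_on_linfun _ _ _ _ 1) => // v; rewrite mul1r. Qed.

(** The denominator never vanishes: for positive [x] the first term is positive, otherwise the
    second is. *)
Definition step (x : R) : R := flat 0 x / (flat 0 x + flat 0 (1 + -1 * x)).

Lemma step_smooth : smooth_on setT step.
Proof.
have f1 : smooth_on setT (fun x : R => flat 0 (1 + -1 * x)).
  exact: (smooth_on_comp1 (openT : open [set: R]) (flat_smooth 0)
    (smooth_on_affine 1 (-1) openT (@smooth_on_id setT))).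
have f2 : smooth_on setT (fun x : R => (flat 0 x + flat 0 (1 + -1 * x))^-1).
  apply: smooth_on_inv; [exact: openT| |exact: smooth_onD openT (flat_smooth 0) f1].
  move=> x _; apply: lt0r_neq0; have [x0|x0] := ltP 0 x.
    by rewrite ltr_pwDl ?flat_gt0 ?flat_ge0.
  by rewrite ltr_wpDl ?flat_ge0 ?flat_gt0// mulN1r subr_gt0 (le_lt_trans x0).
exact: (smooth_onM openT (flat_smooth 0) f2).
Qed.

Lemma step0 x : x <= 0 -> step x = 0.
Proof. by move=> x0; rewrite /step flat_le0// mul0r. Qed.

Lemma step1 x : 1 <= x -> step x = 1.
Proof.
move=> x1; rewrite /step [X in _ + X]flat_le0 ?addr0 ?divff//.
  by rewrite gt_eqF// flat_gt0// (lt_le_trans ltr01).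
by rewrite mulN1r subr_le0.
Qed.

Definition plateau (x : R) : R := step (2 + -1 * x) * step (2 + 1 * x).

Lemma plateau_smooth : smooth_on setT plateau.
Proof.
have h b : smooth_on setT (fun x : R => step (2 + b * x)).
  exact: (smooth_on_comp1 (openT : open [set: R]) step_smooth
    (smooth_on_affine 2 b openT (@smooth_on_id setT))).
exact: (smooth_onM openT (h _) (h _)).
Qed.

Lemma plateau1 x : `|x| <= 1 -> plateau x = 1.
Proof.
by rewrite ler_norml => /andP[x0 x1]; rewrite /plateau !step1 ?mulr1//; lra.
Qed.

Lemma plateau0 x : 2 <= `|x| -> plateau x = 0.
Proof.
rewrite /plateau; have [x0|x0] := leP 0 x.
  by rewrite ger0_norm// => x2; rewrite step0 ?mul0r//; lra.
by rewrite ltr0_norm// => x2; rewrite [X in _ * X]step0 ?mulr0//; lra.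
Qed.

End FlatFunction.

Section Bumps.
Context {R : realType} {M : topologicalType} (S : smoothStructure R M).

Lemma smooth_fun_local (f : M -> R[i]) :
  (forall x, exists c V, [/\ atlas S c, open V, V x, V `<=` cdom c &
    forall b, smooth_on (cphi c @` V) (fun y => cpart b (f (cpsi c y)))]) ->
  smooth_fun S f.
Proof.
move=> floc.
have w1 (j : unit) : [set: unit] j -> 1 <= (1 : R) by [].
suff h : cfam S [set: unit] (fun=> 1) (fun=> f) by exact: (cfam_smooth (j := tt) h I).
apply: cfam_local => // x; have [c [V [Ac oV Vx Vc fV]]] := floc x.
have [K [cK xK KV Kc]] := chart_nbhs (Vc x Vx) oV Vx.
exists c, V, K; split => // b n; apply: (mfam_fixed _ _ _ _ (fV b)).
  exact: image_subset.
apply: continuous_compact => //; apply: continuous_in_subspaceT => y.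
by move=> /set_mem/Kc; exact: cphi_continuous.
Qed.

Lemma smooth_on_prod (E : normedModType R) (U : set E) (I : Type) (s : seq I)
    (f : I -> E -> R) : open U -> (forall i, smooth_on U (f i)) ->
  smooth_on U (fun x => \prod_(i <- s) f i x).
Proof.
move=> oU fs; elim: s => [|i s IH].
  apply: (eq_smooth_on oU _ (@smooth_on_cst R E R U 1)).
  by move=> x _; rewrite big_nil.
apply: (eq_smooth_on oU _ (smooth_onM oU (fs i) IH)).
by move=> x _ /=; rewrite big_cons.
Qed.

(** A product of one-dimensional plateaus in the coordinates of a chart, extended by zero. *)
Lemma bump x (U : set M) : open U -> U x -> exists (chi : Cc S) V,
  [/\ open V, V x, forall y, V y -> chi y = 1 & supp chi `<=` U].
Proof.
move=> oU Ux; have [c Ac cx] := atlas_cover S x.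
have oW := chart_open c oU; pose B := mbasis S.
have [|r r0 rW] := box_sub B oW (a := cphi c x); first by exists x.
(* [plateau] is 1 up to 1 and 0 from 2 on; dividing the coordinates by [s] moves these thresholds to
   the boxes of radius [s] and [r]. *)
pose s := r / 2; have s0 : 0 < s by exact: divr_gt0.
have s2 : s * 2 = r by rewrite mulfVK.
pose t i (y : model S) := 0 + s^-1 * bcoo B i (y - cphi c x).
pose chi0 y := \prod_i plateau (t i y).
have tE i y : `|t i y| = `|bcoo B i (y - cphi c x)| / s.
  by rewrite /t add0r normrM normfV (gtr0_norm s0) mulrC.
have chi0s : smooth_on (cphi c @` cdom c) chi0.
  apply: smooth_on_prod; first exact: cimg_open.
  move=> i; apply: (smooth_on_comp1 (cimg_open c) plateau_smooth).
  apply: smooth_on_affine; first exact: cimg_open.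
  apply: (eq_smooth_on (cimg_open c) (f := fun y =>
      - bcoo B i (cphi c x) + 1 * bcoo B i y)).
    by move=> y _; rewrite mul1r addrC bcooB.
  by apply: smooth_on_affine; [exact: cimg_open|exact: smooth_on_bcoo].
have chi01 y : box B (cphi c x) s y -> chi0 y = 1.
  move=> yb; rewrite /chi0 big1// => i _; apply: plateau1.
  by rewrite tE ler_pdivrMr// mul1r.
have chi00 y : ~ box B (cphi c x) r y -> chi0 y = 0.
  move=> nyb; have [i ni] : exists i, ~ `|bcoo B i (y - cphi c x)| <= r.
    by apply/existsNP.
  rewrite /chi0 (bigD1 i)//= plateau0 ?mul0r//.
  by rewrite tE ler_pdivlMr// mulrC s2 ltW// ltNge; exact/negP.
pose chi y : R[i] := if `[< cdom c y >] then (chi0 (cphi c y))%:C else 0.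
pose K := cpsi c @` box B (cphi c x) r.
have rsub y : box B (cphi c x) r y -> (cphi c @` cdom c) y.
  by move=> /rW[z [cz _] <-]; exists z.
have KU : K `<=` cdom c `&` U.
  by move=> _ [y /rW[z [cz Uz] <-] <-]; rewrite cphiK.
have cK : compact K.
  apply: continuous_compact; last exact: compact_box.
  by apply: continuous_in_subspaceT => y /set_mem/rsub; exact: cpsi_continuous.
have chiK y : ~ K y -> chi y = 0.
  rewrite /chi; case: asboolP => // cy nKy; rewrite chi00//.
  by move=> yb; apply: nKy; exists (cphi c y) => //; exact: cphiK.
have chis : smooth_fun S chi.
  apply: smooth_fun_local => y; have [cy|ncy] := pselect (cdom c y).
    exists c, (cdom c); split; [exact: Ac|exact: cdom_open|exact: cy|exact: subset_refl|].
    move=> b; apply: (eq_smooth_on (cimg_open c) (f := fun z => cpart b 1 * chi0 z)).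
      move=> _ [z cz <-] /=; rewrite (cphiK cz) /chi; case: asboolP => // _.
      by case: b => /=; rewrite ?mul1r ?mul0r.
    have cb := @smooth_on_cst R (model S) R (cphi c @` cdom c) (cpart b 1).
    exact: (smooth_onM (cimg_open c) cb chi0s).
  (* Off the chart domain the function vanishes on a whole neighbourhood, the complement of the
     compact and hence closed set [K], so any chart shows smoothness. *)
  have [d Ad dy] := atlas_cover S y.
  have oK : open (~` K) by rewrite openC; exact: (compact_closedM S cK).
  have oV : open (cdom d `&` ~` K) by apply: openI => //; exact: cdom_open.
  have nKy : ~ K y by move=> /KU[].
  exists d, (cdom d `&` ~` K); split; [exact: Ad|exact: oV|exact: (conj dy nKy)| |].
    exact: subIsetl.
  move=> b; have c0 := @smooth_on_cst R (model S) R (cphi d @` (cdom d `&` ~` K)) 0.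
  have oW' := chart_open d oK.
  apply: (eq_smooth_on oW' _ c0).
  by move=> _ [z [dz nKz] <-]; rewrite (cphiK dz) (chiK z nKz) cpart0.
have chiP : chi \in Cc_pred S.
  by apply: mem_set; split; [exact: chis|exact: (supp_sub_compact S cK chiK).2].
have ox : nbhs x (cdom c `&` cphi c @^-1` box B (cphi c x) s).
  apply: filterI; first by apply: open_nbhs_nbhs; split => //; exact: cdom_open.
  by apply: (cphi_continuous cx); exact: nbhs_box.
have [V [oV Vx VP]] := near_open ox.
exists (MkCc chiP), V; split; [exact: oV|exact: Vx| |].
  by move=> y /VP[cy yb]; rewrite -[LHS]/(chi y) /chi asboolT// chi01.
by move=> y /(supp_sub_compact S cK chiK).1 /KU[].
Qed.

(** The part of 1 not yet covered. The products of [chi n] with it telescope, which gives a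
    partition of unity without dividing by a sum; the remainder vanishes wherever one of the bumps
    equals 1. *)
Fixpoint unity_rem (chi : nat -> Cc S) (n : nat) (x : M) : R[i] :=
  if n is m.+1 then unity_rem chi m x * (1 - chi m x) else 1.

Lemma smooth_fun_cst (z : R[i]) : smooth_fun S (fun=> z).
Proof. by move=> c Ac; split; exact: smooth_on_cst. Qed.

Lemma unity_rem_smooth chi n : smooth_fun S (unity_rem chi n).
Proof.
elim: n => [|n IH]; first exact: (smooth_fun_cst 1).
have h : smooth_fun S (fun x => 1 - chi n x).
  suff <- : (-1 *: (chi n : M -> R[i]) + (fun=> 1)) = (fun x => 1 - chi n x).
    exact: smooth_funZD (Cc_smooth (chi n)) (smooth_fun_cst 1).
  apply/funext => x; rewrite !fctE.
  have -> : -1 *: chi n x = - chi n x :> R[i] by rewrite scaleN1r.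
  by rewrite addrC.
exact: smooth_funM IH h.
Qed.

Definition unity_part chi n : Cc S := smulC (unity_rem_smooth chi n) (chi n).

Lemma sum_unity_part chi n x :
  \sum_(i < n) unity_part chi i x = 1 - unity_rem chi n x.
Proof.
elim: n => [|n IH]; first by rewrite big_ord0 subrr.
rewrite big_ord_recr IH.
have -> : unity_part chi (@ord_max n) x = unity_rem chi n x * chi n x by [].
by rewrite /=; ring.
Qed.

Lemma partition (K : set M) (U : M -> set M) : compact K ->
  (forall x, K x -> open (U x) /\ U x x) ->
  exists n (psi : 'I_n -> Cc S) (p : 'I_n -> M),
    (forall i, K (p i) /\ supp (psi i) `<=` U (p i)) /\
    forall x, K x -> \sum_i psi i x = 1.
Proof.
move=> cK KU.
have ex x : exists cV : Cc S * set M, K x -> [/\ open cV.2, cV.2 x,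
    forall y, cV.2 y -> cV.1 y = 1 & supp cV.1 `<=` U x].
  have [/KU[oU Ux]|nK] := pselect (K x); last by exists (0, set0).
  by have [chi [V [oV Vx chi1 cU]]] := bump oU Ux; exists (chi, V).
have [cV cVP] := choice ex.
have [|n [p [pK Kp]]] := compact_finite_cover (W := fun x => (cV x).2) cK.
  by move=> x /cVP[oV Vx _ _]; exact: open_nbhs_nbhs.
pose chi (i : nat) : Cc S := oapp (fun k => (cV (p k)).1) 0 (insub i : option 'I_n).
have chiE (k : 'I_n) : chi k = (cV (p k)).1.
  by rewrite /chi; case: insubP => [j _ /val_inj -> //|]; rewrite ltn_ord.
exists n, (fun k => unity_part chi k), p; split.
  move=> k; split; first exact: pK.
  have [_ _ _ sU] := cVP _ (pK k).
  apply: subset_trans sU; apply: closureS => x; apply: contra_neq => e.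
  have -> : unity_part chi k x = unity_rem chi k x * chi k x by [].
  by rewrite chiE e mulr0.
move=> x Kx; rewrite sum_unity_part.
have [k _ Vk] := Kp x Kx; have [_ _ /(_ x Vk) chi1 _] := cVP _ (pK k).
suff -> : unity_rem chi n x = 0 by rewrite subr0.
have h m : (k < m)%N -> unity_rem chi m x = 0.
  elim: m => [//|m IH]; rewrite ltnS leq_eqVlt /= => /predU1P[<-|/IH ->].
    by rewrite chiE chi1 subrr mulr0.
  by rewrite mul0r.
exact: h.
Qed.

Lemma cutoff (K : set M) : compact K -> exists chi : Cc S, forall x, K x -> chi x = 1.
Proof.
move=> cK; have [|n [psi [p [_ pK]]]] := @partition K (fun=> setT) cK.
  by move=> x _; split => //; exact: openT.
exists (\sum_i psi i) => x /pK <-.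
by elim/big_rec2 : _ => [//|i z f _ <-].
Qed.

End Bumps.

Section SmoothMaps.
Context {R : realType}.

Lemma smooth_on_scalev (E F : normedModType R) (U : set E) (h : E -> R) (v : F) :
  open U -> smooth_on U h -> smooth_on U (fun x => h x *: v).
Proof.
move=> oU hs.
have sd (f : E -> R) x u : derivable f x u -> is_derive x u (fun y => f y *: v) ('D_u f x *: v).
  move=> fd.
  have cvgq : t^-1 *: (((fun y => f y *: v) \o shift x) (t *: u) - f x *: v)
      @[t --> (0 : R)^'] --> 'D_u f x *: v.
    have h' := @cvgZr_tmp _ _ _ _ _ _ _ v fd.
    apply: cvg_trans (h' _); apply: near_eq_cvg; apply: nearW => t /=.
    by rewrite -scalerBl scalerA.
  by apply: DeriveDef; [apply/cvg_ex; eexists; exact: cvgq|exact: cvg_lim cvgq].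
have dE vs : forall x, U x ->
    iter_derive vs (fun x => h x *: v) x = iter_derive vs h x *: v.
  elim: vs => [//|u vs IH] x Ux /=.
  rewrite -(@derive_val _ _ _ _ _ _ _ (sd _ x u ((hs vs x Ux).2 u))).
  apply: near_eq_derive; near=> y; apply: IH; near: y; exact: open_nbhs_nbhs.
move=> vs x Ux; have [hc hd] := hs vs x Ux.
have nE : {near x, (fun y => iter_derive vs h y *: v) =1
    iter_derive vs (fun x => h x *: v)}.
  by near=> y; apply/esym/dE; near: y; exact: open_nbhs_nbhs.
split=> [|u].
  rewrite /prop_for /continuous_at dE//; apply: cvg_trans (near_eq_cvg nE) _.
  exact: cvgZr_tmp.
apply: near_eq_derivable nE _.
exact: (@ex_derive _ _ _ _ _ _ _ (sd _ x u (hd u))).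
Unshelve. all: by end_near. Qed.

(** The chain rule above is for scalar outer functions; a map into a vector space is treated
    coordinate by coordinate and reassembled here. *)
Lemma smooth_on_coords (E F : normedModType R) (B : basis F) (U : set E) (g : E -> F) :
  open U -> (forall i, smooth_on U (bcoo B i \o g)) -> smooth_on U g.
Proof.
move=> oU gs.
have h (s : seq (bidx B)) : smooth_on U (fun x => \sum_(i <- s) bcoo B i (g x) *: bvec i).
  elim: s => [|i s IH].
    apply: (eq_smooth_on oU _ (@smooth_on_cst R E F U 0)).
    by move=> x _; rewrite big_nil.
  apply: (eq_smooth_on oU _ (smooth_onD oU (smooth_on_scalev (bvec i) oU (gs i)) IH)).
  by move=> x _ /=; rewrite big_cons.
apply: (eq_smooth_on oU _ (h (index_enum (bidx B)))).
by move=> x _; rewrite -bcoo_sum.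
Qed.

Lemma smooth_map_id (M : topologicalType) (S : smoothStructure R M) :
  smooth_map S S id.
Proof.
split; first by move=> x; exact: cvg_id.
by move=> c d Ac Ad; exact: atlas_smooth Ac Ad.
Qed.

Lemma smooth_map_comp (M N P : topologicalType) (S : smoothStructure R M)
    (T : smoothStructure R N) (U : smoothStructure R P) (f : M -> N) (g : N -> P) :
  smooth_map S T f -> smooth_map T U g -> smooth_map S U (g \o f).
Proof.
move=> [fc fs] [gc gs]; split.
  by move=> x; apply: continuous_comp; [exact: fc|exact: gc].
move=> c d Ac Ad vs _ [x [cx /= dx] <-].
have [e Ae ex] := atlas_cover T (f x).
have oge : open (g @^-1` cdom d).
  by apply: open_comp => [y _|]; [exact: gc|exact: cdom_open].
have oV : open (f @^-1` (cdom e `&` g @^-1` cdom d)).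
  apply: open_comp => [y _|]; first exact: fc.
  by apply: openI => //; exact: cdom_open.
pose V := cphi c @` (cdom c `&` f @^-1` (cdom e `&` g @^-1` cdom d)).
have oW : open V by exact: chart_open.
suff h : smooth_on V (cphi d \o (g \o f) \o cpsi c) by apply: h; exists x.
apply: (smooth_on_coords (B := mbasis U) oW) => i.
have oW' := chart_open e oge.
apply: (eq_smooth_on oW (f := (bcoo (mbasis U) i \o (cphi d \o g \o cpsi e)) \o
    (cphi e \o f \o cpsi c))).
  by move=> _ [y [cy [/= ey dy]] <-] /=; rewrite (cphiK cy) cphiK.
apply: (smooth_on_comp (mbasis T) oW oW').
- by apply: smooth_on_bcoo_comp; [exact: oW'|exact: gs e d Ae Ad].
- apply: smooth_onW (fs c e Ac Ae).
  by move=> _ [y [cy [/= ey dy]] <-]; exists y.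
- move=> _ [y [cy [/= ey dy]] <-] /=; rewrite cphiK//.
  by exists (f y).
Qed.

Lemma smooth_map_pair (M N P : topologicalType) (S : smoothStructure R M)
    (T : smoothStructure R N) (U : smoothStructure R P) (f : M -> N) (g : M -> P) :
  smooth_map S T f -> smooth_map S U g ->
  smooth_map S (prodStructure T U) (fun x => (f x, g x)).
Proof.
move=> [fc fs] [gc gs]; split.
  by move=> x; apply: cvg_pair; [exact: fc|exact: gc].
move=> c _ Ac [d1 Ad1 [d2 Ad2 <-]].
have of1 : open (f @^-1` cdom d1).
  by apply: open_comp => [y _|]; [exact: fc|exact: cdom_open].
have og1 : open (g @^-1` cdom d2).
  by apply: open_comp => [y _|]; [exact: gc|exact: cdom_open].
have -> : (fun x => (f x, g x)) @^-1` cdom (prod_chart d1 d2) =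
    (f @^-1` cdom d1) `&` (g @^-1` cdom d2) by [].
have oV := chart_open c (openI of1 og1).
apply: (smooth_on_pair oV (f := cphi d1 \o f \o cpsi c) (g := cphi d2 \o g \o cpsi c)).
  by apply: smooth_onW (fs c d1 Ac Ad1) => _ [y [cy [/= ey dy]] <-]; exists y.
by apply: smooth_onW (gs c d2 Ac Ad2) => _ [y [cy [/= ey dy]] <-]; exists y.
Qed.

Lemma smooth_map_fst (M N : topologicalType) (S : smoothStructure R M)
  (T : smoothStructure R N) : smooth_map (prodStructure S T) S fst.
Proof.
split; first by move=> x; exact: cvg_fst.
move=> _ d [c1 Ac1 [c2 Ac2 <-]] Ad.
apply: smooth_onW (smooth_on_fst (E2 := model T) (atlas_smooth Ac1 Ad)).
by move=> _ [[x y] [[/= cx cy] dx] <-]; exists x.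
Qed.

Lemma smooth_map_snd (M N : topologicalType) (S : smoothStructure R M)
  (T : smoothStructure R N) : smooth_map (prodStructure S T) T snd.
Proof.
split; first by move=> x; exact: cvg_snd.
move=> _ d [c1 Ac1 [c2 Ac2 <-]] Ad.
apply: smooth_onW (smooth_on_snd (E1 := model S) (atlas_smooth Ac2 Ad)).
by move=> _ [[x y] [[/= cx cy] dx] <-]; exists y.
Qed.

End SmoothMaps.

(** * Haar measure *)

Section Haar.
Context {R : realType} {G : topGroupType}.
Hypothesis mulc : continuous (fun x : G * G => (x.1 * x.2)%g).
Hypothesis invc : continuous (fun x : G => (x^-1)%g).
Hypothesis hG : hausdorff_space G.
Hypothesis scG : @second_countable G.
Hypothesis lcG : forall (x : G) (U : set G), open U -> U x ->
  exists K, [/\ compact K, nbhs x K & K `<=` U].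
Implicit Types (K L V W A : set G) (x y t : G).

Definition ltrans x A : set G := [set (x * y)%g | y in A].

Lemma ltransK x A : ltrans x^-1%g (ltrans x A) = A.
Proof.
apply/seteqP; split=> [_ [_ [y Ay <-] <-]|y Ay]; first by rewrite mulKg.
by exists (x * y)%g; [exists y|rewrite mulKg].
Qed.

Lemma ltransE x A y : ltrans x A y <-> A (x^-1 * y)%g.
Proof.
split=> [[z Az <-]|Ay]; first by rewrite mulKg.
by exists (x^-1 * y)%g => //; rewrite mulVKg.
Qed.

Lemma ltransS x A B : A `<=` B -> ltrans x A `<=` ltrans x B.
Proof. by move=> AB _ [y /AB By <-]; exists y. Qed.

Lemma lmul_continuous x : continuous (fun y : G => (x * y)%g).
Proof.
move=> y; apply: (@continuous_comp _ _ _ (fun y => (x, y))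
  (fun z : G * G => (z.1 * z.2)%g)); last exact: mulc.
by apply: cvg_pair; [exact: cvg_cst|exact: cvg_id].
Qed.

Lemma ltrans_preim x A : ltrans x A = (fun y => x^-1 * y)%g @^-1` A.
Proof. by apply/seteqP; split=> y /ltransE. Qed.

Lemma open_ltrans x A : open A -> open (ltrans x A).
Proof.
move=> oA; rewrite ltrans_preim; apply: open_comp => // y _.
exact: lmul_continuous.
Qed.

Lemma compact_ltrans x A : compact A -> compact (ltrans x A).
Proof.
by move=> cA; apply: continuous_compact => //; apply: continuous_subspaceT;
  exact: lmul_continuous.
Qed.

Definition covered V K n := exists t : 'I_n -> G, K `<=` \bigcup_k ltrans (t k) V.

Lemma covered_ex V K : nbhs 1%g V -> compact K -> exists n, covered V K n.
Proof.
move=> nV cK; have [|n [t [_ Kt]]] := compact_finite_cover (W := fun x => ltrans x V) cK.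
  move=> x _; rewrite ltrans_preim; apply: (lmul_continuous (x := x^-1%g)).
  by rewrite mulVg.
by exists n, t.
Qed.

(** Haar's covering index, classically written (K : V). The value 0 of the second branch is a
    default, excluded by [covnumP] for neighbourhoods of 1 and compact sets. *)
Definition covnum V K : nat :=
  if pselect (exists n, `[< covered V K n >]) is left e then ex_minn e else 0%N.

Lemma covnumP V K : nbhs 1%g V -> compact K ->
  covered V K (covnum V K) /\ forall n, covered V K n -> (covnum V K <= n)%N.
Proof.
move=> nV cK; rewrite /covnum; case: pselect => [e|ne].
  case: ex_minnP => m /asboolP cm mmin; split => // n cn.
  by apply: mmin; exact/asboolP.
exfalso; apply: ne; have [n cn] := covered_ex nV cK.
by exists n; exact/asboolP.
Qed.

Lemma covnum_le V K L : nbhs 1%g V -> compact K -> compact L -> K `<=` L ->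
  (covnum V K <= covnum V L)%N.
Proof.
move=> nV cK cL KL; apply: (covnumP nV cK).2.
by have [[t Lt] _] := covnumP nV cL; exists t => x /KL /Lt.
Qed.

Lemma coveredU V K L m n : covered V K m -> covered V L n ->
  covered V (K `|` L) (m + n).
Proof.
move=> [t Kt] [s Ls].
exists (fun k => match fintype.split k with inl i => t i | inr j => s j end).
move=> x [/Kt[k _ tk]|/Ls[k _ sk]].
  by exists (unsplit (inl k)) => //; rewrite (unsplitK (inl k)).
by exists (unsplit (inr k)) => //; rewrite (unsplitK (inr k)).
Qed.

Lemma covnumU V K L : nbhs 1%g V -> compact K -> compact L ->
  (covnum V (K `|` L) <= covnum V K + covnum V L)%N.
Proof.
move=> nV cK cL; apply: (covnumP nV (compactU cK cL)).2.
by apply: coveredU; [exact: (covnumP nV cK).1|exact: (covnumP nV cL).1].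
Qed.

Lemma covered_ltrans V K n x : covered V K n -> covered V (ltrans x K) n.
Proof.
move=> [t Kt]; exists (fun k => x * t k)%g => _ [y /Kt[k _ [z Vz <-]] <-].
by exists k => //; exists z => //; rewrite mulgA.
Qed.

Lemma covnum_ltrans V K x : nbhs 1%g V -> compact K ->
  covnum V (ltrans x K) = covnum V K.
Proof.
move=> nV cK; have cxK := compact_ltrans (x := x) cK.
apply/eqP; rewrite eqn_leq; apply/andP; split.
  by apply: (covnumP nV cxK).2; apply: covered_ltrans; exact: (covnumP nV cK).1.
apply: (covnumP nV cK).2; rewrite -{1}(ltransK x K); apply: covered_ltrans.
exact: (covnumP nV cxK).1.
Qed.

Lemma covered_pred V K n (t : 'I_n -> G) (P : pred 'I_n) :
  (forall x, K x -> exists2 k, P k & ltrans (t k) V x) -> covered V K #|P|.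
Proof.
move=> Kt; exists (fun k => t (enum_val k)) => x /Kt[k Pk tk].
by exists (enum_rank_in Pk k) => //; rewrite enum_rankK_in.
Qed.

(** No translate of [V] meets both sets, so an optimal covering of the union splits into the
    translates meeting [K] and those meeting [L]. *)
Lemma covnum_disjoint V K L : nbhs 1%g V -> compact K -> compact L ->
  (forall t, ltrans t V `&` K !=set0 -> ltrans t V `&` L !=set0 -> False) ->
  covnum V (K `|` L) = (covnum V K + covnum V L)%N.
Proof.
move=> nV cK cL KL; apply/eqP; rewrite eqn_leq covnumU//=.
have [[t KLt] _] := covnumP nV (compactU cK cL); set n := covnum _ _ in t KLt *.
pose P : pred 'I_n := fun k => `[< ltrans (t k) V `&` K !=set0 >].
pose Q : pred 'I_n := fun k => `[< ltrans (t k) V `&` L !=set0 >].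
have cP : (covnum V K <= #|P|)%N.
  apply: (covnumP nV cK).2; apply: (covered_pred (t := t)) => x Kx.
  have [k _ tk] := KLt x (or_introl Kx); exists k => //.
  by apply/asboolP; exists x.
have cQ : (covnum V L <= #|Q|)%N.
  apply: (covnumP nV cL).2; apply: (covered_pred (t := t)) => x Lx.
  have [k _ tk] := KLt x (or_intror Lx); exists k => //.
  by apply/asboolP; exists x.
apply: leq_trans (leq_add cP cQ) _.
have -> : (#|P| + #|Q| = #|[predU P & Q]| + #|[predI P & Q]|)%N.
  by rewrite cardUI.
rewrite [X in (_ + X)%N](_ : _ = 0%N) ?addn0.
  by rewrite -[leqRHS]card_ord max_card.
apply: eq_card0 => k; rewrite !inE; apply/negP => /andP[/asboolP a /asboolP b].
exact: KL a b.
Qed.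

(** Each translate of [L] in a covering of [K] is covered in turn by translates of [V]. This bounds
    the ratios of covering numbers independently of [V]. *)
Lemma covnum_comp V K L : nbhs 1%g V -> nbhs 1%g L -> compact K -> compact L ->
  (covnum V K <= covnum L K * covnum V L)%N.
Proof.
move=> nV nL cK cL; have [[t Kt] _] := covnumP nL cK.
have [[s Ls] _] := covnumP nV cL; apply: (covnumP nV cK).2.
have -> : (covnum L K * covnum V L = #|{: 'I_(covnum L K) * 'I_(covnum V L)}|)%N.
  by rewrite card_prod !card_ord.
exists (fun k => t (enum_val k).1 * s (enum_val k).2)%g => x.
move=> /Kt[i _ [y /Ls[j _ [z Vz <-]] <-]].
exists (enum_rank (i, j)) => //; rewrite enum_rankK; exists z => //=.
by rewrite mulgA.
Qed.

Lemma covnum_gt0 V K : nbhs 1%g V -> compact K -> K !=set0 -> (0 < covnum V K)%N.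
Proof.
move=> nV cK [x Kx]; have [[t Kt] _] := covnumP nV cK.
by have [k _ _] := Kt x Kx; apply: leq_ltn_trans (ltn_ord k).
Qed.

(** Second countability lets the shrinking neighbourhoods run through a sequence, so the content can
    be a limit along an ultrafilter on nat. Codes that belong to no basic neighbourhood of 1
    contribute the whole space. *)
Lemma nbhs1_base : exists V : nat -> set G, (forall n, nbhs 1%g (V n)) /\
  forall U, nbhs 1%g U -> exists N, forall n, (N <= n)%N -> V n `<=` U.
Proof.
have [B /countable_injP[code codeI] [oB bB]] := scG.
have exD i : exists D : set G, nbhs 1%g D /\
    forall b, B b -> b 1%g -> code b = i -> D `<=` b.
  have [[b [Bb b1 bi]]|nb] := pselect (exists b, [/\ B b, b 1%g & code b = i]).
    exists b; split; first by apply: open_nbhs_nbhs; split => //; exact: oB.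
    move=> b' Bb' _ b'i; suff -> : b' = b by [].
    by apply: codeI; rewrite ?inE// b'i.
  exists setT; split; first exact: filterT.
  by move=> b Bb b1 bi; exfalso; apply: nb; exists b.
have [D DP] := choice exD.
pose fix V (n : nat) : set G := if n is m.+1 then V m `&` D m else setT.
exists V; split.
  by elim=> [|n IH] /=; [exact: filterT|apply: filterI => //; exact: (DP n).1].
move=> U /(bB 1%g)[b [Bb b1] bU]; exists (code b).+1.
have VS m n : (m <= n)%N -> V n `<=` V m.
  elim: n => [|n IH]; first by rewrite leqn0 => /eqP ->.
  by rewrite leq_eqVlt => /predU1P[->//|/IH mn x [/mn]].
move=> n bn x /(VS _ _ bn) [_ Dx]; apply: bU.
by apply: ((DP (code b)).2 b) Dx.
Qed.

(** The set [Q] of all quotients of a point of [K] and a point of [L] is compact and misses 1, as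
    the sets are disjoint. For [U] small, quotients of two points of [U], hence of two points in one
    translate of [U], avoid [Q]. *)
Lemma separation K L : compact K -> compact L -> K `&` L = set0 ->
  exists2 U, nbhs 1%g U &
    forall t, ltrans t U `&` K !=set0 -> ltrans t U `&` L !=set0 -> False.
Proof.
move=> cK cL KL.
pose f (x : G * G) := (x.1^-1 * x.2)%g.
have cf : continuous f.
  move=> x; apply: (@continuous_comp _ _ _ (fun x : G * G => (x.1^-1, x.2)%g)
    (fun z : G * G => (z.1 * z.2)%g)); last exact: mulc.
  apply: cvg_pair; last exact: cvg_snd.
  by apply: continuous_comp; [exact: cvg_fst|exact: invc].
pose Q := f @` (K `*` L).
have cQ : closed Q.
  apply: (compact_closed hG); apply: continuous_compact.
    exact: continuous_subspaceT.
  exact: compact_setX.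
have Q1 : ~ Q 1%g.
  move=> [[x y] [/= Kx Ly]]; rewrite /f /= => e.
  have yx : y = x by rewrite -(mulVKg x y) e mulg1.
  have : (K `&` L) x by split => //; rewrite -yx.
  by rewrite KL.
have n1 : nbhs (1%g, 1%g) (f @^-1` (~` Q)).
  apply: cf; rewrite /f /= mulg1 invg1; apply: open_nbhs_nbhs; split => //.
  by rewrite openC.
have [[A B] /= [nA nB] ABQ] := n1.
exists (A `&` B); first exact: filterI.
move=> t [_ [[u [Au _] <-] Ktu]] [_ [[v [_ Bv] <-] Ltv]].
apply: (ABQ (u, v)) => //; exists (t * u, t * v)%g => //.
by rewrite /f /= invgM -mulgA mulKg.
Qed.

(** The topological input for subadditivity on open sets: a compact set inside a union is divided
    between its members. *)
Lemma compact_splitU K V W : open V -> open W -> compact K -> K `<=` V `|` W ->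
  exists A B, [/\ compact A, compact B, A `<=` V, B `<=` W & K = A `|` B].
Proof.
move=> oV oW cK KVW.
pose P L := exists A B, [/\ compact A, compact B, A `<=` V, B `<=` W & L `<=` A `|` B].
have [A [B [cA cB AV BW KAB]]] : P K.
  apply: (compact_induction cK).
  - by exists set0, set0; split => //; exact: compact0.
  - by move=> L L' LL' [A [B [? ? ? ? h]]]; exists A, B; split => // x /LL' /h.
  - move=> L L' [A [B [cA cB AV BW h]]] [A' [B' [cA' cB' AV' BW' h']]].
    exists (A `|` A'), (B `|` B'); split; try exact: compactU.
    + by move=> x [/AV|/AV'].
    + by move=> x [/BW|/BW'].
    + move=> x [/h[xx|xx]|/h'[xx|xx]].
      * by left; left.
      * by right; left.
      * by left; right.
      * by right; right.
  - move=> x /KVW[Vx|Wx].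
      have [L [cL nL LV]] := lcG oV Vx; exists L => //; exists L, set0.
      by split; [exact: cL|exact: compact0|exact: LV|exact: sub0set|move=> y Ly; left].
    have [L [cL nL LV]] := lcG oW Wx; exists L => //; exists set0, L.
    by split; [exact: compact0|exact: cL|exact: sub0set|exact: LV|move=> y Ly; right].
have clK := compact_closed hG cK.
exists (K `&` A), (K `&` B); split.
- by apply: (subclosed_compact _ cA); [apply: closedI => //; exact: compact_closed|exact: subIsetr].
- by apply: (subclosed_compact _ cB); [apply: closedI => //; exact: compact_closed|exact: subIsetr].
- by move=> x [_ /AV].
- by move=> x [_ /BW].
- by rewrite -setIUr; apply/esym/setIidPl.
Qed.

Section Content.
Variables (V : nat -> set G) (K0 : set G).
Hypothesis nV : forall n, nbhs 1%g (V n).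
Hypothesis VN : forall U, nbhs 1%g U -> exists N, forall n, (N <= n)%N -> V n `<=` U.
Hypothesis cK0 : compact K0.
Hypothesis nK0 : nbhs 1%g K0.

(** The fixed compact neighbourhood [K0] normalises: by [covnum_comp] the ratio lies between 0 and
    the number of translates of [K0] needed for [K], so its ultralimit exists. *)
Definition ratio K n : R := (covnum (V n) K)%:R / (covnum (V n) K0)%:R.
Definition content K : R := ulim (ratio K).

Lemma covnumK0_gt0 n : 0 < (covnum (V n) K0)%:R :> R.
Proof.
rewrite ltr0n; apply: covnum_gt0 => //.
by exists 1%g; exact: nbhs_singleton.
Qed.

Lemma ratio_ge0 K n : 0 <= ratio K n.
Proof. by rewrite divr_ge0. Qed.

Lemma ratio_bseq K : compact K -> bseq (ratio K).
Proof.
move=> cK; exists (covnum K0 K)%:R => n; rewrite ger0_norm ?ratio_ge0//.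
rewrite ler_pdivrMr ?covnumK0_gt0// -natrM ler_nat.
exact: covnum_comp.
Qed.

Lemma content_ge0 K : compact K -> 0 <= content K.
Proof.
move=> cK; rewrite -(ulim_cst 0); apply: ulim_le; first exact: bseq_cst.
  exact: ratio_bseq.
by apply: nearW => n; exact: ratio_ge0.
Qed.

Lemma content_le K L : compact K -> compact L -> K `<=` L -> content K <= content L.
Proof.
move=> cK cL KL; apply: ulim_le; try exact: ratio_bseq.
apply: nearW => n; rewrite ler_wpM2r ?invr_ge0// ler_nat.
exact: covnum_le.
Qed.

Lemma contentU K L : compact K -> compact L ->
  content (K `|` L) <= content K + content L.
Proof.
move=> cK cL; rewrite -ulimD; try exact: ratio_bseq.
apply: ulim_le; first by apply: ratio_bseq; exact: compactU.
  by apply: bseqD; exact: ratio_bseq.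
apply: nearW => n; rewrite -mulrDl ler_wpM2r ?invr_ge0// -natrD ler_nat.
exact: covnumU.
Qed.

Lemma content_ltrans K x : compact K -> content (ltrans x K) = content K.
Proof.
move=> cK; congr ulim; apply/funext => n; rewrite /ratio covnum_ltrans//.
Qed.

(** At level [n] covering numbers are only subadditive; equality holds as soon as [V n] lies in the
    separating neighbourhood, hence for almost all [n], and the limit sees nothing else. *)
Lemma content_disjoint K L : compact K -> compact L -> K `&` L = set0 ->
  content (K `|` L) = content K + content L.
Proof.
move=> cK cL KL; have [U nU UP] := separation cK cL KL; have [N VU] := VN nU.
rewrite -ulimD; try exact: ratio_bseq.
apply: eq_ulim; exists N => // n /= Nn; rewrite /ratio -mulrDl -natrD.
rewrite covnum_disjoint// => t tK tL.
have sub A : ltrans t (V n) `&` A !=set0 -> ltrans t U `&` A !=set0.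
  by move=> [x [tx Ax]]; exists x; split => //; exact: (ltransS (VU n Nn)) tx.
by apply: (UP t); exact: sub.
Qed.

Local Open Scope ereal_scope.

(** The content of compact sets is extended to open sets from inside, and then by [haar_outer] to
    all sets from outside. *)
Definition omass (W : set G) : \bar R :=
  ereal_sup [set (content K)%:E | K in [set K | compact K /\ K `<=` W]].

Definition haar_outer (A : set G) : \bar R :=
  ereal_inf [set omass W | W in [set W | open W /\ A `<=` W]].

Lemma omass_ub K W : compact K -> K `<=` W -> (content K)%:E <= omass W.
Proof. by move=> cK KW; apply: ereal_sup_ubound; exists K. Qed.

Lemma omass_lub W r : (forall K, compact K -> K `<=` W -> (content K)%:E <= r) ->
  omass W <= r.
Proof. by move=> h; apply: ge_ereal_sup => _ [K [cK KW] <-]; exact: h. Qed.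

Lemma omass_ge0 W : 0 <= omass W.
Proof.
apply: le_trans (omass_ub (@compact0 _) (sub0set _)).
by rewrite lee_fin content_ge0//; exact: compact0.
Qed.

Lemma omass_le V' W : V' `<=` W -> omass V' <= omass W.
Proof.
by move=> VW; apply: omass_lub => K cK KV; apply: omass_ub => // x /KV /VW.
Qed.

Lemma outer_ge0 A : 0 <= haar_outer A.
Proof. by apply: le_ereal_inf_tmp => _ [W _ <-]; exact: omass_ge0. Qed.

Lemma outer_le A B : A `<=` B -> haar_outer A <= haar_outer B.
Proof.
move=> AB; apply: le_ereal_inf => _ [W [oW BW] <-]; exists W => //.
by split => // x /AB /BW.
Qed.

Lemma outer_open W : open W -> haar_outer W = omass W.
Proof.
move=> oW; apply/eqP; rewrite eq_le; apply/andP; split.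
  by apply: ereal_inf_lbound; exists W => //; split=> // x.
by apply: le_ereal_inf_tmp => _ [W' [oW' WW'] <-]; exact: omass_le.
Qed.

Lemma outer_lub A W : open W -> A `<=` W -> haar_outer A <= omass W.
Proof. by move=> oW AW; apply: ereal_inf_lbound; exists W => //; split. Qed.

Lemma content_set0 : content set0 = 0%R.
Proof.
have := content_disjoint (@compact0 _) (@compact0 _) (setI0 set0).
by rewrite setU0 => /eqP; rewrite -subr_eq0 opprD addNKr oppr_eq0 => /eqP.
Qed.

Lemma outer0 : haar_outer set0 = 0.
Proof.
rewrite outer_open; last exact: open0.
apply/eqP; rewrite eq_le omass_ge0 andbT; apply: omass_lub => K _.
by rewrite subset0 => ->; rewrite content_set0.
Qed.

Lemma content_cover n (W : nat -> set G) K : compact K ->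
  (forall i, open (W i)) -> K `<=` \bigcup_(i in [set i | (i < n)%N]) W i ->
  (content K)%:E <= \sum_(0 <= i < n) omass (W i).
Proof.
move=> + oW; elim: n K => [|n IH] K cK KW.
  rewrite big_geq// (_ : K = set0) ?content_set0//.
  by apply/seteqP; split=> // x /KW[].
have oU : open (\bigcup_(i in [set i | (i < n)%N]) W i) by apply: bigcup_open.
have [|A [B [cA cB AU BW ->]]] := compact_splitU oU (oW n) cK.
  move=> x /KW[i /=]; rewrite ltnS leq_eqVlt => /predU1P[->|ni] Wx; first by right.
  by left; exists i.
rewrite big_nat_recr//=; apply: (@le_trans _ _ (content A + content B)%:E).
  by rewrite lee_fin; exact: contentU.
by rewrite EFinD; apply: leeD; [exact: IH|exact: omass_ub].
Qed.

Lemma omass_bigcup (W : nat -> set G) : (forall i, open (W i)) ->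
  omass (\bigcup_i W i) <= \sum_(i <oo) omass (W i).
Proof.
move=> oW; apply: omass_lub => K cK KW.
have [n Kn] : exists n, K `<=` \bigcup_(i in [set i | (i < n)%N]) W i.
  apply: (compact_induction (P := fun L => exists n,
    L `<=` \bigcup_(i in [set i | (i < n)%N]) W i) cK).
  - by exists 0%N.
  - by move=> L L' LL' [n h]; exists n => x /LL' /h.
  - move=> L L' [n h] [m h']; exists (maxn n m) => x [/h[i /= ni Wx]|/h'[i /= mi Wx]];
      exists i => //=; rewrite leq_max ?ni ?mi ?orbT//.
  - move=> x /KW[i _ Wx]; exists (W i); first exact: open_nbhs_nbhs.
    by exists i.+1 => y Wy; exists i => /=.
apply: le_trans (content_cover cK oW Kn) _.
by apply: nneseries_lim_ge => i _ _; exact: omass_ge0.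
Qed.

Lemma outer_sigma_subadditive : sigma_subadditive haar_outer.
Proof.
move=> A; have [[i ioo]|] := pselect (exists i, haar_outer (A i) = +oo).
  rewrite (eseries_pinfty _ _ ioo) ?leey// => n _.
  by rewrite -ltNye (lt_le_trans _ (outer_ge0 _)).
rewrite -forallNE => Aoo.
apply/lee_addgt0Pr => e e0.
apply: le_trans (@epsilon_trick R (haar_outer \o A) e xpredT
  (fun n => outer_ge0 (A n)) (ltW e0)).
have ex n : exists W, [/\ open W, A n `<=` W &
    omass W <= haar_outer (A n) + (e / (2 ^ n.+1)%:R)%:E].
  have en1 : (0 < e / (2 ^ n.+1)%:R)%R.
    by rewrite divr_gt0// ltr0n expn_gt0.
  have fn : haar_outer (A n) \is a fin_num.
    rewrite fin_numE; apply/andP; split; last exact/eqP/Aoo.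
    by rewrite -ltNye (lt_le_trans _ (outer_ge0 _)).
  have [_ [W [oW AW] <-] /ltW h] := lb_ereal_inf_adherent en1 fn.
  by exists W.
have [W WP] := choice ex.
have oW i : open (W i) by have [] := WP i.
apply: (@le_trans _ _ (omass (\bigcup_i W i))).
  apply: outer_lub; first by apply: bigcup_open.
  by move=> x [i _ Ax]; exists i => //; have [_ + _] := WP i; apply.
apply: le_trans (omass_bigcup oW) _.
by apply: lee_nneseries => [i _ _|i _]; [exact: omass_ge0|have [_ _] := WP i].
Qed.

Lemma omass_ltrans W x : omass (ltrans x W) = omass W.
Proof.
have le W' y : omass (ltrans y W') <= omass W'.
  apply: omass_lub => K cK KW; rewrite -(content_ltrans y^-1%g cK).
  apply: omass_ub; first exact: compact_ltrans.
  by rewrite -(ltransK y W'); exact: ltransS.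
apply/eqP; rewrite eq_le le /=.
by rewrite -{1}(ltransK x W); exact: le.
Qed.

Lemma outer_ltrans A x : haar_outer (ltrans x A) = haar_outer A.
Proof.
have le A' y : haar_outer A' <= haar_outer (ltrans y A').
  apply: le_ereal_inf_tmp => _ [W [oW AW] <-].
  rewrite -(omass_ltrans W y^-1%g); apply: outer_lub; first exact: open_ltrans.
  by rewrite -(ltransK y A'); exact: ltransS.
apply/eqP; rewrite eq_le le andbT.
by rewrite -{2}(ltransK x A); exact: le.
Qed.

Lemma outer_compact K : compact K -> haar_outer K < +oo.
Proof.
move=> cK.
have [W [L [oW cL KW WL]]] : exists W L, [/\ open W, compact L, K `<=` W & W `<=` L].
  apply: (compact_induction (P := fun K => exists W L,
    [/\ open W, compact L, K `<=` W & W `<=` L]) cK).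
  - by exists set0, set0; split => //; [exact: open0|exact: compact0].
  - by move=> A B AB [W [L [? ? BW ?]]]; exists W, L; split => // x /AB /BW.
  - move=> A B [W [L [oW cL AW WL]]] [W' [L' [oW' cL' AW' WL']]].
    exists (W `|` W'), (L `|` L'); split; [exact: openU|exact: compactU| |].
      exact: setUSS.
    exact: setUSS.
  - move=> x _; have [L [cL nL _]] := lcG openT (I : setT x).
    exists (interior L); first exact: nbhs_interior.
    by exists (interior L), L; split => //; [exact: open_interior|exact: interior_subset].
apply: le_lt_trans (outer_lub oW KW) _.
apply: (@le_lt_trans _ _ (content L)%:E); last exact: ltry.
by apply: omass_lub => K' cK' KW'; rewrite lee_fin content_le// => x /KW' /WL.
Qed.

(** After a translation [W] contains a compact neighbourhood [K] of 1. Covering [K0] by translates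
    of [K] bounds every ratio of [K] below by the inverse of their number. *)
Lemma outer_nonempty_open W : open W -> W !=set0 -> 0 < haar_outer W.
Proof.
move=> oW [x Wx]; rewrite -(outer_ltrans W x^-1%g).
have oW1 := @open_ltrans x^-1%g _ oW.
have W1 : ltrans x^-1%g W 1%g by exists x => //; rewrite mulVg.
have [K [cK nK KW]] := lcG oW1 W1.
rewrite outer_open//; apply: (lt_le_trans _ (omass_ub cK KW)).
rewrite lte_fin; have C0 : (0 < (covnum K K0)%:R :> R)%R.
  rewrite ltr0n; apply: covnum_gt0 => //.
  by exists 1%g; exact: nbhs_singleton.
apply: (@lt_le_trans _ _ ((covnum K K0)%:R^-1 : R)%R); first by rewrite invr_gt0.
rewrite -(ulim_cst ((covnum K K0)%:R^-1 : R)%R); apply: ulim_le.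
- exact: bseq_cst.
- exact: ratio_bseq.
apply: nearW => n; rewrite /ratio ler_pdivlMr ?covnumK0_gt0// mulrC.
rewrite ler_pdivrMr// mulrC -natrM ler_nat; exact: covnum_comp.
Qed.

HB.instance Definition _ := isOuterMeasure.Build R G haar_outer outer0 outer_ge0
  outer_le outer_sigma_subadditive.

(** An open [W] around the test set is filled from inside in two steps: a compact part [K] of the
    intersection with [U], then a compact part [L] of [W] minus [K]. These are disjoint, so their
    contents add up to at most the mass of [W]; suprema over [L] and then over [K] give the
    inequality. *)
Lemma open_caratheodory U : open U -> caratheodory_measurable haar_outer U.
Proof.
move=> oU; apply: le_caratheodory_measurable => A.
apply: le_ereal_inf_tmp => _ [W [oW AW] <-].
have oWU : open (W `&` U) by exact: openI.
apply: (@le_trans _ _ (omass (W `&` U) + haar_outer (A `&` ~` U))).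
  by rewrite leeD2r//; apply: outer_lub => //; exact: setSI.
have [->|Woo] := eqVneq (omass W) +oo; first exact: leey.
have step K : compact K -> K `<=` W `&` U ->
    (content K)%:E + haar_outer (A `&` ~` U) <= omass W.
  move=> cK KWU.
  have oWK : open (W `&` ~` K).
    by apply: openI => //; rewrite openC; exact: compact_closed.
  apply: (@le_trans _ _ ((content K)%:E + omass (W `&` ~` K))).
    rewrite leeD2l//; apply: outer_lub => // x [/AW Wx nUx]; split => //.
    by move=> /KWU[].
  rewrite -leeBrDl//; apply: omass_lub => L cL LWK; rewrite leeBrDl//.
  rewrite -EFinD -content_disjoint//.
    apply: omass_ub; first exact: compactU.
    by move=> x [/KWU[]|/LWK[]].
  by apply/seteqP; split=> // x [Kx /LWK[_]].
(* Finiteness, read off from the case of an empty [K], allows this term to cross the inequality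
   before the supremum over [K]. *)
have fA : haar_outer (A `&` ~` U) \is a fin_num.
  have h := step _ (@compact0 _) (sub0set _); rewrite content_set0 add0e in h.
  rewrite ge0_fin_numE; last exact: outer_ge0.
  by apply: le_lt_trans h _; rewrite ltey.
by rewrite -leeBrDr//; apply: omass_lub => K cK KWU; rewrite leeBrDr//; exact: step.
Qed.

Definition haar_fun (A : set (borel G)) : \bar R := haar_outer A.

Lemma borel_caratheodory (A : set (borel G)) : measurable A ->
  caratheodory_measurable haar_outer A.
Proof.
move=> mA; apply: (mA); split; last by move=> U oU; exact: open_caratheodory.
split.
- exact: (caratheodory_measurable_set0 haar_outer).
- move=> B cB; rewrite setTD.
  exact: (@caratheodory_measurable_setC _ _ haar_outer).
- exact: (@caratheodory_measurable_bigcup _ _ haar_outer).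
Qed.

Lemma haar_sigma_additive : semi_sigma_additive haar_fun.
Proof.
move=> F mF tF mUF.
pose mu : {outer_measure set (group_pointed G) -> \bar R} := haar_outer.
apply: (@caratheodory_measure_sigma_additive R (group_pointed G) mu) => //.
  by move=> i; exact: borel_caratheodory.
exact: borel_caratheodory.
Qed.

HB.instance Definition _ := isMeasure.Build _ _ _ haar_fun outer0 outer_ge0
  haar_sigma_additive.

Lemma haar_content : exists mu : {measure set (borel G) -> \bar R},
  is_left_haar mu /\ forall U : set G, open U -> U !=set0 -> 0 < mu U.
Proof.
exists (haar_fun : {measure set (borel G) -> \bar R}).
have pos U : open U -> U !=set0 -> 0 < haar_fun U.
  by move=> oU U0; exact: outer_nonempty_open.
split; last exact: pos.
split.
- by rewrite gt_eqF//; apply: pos; [exact: openT|exists 1%g].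
- by move=> K cK; exact: outer_compact.
- by move=> x A _; exact: outer_ltrans.
Qed.

End Content.

(** Positivity on nonempty open sets is recorded with the measure, because faithfulness of the
    integral will rest on it. *)
Lemma haar_exists : exists mu : {measure set (borel G) -> \bar R},
  is_left_haar mu /\ forall U : set G, open U -> U !=set0 -> (0 < mu U)%E.
Proof.
have [V [nV VN]] := nbhs1_base.
have [K0 [cK0 nK0 _]] := lcG openT (I : setT (1%g : G)).
exact: haar_content nV VN cK0 nK0.
Qed.

End Haar.

(** * Cosine expansions *)

Section CosineBounds.
Context {R : realType}.
Implicit Types x y : R.

Lemma pi_le4 : pi <= 4%:R :> R.
Proof.
have [/andP[_ h] _] := pihalf_02_cos_pihalf R.
by move: h; rewrite ler_pdivrMr// -natrM.
Qed.

Lemma cos_le0 x : pi / 2 <= x <= pi -> cos x <= 0.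
Proof.
move=> /andP[x1 x2]; rewrite -[x](subrK (pi / 2)) cosDpihalf oppr_le0.
have p0 := pi_ge0 R; apply: sin_ge0_pi; apply/andP; split; first by rewrite subr_ge0.
by apply: le_trans x2; rewrite gerBl divr_ge0.
Qed.

Lemma sin_sqr_ge x : 0 <= x <= pi / 4%:R -> x ^+ 2 / 2 <= sin x ^+ 2.
Proof.
move=> /andP[x0 xpi]; have p0 := pi_ge0 R.
have [|c] := @MVT_segment R sin cos 0 x x0 (fun y _ => is_derive_sin y).
  by apply: continuous_subspaceT => z; exact: continuous_sin.
rewrite in_itv /= sin0 !subr0 => /andP[c0 cx] ->.
rewrite exprMn mulrC ler_wpM2r//; first exact: sqr_ge0.
have h : cos (c *+ 2) >= 0.
  apply: cos_ge0_pihalf; apply/andP; split.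
    by lra.
  by lra.
by move: h; rewrite cos_mulr2n; lra.
Qed.

(** Beyond the right angle the cosine is nonpositive and the square of [x] is at most 16, since
    [pi <= 4]; below it the half-angle formula and [sin_sqr_ge] give more than is claimed. *)
Lemma cos_le_sqr x : 0 <= x <= pi -> x ^+ 2 / 16%:R <= 1 - cos x.
Proof.
move=> /andP[x0 xpi]; have p4 := pi_le4; have p0 := pi_ge0 R.
have [xh|xh] := leP x (pi / 2); last first.
  have c0 : cos x <= 0 by apply: cos_le0; rewrite (ltW xh) xpi.
  by nra.
have h := @sin_sqr_ge (x / 2).
have e : cos x = 1 - sin (x / 2) ^+ 2 *+ 2.
  rewrite -[in LHS](divfK (x := 2%:R) _ x)//.
  by rewrite mulr_natr cos_mulr2n cos2sin2 mulrnBl; rewrite mulr2n; lra.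
have {h}h := h _; rewrite e mulr2n; move: h.
have -> : 0 <= x / 2 <= pi / 4%:R by apply/andP; split; lra.
by move=> /(_ isT); nra.
Qed.

End CosineBounds.

Section CosineSums.
Context {R : realType} {I : finType}.
Implicit Types (k : I -> nat) (t : I -> R) (F : (I -> R) -> R).

Definition tshift i (h : R) t : I -> R := fun l => t l + h *+ (l == i).

Definition gridpt n (j : {ffun I -> 'I_n}) : I -> R :=
  fun l => (pi *+ 2) * (j l : nat)%:R / n%:R.

Definition tperiodic F := forall i t, F (tshift i (pi *+ 2) t) = F t.

Definition coskt k t := \prod_i cos ((k i)%:R * t i).

Definition cossum n k F := \sum_(j : {ffun I -> 'I_n}) F (gridpt j) * coskt k (gridpt j).

(* Summation by parts against the cosines turns [nabla] into multiplication by
   2 - 2 cos (k_i h), which is of order (k_i h)^2: hence the decay of [cossum]. *)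
Definition nabla i (h : R) F := fun t =>
  F t *+ 2 - F (tshift i h t) - F (tshift i (- h) t).

Lemma tshiftD i h h' t : tshift i h (tshift i h' t) = tshift i (h' + h) t.
Proof. by apply: funext => l; rewrite /tshift mulrnDl addrA. Qed.

Lemma tshift0 i t : tshift i 0 t = t.
Proof. by apply: funext => l; rewrite /tshift mul0rn addr0. Qed.

Lemma tshiftNK i h t : tshift i (- h) (tshift i h t) = t.
Proof. by rewrite tshiftD addrN tshift0. Qed.

Lemma tshiftC i h l h' t : tshift i h (tshift l h' t) = tshift l h' (tshift i h t).
Proof. by apply: funext => m; rewrite /tshift addrAC. Qed.

Lemma tperiodic_shift i h F : tperiodic F -> tperiodic (fun t => F (tshift i h t)).
Proof. by move=> pF l t; rewrite tshiftC pF. Qed.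

Lemma tperiodic_nabla i h F : tperiodic F -> tperiodic (nabla i h F).
Proof. by move=> pF l t; rewrite /nabla !(tshiftC i _ l) !pF. Qed.

Lemma tperiodicM F F' : tperiodic F -> tperiodic F' -> tperiodic (fun t => F t * F' t).
Proof. by move=> pF pF' l t; rewrite pF pF'. Qed.

Lemma cos_periodic_nat (x : R) m : cos (x + m%:R * (pi *+ 2)) = cos x.
Proof.
elim: m => [|m IH]; first by rewrite mul0r addr0.
by rewrite -natr1 mulrDl mul1r addrA cosD2pi.
Qed.

Lemma tperiodic_coskt k : tperiodic (coskt k).
Proof.
move=> i t; apply: eq_bigr => l _; rewrite /tshift mulrDr.
by case: (l == i); rewrite ?mulr1n ?mulr0n ?mulr0 ?addr0// cos_periodic_nat.
Qed.

(** Shifting one coordinate by the mesh permutes the grid cyclically; periodicity pays for the wrap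
    from the last point to the first. *)
Lemma sum_grid_shift n i F : tperiodic F ->
  \sum_(j : {ffun I -> 'I_n.+1}) F (tshift i ((pi *+ 2) / n.+1%:R) (gridpt j)) =
  \sum_(j : {ffun I -> 'I_n.+1}) F (gridpt j).
Proof.
move=> pF; pose s (j : {ffun I -> 'I_n.+1}) : {ffun I -> 'I_n.+1} :=
  [ffun l => if l == i then ordS (j l) else j l].
pose s' (j : {ffun I -> 'I_n.+1}) : {ffun I -> 'I_n.+1} :=
  [ffun l => if l == i then ord_pred (j l) else j l].
rewrite [RHS](reindex s); last first.
  exists s' => j _; apply/ffunP => l; rewrite !ffunE.
    by case: eqP => // _; rewrite ordSK.
  by case: eqP => // _; rewrite ord_predK.
apply: eq_bigr => j _; have n0 : n.+1%:R != 0 :> R by rewrite pnatr_eq0.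
have [jn|jn] := ltnP (j i).+1 n.+1.
  congr F; apply: funext => l; rewrite /tshift /gridpt ffunE.
  case: eqP => [->|_]; last by rewrite addr0.
  rewrite /= modn_small// mulr1n -[in RHS]natr1.
  by move: (n.+1%:R) n0 => N N0; field.
(* The last grid point in direction [i]: its shift is a full period away from the first point. *)
have jE : j i = n :> nat by apply/eqP; rewrite eqn_leq -ltnS ltn_ord.
rewrite -[RHS](pF i); congr F; apply: funext => l; rewrite /tshift /gridpt ffunE.
case: eqP => [->|_]; last by rewrite addr0.
rewrite /= jE modnn !mulr1n -natr1.
have {}n0 : n%:R + 1 != 0 :> R by rewrite natr1.
by field.
Qed.

Lemma coskt_shiftB i k h t :
  coskt k (tshift i h t) + coskt k (tshift i (- h) t) =
  (cos ((k i)%:R * h) *+ 2) * coskt k t.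
Proof.
have cE t' : coskt k t' = cos ((k i)%:R * t' i) *
    \prod_(l | l != i) cos ((k l)%:R * t' l) by rewrite /coskt (bigD1 i).
have e h' : \prod_(l | l != i) cos ((k l)%:R * tshift i h' t l) =
    \prod_(l | l != i) cos ((k l)%:R * t l).
  by apply: eq_bigr => l /negPf li; rewrite /tshift li addr0.
rewrite !cE !e -mulrDl mulrA; congr (_ * _).
rewrite /tshift eqxx !mulr1n !mulrDr mulrN cosD cosB.
by ring.
Qed.

Lemma cossum_nabla n i k F : tperiodic F ->
  cossum n.+1 k (nabla i ((pi *+ 2) / n.+1%:R) F) =
  (2 - cos ((k i)%:R * ((pi *+ 2) / n.+1%:R)) *+ 2) * cossum n.+1 k F.
Proof.
move=> pF; set h := (pi *+ 2) / n.+1%:R; have pc := tperiodic_coskt k.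
have s1 : \sum_(j : {ffun I -> 'I_n.+1}) F (tshift i h (gridpt j)) * coskt k (gridpt j) =
    \sum_(j : {ffun I -> 'I_n.+1}) F (gridpt j) * coskt k (tshift i (- h) (gridpt j)).
  rewrite -(@sum_grid_shift n i (fun t => F t * coskt k (tshift i (- h) t))).
    by apply: eq_bigr => j _; rewrite tshiftNK.
  by apply: tperiodicM => //; exact: tperiodic_shift.
have s2 : \sum_(j : {ffun I -> 'I_n.+1}) F (tshift i (- h) (gridpt j)) * coskt k (gridpt j) =
    \sum_(j : {ffun I -> 'I_n.+1}) F (gridpt j) * coskt k (tshift i h (gridpt j)).
  rewrite -(@sum_grid_shift n i (fun t => F (tshift i (- h) t) * coskt k t)).
    by apply: eq_bigr => j _; rewrite tshiftNK.
  by apply: tperiodicM => //; exact: tperiodic_shift.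
rewrite /cossum /nabla.
under eq_bigr do rewrite !mulrBl.
rewrite !sumrB s1 s2 mulrBl -addrA -opprD -big_split/=; congr (_ - _).
  by rewrite mulr_sumr; apply: eq_bigr => j _; rewrite mulrnAl mulr_natl.
rewrite mulr_sumr; apply: eq_bigr => j _.
by rewrite -mulrDr [X in _ * X]addrC coskt_shiftB mulrCA.
Qed.

Lemma cossum_iter_nabla n i k F N : tperiodic F ->
  cossum n.+1 k (iter N (nabla i ((pi *+ 2) / n.+1%:R)) F) =
  (2 - cos ((k i)%:R * ((pi *+ 2) / n.+1%:R)) *+ 2) ^+ N * cossum n.+1 k F.
Proof.
move=> pF; have : tperiodic (iter N (nabla i ((pi *+ 2) / n.+1%:R)) F) /\
    cossum n.+1 k (iter N (nabla i ((pi *+ 2) / n.+1%:R)) F) =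
  (2 - cos ((k i)%:R * ((pi *+ 2) / n.+1%:R)) *+ 2) ^+ N * cossum n.+1 k F.
  elim: N => [|N [pN e]]; first by rewrite expr0 mul1r.
  split; first exact: tperiodic_nabla.
  by rewrite /= cossum_nabla// e mulrA -exprS.
by case.
Qed.

Lemma coskt_le1 k t : `|coskt k t| <= 1.
Proof.
rewrite normr_prod; apply: prodr_ile1 => l _.
by rewrite normr_ge0 ler_norml cos_geN1 cos_le1.
Qed.

Lemma cossum_le n k F C : (forall t, `|F t| <= C) ->
  `|cossum n k F| <= n%:R ^+ #|I| * C.
Proof.
move=> FC; apply: le_trans (ler_norm_sum _ _ _) _.
apply: (@le_trans _ _ (\sum_(j : {ffun I -> 'I_n}) C)).
  apply: ler_sum => j _; rewrite normrM; apply: le_trans (FC (gridpt j)).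
  by rewrite ler_piMr// coskt_le1.
rewrite sumr_const; have -> : #|{: {ffun I -> 'I_n}}| = (n ^ #|I|)%N.
  by rewrite card_ffun card_ord.
by rewrite -[leLHS]mulr_natl natrX.
Qed.

(** Each application of [nabla] multiplies the sum by the factor [c], at least an eighth of the
    square of the frequency times the mesh [h]; the condition on [k i] keeps that product below
    [pi], where the cosine bound holds. The powers of [h] cancel against those in the hypothesis, so
    the constant is independent of [m]. *)
Lemma cossum_decay m i k F N C : tperiodic F -> (k i <= m)%N ->
  (forall h t, `|iter N (nabla i h) F t| <= C * (2 * h ^+ 2) ^+ N) ->
  `|cossum m.*2.+1 k F| * (k i)%:R ^+ N.*2 <= m.*2.+1%:R ^+ #|I| * (C * 16%:R ^+ N).
Proof.
move=> pF km FC; set n := m.*2; set h : R := (pi *+ 2) / n.+1%:R.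
have h0 : 0 < h by apply: divr_gt0; rewrite ?ltr0n// mulr2n addr_gt0 ?pi_gt0.
have := cossum_le n.+1 k (FC h); rewrite cossum_iter_nabla// normrM normrX.
rewrite -/h => H; set c := 2 - _ in H.
have ck : ((k i)%:R * h) ^+ 2 / 8%:R <= c.
  have [kh0 khpi] : 0 <= (k i)%:R * h /\ (k i)%:R * h <= pi.
    split; first by rewrite mulr_ge0// ltW.
    rewrite /h mulrA ler_pdivrMr ?ltr0n// -[pi *+ 2]mulr_natl mulrA [pi * _]mulrC.
    rewrite ler_wpM2r ?pi_ge0// -natrM ler_nat muln2 (leq_trans _ (leqnSn _))//.
    by rewrite leq_double.
  have := @cos_le_sqr R ((k i)%:R * h); rewrite kh0 khpi => /(_ isT).
  by rewrite /c mulr2n; lra.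
have c0 : 0 <= c by apply: le_trans ck; rewrite divr_ge0// sqr_ge0.
rewrite (ger0_norm c0) in H.
have hN : 0 < (2 * h ^+ 2) ^+ N by rewrite exprn_gt0// mulr_gt0// exprn_gt0.
(* The number 16 is the product of the 8 in the lower bound on [c] and the 2 in the hypothesis on
   second differences. *)
rewrite -(ler_pM2r hN); have e : (16%:R : R) * (((k i)%:R * h) ^+ 2 / 8%:R) =
    (k i)%:R ^+ 2 * (2 * h ^+ 2) by field.
have {}H := ler_wpM2l (exprn_ge0 N (ler0n R 16)) H.
apply: (@le_trans _ _ (16%:R ^+ N * (c ^+ N * `|cossum n.+1 k F|))); last first.
  by apply: le_trans H _; rewrite -!mulrA; lra.
rewrite mulrA -exprMn -mul2n exprM -mulrA -exprMn mulrC ler_wpM2r ?normr_ge0//.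
apply: lerXn2r; rewrite ?nnegrE.
- by rewrite mulr_ge0 ?sqr_ge0// mulr_ge0// sqr_ge0.
- by rewrite mulr_ge0.
by rewrite -e ler_wpM2l.
Qed.

End CosineSums.

(** * Inversion of the discrete cosine transform *)

Section CosineInversion.
Context {R : realType} {I : finType}.
Implicit Types (k : I -> nat) (t : I -> R) (F : (I -> R) -> R).

(** The usual normalisation of cosine series: 1 for the constant term, 2 for the others. *)
Definition cmul (k : nat) : R := 1 + (k != 0%N)%:R.

Lemma dirichlet_kernel (x : R) m :
  sin (x / 2) * \sum_(k < m.+1) cmul k * cos (k%:R * x) = sin ((m%:R + 2^-1) * x).
Proof.
elim: m => [|m IH].
  rewrite big_ord1 /cmul eqxx addr0 !mul0r cos0 !mulr1 add0r.
  by rewrite mulrC.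
rewrite big_ord_recr /= mulrDr {}IH /cmul /=.
have -> : (m.+1%:R + 2^-1) * x = m.+1%:R * x + x / 2 by field.
have -> : (m%:R + 2^-1) * x = m.+1%:R * x - x / 2 by rewrite -(natr1 m); field.
by rewrite sinB sinD; ring.
Qed.

Lemma sin_natpi m : sin (m%:R * pi) = 0 :> R.
Proof.
by rewrite -[_ * pi]add0r mulr_natl (alternatingn (@sinDpi R)) sin0 mulr0.
Qed.

Definition gkernel n m (a b : R) : R :=
  \sum_(k < m) (cmul k / n%:R) * (cos (k%:R * a) * cos (k%:R * b)).

(** The kernel is a sum of Dirichlet kernels at [x + y] and [x - y], and each of them vanishes at a
    grid point unless the sine of half that angle does. The conclusion is equality of cosines and
    not of points, since [x] and its reflection are not told apart; for functions of the cosines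
    this is enough. *)
Lemma gkernel_eq0 m (a b : nat) :
  let n := m.*2.+1 in
  let x := (pi *+ 2) * a%:R / n%:R in let y := (pi *+ 2) * b%:R / n%:R in
  gkernel n m.+1 x y != 0 -> cos x = cos y :> R.
Proof.
move=> n x y; have n0 : n%:R != 0 :> R by rewrite pnatr_eq0.
have nE : (m%:R + 2^-1 : R) = n%:R / 2.
  have -> : n%:R = m%:R * 2 + 1 :> R by rewrite /n -addn1 natrD -muln2 natrM.
  by field.
pose D (z : R) := \sum_(k < m.+1) cmul k * cos (k%:R * z).
have sD z : sin (z / 2) * D z = sin (n%:R * (z / 2)).
  by rewrite /D dirichlet_kernel nE; congr sin; field.
have sx : n%:R * (x / 2) = a%:R * pi by rewrite /x; field.
have sy : n%:R * (y / 2) = b%:R * pi by rewrite /y; field.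
have sp : sin ((x + y) / 2) * D (x + y) = 0.
  rewrite sD (_ : _ * _ = n%:R * (x / 2) + n%:R * (y / 2)); last by field.
  by rewrite sx sy sinD !sin_natpi mul0r mulr0 addr0.
have sm : sin ((x - y) / 2) * D (x - y) = 0.
  rewrite sD (_ : _ * _ = n%:R * (x / 2) - n%:R * (y / 2)); last by field.
  by rewrite sx sy sinB !sin_natpi mul0r mulr0 subr0.
have cxy : cos x - cos y = - (2 * sin ((x + y) / 2) * sin ((x - y) / 2)).
  have -> : cos x = cos ((x + y) / 2 + (x - y) / 2) by congr cos; field.
  have -> : cos y = cos ((x + y) / 2 - (x - y) / 2) by congr cos; field.
  by rewrite cosB cosD; ring.
have gE : gkernel n m.+1 x y = (D (x - y) + D (x + y)) / (n%:R * 2).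
  rewrite /gkernel /D -big_split /= mulr_suml; apply: eq_bigr => k _.
  rewrite !mulrDr mulrN cosB cosD; field.
  by rewrite -mulr2n mulrn_eq0 negb_or n0.
move=> g0; apply/eqP; rewrite -subr_eq0 cxy oppr_eq0.
have [dm|dm] := eqVneq (D (x - y)) 0; last first.
  by move/eqP: sm; rewrite mulf_eq0 (negPf dm) orbF => /eqP ->; rewrite mulr0.
have [dp|dp] := eqVneq (D (x + y)) 0; last first.
  by move/eqP: sp; rewrite mulf_eq0 (negPf dp) orbF => /eqP ->; rewrite mulr0 mul0r.
by move: g0; rewrite gE dm dp addr0 mul0r eqxx.
Qed.

(* The integral defining a cosine coefficient is discretised on a grid of odd size
   n = 2m+1; by [gkernel_eq0] the expansion is then exact at the grid points.  The
   coefficients themselves are ultrafilter limits in m, see [clim]. *)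
Definition ccoef n k F : R := (\prod_i (cmul (k i) / n%:R)) * cossum n k F.

Definition cos_dependent F := forall t t', (forall i, cos (t i) = cos (t' i)) -> F t = F t'.

Lemma cos_dependent_periodic F : cos_dependent F -> tperiodic F.
Proof.
move=> cF i t; apply: cF => l; rewrite /tshift.
by case: (l == i); rewrite ?mulr1n ?cosD2pi// mulr0n addr0.
Qed.

Definition kord n (k : {ffun I -> 'I_n}) : I -> nat := fun i => k i.

(** Second differences kill constants, while by [cossum_nabla] they multiply the sum by a factor
    that is nonzero for a nonzero frequency at most [m]. *)
Lemma cossum1 m k : (forall i, (k i <= m)%N) -> (exists i, k i != 0%N) ->
  cossum m.*2.+1 k (fun=> (1 : R)) = 0.
Proof.
move=> km [i ki]; set h : R := (pi *+ 2) / m.*2.+1%:R.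
have := @cossum_nabla R I m.*2 i k (fun=> (1 : R)) (fun _ _ => erefl).
have -> : @nabla R I i h (fun=> (1 : R)) = fun=> 0.
  by apply: funext => t; rewrite /nabla mulr2n addrK subrr.
rewrite [LHS]big1 => [|j _]; last by rewrite mul0r.
move/esym/eqP; rewrite mulf_eq0 => /orP[|/eqP//].
rewrite subr_eq0 -subr_eq0.
have [kh0 khpi] : 0 < (k i)%:R * h /\ (k i)%:R * h <= pi.
  split.
    rewrite mulr_gt0// ?ltr0n ?lt0n//; apply: divr_gt0; rewrite ?ltr0n//.
    by rewrite mulr2n addr_gt0 ?pi_gt0.
  rewrite /h mulrA ler_pdivrMr ?ltr0n// -[pi *+ 2]mulr_natl mulrA [pi * _]mulrC.
  rewrite ler_wpM2r ?pi_ge0// -natrM ler_nat muln2 (leq_trans _ (leqnSn _))//.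
  by rewrite leq_double.
have := @cos_le_sqr R ((k i)%:R * h); rewrite (ltW kh0) khpi => /(_ isT).
have : 0 < ((k i)%:R * h) ^+ 2 by rewrite exprn_gt0.
move: (_ ^+ 2) (cos _) => s c s0 sc /eqP; rewrite mulr2n; lra.
Qed.

Lemma cosine_kernel n m (j l : {ffun I -> 'I_n}) :
  \sum_(k : {ffun I -> 'I_m}) (\prod_i (cmul (k i) / n%:R)) *
    (coskt (kord k) (gridpt j) * coskt (kord k) (gridpt l)) =
  \prod_i gkernel n m (gridpt j i) (gridpt l i).
Proof.
rewrite /gkernel bigA_distr_bigA; apply: eq_bigr => k _.
by rewrite /coskt -!big_split.
Qed.

(** The left side is an average of [F] against the product kernel. The kernel is supported where [F]
    takes the same value as at the given point, and its total mass 1 is found by inserting the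
    constant function. *)
Lemma cosine_inversion m F (l : {ffun I -> 'I_m.*2.+1}) : cos_dependent F ->
  \sum_(k : {ffun I -> 'I_m.+1}) ccoef m.*2.+1 (kord k) F * coskt (kord k) (gridpt l) =
  F (gridpt l).
Proof.
move=> cF; set n := m.*2.+1.
have swap F' : \sum_(k : {ffun I -> 'I_m.+1}) ccoef n (kord k) F' * coskt (kord k) (gridpt l) =
    \sum_(j : {ffun I -> 'I_n}) F' (gridpt j) *
      \prod_i gkernel n m.+1 (gridpt j i) (gridpt l i).
  under [RHS]eq_bigr do rewrite -cosine_kernel mulr_sumr.
  rewrite exchange_big; apply: eq_bigr => k _ /=.
  rewrite /ccoef /cossum mulrAC mulr_sumr; apply: eq_bigr => j _.
  by rewrite /kord; ring.
have sum1 : \sum_(j : {ffun I -> 'I_n}) \prod_i gkernel n m.+1 (gridpt j i) (gridpt l i) = 1 :> R.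
  have := swap (fun=> 1); under [X in _ = X -> _]eq_bigr do rewrite mul1r.
  move=> <-; rewrite (bigD1 [ffun=> ord0])//= big1 ?addr0 => [|k k0].
    have k0 i : kord ([ffun=> ord0] : {ffun I -> 'I_m.+1}) i = 0%N by rewrite /kord ffunE.
    have c1 t : coskt (kord ([ffun=> ord0] : {ffun I -> 'I_m.+1})) t = 1 :> R.
      by rewrite /coskt big1// => i _; rewrite k0 mul0r cos0.
    rewrite c1 mulr1 /ccoef /cossum [X in _ * X](eq_bigr (fun=> 1)); last first.
      by move=> j _; rewrite c1 mulr1.
    rewrite sumr_const card_ffun card_ord.
    under eq_bigr do rewrite k0 /cmul eqxx addr0 mul1r.
    rewrite prodr_const natrX exprVn mulVf//.
    by rewrite expf_neq0// pnatr_eq0.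
  rewrite /ccoef cossum1 ?mulr0 ?mul0r// => [i|]; first by rewrite -ltnS ltn_ord.
  apply/existsP; rewrite -negb_forall; apply: contra k0 => /forallP k0.
  by apply/eqP/ffunP => i; rewrite ffunE; apply/val_inj/eqP/k0.
rewrite swap -[RHS]mulr1 -[X in _ = _ * X]sum1 mulr_sumr; apply: eq_bigr => j _.
have [->|pj] := eqVneq (\prod_i gkernel n m.+1 (gridpt j i) (gridpt l i)) 0.
  by rewrite !mulr0.
congr (_ * _); apply: cF => i; apply: (@gkernel_eq0 m).
by apply: contra_neq pj => gi; rewrite (bigD1 i)//= gi mul0r.
Qed.

End CosineInversion.

Section Boxes.
Context {R : realType} {I : finType}.
Implicit Types k : I -> nat.

Definition wt k : R := \prod_i (k i).+1%:R.

Lemma wt_gt0 k : 0 < wt k. Proof. by apply: prodr_gt0 => i _; rewrite ltr0n. Qed.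

Lemma wt_ge k i : (k i).+1%:R <= wt k.
Proof.
rewrite /wt (bigD1 i)//= ler_peMr//.
elim/big_rec: _ => // j x _ x1; apply: (le_trans x1).
by rewrite ler_peMl ?ler1n// (le_trans _ x1).
Qed.

Lemma wt_ge1 k : 1 <= wt k.
Proof.
rewrite /wt; elim/big_rec: _ => // j x _ x1; apply: (le_trans x1).
by rewrite ler_peMl ?ler1n// (le_trans _ x1).
Qed.

Lemma sum_inv_sqr M : \sum_(k < M) (k.+1%:R ^+ 2)^-1 <= 2 :> R.
Proof.
case: M => [|M]; first by rewrite big_ord0.
suff : \sum_(k < M.+1) (k.+1%:R ^+ 2)^-1 <= 2 - M.+1%:R^-1 :> R.
  by move=> h; apply: le_trans h _; rewrite gerBl invr_ge0.
elim: M => [|M IH]; first by rewrite big_ord1 expr1n invr1; lra.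
rewrite big_ord_recr /=; apply: le_trans (lerD IH (lexx _)) _.
have m0 : 0 < M.+1%:R :> R by rewrite ltr0n.
rewrite -[M.+2%:R]natr1; move: (M.+1%:R) m0 => x x0.
have x1 : 0 < x + 1 by rewrite ltr_wpDr.
have e : 2 - (x + 1)^-1 - (2 - x^-1 + ((x + 1) ^+ 2)^-1) = (x * (x + 1) ^+ 2)^-1.
  by field; rewrite !gt_eqF.
by rewrite -subr_ge0 e invr_ge0 mulr_ge0 ?ltW// exprn_gt0.
Qed.

Definition in_box N k := [forall i, (k i < N)%N].

Lemma out_box_wt N k : ~~ in_box N k -> N.+1%:R <= wt k.
Proof.
case/forallPn => i; rewrite -leqNgt => Ni.
by apply: le_trans (wt_ge k i); rewrite ler_nat.
Qed.

(** Of the three powers of the weight one yields the rate outside the box; the remaining two sum to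
    a product of one-dimensional sums, each at most 2. *)
Lemma sum_out_box M N :
  \sum_(k : {ffun I -> 'I_M} | ~~ in_box N (kord k)) (wt (kord k) ^+ 3)^-1 <=
  2 ^+ #|I| * N.+1%:R^-1.
Proof.
apply: (@le_trans _ _ (\sum_(k : {ffun I -> 'I_M}) (wt (kord k) ^+ 2)^-1 * N.+1%:R^-1)).
  rewrite big_mkcond; apply: ler_sum => k _; have w0 := wt_gt0 (kord k).
  case: ifP => [ok|_]; last by rewrite mulr_ge0// invr_ge0 ?exprn_ge0// ltW.
  rewrite exprSr invfM ler_wpM2l ?invr_ge0 ?exprn_ge0 ?(ltW w0)//.
  by rewrite lef_pV2 ?posrE// out_box_wt.
rewrite -mulr_suml ler_wpM2r ?invr_ge0//.
have -> : \sum_(k : {ffun I -> 'I_M}) (wt (kord k) ^+ 2)^-1 =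
    \prod_(i : I) \sum_(k < M) (k.+1%:R ^+ 2)^-1.
  rewrite bigA_distr_bigA; apply: eq_bigr => k _.
  by rewrite /wt -prodrXl -prodfV.
rewrite -prodr_const; apply: ler_prod => i _; rewrite sum_inv_sqr andbT.
by apply: sumr_ge0 => k _; rewrite invr_ge0 exprn_ge0.
Qed.

Lemma sum_in_box (V : nmodType) M N (F : (I -> nat) -> V) : (N <= M)%N ->
  \sum_(k : {ffun I -> 'I_M} | in_box N (kord k)) F (kord k) =
  \sum_(k : {ffun I -> 'I_N}) F (kord k).
Proof.
move=> NM.
pose h (k : {ffun I -> 'I_N}) : {ffun I -> 'I_M} := [ffun i => widen_ord NM (k i)].
have [/forallP N0|] := boolP [forall k : {ffun I -> 'I_M}, ~~ in_box N (kord k)].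
  rewrite big_pred0 => [|k]; last by apply/negbTE.
  rewrite big1// => k _; have /negP := N0 (h k).
  by case; apply/forallP => i; rewrite /kord /h ffunE /=.
case/forallPn => k0; rewrite negbK => /forallP k0N.
pose g (k : {ffun I -> 'I_M}) : {ffun I -> 'I_N} :=
  [ffun i => insubd (Ordinal (k0N i)) (k i : nat)].
rewrite (reindex_onto h g) => [|k /forallP kN]; last first.
  apply/ffunP => i; apply: val_inj; rewrite !ffunE /= val_insubd.
  by have := kN i; rewrite /kord => ->.
apply: eq_big => [k|k _]; last first.
  by congr F; apply: funext => i; rewrite /kord /h ffunE.
apply/andP; split; first by apply/forallP => i; rewrite /kord /h ffunE /=.
apply/eqP/ffunP => i; apply: val_inj; rewrite !ffunE /= val_insubd /=.
by rewrite ltn_ord.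
Qed.

Lemma sum_box_split (V : nmodType) M N (F : (I -> nat) -> V) : (N <= M)%N ->
  \sum_(k : {ffun I -> 'I_M}) F (kord k) =
  \sum_(k : {ffun I -> 'I_N}) F (kord k) +
  \sum_(k : {ffun I -> 'I_M} | ~~ in_box N (kord k)) F (kord k).
Proof.
by move=> NM; rewrite (bigID (fun k : {ffun I -> 'I_M} => in_box N (kord k))) /= sum_in_box.
Qed.

End Boxes.

Section CosineExpansion.
Context {R : realType} {I : finType}.
Implicit Types (k : I -> nat) (t : I -> R) (F : (I -> R) -> R).

(** Zero outside the frequencies resolved by the grid, so that [k] can stay fixed while [m]
    grows. *)
Definition ccoefn m k F : R :=
  if in_box m.+1 k then ccoef m.*2.+1 k F else 0.

Definition clim k F : R := ulim (fun m => ccoefn m k F).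

Lemma grid_approx (x : R) : 0 <= x <= pi ->
  exists2 j : forall m, 'I_m.*2.+1,
    (forall m, `|x - (pi *+ 2) * (j m : nat)%:R / m.*2.+1%:R| <= (pi *+ 2) / m.*2.+1%:R) &
    (fun m => (pi *+ 2) * (j m : nat)%:R / m.*2.+1%:R) @ \oo --> x.
Proof.
move=> /andP[x0 xpi]; have p0 : 0 < pi *+ 2 :> R by rewrite pmulrn_lgt0 ?pi_gt0.
have q0 m : 0 <= x * m.*2.+1%:R / (pi *+ 2).
  by rewrite divr_ge0 ?mulr_ge0 ?(ltW p0).
have jP m : (Num.trunc (x * m.*2.+1%:R / (pi *+ 2)) < m.*2.+1)%N.
  rewrite truncn_lt_nat// ltr_pdivrMr// mulrC ltr_pM2l ?ltr0n//.
  by apply: le_lt_trans xpi _; rewrite mulr2n ltrDl pi_gt0.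
have b m : `|x - (pi *+ 2) * (Ordinal (jP m) : nat)%:R / m.*2.+1%:R| <= (pi *+ 2) / m.*2.+1%:R.
  have n0 : 0 < m.*2.+1%:R :> R by rewrite ltr0n.
  have := truncn_itv (q0 m); rewrite -[nat_of_ord _]/(Num.trunc (x * m.*2.+1%:R / (pi *+ 2))).
  set j := Num.trunc _; clearbody j; move: (m.*2.+1%:R) n0 => n n0 /andP[].
  rewrite ler_pdivlMr// ltr_pdivrMr// => t1 t2.
  rewrite ger0_norm.
    by rewrite lerBlDl -mulrDl ler_pdivlMr//; move: t2; rewrite -natr1; lra.
  by rewrite subr_ge0 ler_pdivrMr// mulrC.
exists (fun m => Ordinal (jP m)) => //.
apply/cvgrPdist_le => e e0; near=> m; apply: le_trans (b m) _.
rewrite ler_pdivrMr ?ltr0n// mulrC -ler_pdivrMr//.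
apply: (@le_trans _ _ m%:R); last by rewrite ler_nat -addnn -addnS leq_addr.
near: m; exact: nbhs_infty_ger.
Unshelve. all: by end_near. Qed.

(** At grid points [u m] tending to [t] the full discrete expansion is exact, so truncation at [N]
    leaves a tail that the decay bounds uniformly in [m]. The ultralimit replaces [F (u m)] by [F t]
    and the discrete coefficients by [clim]. *)
Lemma cosine_expansion F C t N : cos_dependent F ->
  (forall m k, `|ccoefn m k F| * wt k ^+ 3 <= C) ->
  (forall i, 0 <= t i <= pi) ->
  (forall u : nat -> I -> R, (forall i, u n i @[n --> \oo] --> t i) ->
     F (u n) @[n --> \oo] --> F t) ->
  `|F t - \sum_(k : {ffun I -> 'I_N}) clim (kord k) F * coskt (kord k) t| <=
  C * (2 ^+ #|I| * N.+1%:R^-1).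
Proof.
move=> cF dF t0 Ft.
have [j /= jt] : exists j : forall (i : I) m, 'I_m.*2.+1, forall i,
    (fun m => (pi *+ 2) * (j i m : nat)%:R / m.*2.+1%:R) @ \oo --> t i.
  pose j i := sval (cid2 (grid_approx (t0 i))).
  by exists j => i; rewrite /j; case: cid2.
pose u m : I -> R := gridpt [ffun i => j i m].
have ut i : u n i @[n --> \oo] --> t i.
  have -> : (fun n => u n i) = fun m => (pi *+ 2) * (j i m : nat)%:R / m.*2.+1%:R.
    by apply: funext => m; rewrite /u /gridpt ffunE.
  exact: jt.
have C0 : 0 <= C.
  apply: le_trans (dF 0%N (fun=> 0%N)); rewrite mulr_ge0// exprn_ge0//.
  exact/ltW/wt_gt0.
have dF' m k : `|ccoefn m k F| <= C * (wt k ^+ 3)^-1.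
  by rewrite ler_pdivlMr ?exprn_gt0 ?wt_gt0.
have bc k : bseq (fun m => ccoefn m k F).
  by exists (C * (wt k ^+ 3)^-1) => m; exact: dF'.
have be k : bseq (fun m => coskt k (u m)) by exists 1 => m; exact: coskt_le1.
have ce k : coskt k (u n) @[n --> \oo] --> coskt k t.
  rewrite /coskt; elim: (index_enum I) => [|i s IH].
    have -> : (fun n => \prod_(i <- [::]) cos ((k i)%:R * u n i)) = fun=> 1.
      by apply: funext => n; rewrite big_nil.
    by rewrite big_nil; exact: cvg_cst.
  have -> : (fun n => \prod_(j <- i :: s) cos ((k j)%:R * u n j)) =
      fun n => cos ((k i)%:R * u n i) * \prod_(j <- s) cos ((k j)%:R * u n j).
    by apply: funext => n; rewrite big_cons.
  rewrite big_cons; apply: cvgM IH; apply: (cvg_comp _ cos); last exact: continuous_cos.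
  by apply: cvgMr; exact: ut.
have bs : bseq (fun m => \sum_(k : {ffun I -> 'I_N}) ccoefn m (kord k) F * coskt (kord k) (u m)).
  by apply: bseq_sum => k; exact: bseqM.
have Fu : F (u n) @[n --> \oo] --> F t by exact: Ft.
have bF : bseq (fun m => F (u m)).
  have [M [_ MP]] := cvg_seq_bounded (cvgP _ Fu).
  by exists (M + 1) => n; apply: MP => //; rewrite ltrDl.
have -> : F t - \sum_(k : {ffun I -> 'I_N}) clim (kord k) F * coskt (kord k) t =
    ulim (fun m => F (u m) - \sum_(k : {ffun I -> 'I_N}) ccoefn m (kord k) F * coskt (kord k) (u m)).
  rewrite ulimB// (ulim_lim Fu) ulim_sum => [|k]; last exact: bseqM.
  by congr (_ - _); apply: eq_bigr => k _; rewrite ulimM// (ulim_lim (ce _)).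
apply: ulim_norm; first exact: bseqB.
exists N => // m /= Nm; rewrite {1}/u -(cosine_inversion _ cF).
have -> : \sum_(k : {ffun I -> 'I_m.+1}) ccoef m.*2.+1 (kord k) F *
      coskt (kord k) (gridpt [ffun i => j i m]) =
    \sum_(k : {ffun I -> 'I_m.+1}) ccoefn m (kord k) F * coskt (kord k) (u m).
  apply: eq_bigr => k _; rewrite /ccoefn ifT//.
  by apply/forallP => i; exact: ltn_ord.
rewrite (sum_box_split (fun k => ccoefn m k F * coskt k (u m)) (leqW Nm)).
rewrite addrAC subrr add0r; apply: le_trans (ler_norm_sum _ _ _) _.
apply: le_trans (ler_wpM2l C0 (sum_out_box m.+1 N)).
rewrite mulr_sumr; apply: ler_sum => k _; rewrite normrM.
by apply: le_trans (dF' m _); rewrite ler_piMr// coskt_le1.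
Qed.

End CosineExpansion.

Section SecondDifferences.
Context {R : realType} {E : normedModType R}.
Implicit Types (G : E -> R) (v e : E).

Lemma quotient_translate G c v e :
  (fun h : R => h^-1 *: (((fun y => G (y + c)) \o shift e) (h *: v) - G (e + c))) =
  (fun h : R => h^-1 *: ((G \o shift (e + c)) (h *: v) - G (e + c))).
Proof. by apply: funext => h; rewrite /= /shift /= addrA. Qed.

Lemma derive_translate G c v e : 'D_v (fun y => G (y + c)) e = 'D_v G (e + c).
Proof. by rewrite /derive quotient_translate. Qed.

Lemma iter_derive_translate G c vs e :
  iter_derive vs (fun y => G (y + c)) e = iter_derive vs G (e + c).
Proof.
elim: vs e => [//|v vs IH] e /=.
by rewrite -derive_translate; congr ('D_v _ e); apply: funext => y; exact: IH.
Qed.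

Lemma derivable_translate G c v e : derivable G (e + c) v ->
  derivable (fun y => G (y + c)) e v.
Proof.
by rewrite /derivable quotient_translate.
Qed.

Lemma smooth_translate G c : smooth_on setT G ->
  smooth_on setT (fun y => G (y + c)).
Proof.
move=> Gs vs e _; have -> : iter_derive vs (fun y => G (y + c)) =
    fun y => iter_derive vs G (y + c).
  by apply: funext => y; exact: iter_derive_translate.
have [Gc Gd] := Gs vs (e + c) I; split=> [|v]; last exact: derivable_translate.
apply: (@continuous_comp _ _ _ (fun y => y + c)); last exact: Gc.
by apply: cvgD; [exact: cvg_id|exact: cvg_cst].
Qed.

(** A second difference, written as nested expressions [a * f + g] so that [iter_derive_lin] can
    differentiate it. *)
Definition sdiff v (h : R) G := fun e =>
  -1 * G (e + (- h) *: v) + (-1 * G (e + h *: v) + (1 * G e + G e)).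

Lemma smooth_lin G G' a : smooth_on setT G -> smooth_on setT G' ->
  smooth_on setT (fun e => a * G e + G' e).
Proof.
move=> Gs Gs'; have ca := @smooth_on_cst R E R setT a.
exact: (smooth_onD openT (smooth_onM openT ca Gs) Gs').
Qed.

Lemma sdiff_smooth v h G : smooth_on setT G -> smooth_on setT (sdiff v h G).
Proof.
move=> Gs; have t c := smooth_translate c Gs.
exact: (smooth_lin (-1) (t _) (smooth_lin (-1) (t _) (smooth_lin 1 Gs Gs))).
Qed.

Lemma iter_derive_sdiff v h G vs e : smooth_on setT G ->
  iter_derive vs (sdiff v h G) e = sdiff v h (iter_derive vs G) e.
Proof.
move=> Gs; have t c := smooth_translate c Gs.
rewrite /sdiff (iter_derive_lin _ _ openT (t _)
  (smooth_lin (-1) (t _) (smooth_lin 1 Gs Gs)))//.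
rewrite (iter_derive_lin _ _ openT (t _) (smooth_lin 1 Gs Gs))//.
by rewrite (iter_derive_lin _ _ openT Gs Gs)// !iter_derive_translate.
Qed.

(** Both first differences become derivatives at points of the line through [e]; their distance is
    at most two steps, whence the 2, and the mean value theorem is applied once more. *)
Lemma sdiff_le v h G C : smooth_on setT G ->
  (forall e, `|'D_v ('D_v G) e| <= C) -> forall e, `|sdiff v h G e| <= C * (2 * h ^+ 2).
Proof.
move=> Gs GC e.
have d1 y : derivable G y v by have [_] := Gs [::] y I.
have d2 y : derivable ('D_v G) y v by have [_] := Gs [:: v] y I.
have [s /andP[s0 s1] es] := @MVT_scaled R E G e v h (fun _ _ => d1 _).
have [r /andP[r0 r1] er] := @MVT_scaled R E G e v (- h) (fun _ _ => d1 _).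
set p := e + r *: (- h *: v) in er.
have pE : e + s *: (h *: v) = p + ((s + r) * h) *: v.
  rewrite /p -addrA; congr (_ + _); rewrite !scalerA -scalerDl; congr (_ *: _).
  by ring.
have [z _ ez] := @MVT_scaled R E ('D_v G) p v ((s + r) * h) (fun _ _ => d2 _).
rewrite pE in es.
have -> : sdiff v h G e = - (h * ((s + r) * h * 'D_v ('D_v G) (p + z *: (((s + r) * h) *: v)))).
  by rewrite -ez /sdiff; move: es er; move: (G _) (G _) (G _) => a b c; lra.
rewrite normrN (_ : h * _ = h ^+ 2 * (s + r) * 'D_v ('D_v G) (p + z *: (((s + r) * h) *: v))); last by ring.
rewrite normrM [`|h ^+ 2 * _|]normrM (ger0_norm (sqr_ge0 h)) [X in _ <= X](_ : _ = h ^+ 2 * 2 * C); last by ring.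
have sr : 0 <= s + r by rewrite addr_ge0.
apply: ler_pM; [by rewrite mulr_ge0 ?sqr_ge0|exact: normr_ge0| |exact: GC].
by rewrite ler_wpM2l ?sqr_ge0// ger0_norm//; lra.
Qed.

(** Differences commute with derivatives, so [N] of them are traded one by one for pairs of
    derivatives. *)
Lemma iter_sdiff_le v h G C N : smooth_on setT G ->
  (forall e, `|iter_derive (nseq N.*2 v) G e| <= C) ->
  forall e, `|iter N (sdiff v h) G e| <= C * (2 * h ^+ 2) ^+ N.
Proof.
elim: N G C => [|N IH] G C Gs GC e; first by rewrite mulr1; exact: GC.
rewrite iterSr exprS mulrA; apply: IH; first exact: sdiff_smooth.
move=> y; rewrite iter_derive_sdiff//; apply: sdiff_le => [|z]; last exact: GC.
move=> vs z _; rewrite /iter_derive -foldr_cat; exact: (Gs (vs ++ _) z I).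
Qed.

End SecondDifferences.

Section TrigFamilies.
Context {R : realType} {J : Type} (A : set J) (w : J -> R).
Hypothesis w1 : forall j, A j -> 1 <= w j.
Context {E : normedModType R} (l : E -> R) (C : R).
Hypothesis llin : forall a u v, l (a *: u + v) = a * l u + l v.
Hypothesis lbnd : forall v, `|l v| <= C * `|v|.

Lemma quotient_linfun (f : R -> R) (a : R) (e v : E) :
  (fun h : R => h^-1 *: (((fun y => f (a * l y)) \o shift e) (h *: v) - f (a * l e))) =
  (fun h : R => h^-1 *: ((f \o shift (a * l e)) (h *: (a * l v)) - f (a * l e))).
Proof.
apply: funext => h; rewrite /= /shift /= llin mulrDr; congr (_ *: (f (_ + _) - _)).
by rewrite mulrCA.
Qed.

Lemma is_derive_trig (f : R -> R) (a : R) (e v : E) df :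
  is_derive (a * l e) 1 f df ->
  is_derive e v (fun y => f (a * l y)) (a * l v * df).
Proof.
move=> fd; have [d dE] := is_derive_dir (a * l v) fd.
have d' : derivable (fun y => f (a * l y)) e v by rewrite /derivable quotient_linfun.
have e' : 'D_v (fun y => f (a * l y)) e = a * l v * df by rewrite /derive quotient_linfun.
exact: (DeriveDef d' e').
Qed.

Lemma linfun_cont : continuous l.
Proof.
by move=> e; exact: (@smooth_on_linfun R E setT l C llin lbnd [::] e I).1.
Qed.

Variable k : J -> R.
Hypothesis kw : forall j, A j -> `|k j| <= w j.

(** Every derivative brings out a factor [k j], bounded by the weight. Cosine and sine are treated
    together because they exchange under differentiation. *)
Lemma mfam_trig n :
  mfam A w setT setT n (fun j e => cos (k j * l e)) /\
  mfam A w setT setT n (fun j e => sin (k j * l e)).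
Proof.
have oT : open [set: E] := openT.
have base (f df : R -> R) : (forall x : R, is_derive x 1 f (df x)) ->
    (forall x, `|f x| <= 1) ->
    mfam A w (@setT E) setT 0 (fun j e => f (k j * l e)).
  move=> fd f1; apply: mfam0; last first.
    by exists 1, 0%N; split => // j e _ _; rewrite mulr1.
  move=> j _ [|//] _ e _; split; last first.
    by move=> v; have [] := is_derive_trig v (fd (k j * l e)).
  apply: (@continuous_comp _ _ _ (fun e => k j * l e)).
    by apply: cvgMr; exact: linfun_cont.
  exact: is_derive_continuous (fd _).
have c1 (x : R) : `|cos x| <= 1 by rewrite ler_norml cos_geN1 cos_le1.
have s1 (x : R) : `|sin x| <= 1 by rewrite ler_norml sin_geN1 sin_le1.
have bc := base cos _ (@is_derive_cos R) c1.
have bs := base sin _ (@is_derive_sin R) s1.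
elim: n => [|n [IHc IHs]]; first by split; [exact: bc|exact: bs].
have lm v (s : R) : mfam A w (@setT E) setT n (fun j _ => s * (k j * l v)).
  apply: (@mfam_cst _ _ _ _ w1 _ _ _ _ _ (`|s| * `|l v|) 1) => j Aj.
  rewrite !normrM expr1 -mulrA ler_wpM2l// mulrC ler_wpM2l//; exact: kw.
split.
  apply: mfamS => [|v]; first exact: bc.
  apply: (eq_mfam oT (@subsetT _ _) _ (mfamM w1 oT (@subsetT _ _) (lm v (-1)) IHs)).
  move=> j e _ _; have [_ ->] := is_derive_trig v (is_derive_cos (k j * l e)).
  by rewrite /=; ring.
apply: mfamS => [|v]; first exact: bs.
apply: (eq_mfam oT (@subsetT _ _) _ (mfamM w1 oT (@subsetT _ _) (lm v 1) IHc)).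
move=> j e _ _; have [_ ->] := is_derive_trig v (is_derive_sin (k j * l e)).
by rewrite /=; ring.
Qed.

End TrigFamilies.

(** The side is normalised to 1, so the cosine of any angle is an admissible coordinate; the size of
    the cube is hidden in the basis. *)
Record cube (R : realType) (M : topologicalType) (S : smoothStructure R M) := Cube {
  kchart : chart M (model S) ;
  katlas : atlas S kchart ;
  kbas : basis (model S) ;
  kctr : model S ;
  ksub : box kbas kctr 1 `<=` cphi kchart @` cdom kchart }.

Lemma bcoo_comb (R : realType) (E : normedModType R) (B : basis E) (y : bidx B -> R) l :
  bcoo B l (\sum_i y i *: bvec i) = y l.
Proof.
have h (s : seq (bidx B)) : bcoo B l (\sum_(i <- s) y i *: bvec i) =
    \sum_(i <- s) y i * (l == i)%:R.
  elim: s => [|i s IH]; first by rewrite !big_nil bcoo0.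
  by rewrite !big_cons bcoo_lin bcoo_vec IH.
rewrite h (bigD1 l)//= eqxx mulr1 big1 ?addr0// => i /negPf il.
by rewrite eq_sym il mulr0.
Qed.

Lemma cid2P (R : numDomainType) (P : R -> Prop) :
  (exists2 C : R, 0 <= C & P C) -> exists C, 0 <= C /\ P C.
Proof. by move=> [C C0 PC]; exists C. Qed.

Section CubeDecay.
Context {R : realType} {M : topologicalType} (S : smoothStructure R M) (Q : cube S).
Let B := kbas Q.
Let I := bidx B.
Let a := kctr Q.
Implicit Types (k : I -> nat) (t y : I -> R) (e : model S).

Definition kpt y : M := cpsi (kchart Q) (a + \sum_i y i *: bvec i).

Definition ktor (f : M -> R[i]) t : R[i] := f (kpt (fun i => cos (t i))).

Lemma ktor_cos_dependent f b : cos_dependent (fun t => cpart b (ktor f t)).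
Proof. by move=> t t' tt; rewrite /ktor; congr (cpart b (f (kpt _))); apply: funext. Qed.

Lemma iter_nabla_sdiff (F : (I -> R) -> R) (G : model S -> R) i h N :
  (forall e, G e = F (bcoo B ^~ e)) ->
  forall e, iter N (nabla i h) F (bcoo B ^~ e) = iter N (sdiff (bvec i) h) G e.
Proof.
have sh g e : tshift i g (bcoo B ^~ e) = bcoo B ^~ (e + g *: bvec i).
  apply: funext => l; rewrite /tshift bcooD bcooZ bcoo_vec.
  by rewrite mulr_natr.
elim: N F G => [|N IH] F G GF e; first by rewrite /= GF.
rewrite !iterSr; apply: IH => {}e; rewrite /sdiff /nabla !sh -!GF; ring.
Qed.

(** The substitution by cosines sends the whole space of angles into the compact box, so the bounds
    of the family on that one compact set control all angles. *)
Lemma mfam_ktor (A : set (Cc S)) n b : cfam S A (fun=> 1) (fun f => f : M -> R[i]) ->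
  mfam A (fun=> 1) (@setT (model S)) setT n
    (fun f e => cpart b (ktor f (bcoo B ^~ e))).
Proof.
move=> fA; have w1 (f : Cc S) : A f -> 1 <= 1 :> R by [].
have oT : open (@setT (model S)) by exact: openT.
have cL : compact (cpsi (kchart Q) @` box B a 1).
  apply: continuous_compact; last exact: compact_box.
  apply: continuous_in_subspaceT => y /set_mem /ksub; exact: cpsi_continuous.
have Lc : cpsi (kchart Q) @` box B a 1 `<=` cdom (kchart Q).
  by move=> _ [y /ksub[x cx <-] <-]; rewrite cphiK.
have bE : cphi (kchart Q) @` (cpsi (kchart Q) @` box B a 1) = box B a 1.
  apply/seteqP; split=> [_ [_ [y yb <-] <-]|y yb].
    by have [x cx xy] := ksub yb; rewrite -xy cphiK// xy.
  by have [x cx xy] := ksub yb; exists x => //; exists y => //; rewrite -xy cphiK.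
pose g e := a + \sum_i cos (bcoo B i e) *: @bvec _ _ B i.
have gb e : box B a 1 (g e).
  by move=> i; rewrite /g addrC addKr bcoo_comb ler_norml cos_geN1 cos_le1.
have := fA _ (katlas Q) _ cL Lc b; rewrite bE => hf.
apply: (mfam_comp w1 (B := B) (g := g) n oT (@subsetT _ _) (cimg_open (kchart Q))
  (@ksub _ _ _ Q) hf) => [i m| e _ | e _]; last 2 first.
- exact/ksub/gb.
- exact: gb.
have [C C0 bC] := bcoo_bnd B.
have h1 : mfam A (fun=> 1) (@setT (model S)) setT m (fun _ e => cos (1 * bcoo B i e)).
  have kw (f : Cc S) : A f -> `|1 : R| <= 1 by rewrite normr1.
  have := mfam_trig w1 (bcoo_lin i) (bC i) kw m.
  by case.
have h2 : mfam A (fun=> 1) (@setT (model S)) setT m (fun _ _ => bcoo B i a).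
  apply: (@mfam_cst _ _ _ _ w1 _ _ _ _ _ `|bcoo B i a| 0) => f _.
  by rewrite mulr1.
apply: (eq_mfam oT (@subsetT _ _) _ (mfamD w1 oT (@subsetT _ _) h2 h1)).
by move=> f e _ _ /=; rewrite /g bcooD bcoo_comb mul1r.
Qed.

Lemma ktor_iter_nabla (A : set (Cc S)) N b i :
  cfam S A (fun=> 1) (fun f => f : M -> R[i]) ->
  exists2 C, 0 <= C & forall f, A f -> forall h t,
    `|iter N (nabla i h) (fun t => cpart b (ktor f t)) t| <= C * (2 * h ^+ 2) ^+ N.
Proof.
move=> fA; have [_ hb] := mfam_ktor N.*2 b fA.
have [|C [m [C0 fC]]] := hb (nseq N.*2 (bvec i)); first by rewrite size_nseq.
exists C => // f Af h t.
pose e := \sum_i t i *: @bvec _ _ B i.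
have -> : t = bcoo B ^~ e by apply: funext => l; rewrite bcoo_comb.
rewrite (iter_nabla_sdiff (G := fun e => cpart b (ktor f (bcoo B ^~ e))))//.
apply: iter_sdiff_le => [|{}e].
  by apply/smooth_onE => n; exact: (mfam_ktor n b fA).1.
by have := fC f e Af Logic.I; rewrite expr1n mulr1.
Qed.

(** The normalisation of a coefficient cancels the number of grid points, so the bound no longer
    depends on the grid. *)
Lemma ccoef_le n k (F : (I -> R) -> R) X D : 0 <= X ->
  `|cossum n.+1 k F| * X <= n.+1%:R ^+ #|I| * D ->
  `|ccoef n.+1 k F| * X <= 2 ^+ #|I| * D.
Proof.
move=> X0 h; rewrite /ccoef normrM -mulrA.
have n0 : 0 < n.+1%:R :> R by rewrite ltr0n.
have pe : `|\prod_l (cmul (k l) / n.+1%:R)| <= 2 ^+ #|I| / n.+1%:R ^+ #|I| :> R.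
  rewrite -expr_div_n normr_prod -prodr_const; apply: ler_prod => l _.
  rewrite normr_ge0 normrM normfV (ger0_norm (ltW n0)) ler_wpM2r ?invr_ge0 ?(ltW n0)//.
  by rewrite /cmul ger0_norm ?addr_ge0//; case: (k l == 0%N) => /=; rewrite ?addr0; lra.
apply: le_trans (ler_pM _ _ pe h) _ => //; first by rewrite mulr_ge0.
by rewrite -mulrA mulKf// expf_neq0// gt_eqF.
Qed.

Lemma ccoef_decay1 (A : set (Cc S)) N b i :
  cfam S A (fun=> 1) (fun f => f : M -> R[i]) ->
  exists2 C, 0 <= C & forall f, A f -> forall m k,
    `|ccoefn m k (fun t => cpart b (ktor f t))| * (k i)%:R ^+ N.*2 <= C.
Proof.
move=> fA; have [C C0 hC] := ktor_iter_nabla N b i fA.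
have D0 : 0 <= 2 ^+ #|I| * (C * 16%:R ^+ N) by rewrite !mulr_ge0// exprn_ge0.
exists (2 ^+ #|I| * (C * 16%:R ^+ N)) => // f Af m k; rewrite /ccoefn.
case: ifPn => [/forallP km|_]; last by rewrite normr0 mul0r.
apply: ccoef_le; first by rewrite exprn_ge0.
have ki : (k i <= m)%N by rewrite -ltnS.
have pF := cos_dependent_periodic (@ktor_cos_dependent f b).
exact: (cossum_decay pF ki (hC f Af)).
Qed.

Lemma ccoef_bound (A : set (Cc S)) b : cfam S A (fun=> 1) (fun f => f : M -> R[i]) ->
  exists2 C, 0 <= C & forall f, A f -> forall m k,
    `|ccoefn m k (fun t => cpart b (ktor f t))| <= C.
Proof.
move=> fA; have [C [m0 [C0 fC]]] := mfam_bnd (mfam_ktor 0 b fA).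
have D0 : 0 <= 2 ^+ #|I| * C by rewrite mulr_ge0// exprn_ge0.
exists (2 ^+ #|I| * C) => // f Af m k; rewrite /ccoefn.
case: ifPn => [_|_]; last by rewrite normr0.
rewrite -[leLHS]mulr1; apply: ccoef_le => //; rewrite mulr1; apply: cossum_le => t.
have := fC f (\sum_i t i *: @bvec _ _ B i) Af Logic.I; rewrite expr1n mulr1.
by congr (`|cpart b (ktor f _)| <= _); apply: funext => l; rewrite bcoo_comb.
Qed.

(** At an index of maximal frequency every factor of the weight is at most twice that frequency.
    Decay in one direction therefore yields decay in the weight. *)
Lemma wt_max k : (exists i, k i != 0%N) -> exists i,
  (0 < k i)%N /\ (wt k : R) <= (2 * (k i)%:R) ^+ #|I|.
Proof.
move=> [i0 ki0]; case: (@arg_maxnP _ i0 xpredT k isT) => i _ ki; exists i.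
have i1 : (0 < k i)%N by apply: leq_trans (ki i0 isT); rewrite lt0n.
split => //; rewrite /wt -prodr_const; apply: ler_prod => l _; rewrite ler0n /=.
by rewrite -natrM ler_nat; have := ki l isT; lia.
Qed.

Lemma ccoef_decay (A : set (Cc S)) p :
  cfam S A (fun=> 1) (fun f => f : M -> R[i]) ->
  exists2 C, 0 <= C & forall f, A f -> forall b m k,
    `|ccoefn m k (fun t => cpart b (ktor f t))| * wt k ^+ p <= C.
Proof.
(* By [wt_max] the [p]-th power of the weight costs [d * p] powers of the largest frequency. The
   directions and the two parts are finitely many, so their constants are summed. *)
move=> fA; set d := #|I|; pose N := (d * p)%N.
have [D dD] := choice (fun b => cid2P (ccoef_bound b fA)).
have [D' dD'] := choice (fun bi : bool * I => cid2P (ccoef_decay1 N bi.1 bi.2 fA)).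
have Db0 b : 0 <= D b by have [] := dD b.
have D'0 bi : 0 <= 2 ^+ N * D' bi by rewrite mulr_ge0 ?exprn_ge0//; have [] := dD' bi.
exists (\sum_b D b + \sum_bi 2 ^+ N * D' bi).
  by apply: addr_ge0; apply: sumr_ge0 => i _; [exact: Db0|exact: D'0].
move=> f Af b m k.
have sD : D b <= \sum_b D b.
  by rewrite (bigD1 b)//= lerDl sumr_ge0// => c _; have [] := dD c.
have sD' i : 2 ^+ N * D' (b, i) <= \sum_bi 2 ^+ N * D' bi.
  by rewrite (bigD1 (b, i))//= lerDl sumr_ge0.
have [k0|] := pselect (forall i, k i = 0%N).
  have -> : wt k = 1 :> R by rewrite /wt big1// => i _; rewrite k0.
  rewrite expr1n mulr1; apply: le_trans (ler_wpDr _ sD); last by rewrite sumr_ge0.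
  by have [_] := dD b; apply.
move=> /existsNP[i0 /eqP ki0]; have [i [ki wk]] := wt_max (ex_intro _ i0 ki0).
apply: le_trans (ler_wpDl _ (sD' i)); last by rewrite sumr_ge0// => c _; have [] := dD c.
have k1 : 1 <= (k i)%:R :> R by rewrite ler1n.
have w2 : wt k ^+ p <= 2 ^+ N * (k i)%:R ^+ N.*2 :> R.
  apply: (@le_trans _ _ ((2 * (k i)%:R) ^+ N)).
    by rewrite /N exprM lerXn2r ?nnegrE ?exprn_ge0 ?mulr_ge0// ltW// wt_gt0.
  by rewrite exprMn ler_wpM2l ?exprn_ge0// ler_weXn2l// -addnn leq_addr.
apply: le_trans (ler_wpM2l (normr_ge0 _) w2) _.
rewrite mulrCA ler_wpM2l ?exprn_ge0//.
by have [_] := dD' (b, i); apply.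
Qed.

End CubeDecay.

(** * Expansions of test functions on cubes *)

Section ElementaryFunctions.
Context {R : realType}.

Lemma expR_smooth : smooth_on setT (@expR R).
Proof.
apply/smooth_onE; elim=> [|n IH].
  by apply: smooth_upto0_derive => x _; exact: is_derive_expR.
apply: (smooth_uptoS_derive (df := expR)) => //; exact: openT.
Qed.

Lemma ln_smooth : smooth_on [set x : R | 0 < x] (@ln R).
Proof.
have oU : open [set x : R | 0 < x] by exact: open_gt.
have is_d (x : R) : 0 < x -> is_derive x 1 (@ln R) x^-1 by exact: is_derive1_ln.
apply/smooth_onE => -[|n]; first exact: (smooth_upto0_derive is_d).
apply: (smooth_uptoS_derive oU is_d).
have n0 (x : R) : [set x : R | 0 < x] x -> x != 0 by move=> /= x0; rewrite gt_eqF.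
have ids := @smooth_on_id R [set x : R | 0 < x].
by have /smooth_onE := smooth_on_inv oU n0 ids; apply.
Qed.

(** The derivative contains an inverse square root; written with [expR] and [ln] it is visibly
    smooth on the open interval. *)
Lemma acos_smooth : smooth_on [set x : R | -1 < x < 1] (@acos R).
Proof.
have UE : [set x : R | -1 < x < 1] = [set x : R | -1 < x] `&` [set x : R | x < 1].
  by apply/seteqP; split=> x /= => [/andP[]|[-> ->]].
have oU : open [set x : R | -1 < x < 1].
  by rewrite UE; apply: openI; [exact: open_gt|exact: open_lt].
have oP : open [set x : R | 0 < x] by exact: open_gt.
have pos (x : R) : [set x : R | -1 < x < 1] x -> 0 < 1 + -1 * (x * x).
  by move=> /= /andP[x1 x2]; nra.
have ids := @smooth_on_id R [set x : R | -1 < x < 1].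
have qs := smooth_on_affine 1 (-1) oU (smooth_onM oU ids ids).
have ls := smooth_on_comp (basisR R) oU oP ln_smooth qs pos.
have es := smooth_on_comp1 oU expR_smooth (smooth_on_affine 0 (- 2^-1) oU ls).
have ds := smooth_on_affine 0 (-1) oU es.
have is_d (x : R) : [set x : R | -1 < x < 1] x ->
    is_derive x 1 (@acos R) (0 + -1 * (expR (0 + - 2^-1 * ln (1 + -1 * (x * x))))).
  move=> Ux; have p0 := pos x Ux.
  have -> : 0 + -1 * (expR (0 + - 2^-1 * ln (1 + -1 * (x * x)))) =
      - (Num.sqrt (1 - x ^+ 2))^-1.
    rewrite !add0r mulN1r (mulNr 2^-1) expRN; congr (- (_)^-1).
    have -> : 1 - x ^+ 2 = 1 + -1 * (x * x) by ring.
    rewrite -[RHS]ger0_norm ?sqrtr_ge0//.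
    apply/eqP; rewrite -(@eqrXn2 _ 2%N) ?expR_ge0 ?normr_ge0// ger0_norm ?sqrtr_ge0//.
    rewrite sqr_sqrtr ?(ltW p0)// expr2 -expRD.
    by rewrite (_ : _ + _ = ln (1 + -1 * (x * x))) ?lnK//; lra.
  exact: is_derive1_acos.
apply/smooth_onE => -[|n]; first exact: (smooth_upto0_derive is_d).
by apply: (smooth_uptoS_derive oU is_d); have /smooth_onE := ds; apply.
Qed.

End ElementaryFunctions.

Section RapidSeries.
Context {R : realType} {I : finType}.
Implicit Types k : I -> nat.
Local Notation normc := ComplexField.Normc.normc.

Definition rapid (al : (I -> nat) -> R) :=
  (forall k, 0 <= al k) /\ forall p, exists C, forall k, al k * wt k ^+ p <= C.

(** Polynomial growth expressed bornologically: multiplied by any rapidly decreasing sequence the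
    family becomes small. No seminorms on [X] are involved. *)
Definition fast_family (X : bornType R) (e : (I -> nat) -> X) :=
  forall al, rapid al -> small (range (fun k => (al k)%:C *: e k)).

Definition rapid_coefs (V : bornType R) (A : (I -> nat) -> V -> R[i]) :=
  (forall k a u v, A k (a *: u + v) = a * A k u + A k v) /\
  forall B, small B -> forall p, exists C, forall f k, B f ->
    normc (A k f) * wt k ^+ p <= C.

Definition series (V X : bornType R) (A : (I -> nat) -> V -> R[i])
    (e : (I -> nat) -> X) N f :=
  \sum_(k : {ffun I -> 'I_N}) A (kord k) f *: e (kord k).

Lemma rapidX al q : rapid al -> rapid (fun k => al k * wt k ^+ q).
Proof.
move=> [a0 ar]; split=> [k|p]; first by rewrite mulr_ge0// exprn_ge0// ltW// wt_gt0.
have [C aC] := ar (q + p)%N; exists C => k; rewrite -mulrA -exprD; exact: aC.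
Qed.

Lemma rapidZ al c : 0 <= c -> rapid al -> rapid (fun k => c * al k).
Proof.
move=> c0 [a0 ar]; split=> [k|p]; first by rewrite mulr_ge0.
by have [C aC] := ar p; exists (c * C) => k; rewrite -mulrA ler_wpM2l.
Qed.

Lemma rapid_dom (J : Type) (P : set J) (g : J -> (I -> nat) -> R) :
  (forall j k, 0 <= g j k) ->
  (forall p, exists C, forall j k, P j -> g j k * wt k ^+ p <= C) ->
  exists2 al, rapid al & forall j k, P j -> g j k <= al k.
Proof.
move=> g0 gr.
have [[f0 Bf0]|B0] := pselect (P !=set0); last first.
  exists (fun=> 0); first by split=> // p; exists 0 => k; rewrite mul0r.
  by move=> f k Bf; case: B0; exists f.
pose al k := sup [set g f k | f in P].
have ub k : has_ubound [set g f k | f in P].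
  have [C hC] := gr 0%N; exists C => _ [f Bf <-].
  by have := hC f k Bf; rewrite mulr1.
have gal f k : P f -> g f k <= al k.
  by move=> Bf; apply: ub_le_sup => //; exists f.
exists al => //; split=> [k|p]; first exact: le_trans (g0 f0 k) (gal f0 k Bf0).
have [C hC] := gr p; exists C => k; have w0 : 0 < wt k ^+ p :> R by rewrite exprn_gt0 ?wt_gt0.
rewrite -ler_pdivlMr//; apply: ge_sup; first by exists (g f0 k); exists f0.
by move=> _ [f Bf <-]; rewrite ler_pdivlMr//; exact: hC.
Qed.

Lemma rapid_sup (V : bornType R) A (B : set V) : rapid_coefs A -> small B ->
  exists2 al, rapid al & forall f k, B f -> normc (A k f) <= al k.
Proof.
move=> [_ Ar] sB; apply: (rapid_dom (g := fun f k => normc (A k f))) => [f k|p]; first exact: normc_ge0.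
by have [C hC] := Ar B sB p; exists C => f k; exact: hC.
Qed.

(** The envelope of the coefficients over [B] is still rapid after multiplication by the cube of the
    weight and the constant of [sum_out_box]; the correspondingly scaled vectors span the disk. With
    these factors tails are bounded exactly by [rate N]. *)
Lemma rapid_terms (V X : bornType R) A (e : (I -> nat) -> X) (B : set V) :
  rapid_coefs A -> fast_family e -> small B ->
  exists T, [/\ is_disk T, small T & forall f k, B f ->
    scaled_in T ((2 ^+ #|I|)^-1 * (wt k ^+ 3)^-1) (A k f *: e k)].
Proof.
move=> Ac ef sB; have [al ral le] := rapid_sup Ac sB.
have c0 : 0 < 2 ^+ #|I| :> R by rewrite exprn_gt0.
have rbe := rapidZ (ltW c0) (rapidX 3 ral); set be := (fun k => _) in rbe.
exists (disked_hull (range (fun k => (be k)%:C *: e k))); split.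
- exact: is_disk_hull.
- by apply: small_hull; exact: ef.
move=> f k Bf; have w0 : 0 < wt k ^+ 3 :> R by rewrite exprn_gt0 ?wt_gt0.
(* A vanishing envelope forces the coefficient to vanish; otherwise one divides by it. *)
have [be0|be0] := eqVneq (be k) 0.
  have al0 : al k = 0.
    move/eqP: be0; rewrite /be mulf_eq0 gt_eqF//= mulf_eq0 (gt_eqF w0) orbF.
    exact: eqP.
  have -> : A k f = 0.
    apply: ComplexField.Normc.eq0_normc; apply/eqP.
    by rewrite eq_le normc_ge0 andbT -al0 le.
  by rewrite scale0r; apply: scaled_in0; exact: is_disk_hull.
have bp : 0 < be k by rewrite lt_neqAle eq_sym be0 rbe.1.
have -> : A k f *: e k = (A k f / (be k)%:C) *: ((be k)%:C *: e k).
  by rewrite scalerA divfK// realC_neq0.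
rewrite -[_ * _]mulr1; apply: scaled_inZ; [exact: is_disk_hull|exact: ler01| |].
  rewrite normrM normfV norm_realC ?(ltW bp)// normcE' -fmorphV -rmorphM lecR.
  rewrite ler_pdivrMr// /be -[_ * (_ * _)]mulrA; rewrite [leRHS](_ : _ = al k); first exact: le.
  by field; rewrite !gt_eqF ?wt_gt0.
by apply: scaled_in1; apply: sub_disked_hull; exists k.
Qed.

Lemma series_linear (V X : bornType R) A (e : (I -> nat) -> X) N :
  rapid_coefs A -> linear (@series V X A e N).
Proof.
move=> [Al _] a u v; rewrite /series scaler_sumr -big_split /=.
by apply: eq_bigr => k _; rewrite Al scalerDl scalerA.
Qed.

Lemma series_bounded (V X : bornType R) A (e : (I -> nat) -> X) N :
  rapid_coefs A -> fast_family e -> bounded_linear (@series V X A e N).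
Proof.
move=> Ac ef; split; first exact: series_linear.
move=> B sB; have [T [dT sT TB]] := rapid_terms Ac ef sB.
pose r : R := \sum_(k : {ffun I -> 'I_N}) ((2 ^+ #|I|)^-1 * (wt (kord k) ^+ 3)^-1).
apply: smallW (smallZ r%:C sT) _ => _ [f Bf <-].
have [t Tt e1] : scaled_in T r (series A e N f).
  apply: scaled_in_sum => // k _; last exact: TB.
  by rewrite mulr_ge0 ?invr_ge0 ?exprn_ge0// ltW// wt_gt0.
by exists t.
Qed.

Lemma series_cvg (V X : bornType R) A (e : (I -> nat) -> X) :
  complete_born X -> rapid_coefs A -> fast_family e ->
  exists2 L : V -> X, bounded_linear L & ufast_cvg (series A e) L.
Proof.
move=> cX Ac ef; apply: bhom_fast_lim => // [N|B sB]; first exact: series_bounded.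
have [T [dT sT TB]] := rapid_terms Ac ef sB; exists T; split => // f N M Bf NM.
rewrite /series (sum_box_split (fun k => A k f *: e k) NM) addrAC subrr add0r.
have w0 k : 0 <= (wt k ^+ 3)^-1 :> R by rewrite invr_ge0 exprn_ge0// ltW// wt_gt0.
have c0 : 0 < 2 ^+ #|I| :> R by rewrite exprn_gt0.
have h := @scaled_in_sum _ _ T _ (index_enum {ffun I -> 'I_M})
  (fun k : {ffun I -> 'I_M} => ~~ in_box N (kord k)) (fun k : {ffun I -> 'I_M} => (2 ^+ #|I|)^-1 * (wt (kord k) ^+ 3)^-1)
  (fun k : {ffun I -> 'I_M} => A (kord k) f *: e (kord k)) dT.
have {}h := h _ _; apply: (scaled_in_le dT _ _ (h _ _)).
- by apply: sumr_ge0 => k _; rewrite mulr_ge0// invr_ge0 ltW.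
- by rewrite -mulr_sumr mulrC ler_pdivrMr// mulrC; exact: sum_out_box.
- by move=> k _; rewrite mulr_ge0// invr_ge0 ltW.
- by move=> k _; exact: TB.
Qed.

End RapidSeries.

Lemma normcRM (R : realType) (r : R) (z : R[i]) : 0 <= r ->
  ComplexField.Normc.normc (r%:C * z) = r * ComplexField.Normc.normc z.
Proof. by move=> r0; apply: (@complexI R); rewrite -normcE' normrM norm_realC// rmorphM. Qed.

Lemma normc_leD (R : realType) (z t : R[i]) : ComplexField.Normc.normc (z + t) <=
  ComplexField.Normc.normc z + ComplexField.Normc.normc t.
Proof. by rewrite -lecR rmorphD -!normcE' ler_normD. Qed.

Lemma normc_opp (R : realType) (z : R[i]) :
  ComplexField.Normc.normc (- z) = ComplexField.Normc.normc z.
Proof. by apply: (@complexI R); rewrite -!normcE' normrN. Qed.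

Section PointEvaluation.
Context {R : realType} {M : topologicalType} (S : smoothStructure R M).
Local Notation normc := ComplexField.Normc.normc.

Lemma small_point (A : set (Cc S)) x : small A ->
  exists2 C, 0 <= C & forall f, A f -> normc (f x) <= C.
Proof.
move=> /Cc_smallP[_ fA]; have [c Ac cx] := atlas_cover S x.
have w1 (f : Cc S) : A f -> 1 <= 1 :> R by [].
have cL := @compact_set1 M x.
have Lc : [set x] `<=` cdom c by move=> _ ->.
have [C [m [C0 fC]]] := cfam_jet [::] w1 fA Ac cL Lc.
exists C => // f Af; have := fC f x Af (erefl x).
by rewrite csem_point cphiK// expr1n mulr1.
Qed.

Lemma fast_cvg_point (u : nat -> Cc S) l x : fast_cvg u l ->
  exists C, forall n, normc (u n x - l x) <= C * rate n.
Proof.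
move=> [A [dA sA Au]]; have [C C0 AC] := small_point x sA.
exists C => n; have [t At e] := Au n.
have -> : u n x - l x = (rate n)%:C * t x by rewrite -CcBE e CcZE.
by rewrite normcRM ?rate_ge0// mulrC ler_wpM2r ?rate_ge0// AC.
Qed.

Lemma normc_rate_eq0 (z : R[i]) C : (forall n, normc z <= C * rate n) -> z = 0.
Proof.
move=> zC; apply: ComplexField.Normc.eq0_normc; apply/eqP.
rewrite eq_le normc_ge0 andbT; apply/ler_addgt0Pl => e e0; rewrite addr0.
have C1 : 0 < `|C| + 1 by rewrite ltr_wpDl.
have [N /(_ N (leqnn N)) rN] := rate_lt (divr_gt0 e0 C1).
apply: le_trans (zC N) _; apply: (@le_trans _ _ ((`|C| + 1) * rate N)).
  by rewrite ler_wpM2r ?rate_ge0// (le_trans (ler_norm _))// lerDl.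
by rewrite mulrC -ler_pdivlMr// ltW.
Qed.

Lemma fast_cvg_pointwise (u : nat -> Cc S) l (g : M -> R[i]) : fast_cvg u l ->
  (forall x, exists C, forall n, normc (u n x - g x) <= C * rate n) ->
  forall x, l x = g x.
Proof.
move=> ul ug x; have [C uC] := fast_cvg_point x ul; have [D uD] := ug x.
apply/eqP; rewrite -subr_eq0; apply/eqP; apply: (@normc_rate_eq0 _ (C + D)) => n.
have -> : l x - g x = - (u n x - l x) + (u n x - g x) by ring.
apply: le_trans (normc_leD _ _) _.
by rewrite mulrDl lerD// normc_opp.
Qed.

End PointEvaluation.

Section CubeSeries.
Context {R : realType} {M : topologicalType} (S : smoothStructure R M) (Q : cube S).
Let B := kbas Q.
Let K := bidx B.
Let a := kctr Q.
Let c := kchart Q.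
Implicit Types (k : K -> nat) (f : Cc S).
Local Notation normc := ComplexField.Normc.normc.

Definition kopen : set M :=
  [set x | cdom c x /\ forall i, `|bcoo B i (cphi c x - a)| < 1].

Definition kang x : K -> R := fun i => acos (bcoo B i (cphi c x - a)).

Lemma open_kopen : open kopen.
Proof.
rewrite openE => x [cx xi].
have h1 : \forall y \near x, cdom c y by exact: open_nbhs_nbhs (conj (cdom_open c) cx).
have h2 : \forall y \near x, forall i, `|bcoo B i (cphi c y - a)| < 1.
  apply: filter_forall => i.
  have cf : {for x, continuous (fun y => `|bcoo B i (cphi c y - a)|)}.
    apply: (@continuous_comp _ _ _ (fun y => bcoo B i (cphi c y - a))); last exact: norm_continuous.
    apply: (@continuous_comp _ _ _ (fun y => cphi c y - a)); last exact: bcoo_continuous.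
    by apply: cvgB; [exact: cphi_continuous cx|exact: cvg_cst].
  exact: (cvgr_lt _ cf _ (xi i)).
exact: (filterS2 _ _ h1 h2).
Qed.

Lemma kang_range x i : kopen x -> 0 <= kang x i <= pi.
Proof.
move=> [_ xi]; have := xi i; rewrite ltr_norml => /andP[/ltW x0 /ltW x1].
by rewrite acos_ge0 ?acos_lepi ?x0.
Qed.

Lemma kpt_kang x : kopen x -> kpt (Q := Q) (fun i => cos (kang x i)) = x.
Proof.
move=> [cx xi]; rewrite /kpt -[RHS](cphiK cx); congr cpsi.
rewrite -[RHS](subrK a) addrC; congr (_ + _).
rewrite [RHS](bcoo_sum B); apply: eq_bigr => i _; congr (_ *: _).
by apply: acosK; rewrite in_itv /= -ler_norml ltW.
Qed.

Lemma ktor_kang (f : M -> R[i]) x : kopen x -> ktor (Q := Q) f (kang x) = f x.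
Proof. by move=> Kx; rewrite /ktor kpt_kang. Qed.

Lemma kcoef_bseq f b k : bseq (fun m => ccoefn m k (fun t => cpart b (ktor (Q := Q) f t))).
Proof.
have [_ fA] := (Cc_smallP [set f]).1 (small_set1 f).
have [C C0 fC] := ccoef_bound Q b fA.
by exists C => m; exact: fC.
Qed.

Definition kcoef k (f : Cc S) : R[i] :=
  clim k (fun t => cpart true (ktor (Q := Q) f t)) +i*
  clim k (fun t => cpart false (ktor (Q := Q) f t)).

Lemma cpart_kcoef b k f : cpart b (kcoef k f) = clim k (fun t => cpart b (ktor (Q := Q) f t)).
Proof. by case: b. Qed.

Lemma ccoefn_lin m k x y (F G H : (K -> R) -> R) :
  (forall t, H t = x * F t + y * G t) ->
  ccoefn m k H = x * ccoefn m k F + y * ccoefn m k G.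
Proof.
move=> HE; rewrite /ccoefn; case: ifP => _; last by rewrite !mulr0 addr0.
rewrite /ccoef (mulrCA x) (mulrCA y) -mulrDr; congr (_ * _).
rewrite /cossum !mulr_sumr -big_split; apply: eq_bigr => j _ /=.
by rewrite HE mulrDl !mulrA.
Qed.

Lemma kcoef_lin k z f g : kcoef k (z *: f + g) = z * kcoef k f + kcoef k g.
Proof.
apply: cpart_eq => b; rewrite cpartD cpart_kcoef.
have bs := kcoef_bseq.
pose F h d := fun t => cpart d (ktor (Q := Q) h t).
(* The sign with which the other part of [f] enters the part [b] of a complex multiple. *)
pose s : R := if b then - complex.Im z else complex.Im z.
have e m : ccoefn m k (F (z *: f + g) b) =
    (complex.Re z * ccoefn m k (F f b) + s * ccoefn m k (F f (~~ b))) + ccoefn m k (F g b).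
  pose G t := complex.Re z * F f b t + s * F f (~~ b) t.
  rewrite -(@ccoefn_lin m k _ _ (F f b) (F f (~~ b)) G)//.
  rewrite -[LHS]mul1r -[X in _ = X + _]mul1r -[X in _ = _ + X]mul1r.
  rewrite -(@ccoefn_lin m k 1 1 G (F g b) (F (z *: f + g) b)) ?mul1r// => t.
  rewrite !mul1r /F /G /ktor CcE cpartD; congr (_ + _); rewrite /F /s /ktor.
  by case: (f _) => u v; case: z {s G} => x y; case: b => /=; ring.
rewrite /clim (_ : (fun m => _) = fun m => (complex.Re z * ccoefn m k (F f b) +
  s * ccoefn m k (F f (~~ b))) + ccoefn m k (F g b)); last by apply: funext.
have c1 := bseq_cst (complex.Re z); have c2 := bseq_cst s.
rewrite ulimD; [|by apply: bseqD; apply: bseqM => //; exact: bs|exact: bs].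
rewrite ulimD; [|by apply: bseqM => //; exact: bs|by apply: bseqM => //; exact: bs].
rewrite !ulimZ; [|exact: bs|exact: bs].
rewrite [in RHS]cpart_kcoef; congr (_ + _).
have -> : ulim (fun n => ccoefn n k (F f b)) = cpart b (kcoef k f) by rewrite cpart_kcoef.
have -> : ulim (fun n => ccoefn n k (F f (~~ b))) = cpart (~~ b) (kcoef k f).
  by rewrite cpart_kcoef.
rewrite /s; case: (kcoef k f) => u v; case: z {s e c1 c2} => x y.
by case: b => /=; ring.
Qed.

Lemma kcoef_rapid : rapid_coefs kcoef.
Proof.
split=> [k z f g|A sA p]; first exact: kcoef_lin.
have [_ fA] := (Cc_smallP A).1 sA.
have [C C0 fC] := ccoef_decay Q p fA.
exists (C + C) => f k Af; have w0 : 0 < wt k ^+ p :> R by rewrite exprn_gt0 ?wt_gt0.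
have h b : `|cpart b (kcoef k f)| * wt k ^+ p <= C.
  rewrite -ler_pdivlMr// cpart_kcoef; apply: ulim_normC => m.
  by rewrite ler_pdivlMr//; exact: fC.
apply: le_trans (ler_wpM2r (ltW w0) (normc_le_parts _)) _.
by rewrite mulrDl lerD.
Qed.

Variables (psi : Cc S) (psiK : supp psi `<=` kopen).

(** The cosine of a multiple of acos is a Chebyshev polynomial of the coordinate. *)
Definition kfun k x : R[i] := psi x * (coskt k (kang x))%:C.

(** Inside the open cube this is [mfam_trig] composed with the smooth angle functions; elsewhere the
    cutoff vanishes on a neighbourhood, which hides the failure of smoothness of acos at the
    faces. *)
Lemma cfam_kfun : cfam S setT (fun k => wt k : R) kfun.
Proof.
have w1 k : [set: K -> nat] k -> 1 <= wt k :> R by move=> _; exact: wt_ge1.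
apply: cfam_local => // x; have [Kx|nKx] := pselect (kopen x); last first.
  have [d Ad dx] := atlas_cover S x.
  have oV : open (~` supp psi) by apply: closed_openC; exact: closed_closure.
  have Vx : (~` supp psi) x by move=> /psiK.
  have [L [cL nL LV Ld]] := chart_nbhs dx oV Vx.
  exists d, (cdom d `&` ~` supp psi), L; split => //.
  - by split; [apply: openI => //; exact: cdom_open|move=> y []].
  - by move=> y Ly; split; [exact: Ld|exact: LV].
  move=> b n; have oU := chart_open d oV.
  have QU : cphi d @` L `<=` cphi d @` (cdom d `&` ~` supp psi).
    by apply: image_subset => y Ly; split; [exact: Ld|exact: LV].
  apply: (eq_mfam oU QU (f := fun _ _ => 0)); last first.
    by apply: (@mfam_cst _ _ _ _ w1 _ _ _ _ _ 0 0) => k _; rewrite normr0 mul0r.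
  move=> k _ _ [y [dy ny] <-]; rewrite /kfun cphiK//.
  by rewrite (supp_out ny) mul0r cpart0.
have [L [cL nL LV Lc]] := chart_nbhs Kx.1 open_kopen Kx.
have Kc : kopen `<=` cdom c by move=> y [].
exists c, kopen, L; split => //; first exact: katlas.
  by split => //; exact: open_kopen.
move=> b n; have oU : open (cphi c @` kopen) by rewrite cphi_sub//; exact: chart_open open_kopen.
have QU : cphi c @` L `<=` cphi c @` kopen by exact: image_subset.
have cQ : compact (cphi c @` L).
  apply: continuous_compact => //; apply: continuous_in_subspaceT => y.
  by move=> /set_mem/Lc; exact: cphi_continuous.
have hp : mfam setT (fun k => wt k : R) (cphi c @` kopen) (cphi c @` L) n
    (fun _ y => cpart b (psi (cpsi c y))).
  apply: mfam_fixed => //; have [f1 f2] := (CcP psi).1 c (katlas Q).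
  apply: (@smooth_onW _ _ _ (cphi c @` cdom c)); first exact: image_subset.
  by case: b; [exact: f1|exact: f2].
have sg i : smooth_on (cphi c @` kopen) (fun y => acos (bcoo B i (y - a))).
  have oW : open [set x : R | -1 < x < 1].
    rewrite (_ : [set x : R | _] = [set x : R | -1 < x] `&` [set x : R | x < 1]).
      by apply: openI; [exact: open_gt|exact: open_lt].
    by apply/seteqP; split=> z /= => [/andP[]|[-> ->]].
  have s1 := smooth_on_affine (- bcoo B i a) 1 oU (@smooth_on_bcoo _ _ (cphi c @` kopen) B i).
  have s2 : smooth_on (cphi c @` kopen) (fun y => bcoo B i (y - a)).
    by apply: (eq_smooth_on oU _ s1) => y _; rewrite bcooB mul1r addrC.
  apply: (smooth_on_comp (basisR R) oU oW acos_smooth s2) => _ [y [cy yi] <-] /=.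
  by rewrite -ltr_norml.
have hc i : mfam setT (fun k => wt k : R) (cphi c @` kopen) (cphi c @` L) n
    (fun k y => cos ((k i)%:R * acos (bcoo B i (y - a)))).
  have kw (k : K -> nat) : [set: K -> nat] k -> `|(k i)%:R| <= wt k :> R.
    move=> _; rewrite ger0_norm//; apply: le_trans (wt_ge k i); by rewrite ler_nat.
  have idl (z u v : R) : z *: u + v = z * u + v by [].
  have idb (v : R) : `|v| <= 1 * `|v| by rewrite mul1r.
  have tf m := (mfam_trig w1 idl idb kw m).1.
  apply: (mfam_comp w1 (B := basisR R) n oU QU openT (@subsetT _ setT) tf) => //.
  by move=> [] m; apply: mfam_fixed => //; exact: sg.
apply: (eq_mfam oU QU _ (mfamM w1 oU QU (mfam_prod w1 oU QU (index_enum K) hc) hp)).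
move=> k _ _ [y [cy yi] <-] /=; rewrite /kfun cphiK// [psi y * _]mulrC cpartRM.
by congr (_ * _); rewrite /coskt /kang.
Qed.

End CubeSeries.

Section CubeVectors.
Context {R : realType} {M : topologicalType} (S : smoothStructure R M) (Q : cube S).
Let B := kbas Q.
Let K := bidx B.
Implicit Types (k : K -> nat) (f : Cc S).
Local Notation normc := ComplexField.Normc.normc.

Lemma Cc_sumE (I : Type) (s : seq I) (P : pred I) (F : I -> Cc S) x :
  (\sum_(i <- s | P i) F i) x = \sum_(i <- s | P i) F i x.
Proof. by elim/big_rec2 : _ => [//|i z f _ <-]. Qed.

Lemma ktor_continuous f b (t : K -> R) (u : nat -> K -> R) :
  (forall i, u n i @[n --> \oo] --> t i) ->
  cpart b (ktor (Q := Q) f (u n)) @[n --> \oo] --> cpart b (ktor (Q := Q) f t).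
Proof.
move=> ut; have [_ fA] := (Cc_smallP [set f]).1 (small_set1 f).
pose e (y : K -> R) := \sum_i y i *: @bvec _ _ B i.
have Ge y : ktor (Q := Q) f y = ktor (Q := Q) f (bcoo B ^~ (e y)).
  by congr (ktor f _); apply: funext => l; rewrite bcoo_comb.
have eu : e (u n) @[n --> \oo] --> e t.
  apply: (@cvg_sumv _ _ _ (nbhs \oo)) => i; exact: cvgZr_tmp (ut i).
have [+ _] := mfam_ktor Q 0 b fA => /(_ f (erefl f) [::] isT (e t) Logic.I) [cG _].
rewrite Ge; under eq_fun do rewrite Ge.
exact: (cvg_comp (fun n => e (u n)) _ eu cG).
Qed.

Variables (psi : Cc S) (psiK : supp psi `<=` kopen Q).

Fact kvec_subproof k : kfun (Q := Q) psi k \in Cc_pred S.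
Proof.
apply: mem_set; split; first exact: cfam_smooth (cfam_kfun psiK) Logic.I.
by apply: supp_sub (CcP psi).2 => x; rewrite /kfun => ->; rewrite mul0r.
Qed.
Definition kvec k : Cc S := MkCc (kvec_subproof k).

Lemma kvec_fast : fast_family kvec.
Proof.
move=> al [al0 ar]; apply: (small_image_cfam (K := supp psi)).
- exact: (CcP psi).2.
- move=> k x _ nx; rewrite CcZE -[kvec k x]/(kfun (Q := Q) psi k x) /kfun.
  by rewrite (supp_out nx) mul0r mulr0.
have w1 k : [set: K -> nat] k -> 1 <= wt k :> R by move=> _; exact: wt_ge1.
apply: jet_cfam => [k _|c Ac L cL Lc vs]; first exact: Cc_smooth.
have [C [m [C0 h]]] := cfam_jet vs w1 (cfam_kfun psiK) Ac cL Lc.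
have [D aD] := ar m; exists (D * C), 0%N; split.
  by rewrite mulr_ge0// (le_trans _ (aD (fun=> 0%N)))// mulr_ge0// exprn_ge0// ltW// wt_gt0.
move=> k x _ Lx; rewrite mulr1 jetZ//; last exact: Lc.
rewrite normcRM//; apply: le_trans (ler_wpM2l (al0 k) (h k x Logic.I Lx)) _.
by rewrite mulrCA mulrC ler_wpM2r.
Qed.

Lemma kseries_point f x : exists C, forall N,
  normc (series (kcoef (Q := Q)) kvec N f x - psi x * f x) <= C * rate N.
Proof.
have sE N : series (kcoef (Q := Q)) kvec N f x =
    psi x * \sum_(k : {ffun K -> 'I_N}) kcoef (kord k) f * (coskt (kord k) (kang (Q := Q) x))%:C.
  rewrite /series Cc_sumE mulr_sumr; apply: eq_bigr => k _.
  by rewrite CcZE -[kvec _ x]/(kfun (Q := Q) psi _ x) /kfun mulrCA.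
have [Kx|nK] := pselect (kopen Q x); last first.
  exists 0 => N; rewrite sE.
  have -> : psi x = 0 by apply: supp_out; move=> /psiK.
  by rewrite !mul0r subr0 ComplexField.Normc.normc0.
have [_ fA] := (Cc_smallP [set f]).1 (small_set1 f).
have [C C0 fC] := ccoef_decay Q 3 fA.
pose D := C * 2 ^+ #|K|; exists (normc (psi x) * (D + D)) => N.
rewrite sE -mulrBr ComplexField.Normc.normcM -mulrA ler_wpM2l ?normc_ge0//.
rewrite -normc_opp opprB.
have h b : `|cpart b (f x - \sum_(k : {ffun K -> 'I_N}) kcoef (kord k) f *
    (coskt (kord k) (kang (Q := Q) x))%:C)| <= D * rate N.
  have := @cosine_expansion R K (fun t => cpart b (ktor (Q := Q) f t)) C (kang (Q := Q) x) N
    (@ktor_cos_dependent _ _ _ Q f b) (fun m k => fC f (erefl f) b m k)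
    (fun i => kang_range i Kx) (fun u => @ktor_continuous f b _ u).
  rewrite ktor_kang// cpartB cpart_sum mulrA.
  congr (`|_ - _| <= _); apply: eq_bigr => k _.
  by rewrite -cpart_kcoef [kcoef _ _ * _]mulrC cpartRM mulrC.
by apply: le_trans (normc_le_parts _) _; rewrite mulrDl lerD.
Qed.

(** Rapid coefficients, a fast family and completeness give a limit operator first; the pointwise
    cosine expansion then identifies it as multiplication by [psi]. *)
Lemma kseries_cvg : ufast_cvg (series (kcoef (Q := Q)) kvec) (Cc_mul psi).
Proof.
have [L Lb sL] := series_cvg (@Cc_complete _ _ S) (@kcoef_rapid _ _ _ Q) kvec_fast.
have -> : Cc_mul psi = L; last exact: sL.
apply: funext => f; apply: Cc_ext_eq => x; symmetry.
apply: (fast_cvg_pointwise (ufast_fast f sL) (g := fun x => psi x * f x)) => y.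
exact: kseries_point.
Qed.

End CubeVectors.

(** * Expansions on products of cubes *)

Section ProductBasis.
Context {R : realType} {E F : normedModType R} (B : basis E) (B' : basis F).

Definition prod_bvec (s : bidx B + bidx B') : E * F :=
  match s with inl i => (bvec i, 0) | inr j => (0, bvec j) end.
Definition prod_bcoo (s : bidx B + bidx B') (v : E * F) : R :=
  match s with inl i => bcoo B i v.1 | inr j => bcoo B' j v.2 end.

Lemma sum_prod_bvec (y : bidx B + bidx B' -> R) : \sum_s y s *: prod_bvec s =
  (\sum_i y (inl i) *: bvec i, \sum_j y (inr j) *: bvec j).
Proof.
rewrite big_sumType /=; apply/eqP; rewrite xpair_eqE; apply/andP; split; apply/eqP.
  rewrite [LHS](raddfD (@fst _ _)) !raddf_sum /= [X in _ + X]big1 ?addr0//.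
  by move=> i _; rewrite scaler0.
rewrite [LHS](raddfD (@snd _ _)) !raddf_sum /= [X in X + _]big1 ?add0r//.
by move=> i _; rewrite scaler0.
Qed.

Definition prod_basis : basis (E * F)%type.
Proof.
apply: (@Basis R (E * F)%type (bidx B + bidx B')%type prod_bvec prod_bcoo).
- by move=> [i|j] a u v /=; rewrite bcoo_lin.
- by move=> v; rewrite sum_prod_bvec /= -!bcoo_sum; case: v.
- by move=> [i|i] [j|j] /=; rewrite ?bcoo_vec ?bcoo0.
- have [C C0 BC] := bcoo_bnd B; have [D D0 BD] := bcoo_bnd B'.
  have h1 (v : E * F) : `|v.1| <= `|v| by rewrite [leRHS]prod_normE le_max lexx.
  have h2 (v : E * F) : `|v.2| <= `|v| by rewrite [leRHS]prod_normE le_max lexx orbT.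
  exists (C + D); first exact: addr_gt0.
  move=> [i|j] v /=; [apply: le_trans (BC i _) _|apply: le_trans (BD j _) _].
    apply: (@le_trans _ _ (C * `|v|)); first by rewrite ler_wpM2l// ltW.
    by rewrite ler_wpM2r// lerDl ltW.
  apply: (@le_trans _ _ (D * `|v|)); first by rewrite ler_wpM2l// ltW.
  by rewrite ler_wpM2r// lerDr ltW.
Defined.

End ProductBasis.

Section SumIndices.
Context {R : realType} {I J : finType}.

Definition kl (k : I + J -> nat) : I -> nat := fun i => k (inl i).
Definition kr (k : I + J -> nat) : J -> nat := fun j => k (inr j).
Definition kcat (k1 : I -> nat) (k2 : J -> nat) (s : I + J) : nat :=
  match s with inl i => k1 i | inr j => k2 j end.

Lemma wt_cat k : wt k = wt (kl k) * wt (kr k) :> R.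
Proof. by rewrite /wt big_sumType. Qed.

Lemma kcatK k : kcat (kl k) (kr k) = k.
Proof. by apply: funext => -[]. Qed.

Lemma in_box_cat n k : in_box n k = in_box n (kl k) && in_box n (kr k).
Proof.
apply/forallP/andP => [h|[/forallP h1 /forallP h2] [i|j]].
- by split; apply/forallP => i; exact: h.
- exact: h1.
- exact: h2.
Qed.

Lemma sum_ffun_cat (V : nmodType) n (H : {ffun I -> 'I_n} -> {ffun J -> 'I_n} -> V) :
  \sum_(k : {ffun I + J -> 'I_n}) H [ffun i => k (inl i)] [ffun j => k (inr j)] =
  \sum_(k1 : {ffun I -> 'I_n}) \sum_(k2 : {ffun J -> 'I_n}) H k1 k2.
Proof.
rewrite pair_big /=.
pose h (p : {ffun I -> 'I_n} * {ffun J -> 'I_n}) : {ffun I + J -> 'I_n} :=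
  [ffun s => match s with inl i => p.1 i | inr j => p.2 j end].
rewrite (reindex h); last first.
  exists (fun k : {ffun I + J -> 'I_n} => ([ffun i => k (inl i)], [ffun j => k (inr j)])).
    by move=> [k1 k2] _; congr pair; apply/ffunP => i; rewrite !ffunE.
  by move=> k _; apply/ffunP => -[i|j]; rewrite !ffunE.
apply: eq_bigr => -[k1 k2] _ /=.
by congr (H _ _); apply/ffunP => i; rewrite !ffunE.
Qed.

(** The grid of the product is the product of the grids, so the finite double sum factors exactly.
    This takes the place of Fubini for the coefficients. *)
Lemma ccoefn_cat m k (F : (I -> R) -> R) (G : (J -> R) -> R) :
  ccoefn m k (fun t => F (fun i => t (inl i)) * G (fun j => t (inr j))) =
  ccoefn m (kl k) F * ccoefn m (kr k) G.
Proof.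
rewrite /ccoefn in_box_cat; case: in_box => /=; last by rewrite mul0r.
case: in_box => /=; last by rewrite mulr0.
rewrite /ccoef big_sumType /= mulrACA; congr (_ * _).
rewrite /cossum mulr_suml; under [RHS]eq_bigr do rewrite mulr_sumr.
rewrite -(sum_ffun_cat (fun j l => F (gridpt j) * coskt (kl k) (gridpt j) *
  (G (gridpt l) * coskt (kr k) (gridpt l)))); apply: eq_bigr => j _.
have -> : gridpt [ffun i => j (inl i)] = (fun i => gridpt j (inl i)) :> (I -> R).
  by apply: funext => i; rewrite /gridpt ffunE.
have -> : gridpt [ffun i => j (inr i)] = (fun i => gridpt j (inr i)) :> (J -> R).
  by apply: funext => i; rewrite /gridpt ffunE.
by rewrite /coskt big_sumType mulrACA.
Qed.

End SumIndices.

Section ExternalBounded.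
Context {R : realType} {M N : topologicalType}.
Context (S : smoothStructure R M) (T : smoothStructure R N).

Lemma Cc_extE (f : Cc S) (g : Cc T) x : Cc_ext f g x = f x.1 * g x.2.
Proof. by []. Qed.

Lemma Cc_ext_bounded : bounded_bilinear (@Cc_ext R M N S T).
Proof.
split.
- move=> g a f f'; apply: Cc_ext_eq => x; rewrite CcE !Cc_extE CcE.
  by rewrite mulrDl mulrA.
- move=> f a g g'; apply: Cc_ext_eq => x; rewrite CcE !Cc_extE CcE.
  by rewrite mulrDr mulrCA.
move=> A B /Cc_smallP[[K cK AK] fA] /Cc_smallP[[L cL BL] fB].
pose P : set (Cc S * Cc T) := [set p | A p.1 /\ B p.2].
have w1 (p : Cc S * Cc T) : P p -> 1 <= 1 :> R by [].
have w2 (p : Cc S) : A p -> 1 <= 1 :> R by [].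
have w3 (p : Cc T) : B p -> 1 <= 1 :> R by [].
have h1 : cfam (prodStructure S T) P (fun=> 1) (fun p x => p.1 x.1).
  have r := @cfam_reindex _ _ S _ _ A P (fun=> 1) (fun=> 1) fst _ w2
    (fun p (Pp : P p) => conj Pp.1 (lexx _)) fA.
  exact: (cfam_pull w1 (smooth_map_fst S T) r).
have h2 : cfam (prodStructure S T) P (fun=> 1) (fun p x => p.2 x.2).
  have r := @cfam_reindex _ _ T _ _ B P (fun=> 1) (fun=> 1) snd _ w3
    (fun p (Pp : P p) => conj Pp.2 (lexx _)) fB.
  exact: (cfam_pull w1 (smooth_map_snd S T) r).
have : small ((fun p => Cc_ext p.1 p.2) @` P).
  apply: (small_image_cfam (K := K `*` L)); first exact: compact_setX.
    move=> [f g] [x y] [Af Bg] nKL; rewrite Cc_extE /=.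
    have [Kx|nK] := pselect (K x); last first.
      by rewrite (supp_out (f := f)) ?mul0r// => /(AK _ Af).
    rewrite [g y](supp_out (f := g)) ?mulr0// => /(BL _ Bg) Ly.
    exact: nKL.
  exact: (cfamM w1 h1 h2).
apply: small_sub => _ [f [g [Af Bg ->]]]; by exists (f, g).
Qed.

End ExternalBounded.

Section ProductCube.
Context {R : realType} {M N : topologicalType}.
Context (S : smoothStructure R M) (T : smoothStructure R N).
Variables (Q : cube S) (Q' : cube T).
Let SS := prodStructure S T.
Let B := kbas Q.
Let B' := kbas Q'.

Lemma kprod_sub : box (prod_basis B B') (kctr Q, kctr Q') 1 `<=`
  cphi (prod_chart (kchart Q) (kchart Q')) @` cdom (prod_chart (kchart Q) (kchart Q')).
Proof.
move=> [e e'] h; have [x cx xe] := @ksub _ _ _ Q e (fun i => h (inl i)).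
have [y cy ye] := @ksub _ _ _ Q' e' (fun j => h (inr j)).
by exists (x, y) => //=; rewrite /prod_phi /= xe ye.
Qed.

Lemma kprod_atlas : atlas SS (prod_chart (kchart Q) (kchart Q')).
Proof. by exists (kchart Q); [exact: katlas|exists (kchart Q') => //; exact: katlas]. Qed.

Definition kprod : cube SS := @Cube R _ SS (prod_chart (kchart Q) (kchart Q'))
  kprod_atlas (prod_basis B B') (kctr Q, kctr Q') kprod_sub.

Lemma ktor_prod (f : Cc S) (g : Cc T) (t : bidx B + bidx B' -> R) :
  ktor (Q := kprod) (Cc_ext f g) t =
  ktor (Q := Q) f (fun i => t (inl i)) * ktor (Q := Q') g (fun j => t (inr j)).
Proof.
rewrite /ktor /kpt /= sum_prod_bvec /=.
by [].
Qed.

(** Ultralimits are multiplicative on real bounded sequences; the complex product is assembled from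
    the four products of parts. *)
Lemma kcoef_prod k (f : Cc S) (g : Cc T) : kcoef (Q := kprod) k (Cc_ext f g) =
  kcoef (Q := Q) (kl k) f * kcoef (Q := Q') (kr k) g.
Proof.
pose F b t := cpart b (ktor (Q := Q) f t); pose G b t := cpart b (ktor (Q := Q') g t).
have bF b k1 : bseq (fun m => ccoefn m k1 (F b)) by exact: kcoef_bseq.
have bG b k2 : bseq (fun m => ccoefn m k2 (G b)) by exact: kcoef_bseq.
pose H b1 b2 (t : bidx B + bidx B' -> R) :=
  F b1 (fun i => t (inl i)) * G b2 (fun j => t (inr j)).
have cH b1 b2 : ulim (fun m => ccoefn m k (H b1 b2)) =
    cpart b1 (kcoef (Q := Q) (kl k) f) * cpart b2 (kcoef (Q := Q') (kr k) g).
  rewrite !cpart_kcoef /clim -ulimM; [|exact: bF|exact: bG].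
  by congr ulim; apply: funext => m; rewrite /H ccoefn_cat.
have bH b1 b2 : bseq (fun m => ccoefn m k (H b1 b2)).
  have -> : (fun m => ccoefn m k (H b1 b2)) =
      fun m => ccoefn m (kl k) (F b1) * ccoefn m (kr k) (G b2).
    by apply: funext => m; rewrite /H ccoefn_cat.
  exact: bseqM.
apply: cpart_eq => -[]; rewrite cpart_kcoef /clim.
  rewrite (_ : (fun m => _) = fun m => 1 * ccoefn m k (H true true) +
      -1 * ccoefn m k (H false false)).
    rewrite ulimD; [|by apply: bseqM; [exact: bseq_cst|exact: bH]..].
    rewrite !ulimZ ?cH//; case: (kcoef _ _) => u v; case: (kcoef _ _) => x y /=.
    by rewrite mul1r mulN1r.
  apply: funext => m; apply: ccoefn_lin => t; rewrite ktor_prod /H /F /G.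
  case: (ktor _ _) => u v; case: (ktor _ _) => x y /=.
  by rewrite mul1r mulN1r.
rewrite (_ : (fun m => _) = fun m => 1 * ccoefn m k (H true false) +
    1 * ccoefn m k (H false true)).
  rewrite ulimD; [|by apply: bseqM; [exact: bseq_cst|exact: bH]..].
  rewrite !ulimZ ?cH//; case: (kcoef _ _) => u v; case: (kcoef _ _) => x y /=.
  by rewrite !mul1r.
apply: funext => m; apply: ccoefn_lin => t; rewrite ktor_prod /H /F /G.
case: (ktor _ _) => u v; case: (ktor _ _) => x y /=.
by rewrite !mul1r.
Qed.

Variables (psi : Cc S) (psi' : Cc T).
Hypotheses (psiK : supp psi `<=` kopen Q) (psiK' : supp psi' `<=` kopen Q').

Lemma supp_ext (f : Cc S) (g : Cc T) : supp (Cc_ext f g) `<=` supp f `*` supp g.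
Proof.
apply: supp_subP => [|[x y] nxy].
  exact: (compact_closedM SS (compact_setX (CcP f).2 (CcP g).2)).
rewrite Cc_extE /=; have [fx|nf] := pselect (supp f x); last by rewrite supp_out ?mul0r.
by rewrite [g y]supp_out ?mulr0// => gy; exact: nxy.
Qed.

Lemma kprod_open : kopen Q `*` kopen Q' `<=` kopen kprod.
Proof.
by move=> [x y] [/= [cx xi] [cy yj]]; split=> // -[i|j] /=; [exact: xi|exact: yj].
Qed.

Lemma psi_prodK : supp (Cc_ext psi psi') `<=` kopen kprod.
Proof. by move=> z /supp_ext [/psiK z1 /psiK' z2]; exact: kprod_open. Qed.

Lemma kvec_prod k : kvec psi_prodK k = Cc_ext (kvec psiK (kl k)) (kvec psiK' (kr k)).
Proof.
apply: Cc_ext_eq => -[x y]; rewrite Cc_extE.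
rewrite -[kvec psi_prodK k (x, y)]/(kfun (Q := kprod) (Cc_ext psi psi') k (x, y)).
rewrite -[kvec psiK _ _]/(kfun psi (kl k) x) -[kvec psiK' _ _]/(kfun psi' (kr k) y).
rewrite /kfun Cc_extE /= /coskt big_sumType /= rmorphM mulrACA.
by [].
Qed.

End ProductCube.

Section ScaledBasis.
Context {R : realType} {E : normedModType R} (B : basis E) (r : R).
Hypothesis r0 : 0 < r.

Definition scale_basis : basis E.
Proof.
apply: (@Basis R E (bidx B) (fun i => r *: bvec i) (fun i v => r^-1 * bcoo B i v)).
- by move=> i a u v; rewrite bcoo_lin mulrDr mulrCA.
- move=> v; rewrite [LHS](bcoo_sum B); apply: eq_bigr => i _.
  by rewrite scalerA mulrAC mulVf ?mul1r// gt_eqF.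
- by move=> i j; rewrite bcooZ bcoo_vec mulKf// gt_eqF.
have [C C0 BC] := bcoo_bnd B; exists (r^-1 * C); first by rewrite mulr_gt0 ?invr_gt0.
move=> i v; have ri : 0 <= r^-1 by rewrite invr_ge0 ltW.
by rewrite normrM (ger0_norm ri) -mulrA ler_wpM2l.
Defined.

End ScaledBasis.

(** A box of radius [r] inside the chart image becomes the unit box after the basis is scaled by
    [r]. *)
Lemma cube_exists (R : realType) (M : topologicalType) (S : smoothStructure R M) x :
  exists Q : cube S, kopen Q x.
Proof.
have [c Ac cx] := atlas_cover S x; pose B := mbasis S.
have [|r r0 rW] := box_sub B (cimg_open c) (a := cphi c x); first by exists x.
have sub : box (scale_basis B r0) (cphi c x) 1 `<=` cphi c @` cdom c.
  move=> e h; apply: rW => i; have := h i; rewrite /= normrM gtr0_norm ?invr_gt0//.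
  by rewrite ler_pdivrMl// mulr1.
exists (Cube Ac sub); split => // i /=.
by rewrite subrr bcoo0 mulr0 normr0.
Qed.

Section LinearSums.
Context {R : realType} {V X : bornType R} (f : V -> X).
Hypothesis fl : linear f.

Lemma lin0 : f 0 = 0.
Proof. by have := fl (-1) 0 0; rewrite scaler0 addr0 scaleN1r addNr. Qed.

Lemma linD u v : f (u + v) = f u + f v.
Proof. by have := fl 1 u v; rewrite !scale1r. Qed.

Lemma linZ a u : f (a *: u) = a *: f u.
Proof. by have := fl a u 0; rewrite !addr0 lin0 addr0. Qed.

Lemma lin_sum (I : Type) (s : seq I) (u : I -> V) :
  f (\sum_(i <- s) u i) = \sum_(i <- s) f (u i).
Proof.
by elim: s => [|i s IH]; rewrite ?big_nil ?lin0// !big_cons linD IH.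
Qed.

End LinearSums.

Section LinearMaps.
Context {R : realType} {V X Y : bornType R}.

Lemma bl_comp (g : X -> Y) (f : V -> X) :
  bounded_linear f -> bounded_linear g -> bounded_linear (g \o f).
Proof.
move=> [fl fb] [gl gb]; split=> [a u v /=|A sA]; first by rewrite fl gl.
by rewrite -image_comp; exact/gb/fb.
Qed.

Lemma bl_cst0 : bounded_linear (fun _ : V => 0 : X).
Proof. exact: (homP (0 : bhom V X)). Qed.

Lemma bl_add (f g : V -> X) : bounded_linear f -> bounded_linear g ->
  bounded_linear (fun x => f x + g x).
Proof. by move=> fP gP; exact: (homP (mkhom fP + mkhom gP)). Qed.

Lemma bl_sum (I : Type) (s : seq I) (f : I -> V -> X) :
  (forall i, bounded_linear (f i)) -> bounded_linear (fun x => \sum_(i <- s) f i x).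
Proof.
move=> fP; elim: s => [|i s IH].
  by under eq_fun do rewrite big_nil; exact: bl_cst0.
by under eq_fun do rewrite big_cons; exact: bl_add.
Qed.

End LinearMaps.

(** * Tensor products and approximation *)

Section TensorProduct.
Context {R : realType} {M N : topologicalType}.
Context (S : smoothStructure R M) (T : smoothStructure R N).
Let SS := prodStructure S T.

Section Local.
Variables (Q : cube S) (Q' : cube T) (psi : Cc S) (psi' : Cc T).
Hypotheses (psiK : supp psi `<=` kopen Q) (psiK' : supp psi' `<=` kopen Q').

(* A rapid sequence al k is dominated by be k' * ga k'' with be and ga rapid: take
   for each the supremum of sqrt (al k) over the other index. *)
Lemma prod_fast_family (X : bornType R) (b : Cc S -> Cc T -> X) : bounded_bilinear b ->
  fast_family (fun k => b (kvec psiK (kl k)) (kvec psiK' (kr k))).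
Proof.
move=> [bl br bb] al [al0 ar].
pose sq k := Num.sqrt (al k).
have sqw p : exists C, forall k, sq k * wt k ^+ p <= C.
  have [C aC] := ar p.*2; exists (Num.sqrt C) => k.
  have w0 : 0 <= wt k ^+ p :> R by rewrite exprn_ge0// ltW// wt_gt0.
  rewrite -[wt k ^+ p]ger0_norm// -sqrtr_sqr -sqrtrM// -exprM muln2.
  by rewrite ler_wsqrtr.
have [be rbe leb] : exists2 be, rapid be & forall k2 k1, setT k2 -> sq (kcat k1 k2) <= be k1.
  apply: rapid_dom => [k2 k1|p]; first exact: sqrtr_ge0.
  have [C sC] := sqw p; exists C => k2 k1 _; apply: le_trans (sC (kcat k1 k2)).
  rewrite ler_wpM2l ?sqrtr_ge0// lerXn2r ?nnegrE ?(ltW (wt_gt0 _))//.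
  by rewrite [leRHS]wt_cat ler_peMr ?(ltW (wt_gt0 _))// wt_ge1.
have [ga rga leg] : exists2 ga, rapid ga & forall k1 k2, setT k1 -> sq (kcat k1 k2) <= ga k2.
  apply: (rapid_dom (g := fun k1 k2 => sq (kcat k1 k2))) => [k2 k1|p]; first exact: sqrtr_ge0.
  have [C sC] := sqw p; exists C => k1 k2 _; apply: le_trans (sC (kcat k1 k2)).
  rewrite ler_wpM2l ?sqrtr_ge0// lerXn2r ?nnegrE ?(ltW (wt_gt0 _))//.
  by rewrite [leRHS]wt_cat ler_peMl ?(ltW (wt_gt0 _))// wt_ge1.
have s1 := kvec_fast psiK rbe; have s2 := kvec_fast psiK' rga.
apply: smallW (small_hull (bb _ _ s1 s2)) _ => _ [k _ <-] D dD sub.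
have alE : al k = sq k * sq k by rewrite -expr2 sqr_sqrtr.
have lb : sq k <= be (kl k) by have := leb (kr k) (kl k) Logic.I; rewrite kcatK.
have lg : sq k <= ga (kr k) by have := leg (kl k) (kr k) Logic.I; rewrite kcatK.
have [a0|a0] := eqVneq (al k) 0; first by rewrite a0 scale0r; exact: is_disk0.
have sp : 0 < sq k by rewrite sqrtr_gt0 lt_neqAle eq_sym a0 al0.
have bp := lt_le_trans sp lb; have gp := lt_le_trans sp lg.
have -> : (al k)%:C *: b (kvec psiK (kl k)) (kvec psiK' (kr k)) =
    ((al k)%:C / ((be (kl k))%:C * (ga (kr k))%:C)) *:
    b ((be (kl k))%:C *: kvec psiK (kl k)) ((ga (kr k))%:C *: kvec psiK' (kr k)).
  rewrite (linZ (bl _)) (linZ (br _)) !scalerA; congr (_ *: _).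
  by field; rewrite !realC_neq0.
apply: is_diskZ => //.
  rewrite normrM normfV normrM !norm_realC ?(ltW bp) ?(ltW gp)//.
  rewrite -rmorphM ler_pdivrMr ?mul1r ?ltcR ?mulr_gt0// lecR alE.
  by rewrite ler_pM// ltW.
apply: sub; exists ((be (kl k))%:C *: kvec psiK (kl k)), ((ga (kr k))%:C *: kvec psiK' (kr k)).
by split; [exists (kl k)|exists (kr k)|].
Qed.

(** The map is the series of the coefficients of [F] against the values of [b] on pairs of vectors,
    which form a fast family by [prod_fast_family]. *)
Lemma tensor_local (X : bornType R) (b : Cc S -> Cc T -> X) : complete_born X ->
  bounded_bilinear b -> exists2 L : Cc SS -> X, bounded_linear L &
    forall f g, L (Cc_ext f g) = b (Cc_mul psi f) (Cc_mul psi' g).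
Proof.
move=> cX bB; have [bl br _] := bB.
have [L Lb sL] := series_cvg cX (@kcoef_rapid _ _ _ (kprod Q Q')) (prod_fast_family bB).
exists L => // f g; apply: (fast_cvg_unique cX (ufast_fast (Cc_ext f g) sL)).
have c1 := ufast_fast f (kseries_cvg psiK); have c2 := ufast_fast g (kseries_cvg psiK').
(* Truncating both expansions at the same [n] gives precisely the truncation of the product
   expansion, so both limits are limits of one sequence. *)
have := fast_cvg_bilin bB c1 c2; congr fast_cvg; apply: funext => n.
rewrite /series (lin_sum (bl _)).
under eq_bigr => k1 _ do rewrite (lin_sum (br _)).
rewrite -sum_ffun_cat; apply: eq_bigr => k _.
rewrite (linZ (bl _)) (linZ (br _)) scalerA kcoef_prod.
have -> : kord [ffun i => k (inl i)] = kl (kord k).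
  by apply: funext => i; rewrite /kord /kl ffunE.
have -> : kord [ffun i => k (inr i)] = kr (kord k) by apply: funext => i; rewrite /kord /kr ffunE.
by [].
Qed.

End Local.

Lemma cube_partition (K : set M) : compact K ->
  exists n (psi : 'I_n -> Cc S) (Q : 'I_n -> cube S),
    (forall i, supp (psi i) `<=` kopen (Q i)) /\
    forall x, K x -> \sum_i psi i x = 1.
Proof.
move=> cK; have [Q QP] := choice (cube_exists S).
have [|n [psi [p [ps pK]]]] := @partition _ _ S K (fun x => kopen (Q x)) cK.
  by move=> x _; split; [exact: open_kopen|exact: QP].
by exists n, psi, (fun i => Q (p i)); split=> // i; have [] := ps i.
Qed.

End TensorProduct.

Section CompactUnions.
Context {R : realType} {M : topologicalType} (S : smoothStructure R M).

Lemma cutoff_family n (psi : 'I_n -> Cc S) :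
  exists chi : Cc S, forall i x, supp (psi i) x -> chi x = 1.
Proof.
have h (s : seq 'I_n) : exists2 K, compact K &
    forall i, i \in s -> supp (psi i) `<=` K.
  elim: s => [|i s [K cK KP]]; first by exists set0; [exact: compact0|].
  exists (supp (psi i) `|` K); first by apply: compactU => //; exact: (CcP (psi i)).2.
  by move=> j /[!inE] /predU1P[->|js] x sx; [left|right; exact: (KP j)].
have [K cK KP] := h (index_enum 'I_n); have [chi chi1] := cutoff S cK.
by exists chi => i x sx; apply: chi1; apply: (KP i) => //; exact: mem_index_enum.
Qed.

Lemma Cc_mul_supp1 (chi f : Cc S) : (forall x, supp f x -> chi x = 1) -> Cc_mul chi f = f.
Proof.
move=> h; apply: Cc_ext_eq => x; rewrite -[Cc_mul chi f x]/(chi x * f x).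
have [fx|nf] := pselect (supp f x); first by rewrite h// mul1r.
by rewrite (supp_out nf) mulr0.
Qed.

Lemma Cc_mulE (f g : Cc S) x : Cc_mul f g x = f x * g x. Proof. by []. Qed.

Lemma Cc_mul_linear (chi : Cc S) : bounded_linear (Cc_mul chi).
Proof.
have -> : Cc_mul chi = smulC (Cc_smooth chi).
  by apply: funext => f; apply: Cc_ext_eq => x; rewrite Cc_mulE smulCE.
exact: smulC_bounded.
Qed.

Lemma supp_kvec (Q : cube S) (psi : Cc S) (psiK : supp psi `<=` kopen Q) k :
  supp (kvec psiK k) `<=` supp psi.
Proof.
apply: supp_subP; first exact: closed_closure.
move=> x nx; rewrite -[kvec psiK k x]/(kfun (Q := Q) psi k x) /kfun.
by rewrite (supp_out nx) mul0r.
Qed.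

End CompactUnions.

Section TensorProduct2.
Context {R : realType} {M N : topologicalType}.
Context (S : smoothStructure R M) (T : smoothStructure R N).
Let SS := prodStructure S T.

(** Besides density this keeps one pair of cutoffs acting as the identity on all the elementary
    factors; the identification of the relations in [Cc_essential_left] depends on it. *)
Lemma ext_dense (F : Cc SS) : exists (u : nat -> Cc SS) (chi : Cc S) (chi' : Cc T),
  fast_cvg u F /\ forall n, lspan [set G | exists f g,
    [/\ Cc_mul chi f = f, Cc_mul chi' g = g & G = Cc_ext f g]] (u n).
Proof.
have c1 : compact (fst @` supp F).
  apply: continuous_compact (CcP F).2; apply: continuous_subspaceT => x; exact: cvg_fst.
have c2 : compact (snd @` supp F).
  apply: continuous_compact (CcP F).2; apply: continuous_subspaceT => x; exact: cvg_snd.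
have [n [psi [Q [psiK p1]]]] := cube_partition S c1.
have [m [psi' [Q' [psiK' p1']]]] := cube_partition T c2.
have [chi chi1] := cutoff_family psi; have [chi' chi1'] := cutoff_family psi'.
pose u (ij : 'I_n * 'I_m) := series (kcoef (Q := kprod (Q ij.1) (Q' ij.2)))
  (kvec (psi_prodK (psiK ij.1) (psiK' ij.2))).
exists (fun N => \sum_ij u ij N F), chi, chi'; split.
  have eF : F = \sum_(ij : 'I_n * 'I_m) Cc_mul (Cc_ext (psi ij.1) (psi' ij.2)) F.
    apply: Cc_ext_eq => x; rewrite Cc_sumE.
    under eq_bigr do rewrite Cc_mulE Cc_extE.
    rewrite -mulr_suml -(pair_big xpredT xpredT (fun i j => psi i x.1 * psi' j x.2)) /=.
    under eq_bigr do rewrite -mulr_sumr.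
    rewrite -mulr_suml; have [Fx|nF] := pselect (supp F x).
      by rewrite p1 ?p1' ?mul1r//; exists x.
    by rewrite (supp_out nF) mulr0.
  have h ij : fast_cvg (u ij ^~ F) (Cc_mul (Cc_ext (psi ij.1) (psi' ij.2)) F).
    exact: (ufast_fast F (kseries_cvg (psi_prodK (psiK ij.1) (psiK' ij.2)))).
  by rewrite [X in fast_cvg _ X]eF; exact: (fast_cvg_sum (index_enum _) h).
move=> k; rewrite /u; elim: (index_enum _) => [|ij s IH]; first by rewrite big_nil; exact: lspan0.
rewrite big_cons; apply: lspanD => //; rewrite /series.
elim: (index_enum {ffun _ -> _}) => [|ka t IHt]; first by rewrite big_nil; exact: lspan0.
rewrite big_cons; apply: lspanD => //; apply: lspanZ; apply: sub_lspan.
rewrite kvec_prod; eexists; eexists; split; last reflexivity.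
  by apply: Cc_mul_supp1 => x /supp_kvec; exact: chi1.
by apply: Cc_mul_supp1 => x /supp_kvec; exact: chi1'.
Qed.

Lemma lspan_agree (V X : bornType R) (L1 L2 : V -> X) (A : set V) x :
  linear L1 -> linear L2 -> (forall y, A y -> L1 y = L2 y) -> lspan A x -> L1 x = L2 x.
Proof.
move=> l1 l2 h [n [c [y [Ay ->]]]].
rewrite (lin_sum l1) (lin_sum l2); apply: eq_bigr => k _.
by rewrite (linZ l1) (linZ l2) h.
Qed.

Lemma ext_unique (X : bornType R) (L1 L2 : Cc SS -> X) : complete_born X ->
  bounded_linear L1 -> bounded_linear L2 ->
  (forall f g, L1 (Cc_ext f g) = L2 (Cc_ext f g)) -> L1 = L2.
Proof.
move=> cX b1 b2 h; apply: funext => F; have [u [chi [chi' [uF uN]]]] := ext_dense F.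
apply: (fast_cvg_unique cX (fast_cvg_comp b1 uF)).
have := fast_cvg_comp b2 uF; congr fast_cvg; apply: funext => n /=.
apply/esym/(lspan_agree b1.1 b2.1 _ (uN n)) => _ [f [g [_ _ ->]]]; exact: h.
Qed.

(** The local maps are summed over all pairs of cubes of two partitions; by bilinearity the cutoffs
    add up to 1 on the given compact sets. *)
Lemma tensor_cutoff (X : bornType R) (b : Cc S -> Cc T -> X) (K : set M) (K' : set N) :
  complete_born X -> bounded_bilinear b -> compact K -> compact K' ->
  exists (L : Cc SS -> X) (chi : Cc S) (chi' : Cc T), [/\ bounded_linear L,
    forall f g, L (Cc_ext f g) = b (Cc_mul chi f) (Cc_mul chi' g),
    forall x, K x -> chi x = 1 & forall y, K' y -> chi' y = 1].
Proof.
move=> cX bB cK cK'; have [bl br _] := bB.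
have [n [psi [Q [psiK p1]]]] := cube_partition S cK.
have [m [psi' [Q' [psiK' p1']]]] := cube_partition T cK'.
have ex (ij : 'I_n * 'I_m) : exists L : Cc SS -> X, bounded_linear L /\
    forall f g, L (Cc_ext f g) = b (Cc_mul (psi ij.1) f) (Cc_mul (psi' ij.2) g).
  by have [L] := tensor_local (psiK ij.1) (psiK' ij.2) cX bB; exists L.
have [L LP] := choice ex.
exists (fun F => \sum_ij L ij F), (\sum_i psi i), (\sum_j psi' j); split.
- by apply: bl_sum => ij; have [] := LP ij.
- move=> f g; rewrite (eq_bigr (fun ij => b (Cc_mul (psi ij.1) f) (Cc_mul (psi' ij.2) g))).
    rewrite -(pair_big xpredT xpredT (fun i j => b (Cc_mul (psi i) f) (Cc_mul (psi' j) g))) /=.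
    have -> : Cc_mul (\sum_i psi i) f = \sum_i Cc_mul (psi i) f.
      by apply: Cc_ext_eq => x; rewrite Cc_mulE !Cc_sumE mulr_suml.
    have -> : Cc_mul (\sum_j psi' j) g = \sum_j Cc_mul (psi' j) g.
      by apply: Cc_ext_eq => x; rewrite Cc_mulE !Cc_sumE mulr_suml.
    rewrite (lin_sum (bl _)); apply: eq_bigr => i _.
    by rewrite (lin_sum (br _)).
  by move=> ij _; have [_] := LP ij; apply.
- by move=> x Kx; rewrite Cc_sumE p1.
- by move=> y Ky; rewrite Cc_sumE p1'.
Qed.

(** Each map from [tensor_cutoff] is correct for functions supported in its compact rectangle. Two
    of them agree on functions for which both are correct, so they glue. *)
Lemma tensor_exists (X : bornType R) (b : Cc S -> Cc T -> X) :
  complete_born X -> bounded_bilinear b ->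
  exists2 L : Cc SS -> X, bounded_linear L & forall f g, L (Cc_ext f g) = b f g.
Proof.
move=> cX bB.
pose P (KK : set M * set N) (L : Cc SS -> X) := exists (chi : Cc S) (chi' : Cc T),
  [/\ bounded_linear L, forall f g, L (Cc_ext f g) = b (Cc_mul chi f) (Cc_mul chi' g),
    forall x, KK.1 x -> chi x = 1 & forall y, KK.2 y -> chi' y = 1].
have mulext_bounded (G : Cc SS) : bounded_linear (Cc_mul G) by exact: Cc_mul_linear.
(* Each map is preceded by multiplication with the cutoffs of the other. The two compositions agree
   on external products and hence everywhere, and on [F] all cutoffs act trivially. *)
have agree KK KK' L L' (F : Cc SS) : P KK L -> P KK' L' ->
    supp F `<=` KK.1 `*` KK.2 -> supp F `<=` KK'.1 `*` KK'.2 -> L F = L' F.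
  move=> [c [d [bL LE c1 d1]]] [c' [d' [bL' LE' c1' d1']]] FK FK'.
  have e : L \o Cc_mul (Cc_ext c' d') = L' \o Cc_mul (Cc_ext c d).
    apply: (ext_unique cX); [exact: bl_comp|exact: bl_comp|move=> f g /=].
    have h (x y : Cc S) (z t : Cc T) :
        Cc_mul (Cc_ext x z) (Cc_ext y t) = Cc_ext (Cc_mul x y) (Cc_mul z t).
      by apply: Cc_ext_eq => w; rewrite Cc_mulE !Cc_extE !Cc_mulE mulrACA.
    rewrite !h LE LE'; congr b; apply: Cc_ext_eq => w; rewrite !Cc_mulE; exact: mulrCA.
  have fix1 (x : Cc S) (z : Cc T) (A : set M) (B : set N) : (forall w, A w -> x w = 1) ->
      (forall w, B w -> z w = 1) -> supp F `<=` A `*` B -> Cc_mul (Cc_ext x z) F = F.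
    move=> xA zB FAB; apply: Cc_mul_supp1 => w /FAB[Aw Bw].
    by rewrite Cc_extE xA ?zB ?mulr1.
  have := congr1 (fun g => g F) e.
  by rewrite /= (fix1 _ _ _ _ c1 d1 FK) (fix1 _ _ _ _ c1' d1' FK').
have ex (K : set M) (K' : set N) : compact K -> compact K' -> exists L, P (K, K') L.
  by move=> cK cK'; have [L [c [d LP]]] := tensor_cutoff cX bB cK cK'; exists L, c, d.
pose pr (A : set (M * N)) : set M * set N := (fst @` A, snd @` A).
have prc (A : set (M * N)) : compact A -> compact (pr A).1 /\ compact (pr A).2.
  move=> cA; split; apply: continuous_compact cA; apply: continuous_subspaceT => x;
    [exact: cvg_fst|exact: cvg_snd].
have prs (A : set (M * N)) : A `<=` (pr A).1 `*` (pr A).2.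
  by move=> x Ax; split; exists x.
(* The map is chosen for each function by its own support. Linearity and boundedness are checked by
   passing to one compact set for all functions concerned. *)
have [L0 L0P] := choice (fun F : Cc SS => ex _ _ (prc _ (CcP F).2).1 (prc _ (CcP F).2).2).
have LE (K : set (M * N)) L (F : Cc SS) : P (pr K) L -> supp F `<=` K -> L0 F F = L F.
  move=> PL FK; apply: (agree _ _ _ _ _ (L0P F) PL); first exact: prs.
  by move=> x /FK /prs.
have exK (K : set (M * N)) : compact K -> exists L, P (pr K) L.
  by move=> cK; have [k1 k2] := prc _ cK; exact: ex.
exists (fun F => L0 F F); last first.
  move=> f g.
  have [L PL] := ex (supp f) (supp g) (CcP f).2 (CcP g).2.
  rewrite (agree _ _ _ _ _ (L0P (Cc_ext f g)) PL); last 2 first.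
  - exact: prs.
  - exact: supp_ext.
  by have [c' [d' [_ -> e1 e2]]] := PL; rewrite (Cc_mul_supp1 e1) (Cc_mul_supp1 e2).
split.
  move=> a F G; have cK := compactU (CcP F).2 (CcP G).2.
  have [L PL] := exK _ cK; have [c [d [bL _ _ _]]] := PL.
  have eF : L0 F F = L F by apply: (LE _ L F PL) => x; left.
  have eG : L0 G G = L G by apply: (LE _ L G PL) => x; right.
  rewrite eF eG (LE _ L (a *: F + G) PL) ?bL.1//.
  apply: supp_subP => [|x nx]; first exact: (compact_closedM SS cK).
  rewrite CcE [F x]supp_out; last by move=> sx; apply: nx; left.
  by rewrite [G x]supp_out ?mulr0 ?addr0// => sx; apply: nx; right.
move=> A sA; have [[K cK AK] _] := (Cc_smallP A).1 sA.
have [L PL] := exK _ cK; have [c [d [bL _ _ _]]] := PL.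
apply: smallW (bL.2 _ sA) _ => _ [F AF <-]; exists F => //.
by rewrite (LE _ L F PL)//; exact: AK.
Qed.

Lemma Cc_ctensor : is_ctensor (@Cc_ext R M N S T).
Proof.
split; [exact: Cc_complete|exact: Cc_ext_bounded|move=> X b cX bB].
have [L bL LE] := tensor_exists cX bB; exists (mkhom bL); split=> // L' L'E.
apply: val_inj; apply: (ext_unique cX bL (homP L')) => f g.
by rewrite LE L'E.
Qed.

End TensorProduct2.

(** * Approximation by finite rank operators *)

Section FiniteRank.
Context {R : realType} {V W : bornType R}.

Definition frank (f : V -> W) := exists n (e : 'I_n -> W), forall x, lspan (range e) (f x).

Lemma frank0 : frank (fun=> 0).
Proof. by exists 0%N, (fun=> 0) => x; exact: lspan0. Qed.

Lemma frankD f g : frank f -> frank g -> frank (fun x => f x + g x).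
Proof.
move=> [n [e fe]] [m [d gd]].
exists (n + m)%N, (fun k => match fintype.split k with inl i => e i | inr j => d j end) => x.
apply: lspanD; [apply: lspanS (fe x)|apply: lspanS (gd x)].
  by move=> _ [i _ <-]; exists (lshift m i) => //; rewrite (unsplitK (inl i)).
by move=> _ [i _ <-]; exists (rshift n i) => //; rewrite (unsplitK (inr i)).
Qed.

Lemma frank1 (c : V -> R[i]) e : frank (fun x => c x *: e).
Proof.
exists 1%N, (fun=> e) => x; apply: lspanZ; apply: sub_lspan.
by exists ord0.
Qed.

Lemma frank_sum (I : Type) (s : seq I) (f : I -> V -> W) :
  (forall i, frank (f i)) -> frank (fun x => \sum_(i <- s) f i x).
Proof.
move=> fr; elim: s => [|i s IH]; first by under eq_fun do rewrite big_nil; exact: frank0.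
by under eq_fun do rewrite big_cons; exact: frankD.
Qed.

End FiniteRank.

Section DiskSpanMaps.
Context {R : realType} {V X : bornType R} (S : disk V).

Lemma val_bounded : small (S : set V) -> bounded_linear (val : dspan S -> V).
Proof.
move=> sS; split=> // B /dspan_smallP[r r0 Br].
apply: smallW (smallZ r%:C sS) _ => _ [x Bx <-].
by have [s Ss ->] := Br x Bx; exists s.
Qed.

(** The maps sending [S] into [A] form an equibounded disk, so a uniform rate on [S] is convergence
    in the space of bounded maps. *)
Lemma dspan_fast_cvg (g : nat -> bhom (dspan S) X) (j : bhom (dspan S) X) (A : set X) :
  is_disk A -> small A ->
  (forall n (x : dspan S), disk_set S (val x) -> scaled_in A (rate n) (g n x - j x)) ->
  fast_cvg g j.
Proof.
move=> dA sA gj.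
pose D : set (bhom (dspan S) X) := [set h | forall x, disk_set S (val x) -> A (h x)].
exists D; split.
- split; first by exists 0 => x _; exact: is_disk0.
  by move=> a b h k ab Dh Dk x Sx; apply: dA.2 => //; [exact: Dh|exact: Dk].
- move=> B /dspan_smallP[r r0 Br]; apply: smallW (smallZ r%:C sA) _.
  move=> _ [h [x [Dh Bx ->]]]; have [s Ss xs] := Br x Bx.
  have Ls : lspan S s by exact: sub_lspan.
  pose y : dspan S := DSpan (mem_set Ls : s \in dspan_pred S).
  exists (h y); first exact: Dh.
  have -> : x = r%:C *: y by apply: val_inj.
  by rewrite (linZ (homP h).1).
move=> n; exists ((rate n)%:C^-1 *: (g n - j)).
  move=> x Sx; have [t At e] := gj n x Sx.
  rewrite -[_ x]/((rate n)%:C^-1 *: (g n x - j x)) e scalerA mulVf ?scale1r//.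
  exact: realC_neq0 (rate_gt0 n).
by rewrite scalerA divff ?scale1r// realC_neq0// rate_gt0.
Qed.

End DiskSpanMaps.

(** The open gauge balls of integral radius cover the compact disk; finitely many suffice, so it is
    absorbed by the small disk [T]. *)
Lemma compact_disk_small (R : realType) (V : bornType R) (S : disk V) :
  compact_disk S -> small (S : set V).
Proof.
move=> [dS [T [sT [dT _ _] [ST cover]]]].
pose U (n : nat) : set V := [set x | gauge T x < n%:R].
have oU n : gauge_open T (U n).
  move=> x Tx /= xn; pose e := (n%:R - gauge T x) / 3%:R.
  have e0 : 0 < e by rewrite divr_gt0// subr_gt0.
  exists e => // y Ty yx; rewrite /U /=.
  have h1 : scaled_in T (gauge T x + e) x.
    by apply: gauge_lt_scaled => //; rewrite ltrDl.
  have h2 : scaled_in T e (y - x) by apply: gauge_lt_scaled => //; exact: lspanB.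
  have gx := gauge_ge0 T x.
  have := scaled_inD dT _ (ltW e0) h1 h2.
  rewrite [x + _]addrC subrK => /(_ (addr_ge0 gx (ltW e0))) h3.
  have p0 : 0 < gauge T x + e + e by rewrite addr_gt0// ltr_wpDl.
  apply: le_lt_trans (scaled_gauge dT p0 h3) _.
  have ee : e * 3%:R = n%:R - gauge T x by rewrite /e divfK.
  by move: ee e0 {xn}; move: (gauge T x) e {h1 h2 gx h3 p0 yx} => g e; lra.
have [x Sx|m [k Sk]] := cover nat U oU.
  have [N gN] : exists N : nat, gauge T x < N%:R.
    by exists (Num.trunc (gauge T x)).+1; exact: truncnS_gt.
  by exists N.
pose N := (\max_j k j)%N.
apply: smallW (smallZ (N%:R : R)%:C sT) _ => x Sx; have [j _ xj] := Sk x Sx.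
have [|t Tt ->] := @gauge_lt_scaled _ _ T x N%:R dT (ST x Sx).
  by apply: lt_le_trans xj _; rewrite ler_nat; exact: leq_bigmax.
by exists t.
Qed.

Lemma Cc_approximation (R : realType) (M : topologicalType) (S : smoothStructure R M) :
  approximation_property (Cc S).
Proof.
move=> D cD; have sD := compact_disk_small cD.
have [[K cK DK] _] := (Cc_smallP (D : set (Cc S))).1 sD.
have [n [psi [Q [psiK p1]]]] := cube_partition S cK.
pose F i := series (kcoef (Q := Q i)) (kvec (psiK i)).
pose f N x := \sum_i F i N x.
have fb N : bounded_linear (f N).
  by apply: bl_sum => i; exact: series_bounded (@kcoef_rapid _ _ _ (Q i)) (kvec_fast (psiK i)).
exists (fun N => mkhom (fb N)); split.
  move=> N; suff : frank (f N) by [].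
  by apply: frank_sum => i; apply: frank_sum => k; exact: frank1.
have vb := val_bounded sD.
exists (fun N => mkhom (bl_comp vb (fb N))), (mkhom vb); split => //.
apply: fast_born_cvg.
have [A AP] := choice (fun i => kseries_cvg (psiK i) sD).
pose B : set (Cc S) := disked_hull [set G | exists i, A i G].
have sB : small B.
  apply: small_hull.
  have h (s : seq 'I_n) : small [set G | exists i, i \in s /\ A i G].
    elim: s => [|i s IH]; first by apply: smallW (@small0 R (Cc S)) _ => G [i []].
    have [_ sA _] := AP i; apply: smallW (smallU sA IH) _ => G [j [+ AG]].
    by rewrite inE => /predU1P[ji|js]; [left; rewrite -ji|right; exists j].
  by apply: smallW (h (index_enum 'I_n)) _ => G [i AG]; exists i; rewrite mem_index_enum.
have dB : is_disk B by exact: is_disk_hull.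
have n1 : 0 <= n%:R :> R by [].
(* The dilation by [n], the number of cubes, absorbs the sum of the [n] errors, each at rate
   [rate N] in [B]. *)
apply: (dspan_fast_cvg (A := [set (n%:R : R)%:C *: G | G in B])).
- exact: is_diskZset.
- exact: smallZ.
move=> N x Dx; apply: scaled_in_scale => //=.
have eN : val x = \sum_i Cc_mul (psi i) (val x).
  apply: Cc_ext_eq => y; rewrite Cc_sumE.
  under eq_bigr do rewrite Cc_mulE.
  rewrite -mulr_suml; have [sy|ny] := pselect (supp (val x : Cc S) y).
    by rewrite p1 ?mul1r//; exact: (DK _ Dx).
  by rewrite (supp_out ny) mulr0.
rewrite [X in _ - X]eN /f -sumrB.
have -> : n%:R * rate N = \sum_(i < n) rate N :> R.
  by rewrite sumr_const card_ord mulr_natl.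
apply: scaled_in_sum => // i _; have [_ _ h] := AP i.
by apply: scaled_in_sub (h _ N Dx) => G AG; apply: sub_disked_hull; exists i.
Qed.

(** * Essential modules and multipliers *)

Section Quotients.
Context {R : realType}.

Lemma lspan_map (V W : bornType R) (D : V -> W) (A : set V) (N : set W) x : linear D ->
  (forall y, A y -> lspan N (D y)) -> lspan A x -> lspan N (D x).
Proof.
move=> Dl AN [n [c [y [Ay ->]]]]; rewrite (lin_sum Dl).
elim: (index_enum _) => [|k s IH]; first by rewrite big_nil; exact: lspan0.
by rewrite big_cons; apply: lspanD => //; rewrite (linZ Dl); apply: lspanZ; exact: AN.
Qed.

(* A section s of p on all of Q is not available for Q = Cc(X), only one for each
   small set or element; this suffices to identify the kernel and the bornology. *)
Lemma quotient_section (T Q : bornType R) (p : bhom T Q) (N : set T) :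
  complete_born Q -> (forall z, N z -> p z = 0) ->
  (forall F, exists (s : Q -> T) (u : nat -> T),
     [/\ bounded_linear s, fast_cvg u F & forall n, lspan N (u n - s (p (u n)))]) ->
  (forall B, small B -> exists2 s : Q -> T, bounded_linear s & forall w, B w -> p (s w) = w) ->
  is_quotient (born_closure (lspan N)) p.
Proof.
move=> cQ pN dense sec; have [pl pb] := homP p; split.
- move=> y; have [s _ sy] := sec [set y] (small_set1 y).
  by exists (s y); exact: sy.
- move=> x; split=> [px0 F [cF NF]|].
    (* The sequence in the relations converges to [x - s (p x)], which is [x] because [p x]
       vanishes. *)
    have [s [u [sb ux uN]]] := dense x; apply: (cF (fun n => u n - s (p (u n)))).
      by move=> n; apply: NF.
    apply: fast_born_cvg.
    have h := fast_cvg_lin (-1) (fast_cvg_comp sb (fast_cvg_comp (homP p) ux)) ux.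
    move: h; rewrite /= px0 (lin0 sb.1) scaler0 add0r; congr fast_cvg.
    by apply: funext => n; rewrite scaleN1r addrC.
  (* Conversely the kernel of [p] is closed, by uniqueness of limits in [Q], and contains the
     relations, so it contains their closure. *)
  move=> /(_ [set z | p z = 0]) h; apply: h; split.
    move=> u l /= u0 ul; apply: (born_cvg_unique cQ (born_cvg_comp (homP p) ul)).
    have -> : p \o u = fun=> 0 by apply: funext.
    exact: fast_born_cvg (fast_cvg_cst 0).
  move=> z [n [c [y [Ny ->]]]] /=; rewrite (lin_sum pl) big1// => k _.
  by rewrite (linZ pl) pN ?scaler0.
- move=> B; split=> [sB|[C sC <-]]; last exact: pb.
  have [s sb sB'] := sec B sB; exists (s @` B); first exact: sb.2.
  apply/seteqP; split=> [_ [_ [w Bw <-] <-]|w Bw]; first by rewrite sB'.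
  by exists (s w); [exists w|exact: sB'].
Qed.

Lemma id_isom (V : bornType R) : exists2 f : bhom V V, is_isom f & forall x, f x = x.
Proof.
have b : bounded_linear (@idfun V) by split=> // A; rewrite image_id.
by exists (mkhom b) => //; exists (mkhom b); split.
Qed.

Lemma bilin_swap (V W X : bornType R) (b : V -> W -> X) :
  bounded_bilinear b -> bounded_bilinear (fun w v => b v w).
Proof.
move=> [bl br bb]; split=> // A B sA sB; apply: smallW (bb _ _ sB sA) _.
by move=> _ [w [v [Aw Bv ->]]]; exists v, w.
Qed.

Lemma bilin_bounded_r (V W X : bornType R) (b : V -> W -> X) v :
  bounded_bilinear b -> bounded_linear (b v).
Proof.
move=> [bl br bb]; split=> // A sA; apply: smallW (bb _ _ (small_set1 v) sA) _.
by move=> _ [w Aw <-]; exists v, w.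
Qed.

End Quotients.

Section ProperPullback.
Context {R : realType} {X Y : topologicalType}.
Context (SX : smoothStructure R X) (SY : smoothStructure R Y) (q : X -> Y).
Hypothesis qs : smooth_map SX SY q.
Hypothesis qp : forall K, compact K -> compact (q @^-1` K).

Fact ppull_subproof (F : Cc SY) : (fun x => F (q x)) \in Cc_pred SX.
Proof.
apply: mem_set; split; first exact: (smooth_fun_pull qs (CcP F).1).
apply: (supp_sub_compact SX (qp (CcP F).2) _).2 => x nx.
by apply: supp_out; move=> sx; exact: nx.
Qed.
Definition ppull (F : Cc SY) : Cc SX := MkCc (ppull_subproof F).

Lemma ppullE F x : ppull F x = F (q x). Proof. by []. Qed.

Lemma ppull_bounded : bounded_linear ppull.
Proof.
split; first by move=> a F G; apply: Cc_ext_eq => x; rewrite CcE !ppullE CcE.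
move=> A /Cc_smallP[[K cK AK] fA]; apply: (small_image_cfam (qp cK)).
  by move=> F x AF nx; rewrite ppullE supp_out// => /(AK _ AF).
have w1 (p : Cc SY) : A p -> 1 <= 1 :> R by [].
exact: (cfam_pull w1 qs fA).
Qed.

End ProperPullback.

Section EssentialModules.
Context {R : realType} {M X : topologicalType}.
Context (S : smoothStructure R M) (SX : smoothStructure R X) (pr : X -> M).
Hypothesis prs : smooth_map SX S pr.
Hypothesis algH : is_born_alg (@Cc_mul R M S).
Let H := BornAlg algH.

(** A continuous map with a continuous left inverse is proper: the preimage of [K] is closed and
    lies in the compact image of [K] under the inverse. Graphs and diffeomorphisms are the cases
    needed. *)
Lemma compact_preimage_sub (Y : topologicalType) (SY : smoothStructure R Y) (q : X -> Y)
    (r : Y -> X) : continuous q -> continuous r -> (forall x, r (q x) = x) ->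
  forall K, compact K -> compact (q @^-1` K).
Proof.
move=> qc rc rq K cK; apply: (@subclosed_compact _ _ (r @` K)).
- apply: (@closed_comp _ _ q K); first by move=> x _; exact: qc.
  exact: (compact_closedM SY cK).
- by apply: continuous_compact cK; exact: continuous_subspaceT.
- by move=> x Kx; exists (q x).
Qed.

Lemma compact_image_pr K : compact K -> compact (pr @` K).
Proof. by move=> cK; apply: continuous_compact cK; exact: (continuous_subspaceT prs.1). Qed.

(** Under the concrete model of the tensor product the action is restriction to the graph of [pr], a
    proper embedding; so the quotient is [Cc SX] itself and [quotient_section] applies. *)
Lemma Cc_essential_left (la : H -> Cc SX -> Cc SX) :
  (forall h v x, la h v x = h (pr x) * v x) -> essential_left la.
Proof.
move=> laE.
have {laE} -> : la = pact prs.
  by apply: funext => h; apply: funext => v; apply: Cc_ext_eq => x; rewrite pactE laE.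
split; first exact: pact_bounded.
  by move=> f g v; apply: Cc_ext_eq => x; exact: esym (mulrA (f (pr x)) _ _).
have qs : smooth_map SX (prodStructure S SX) (fun x => (pr x, x)).
  exact: (smooth_map_pair prs (smooth_map_id SX)).
have qp := compact_preimage_sub (prodStructure S SX) qs.1 (smooth_map_snd S SX).1 (fun _ => erefl).
have [a ai aE] := id_isom (Cc SX).
exists (Cc (prodStructure S SX)), (@Cc_ext R M X S SX), (Cc SX),
  (mkhom (ppull_bounded qs qp)), a; split; [exact: Cc_ctensor| |exact: ai|]; last first.
  by move=> m v; rewrite aE; apply: Cc_ext_eq => x; rewrite pactE ppullE Cc_extE.
apply: quotient_section; first exact: Cc_complete.
- move=> _ [m [h [v ->]]]; apply: Cc_ext_eq => x.
  rewrite -[LHS]/((Cc_ext (bmul m h : Cc S) v - Cc_ext m (pact prs h v)) (pr x, x)).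
  rewrite CcBE !Cc_extE; apply/eqP; rewrite subr_eq0; apply/eqP.
  exact: esym (mulrA (m (pr x)) _ _).
- move=> F; have [u [chi [chi' [uF uN]]]] := ext_dense F.
  have sb := bilin_bounded_r chi (Cc_ext_bounded S SX).
  exists (Cc_ext chi), u; split => // n; move: (uN n).
  apply: (lspan_map (D := fun z => z - Cc_ext chi (ppull qs qp z))).
    move=> b y z; rewrite (ppull_bounded qs qp).1 sb.1 scalerBr opprD addrACA.
    by [].
  (* Because [chi] times [f] is [f], the difference is literally the defining relation for [chi],
     [f] and [g]. *)
  move=> _ [f [g [cf _ ->]]]; apply: sub_lspan; exists chi, f, g.
  rewrite (cf : @bmul R H chi f = f); congr (_ - Cc_ext _ _); apply: Cc_ext_eq => x.
  by rewrite ppullE Cc_extE pactE.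
move=> B sB; have [[K cK BK] _] := (Cc_smallP B).1 sB.
have [chi chi1] := cutoff S (compact_image_pr cK).
exists (Cc_ext chi); first exact: (bilin_bounded_r chi (Cc_ext_bounded S SX)).
move=> w Bw; apply: Cc_ext_eq => x; rewrite -[LHS]/(chi (pr x) * w x).
have [wx|nw] := pselect (supp w x); last by rewrite (supp_out nw) mulr0.
by rewrite chi1 ?mul1r//; exists x => //; exact: (BK w Bw).
Qed.

Lemma Cc_essential_right (ra : Cc SX -> H -> Cc SX) :
  (forall v h x, ra v h x = v x * h (pr x)) -> essential_right ra.
Proof.
move=> raE.
have {raE} -> : ra = fun v h => pact prs h v.
  apply: funext => v; apply: funext => h; apply: Cc_ext_eq => x.
  by rewrite pactE raE mulrC.
split; first exact: (bilin_swap (pact_bounded prs)).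
  move=> v f g; apply: Cc_ext_eq => x.
  rewrite -[LHS]/(Cc_fun f (pr x) * Cc_fun g (pr x) * v x) !pactE.
  by rewrite -mulrA mulrCA.
have qs : smooth_map SX (prodStructure SX S) (fun x => (x, pr x)).
  exact: (smooth_map_pair (smooth_map_id SX) prs).
have qp := compact_preimage_sub (prodStructure SX S) qs.1 (smooth_map_fst SX S).1 (fun _ => erefl).
have [a ai aE] := id_isom (Cc SX).
exists (Cc (prodStructure SX S)), (@Cc_ext R X M SX S), (Cc SX),
  (mkhom (ppull_bounded qs qp)), a; split; [exact: Cc_ctensor| |exact: ai|]; last first.
  by move=> m v; rewrite aE; apply: Cc_ext_eq => x; rewrite pactE ppullE Cc_extE mulrC.
have sb (chi : Cc S) : bounded_linear (fun w : Cc SX => Cc_ext w chi).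
  exact: (bilin_bounded_r chi (bilin_swap (Cc_ext_bounded SX S))).
apply: quotient_section; first exact: Cc_complete.
- move=> _ [m [h [v ->]]]; apply: Cc_ext_eq => x.
  rewrite -[LHS]/((Cc_ext (pact prs h m) v - Cc_ext m (bmul h v : Cc S)) (x, pr x)).
  rewrite CcBE !Cc_extE; apply/eqP; rewrite subr_eq0 pactE; apply/eqP.
  by rewrite -[RHS]/(m x * (h (pr x) * v (pr x))) -mulrA mulrCA.
- move=> F; have [u [chi' [chi [uF uN]]]] := ext_dense F.
  exists (fun w : Cc SX => Cc_ext w chi), u; split; [exact: sb|exact: uF|] => n; move: (uN n).
  apply: (lspan_map (D := fun z => z - Cc_ext (ppull qs qp z) chi)).
    move=> b y z; rewrite (ppull_bounded qs qp).1 (sb chi).1 scalerBr opprD addrACA.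
    by [].
  move=> _ [f [g [_ cg ->]]]; rewrite -opprB -scaleN1r; apply: lspanZ.
  apply: sub_lspan; exists f, g, chi.
  have -> : @bmul R H g chi = g.
    by apply: Cc_ext_eq => x; rewrite -[RHS](congr1 (fun h : Cc S => h x) cg) Cc_mulE mulrC.
  congr (Cc_ext _ _ - _); apply: Cc_ext_eq => x.
  by rewrite ppullE Cc_extE pactE mulrC.
move=> B sB; have [[K cK BK] _] := (Cc_smallP B).1 sB.
have [chi chi1] := cutoff S (compact_image_pr cK).
exists (fun w : Cc SX => Cc_ext w chi); first exact: sb.
move=> w Bw; apply: Cc_ext_eq => x; rewrite -[LHS]/(w x * chi (pr x)).
have [wx|nw] := pselect (supp w x); last by rewrite (supp_out nw) mul0r.
by rewrite chi1 ?mulr1//; exists x => //; exact: (BK w Bw).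
Qed.

End EssentialModules.

(** * Multipliers as smooth functions *)

Section FunctionMultipliers.
Context {R : realType} {X : topologicalType} (SX : smoothStructure R X).
Hypothesis algX : is_born_alg (@Cc_mul R X SX).
Let K := BornAlg algX.

Lemma mult_eq (H : bornAlg R) (m n : multiplier H) :
  (forall F, mL m F = mL n F) -> (forall F, mR m F = mR n F) -> m = n.
Proof.
move=> hL hR; apply: val_inj; rewrite [val m]surjective_pairing [val n]surjective_pairing.
by congr pair; apply: val_inj; apply: funext; [exact: hL|exact: hR].
Qed.

Definition smul_hom phi (phis : smooth_fun SX phi) : bhom K K :=
  @mkhom R (K : bornType R) K (smulC phis) (smulC_bounded phis).

Fact mfun_subproof phi (phis : smooth_fun SX phi) :
  (smul_hom phis, smul_hom phis) \in @mult_pred R K.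
Proof.
apply: mem_set => f g; split; apply: Cc_ext_eq => x.
- exact: mulrA.
- exact: mulrCA.
- by rewrite -[LHS]/(f x * (phi x * g x)) -[RHS]/(phi x * f x * g x) mulrCA mulrA.
Qed.
Definition mfun phi (phis : smooth_fun SX phi) : multiplier K :=
  Multiplier (mfun_subproof phis).

Lemma mfunLE phi (phis : smooth_fun SX phi) (F : Cc SX) x :
  (mL (mfun phis) F : Cc SX) x = phi x * F x.
Proof. by []. Qed.

Lemma bump1 (x : X) : exists chi : Cc SX, chi x = 1.
Proof.
have [chi [V [_ Vx V1 _]]] := bump SX openT (Logic.I : setT x).
by exists chi; exact: V1.
Qed.

(** The candidate for the function: the value at [x] of the multiplier applied to a bump equal to 1
    at [x]. Independence of the bump is a consequence of [mvalL]. *)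
Definition mval (m : multiplier K) x : R[i] :=
  (mL m (projT1 (cid (bump1 x)) : K) : Cc SX) x.

(** By commutativity and the multiplier law, [m F] times [chi] equals [m chi] times [F]; evaluation
    at [x] gives the claim. *)
Lemma mvalL (m : multiplier K) (F : Cc SX) x :
  (mL m F : Cc SX) x = mval m x * F x.
Proof.
rewrite /mval; case: cid => chi /= chi1.
have [h1 _ _] := multP m F chi; have [h2 _ _] := multP m chi F.
have e : @bmul R K F chi = @bmul R K chi F.
  by apply: Cc_ext_eq => y; exact: mulrC.
rewrite e h2 in h1; have := congr1 (fun G : Cc SX => G x) h1.
rewrite -[X in X = _]/((mL m (chi : K) : Cc SX) x * F x).
by rewrite -[X in _ = X]/((mL m F : Cc SX) x * chi x) chi1 mulr1.
Qed.

Lemma mvalR (m : multiplier K) (F : Cc SX) x :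
  (mR m F : Cc SX) x = mval m x * F x.
Proof.
have [chi chi1] := bump1 x.
have [_ _ h] := multP m F chi; have := congr1 (fun G : Cc SX => G x) h.
rewrite -[X in X = _]/(F x * (mL m chi : Cc SX) x) mvalL chi1 mulr1 mulrC => ->.
by rewrite -[RHS]/((mR m F : Cc SX) x * chi x) chi1 mulr1.
Qed.

(** Where a bump equals 1 the function coincides with the test function obtained by applying the
    multiplier to that bump. *)
Lemma mval_smooth (m : multiplier K) : smooth_fun SX (mval m).
Proof.
apply: smooth_fun_local => x; have [c Ac cx] := atlas_cover SX x.
have [chi [V [oV Vx V1 _]]] := bump SX (cdom_open c) cx.
have oW : open (cdom c `&` V) by apply: openI => //; exact: cdom_open.
exists c, (cdom c `&` V); split; [exact: Ac|exact: oW|by []|by move=> y []|].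
move=> b; have oU := chart_open c oV.
have hs : smooth_on (cphi c @` (cdom c `&` V))
    (fun y => cpart b ((mL m chi : Cc SX) (cpsi c y))).
  have [f1 f2] := (CcP (mL m chi : Cc SX)).1 c Ac.
  apply: (@smooth_onW _ _ _ (cphi c @` cdom c)); first by apply: image_subset => y [].
  by case: b; [exact: f1|exact: f2].
apply: (eq_smooth_on oU _ hs) => _ [y [cy Vy] <-]; rewrite cphiK//.
by rewrite mvalL V1 ?mulr1.
Qed.

Lemma mval_mfun phi (phis : smooth_fun SX phi) x : mval (mfun phis) x = phi x.
Proof.
have [chi chi1] := bump1 x; have := mvalL (mfun phis) chi x.
by rewrite mfunLE chi1 !mulr1.
Qed.

Lemma mval_eq (m n : multiplier K) : mval m =1 mval n -> m = n.
Proof.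
move=> mn; apply: mult_eq => F; apply: Cc_ext_eq => x.
  by rewrite !mvalL mn.
by rewrite !mvalR mn.
Qed.

Lemma mval_lin a (m n : multiplier K) x : mval (a *: m + n) x = a * mval m x + mval n x.
Proof.
have [chi chi1] := bump1 x; have := mvalL (a *: m + n) chi x.
rewrite -[X in X = _ -> _]/((a *: mL m (chi : K) + mL n (chi : K) : Cc SX) x) CcE !mvalL.
by rewrite chi1 (mulr1 (mval m x)) (mulr1 (mval n x)) (mulr1 (mval _ x)) => ->.
Qed.

Lemma mval_one x : mval mone x = 1.
Proof.
have [chi chi1] := bump1 x; have := mvalL mone chi x.
by rewrite chi1 mulr1 => <-.
Qed.

Lemma mval_mul (m n : multiplier K) x : mval (mmul m n) x = mval m x * mval n x.
Proof.
have [chi chi1] := bump1 x; have := mvalL (mmul m n) chi x.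
rewrite -[X in X = _ -> _]/((mL m (mL n (chi : K)) : Cc SX) x) !mvalL.
by rewrite chi1 (mulr1 (mval n x)) (mulr1 (mval (mmul m n) x)) => ->.
Qed.

Lemma mval_embed (f : Cc SX) x : mval (membed (f : K)) x = f x.
Proof.
have [chi chi1] := bump1 x; have := mvalL (membed (f : K)) chi x.
rewrite -[X in X = _ -> _]/(f x * chi x).
by rewrite chi1 (mulr1 (f x)) (mulr1 (mval _ x)) => ->.
Qed.

End FunctionMultipliers.

Section PullbackHom.
Context {R : realType} {M X : topologicalType}.
Context (S : smoothStructure R M) (SX : smoothStructure R X) (pr : X -> M).
Hypothesis prs : smooth_map SX S pr.
Hypothesis algM : is_born_alg (@Cc_mul R M S).
Hypothesis algX : is_born_alg (@Cc_mul R X SX).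
Let H := BornAlg algM.
Let K := BornAlg algX.

Definition mpull (phi : M -> R[i]) (phis : smooth_fun S phi) : multiplier K :=
  mfun algX (smooth_fun_pull prs phis).

Lemma pullhom_bounded :
  bounded_linear (fun h : Cc S => mpull (CcP h).1 : multiplier K).
Proof.
split; first by move=> a f g; apply: mval_eq => x; rewrite mval_lin !mval_mfun CcE.
have [_ _ pb] := pact_bounded prs.
by move=> A sA; split=> B sB; apply: smallW (pb _ _ sA sB) _ => _ [_ [F [[_ [f Af <-] <-] BF ->]]];
  exists f, F; split.
Qed.

Definition pullhom : bhom H (multiplier K) :=
  @mkhom R (H : bornType R) (multiplier K) _ pullhom_bounded.

Lemma mval_pullhom (h : Cc S) x : mval (pullhom h) x = h (pr x).
Proof. exact: mval_mfun. Qed.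

Lemma pullhom_essential : essential_hom pullhom.
Proof.
split.
- move=> f g; apply: mval_eq => x; rewrite mval_mul !mval_pullhom.
  by [].
- have := @Cc_essential_left R M X S SX pr prs algM
    (fun h (k : Cc SX) => mL (pullhom h) (k : K) : Cc SX).
  by apply=> h v x; rewrite mvalL mval_pullhom.
- have := @Cc_essential_right R M X S SX pr prs algM
    (fun (k : Cc SX) h => mR (pullhom h) (k : K) : Cc SX).
  by apply=> v h x; rewrite mvalR mval_pullhom mulrC.
Qed.

(** The bornology on multipliers only controls products with small sets. A cutoff that is 1 on the
    image of the common support replaces each multiplier by its product with that cutoff, and these
    products form a small set. *)
Lemma pullext_bounded :
  bounded_linear (fun m : multiplier H => mpull (mval_smooth m) : multiplier K).
Proof.
split; first by move=> a f g; apply: mval_eq => x; rewrite mval_lin !mval_mfun mval_lin.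
move=> A [sA _].
have key (B : set (Cc SX)) : small B -> small
    [set F : Cc SX | exists m G, [/\ A m, B G & F = smulC (smooth_fun_pull prs (mval_smooth m)) G]].
  move=> sB; have [[L cL BL] _] := (Cc_smallP B).1 sB.
  have [chi chi1] := cutoff S (compact_image_pr prs cL).
  have [_ _ pb] := pact_bounded prs.
  have s1 := sA _ (small_set1 (chi : H)).
  apply: smallW (pb _ _ s1 sB) _ => _ [m [G [Am BG ->]]].
  exists (mL m (chi : H)), G; split => //; first by exists (mL m), chi; split => //; exists m.
  apply: Cc_ext_eq => x; rewrite smulCE pactE mvalL.
  have [Gx|nG] := pselect (supp G x); last by rewrite (supp_out nG) !mulr0.
  by rewrite chi1 ?mulr1//; exists x => //; exact: (BL G BG).
by split=> B sB; apply: smallW (key B sB) _ => _ [_ [G [[_ [m Am <-] <-] BG ->]]];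
  exists m, G; split.
Qed.

Definition pullext : bhom (multiplier H) (multiplier K) := mkhom pullext_bounded.

Lemma mval_pullext (m : multiplier H) x : mval (pullext m) x = mval m (pr x).
Proof. exact: mval_mfun. Qed.

Lemma pullhom_extension : is_extension pullhom pullext.
Proof.
split.
- by apply: mval_eq => x; rewrite mval_pullext !mval_one.
- by move=> m n; apply: mval_eq => x; rewrite mval_mul !mval_pullext mval_mul.
- by move=> f; apply: mval_eq => x; rewrite mval_pullext mval_pullhom mval_embed.
Qed.

End PullbackHom.

Lemma Cc_alg (R : realType) (M : topologicalType) (S : smoothStructure R M) :
  is_born_alg (@Cc_mul R M S).
Proof.
have e : @Cc_mul R M S = pact (smooth_map_id S).
  by apply: funext => f; apply: funext => g; apply: Cc_ext_eq => x; rewrite pactE Cc_mulE.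
split; [exact: Cc_complete|rewrite e; exact: pact_bounded|].
by move=> f g h; apply: Cc_ext_eq => x; rewrite !Cc_mulE mulrA.
Qed.

(** * The Haar functional *)

Section TestFunctionBounds.
Context {R : realType} {M : topologicalType} (S : smoothStructure R M).
Local Notation normc := ComplexField.Normc.normc.

Lemma Cc_continuous (f : Cc S) b : continuous (fun x => cpart b (f x)).
Proof.
move=> x; have [c Ac cx] := atlas_cover S x.
have [f1 f2] := (CcP f).1 c Ac.
have fc : {for cphi c x, continuous (fun y => cpart b (f (cpsi c y)))}.
  have cix : (cphi c @` cdom c) (cphi c x) by exists x.
  by case: b; [exact: (f1 [::] _ cix).1|exact: (f2 [::] _ cix).1].
have h : {for x, continuous (fun y => cpart b (f (cpsi c (cphi c y))))}.
  exact: (@continuous_comp _ _ _ (cphi c) (fun y => cpart b (f (cpsi c y))) x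
    (cphi_continuous cx) fc).
have near_eq : {near x, (fun y => cpart b (f (cpsi c (cphi c y)))) =1 (fun y => cpart b (f y))}.
  have nc : \forall y \near x, cdom c y by exact: open_nbhs_nbhs (conj (cdom_open c) cx).
  by apply: filterS nc => y cy /=; rewrite cphiK.
rewrite /continuous_at -[f x](congr1 f (cphiK cx)).
exact: cvg_trans (near_eq_cvg near_eq) h.
Qed.

Lemma small_sup (A : set (Cc S)) : small A -> exists2 K, compact K & exists2 C, 0 <= C &
  forall f, A f -> forall x, normc (f x) <= C * \1_K x.
Proof.
move=> sA; have [[K cK AK] fA] := (Cc_smallP A).1 sA.
have w1 (f : Cc S) : A f -> 1 <= 1 :> R by [].
have [C [C0 AC]] : exists C, 0 <= C /\ forall f x, A f -> K x -> normc (f x) <= C.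
  apply: (compact_induction (P := fun L => exists C, 0 <= C /\
    forall f x, A f -> L x -> normc (f x) <= C) cK).
  - by exists 0.
  - by move=> L L' LL' [C [C0 h]]; exists C; split => // f x Af /LL'; exact: h.
  - move=> L L' [C [C0 h]] [D [D0 h']]; exists (C + D); split; first exact: addr_ge0.
    move=> f x Af [Lx|Lx]; first by apply: le_trans (h f x Af Lx) _; rewrite lerDl.
    by apply: le_trans (h' f x Af Lx) _; rewrite lerDr.
  move=> x _; have [c Ac cx] := atlas_cover S x.
  have [L [cL nL _ Lc]] := chart_nbhs cx openT (Logic.I : setT x).
  have [C [m [C0 fC]]] := cfam_jet [::] w1 fA Ac cL Lc.
  exists L; first exact: nL.
  exists C; split => // f y Af Ly; have := fC f y Af Ly.
  by rewrite csem_point cphiK ?expr1n ?mulr1//; exact: Lc.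
exists K => //; exists C => // f Af x; rewrite indicE.
have [xK|xK] := pselect (K x); first by rewrite mem_set// mulr1; exact: AC.
rewrite memNset// mulr0 [f x]supp_out ?ComplexField.Normc.normc0//.
by move=> /(AK f Af).
Qed.

End TestFunctionBounds.

Section HaarIntegral.
Context {R : realType} {G : topGroupType}.
Hypothesis hG : hausdorff_space G.
Hypothesis mulc : continuous (fun x : G * G => (x.1 * x.2)%g).
Variable mu : {measure set (borel G) -> \bar R}.
Hypothesis muH : is_left_haar mu.

Lemma borel_open (U : set G) : open U -> measurable (U : set (borel G)).
Proof. by move=> oU; apply: sub_sigma_algebra. Qed.

Lemma borel_compact (K : set G) : compact K -> measurable (K : set (borel G)).
Proof.
move=> cK; rewrite -[K]setCK; apply: measurableC; apply: borel_open.
by rewrite openC; exact: (compact_closed hG).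
Qed.

Lemma continuous_measurable (g : G -> R) : continuous g ->
  measurable_fun [set: borel G] (g : borel G -> R).
Proof.
move=> gc; apply: (measurability _ (measurable_realfun.RGenOInfty.measurableE R)) => // _ [_ [x ->] <-].
rewrite setTI; apply: borel_open; apply: open_comp => [y _|]; first exact: gc.
exact: interval_open.
Qed.

Lemma lmul_measurable (x : G) :
  measurable_fun [set: borel G] ((fun y : borel G => (x * y)%g : borel G)).
Proof.
apply: (@measurability _ _ (borel G) (borel G) setT _ (@open G)) => // _ [U oU <-].
rewrite setTI; apply: borel_open; apply: open_comp => // y _.
exact: lmul_continuous.
Qed.

Lemma integrable_indic_compact (K : set G) : compact K ->
  mu.-integrable [set: borel G] (fun x => (\1_K x : R)%:E).
Proof.
move=> cK; have mK := borel_compact cK; have [_ fin _] := muH.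
apply/integrableP; split.
  by apply/measurable_EFinP; exact: measurable_indic.
under eq_integral do rewrite /= ger0_norm//.
by rewrite integral_indic// setIT; exact: fin.
Qed.

Lemma integrable_bounded (g : G -> R) K C : continuous g -> compact K ->
  (forall x, `|g x| <= C * \1_K x) -> mu.-integrable [set: borel G] (EFin \o g).
Proof.
move=> gc cK gK.
have iK := integrableZl (measurableT : measurable [set: borel G]) C
  (integrable_indic_compact cK).
apply: (le_integrable measurableT _ _ iK).
  by apply/measurable_EFinP; exact: continuous_measurable.
by move=> x _ /=; rewrite lee_fin (le_trans (gK x))// ler_norm.
Qed.

Lemma Rintegral_bounded (g : G -> R) K C : continuous g -> compact K ->
  (forall x, `|g x| <= C * \1_K x) ->
  `|\int[mu]_(x in [set: borel G]) g x| <= C * fine (mu K).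
Proof.
move=> gc cK gK; have ig := integrable_bounded gc cK gK.
have mT : measurable [set: borel G] by exact: measurableT.
have iK := integrable_indic_compact cK; have iCK := integrableZl mT C iK.
have ign : mu.-integrable [set: borel G] (EFin \o (fun x => `|g x|)) by exact: integrable_norm.
have h1 := le_normr_Rintegral mT ig.
have h2 := le_Rintegral mT ign iCK (fun x _ => gK x).
apply: le_trans h1 _; apply: le_trans h2 _.
rewrite (RintegralZl C mT iK) /Rintegral integral_indic ?setIT//; exact: borel_compact.
Qed.

Lemma Rintegral_gt0 (g : G -> R) U e : mu.-integrable [set: borel G] (EFin \o g) ->
  continuous g -> (forall x, 0 <= g x) -> open U -> (0 < mu U)%E -> 0 < e ->
  (forall x, U x -> e <= g x) -> 0 < \int[mu]_(x in [set: borel G]) g x.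
Proof.
move=> ig gc g0 oU mU e0 Ug; have mUm := borel_open oU.
apply: fine_gt0; apply/andP; split; last exact: integrable_lty.
apply: (@lt_le_trans _ _ (\int[mu]_(x in [set: borel G]) (e%:E * (\1_U x : R)%:E))%E).
  rewrite ge0_integralZl//; last 2 first.
  - by apply/measurable_EFinP; exact: measurable_indic.
  - by rewrite lee_fin ltW.
  by rewrite integral_indic// setIT mule_gt0.
apply: ge0_le_integral => //.
- by move=> x _; rewrite mule_ge0// lee_fin ltW.
- by apply: measurable_funeM; apply/measurable_EFinP; exact: measurable_indic.
- by apply/measurable_EFinP; exact: continuous_measurable.
move=> x _; rewrite -EFinM lee_fin indicE.
have [Ux|nU] := pselect (U x); first by rewrite mem_set// mulr1; exact: Ug.
by rewrite memNset// mulr0.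
Qed.

Lemma Rintegral_lmul (g : G -> R) (x : G) : continuous g ->
  mu.-integrable [set: borel G] (EFin \o g) ->
  mu.-integrable [set: borel G] (EFin \o (fun y => g (x * y)%g)) ->
  \int[mu]_(y in [set: borel G]) g (x * y)%g = \int[mu]_(y in [set: borel G]) g y.
Proof.
move=> gc ig igx; have mx := lmul_measurable x; rewrite /Rintegral; congr fine.
have mg : measurable_fun [set: borel G] (EFin \o g).
  by apply/measurable_EFinP; exact: continuous_measurable.
have := integral_pushforward mx (mu := mu) (D := setT) mg igx measurableT.
rewrite preimage_setT => <-.
apply: eq_measure_integral => A mA _; rewrite /pushforward.
(* The pushforward of the measure at [A] is the measure of the preimage, which is the translate of
   [A] by the inverse of [x]. *)
have [_ _ inv] := muH; rewrite -(inv x^-1%g A mA); congr (mu _).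
apply/seteqP; split=> [y /= Ay|_ [y Ay <-]] /=; last by rewrite mulVKg.
by exists (x * y)%g => //; rewrite mulKg.
Qed.

End HaarIntegral.

Section HaarFunctional.
Context {R : realType} (G : lieGroup R).
Let S := lie_smooth G.
Local Notation normc := ComplexField.Normc.normc.
Variable mu : {measure set (borel G) -> \bar R}.
Hypothesis muH : is_left_haar mu.
Hypothesis mupos : forall U : set G, open U -> U !=set0 -> (0 < mu U)%E.
Let hG : hausdorff_space G := smooth_hausdorff S.

Definition hint (f : Cc S) : R[i] := haar_integral mu f.

Lemma cpart_hint b f : cpart b (hint f) = \int[mu]_(x in [set: borel G]) cpart b (f x).
Proof. by case: b. Qed.

Lemma part_integrable (f : Cc S) b :
  mu.-integrable [set: borel G] (EFin \o (fun x => cpart b (f x))).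
Proof.
have [K cK [C C0 fC]] := small_sup (small_set1 f).
apply: (integrable_bounded hG muH (@Cc_continuous _ _ S f b) cK (C := C)) => x.
exact: le_trans (cpart_le b _) (fC f (erefl f) x).
Qed.

Lemma hint_lin a f g : hint (a *: f + g) = a * hint f + hint g.
Proof.
have mT : measurable [set: borel G] by exact: measurableT.
have iZ z (h : Cc S) b := integrableZl mT z (part_integrable h b).
apply: cpart_eq => b; rewrite cpartD !cpart_hint.
have e1 (h : Cc S) b' z : \int[mu]_(x in [set: borel G]) (z * cpart b' (h x)) =
    z * cpart b' (hint h) by rewrite cpart_hint (RintegralZl z mT (part_integrable h b')).
have iD z1 z2 (h : Cc S) b1 b2 : mu.-integrable [set: borel G]
    (EFin \o (fun x => z1 * cpart b1 (h x) + z2 * cpart b2 (h x))).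
  exact: (integrableD mT (iZ z1 h b1) (iZ z2 h b2)).
have e2 z1 z2 (h : Cc S) b1 b2 : \int[mu]_(x in [set: borel G])
    (z1 * cpart b1 (h x) + z2 * cpart b2 (h x)) =
    z1 * cpart b1 (hint h) + z2 * cpart b2 (hint h).
  by rewrite (RintegralD mT (iZ z1 h b1) (iZ z2 h b2)) !e1.
pose s : R := if b then - complex.Im a else complex.Im a.
have -> : (fun x => cpart b ((a *: f + g) x)) =
    fun x => (complex.Re a * cpart b (f x) + s * cpart (~~ b) (f x)) + cpart b (g x).
  apply: funext => x; rewrite CcE cpartD /s; congr (_ + _).
  by case: (f x) => u v; case: a {s} => p q; case: b => /=; ring.
rewrite (RintegralD mT (iD _ _ f _ _) (part_integrable g b)) e2 -(cpart_hint b g).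
congr (_ + _); rewrite /s; case: (hint f) => u v; case: a {s} => p q.
by case: b => /=; ring.
Qed.

Lemma hint_bounded : @bounded_functional R (Cc S) hint.
Proof.
split; first exact: hint_lin.
move=> A sA; have [K cK [C C0 fC]] := small_sup sA.
pose r := C * fine (mu K); exists (r + r)%:C => f Af.
rewrite normcE' lecR; apply: le_trans (normc_le_parts _) _.
have h b : `|cpart b (hint f)| <= r.
  rewrite cpart_hint; apply: (Rintegral_bounded hG muH (@Cc_continuous _ _ S f b) cK) => x.
  exact: le_trans (cpart_le b _) (fC f Af x).
exact: lerD (h true) (h false).
Qed.

Lemma hint_lmul (f g : Cc S) x : (forall y, g y = f (x * y)%g) -> hint g = hint f.
Proof.
move=> gf; apply: cpart_eq => b; rewrite !cpart_hint.
have e : (fun y => cpart b (g y)) = fun y => cpart b (f (x * y)%g).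
  by apply: funext => y; rewrite gf.
have ig := part_integrable g b; rewrite e in ig; rewrite e.
have mulc := (lie_mul_smooth G).1.
exact: (Rintegral_lmul mulc muH (@Cc_continuous _ _ S f b) (part_integrable f b) ig).
Qed.

Fact Cc_conj_subproof (f : Cc S) : (fun x => (f x)^*%C) \in Cc_pred S.
Proof.
apply: mem_set; split; last first.
  by apply: supp_sub (CcP f).2 => x ->; rewrite conjc0.
move=> c Ac; have [f1 f2] := (CcP f).1 c Ac; have oU := cimg_open c; split.
  by apply: (eq_smooth_on oU _ f1) => y _ /=; case: (f _).
have h := smooth_on_affine 0 (-1) oU f2.
by apply: (eq_smooth_on oU _ h) => y _ /=; case: (f _) => u v /=; rewrite add0r mulN1r.
Qed.
Definition Cc_conj (f : Cc S) : Cc S := MkCc (Cc_conj_subproof f).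

(** The product of [f] with its conjugate is nonnegative and continuous; if [f] were nonzero it
    would exceed a positive constant on a nonempty open set, which has positive measure. *)
Lemma hint_conj_eq0 (f : Cc S) : hint (Cc_mul f (Cc_conj f)) = 0 -> f = 0.
Proof.
move=> h0; apply: Cc_ext_eq => x0; apply: contrapT => /eqP fx0.
set g := Cc_mul f (Cc_conj f) in h0.
have gE x : cpart true (g x) = cpart true (f x) ^+ 2 + cpart false (f x) ^+ 2.
  rewrite -[g x]/(f x * (f x)^*%C); case: (f x) => u v /=; ring.
have g0 x : 0 <= cpart true (g x) by rewrite gE addr_ge0 ?sqr_ge0.
have gx0 : 0 < cpart true (g x0).
  rewrite lt_neqAle g0 andbT eq_sym; apply: contra fx0.
  rewrite gE paddr_eq0 ?sqr_ge0// !sqrf_eq0 => /andP[/eqP h1 /eqP h2].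
  by apply/eqP/cpart_eq => -[]; rewrite ?h1 ?h2.
pose e := cpart true (g x0) / 2.
have e0 : 0 < e by rewrite divr_gt0.
pose U : set G := [set x | e < cpart true (g x)].
have gc := @Cc_continuous _ _ S g true.
have oU : open U.
  apply: (@open_comp _ _ (fun x => cpart true (g x)) [set y | e < y]); last exact: open_gt.
  by move=> x _; exact: gc.
have Ux0 : U x0 by rewrite /U /= ltr_pdivrMr// ltr_pMr// ltr1n.
have mU : (0 < mu U)%E by apply: mupos => //; exists x0.
have := Rintegral_gt0 (part_integrable g true) gc g0 oU mU e0 (fun x Ux => ltW Ux).
by rewrite -cpart_hint h0 /= ltxx.
Qed.

Lemma hint_faithful : @faithful R (BornAlg (Cc_alg S)) hint.
Proof.
split=> f h; apply: hint_conj_eq0; first exact: h.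
rewrite -[RHS](h (Cc_conj f)); congr hint.
by apply: Cc_ext_eq => x; exact: mulrC.
Qed.

End HaarFunctional.

Section Diffeomorphisms.
Context {R : realType} {X : topologicalType} (SX : smoothStructure R X) (q r : X -> X).
Hypothesis qs : smooth_map SX SX q.
Hypothesis rs : smooth_map SX SX r.
Hypothesis rq : forall x, r (q x) = x.
Hypothesis qr : forall x, q (r x) = x.

Let qp := compact_preimage_sub SX qs.1 rs.1 rq.
Let rp := compact_preimage_sub SX rs.1 qs.1 qr.

Lemma diffeo_isom : exists2 g : bhom (Cc SX) (Cc SX), is_isom g &
  forall F x, g F x = F (q x).
Proof.
exists (mkhom (ppull_bounded qs qp)) => //; exists (mkhom (ppull_bounded rs rp)).
split=> F; apply: Cc_ext_eq => x.
- by rewrite -[LHS]/(F (q (r x))) qr.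
- by rewrite -[LHS]/(F (r (q x))) rq.
Qed.

End Diffeomorphisms.

Lemma ctensor_isom (R : realType) (V W T T' : bornType R) (t : V -> W -> T) (e : T -> T')
    (e' : T' -> T) : complete_born T' -> bounded_linear e -> bounded_linear e' ->
  cancel e e' -> cancel e' e -> is_ctensor t -> is_ctensor (fun v w => e (t v w)).
Proof.
move=> cT' [el eb] [el' eb'] ee' e'e [cT [tl tr tb] tu]; split=> //.
  split=> [w|v|A B sA sB].
  - by move=> a u v; rewrite tl el.
  - by move=> a u w; rewrite tr el.
  apply: smallW (eb _ (tb _ _ sA sB)) _ => _ [v [w [Av Bw ->]]].
  by exists (t v w) => //; exists v, w.
move=> X b cX bB; have [L [LE Lu]] := tu X b cX bB.
exists (mkhom (bl_comp (conj el' eb') (homP L))); split=> [v w|L' L'E].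
  by rewrite /= ee' LE.
have -> : L = mkhom (bl_comp (conj el eb) (homP L')) by apply: Lu => v w; rewrite /= L'E.
by apply: val_inj; apply: funext => x; rewrite /= e'e.
Qed.

(** * The quantum group *)

Section LieGroup.
Context {R : realType} (G : lieGroup R).
Let S := lie_smooth G.
Let SS := prodStructure S S.
Let S3 := prodStructure SS S.
Let S3' := prodStructure S SS.
Let H := BornAlg (Cc_alg S).
Let HH := BornAlg (Cc_alg SS).
Let HHH := BornAlg (Cc_alg S3).
Implicit Types (f g h : Cc S) (F : Cc SS) (x y z : G) (p : G * G).

Let mulS : smooth_map SS S (fun p => (p.1 * p.2)%g) := lie_mul_smooth G.

Lemma smooth_map_mul (M : topologicalType) (T : smoothStructure R M) (a b : M -> G) :
  smooth_map T S a -> smooth_map T S b -> smooth_map T S (fun m => (a m * b m)%g).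
Proof. by move=> sa sb; exact: (smooth_map_comp (smooth_map_pair sa sb) mulS). Qed.

Lemma smooth_map_inv (M : topologicalType) (T : smoothStructure R M) (a : M -> G) :
  smooth_map T S a -> smooth_map T S (fun m => ((a m)^-1)%g).
Proof. by move=> sa; exact: (smooth_map_comp sa (lie_inv_smooth G)). Qed.

Let s1 : smooth_map SS S fst := smooth_map_fst S S.
Let s2 : smooth_map SS S snd := smooth_map_snd S S.

Definition comult : bhom H (multiplier HH) := pullhom mulS (Cc_alg S) (Cc_alg SS).

Lemma mval_comult f p : mval (comult f) p = f (p.1 * p.2)%g.
Proof. exact: mval_pullhom. Qed.

Lemma Cc_tensor_alg (M N : topologicalType) (T : smoothStructure R M) (U : smoothStructure R N) :
  @is_tensor_alg R (BornAlg (Cc_alg T)) (BornAlg (Cc_alg U))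
    (BornAlg (Cc_alg (prodStructure T U))) (@Cc_ext R M N T U).
Proof.
split; first exact: Cc_ctensor.
by move=> a b a' b'; apply: Cc_ext_eq => w; exact: mulrACA.
Qed.

Let a1 : smooth_map S3 S (fun w => w.1.1) :=
  smooth_map_comp (smooth_map_fst SS S) s1.
Let a2 : smooth_map S3 S (fun w => w.1.2) :=
  smooth_map_comp (smooth_map_fst SS S) s2.
Let a3 : smooth_map S3 S snd := smooth_map_snd SS S.
Let b1 : smooth_map S3' S fst := smooth_map_fst S SS.
Let b2 : smooth_map S3' S (fun w => w.2.1) :=
  smooth_map_comp (smooth_map_snd S SS) s1.
Let b3 : smooth_map S3' S (fun w => w.2.2) :=
  smooth_map_comp (smooth_map_snd S SS) s2.

Definition assoc (w : G * G * G) : G * (G * G) := (w.1.1, (w.1.2, w.2)).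
Definition assoc' (w : G * (G * G)) : G * G * G := ((w.1, w.2.1), w.2.2).

Let as_smooth : smooth_map S3 S3' assoc := smooth_map_pair a1 (smooth_map_pair a2 a3).
Let as_smooth' : smooth_map S3' S3 assoc' := smooth_map_pair (smooth_map_pair b1 b2) b3.

Lemma assocK w : assoc' (assoc w) = w. Proof. by case: w => [[]]. Qed.
Lemma assocK' w : assoc (assoc' w) = w. Proof. by case: w => [? []]. Qed.

Let asp := compact_preimage_sub S3' as_smooth.1 as_smooth'.1 assocK.
Let asp' := compact_preimage_sub S3 as_smooth'.1 as_smooth.1 assocK'.

(** Coassociativity compares both bracketings in one algebra; here the second one is transported
    along reassociation to functions on the first. *)
Definition rtensor (f : H) (F : HH) : HHH := ppull as_smooth asp (Cc_ext f F).

Lemma rtensorE f F w : (rtensor f F : Cc S3) w = f w.1.1 * F (w.1.2, w.2).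
Proof. by []. Qed.

Lemma rtensor_alg : is_tensor_alg rtensor.
Proof.
split; last by move=> a b a' b'; apply: Cc_ext_eq => w; exact: mulrACA.
have k1 : cancel (ppull as_smooth asp) (ppull as_smooth' asp').
  by move=> K; apply: Cc_ext_eq => w; rewrite !ppullE assocK'.
have k2 : cancel (ppull as_smooth' asp') (ppull as_smooth asp).
  by move=> K; apply: Cc_ext_eq => w; rewrite !ppullE assocK.
have h := ctensor_isom (@Cc_complete _ _ S3) (ppull_bounded as_smooth asp)
  (ppull_bounded as_smooth' asp') k1 k2 (Cc_ctensor S SS).
exact h.
Qed.

Let dl : smooth_map S3 SS (fun w => (w.1.1 * w.1.2, w.2)%g) :=
  smooth_map_pair (smooth_map_mul a1 a2) a3.
Let dr : smooth_map S3 SS (fun w => (w.1.1, w.1.2 * w.2)%g) :=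
  smooth_map_pair a1 (smooth_map_mul a2 a3).

Lemma comult_coassociative : @coassociative R H HH (@Cc_ext R G G S S) comult.
Proof.
exists HHH, (@Cc_ext R _ _ SS S), rtensor,
  (pullhom dl (Cc_alg SS) (Cc_alg S3)), (pullhom dr (Cc_alg SS) (Cc_alg S3)),
  (pullext dl (Cc_alg SS) (Cc_alg S3)), (pullext dr (Cc_alg SS) (Cc_alg S3)).
split.
- split; [exact: Cc_tensor_alg|exact: rtensor_alg|].
  by move=> a b c; apply: Cc_ext_eq => w; rewrite rtensorE !Cc_extE mulrA.
- split; [exact: pullhom_essential|exact: pullhom_extension|].
  move=> a b F c; split; apply: Cc_ext_eq => w.
    by rewrite mvalL mval_pullhom !Cc_extE !mvalL mval_comult mval_embed mulrACA.
  by rewrite mvalR mval_pullhom !Cc_extE !mvalR mval_comult mval_embed mulrACA.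
- split; [exact: pullhom_essential|exact: pullhom_extension|].
  move=> a b c F; split; apply: Cc_ext_eq => w.
    by rewrite mvalL mval_pullhom !rtensorE !Cc_extE !mvalL mval_comult mval_embed mulrACA.
  by rewrite mvalR mval_pullhom !rtensorE !Cc_extE !mvalR mval_comult mval_embed mulrACA.
- move=> f; apply: mval_eq => w; rewrite !mval_pullext !mval_comult /=.
  by rewrite mulgA.
Qed.

Definition mult1 f : multiplier HH := mpull s1 (Cc_alg SS) (CcP f).1.
Definition mult2 f : multiplier HH := mpull s2 (Cc_alg SS) (CcP f).1.

Lemma mval_mult1 f p : mval (mult1 f) p = f p.1. Proof. exact: mval_mfun. Qed.
Lemma mval_mult2 f p : mval (mult2 f) p = f p.2. Proof. exact: mval_mfun. Qed.

Lemma mult1_tensor f :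
  @is_mtensor R H H HH (@Cc_ext R G G S S) (membed (f : H)) mone (mult1 f).
Proof.
move=> a b; split; apply: Cc_ext_eq => p.
  by rewrite mvalL mval_mult1 !Cc_extE mulrA.
by rewrite mvalR mval_mult1 !Cc_extE mulrA [f _ * a _]mulrC.
Qed.

Lemma mult2_tensor f :
  @is_mtensor R H H HH (@Cc_ext R G G S S) mone (membed (f : H)) (mult2 f).
Proof.
move=> a b; split; apply: Cc_ext_eq => p.
  by rewrite mvalL mval_mult2 !Cc_extE mulrCA.
by rewrite mvalR mval_mult2 !Cc_extE mulrCA [f _ * b _]mulrC.
Qed.

Local Notation t := (@Cc_ext R G G S S).

(** The inverse of the underlying diffeomorphism recovers [y] from [x * y] and [x]. The explicit
    formula for [g] is kept because the invariance of the integral is computed from it. *)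
Lemma comult_gamma_l : exists2 g : bhom HH HH, is_isom g &
  @is_gamma_l R H HH t comult g /\ forall F p, (g F : Cc SS) p = F (p.1 * p.2, p.1)%g.
Proof.
have q := smooth_map_pair mulS s1.
have r := smooth_map_pair s2 (smooth_map_mul (smooth_map_inv s2) s1).
have [| |g ig gE] := diffeo_isom q r.
- by move=> [x y] /=; rewrite mulKg.
- by move=> [x y] /=; rewrite mulVKg.
exists g => //; split; last by move=> F p; rewrite gE.
move=> x y; exists (mult1 y); first exact: mult1_tensor.
apply: mval_eq => p; rewrite mval_embed mval_mul mval_comult mval_mult1.
by rewrite gE Cc_extE.
Qed.

Lemma comult_gamma_r : exists2 g : bhom HH HH, is_isom g & @is_gamma_r R H HH t comult g.
Proof.
have q := smooth_map_pair mulS s2.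
have r := smooth_map_pair (smooth_map_mul s1 (smooth_map_inv s2)) s2.
have [| |g ig gE] := diffeo_isom q r.
- by move=> [x y] /=; rewrite mulgK.
- by move=> [x y] /=; rewrite mulgVK.
exists g => //.
move=> x y; exists (mult2 y); first exact: mult2_tensor.
apply: mval_eq => p; rewrite mval_embed mval_mul mval_comult mval_mult2.
by rewrite gE Cc_extE.
Qed.

Lemma comult_rho_l : exists2 g : bhom HH HH, is_isom g &
  @is_rho_l R H HH t comult g /\ forall F p, (g F : Cc SS) p = F (p.1, p.1 * p.2)%g.
Proof.
have q := smooth_map_pair s1 mulS.
have r := smooth_map_pair s1 (smooth_map_mul (smooth_map_inv s1) s2).
have [| |g ig gE] := diffeo_isom q r.
- by move=> [x y] /=; rewrite mulKg.
- by move=> [x y] /=; rewrite mulVKg.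
exists g => //; split; last by move=> F p; rewrite gE.
move=> x y; exists (mult1 x); first exact: mult1_tensor.
apply: mval_eq => p; rewrite mval_embed mval_mul mval_comult mval_mult1.
by rewrite gE Cc_extE.
Qed.

Lemma comult_rho_r : exists2 g : bhom HH HH, is_isom g & @is_rho_r R H HH t comult g.
Proof.
have q := smooth_map_pair s2 mulS.
have r := smooth_map_pair (smooth_map_mul s2 (smooth_map_inv s1)) s1.
have [| |g ig gE] := diffeo_isom q r.
- by move=> [x y] /=; rewrite mulgK.
- by move=> [x y] /=; rewrite mulgVK.
exists g => //.
move=> x y; exists (mult2 x); first exact: mult2_tensor.
apply: mval_eq => p; rewrite mval_embed mval_mul mval_comult mval_mult2.
by rewrite gE Cc_extE.
Qed.

Section Invariance.
Variable mu : {measure set (borel G) -> \bar R}.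
Hypothesis muH : is_left_haar mu.
Local Notation phi := (@hint R G mu).

Let ps x : smooth_map S SS (fun y => (x, y)).
Proof.
apply: (smooth_map_pair _ (smooth_map_id S)); split; first by move=> y; exact: cvg_cst.
move=> c d Ac Ad; exact: (@smooth_on_cst R _ _ _ (cphi d x)).
Qed.
Let pp x := compact_preimage_sub SS (ps x).1 (smooth_map_snd S S).1 (fun=> erefl).

(* The partial integral is smooth because it agrees with the bounded extension of
   f (x) g |-> phi(g) f on elementary tensors. *)
Lemma haar_slice : exists2 s : bhom HH H,
  forall f g, s (t f g) = phi g *: f & forall F x, (s F : Cc S) x = phi (ppull (ps x) (@pp x) F).
Proof.
have [pl pb] := hint_bounded muH.
have bB : @bounded_bilinear R (Cc S) (Cc S) (Cc S) (fun f g => phi g *: f).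
  split.
  - by move=> g a f f'; rewrite scalerDr !scalerA mulrC.
  - by move=> f a g g'; rewrite pl scalerDl scalerA.
  move=> A B sA sB; have [r Br] := pb B sB.
  (* The bound [r] is a complex number; the modulus of its real part plus 1 is a positive real bound
     by which one may divide. *)
  have r1 : (0 : R) < `|complex.Re r| + 1 by rewrite ltr_wpDl.
  apply: smallW (smallZ (`|complex.Re r| + 1)%:C (small_hull sA)) _ => _ [f [g [Af Bg ->]]].
  exists ((phi g / (`|complex.Re r| + 1)%:C) *: f); last first.
    by rewrite scalerA mulrC divfK// realC_neq0.
  apply: (is_diskZ (is_disk_hull A)); last exact: sub_disked_hull.
  rewrite normrM normfV (norm_realC (ltW r1)) ler_pdivrMr ?ltcR// mul1r.
  have := Br g Bg; rewrite normcE'; case: r {Br r1} => a b; rewrite lecE /= => /andP[_ h].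
  by rewrite lecR (le_trans h)// (le_trans (ler_norm a))// lerDl.
have [L Lb LE] := tensor_exists (@Cc_complete _ _ S) bB.
exists (mkhom Lb) => // F x; rewrite -[LHS]/(L F x).
(* The comparison at [x] is one of scalar functionals, whereas [ext_unique] speaks of maps into a
   bornological space; multiplying [chi] by the scalars turns them into such maps, and evaluation at
   [x] recovers them. *)
have [chi chi1] := bump1 S x.
pose L1 F := L F x *: chi; pose L2 F := phi (ppull (ps x) (@pp x) F) *: chi.
have scal (w : Cc SS -> R[i]) : (forall a u v, w (a *: u + v) = a * w u + w v) ->
    (forall A, small A -> exists2 C : R, 0 <= C & forall F, A F -> `|w F| <= C%:C) ->
    @bounded_linear R (Cc SS) (Cc S) (fun F => w F *: chi).
  move=> wl wb; split; first by move=> a u v; rewrite wl scalerDl scalerA.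
  move=> A sA; have [C C0 wC] := wb A sA.
  have C1 : 0 < C + 1 by rewrite ltr_wpDl.
  apply: smallW (smallZ (C + 1)%:C (small_hull (small_set1 chi))) _ => _ [K AK <-].
  exists ((w K / (C + 1)%:C) *: chi); last by rewrite scalerA mulrC divfK// realC_neq0.
  apply: (is_diskZ (is_disk_hull [set chi])); last exact: sub_disked_hull.
  rewrite normrM normfV (norm_realC (ltW C1)) ler_pdivrMr ?ltcR// mul1r.
  by apply: le_trans (wC K AK) _; rewrite lecR lerDl.
have L1b : bounded_linear L1.
  apply: scal => [a u v|A sA]; first by rewrite Lb.1 CcE.
  have [C C0 hC] := small_point x (Lb.2 _ sA); exists C => // K AK.
  by rewrite normcE' lecR; apply: hC; exists K.
have L2b : bounded_linear L2.
  have [ql qb] := ppull_bounded (ps x) (@pp x).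
  apply: scal => [a u v|A sA]; first by rewrite ql pl.
  have [r rb] := pb _ (qb _ sA); exists `|complex.Re r| => // K AK.
  have := rb _ (ex_intro2 _ _ K AK erefl); rewrite normcE'.
  case: r {rb} => a b; rewrite lecE /= => /andP[_ h].
  by rewrite lecR (le_trans h)// ler_norm.
have e : L1 = L2.
  apply: (ext_unique (@Cc_complete _ _ S) L1b L2b) => f g; rewrite /L1 /L2 LE CcZE.
  congr (_ *: _).
  have -> : ppull (ps x) (@pp x) (Cc_ext f g) = f x *: g.
    by apply: Cc_ext_eq => y; rewrite ppullE Cc_extE CcZE.
  have := pl (f x) g 0; rewrite addr0 => ->.
  have -> : phi 0 = 0 by have := pl (-1) 0 0; rewrite scaler0 addr0 mulN1r addNr.
  by rewrite addr0 mulrC.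
have := congr1 (fun K : Cc SS -> Cc S => K F x) e; rewrite /L1 /L2 !CcZE chi1 (mulr1 (L F x)).
by rewrite mulr1.
Qed.

(** Both slices are integrals over [y] of [f (x * y) * g x]; translation invariance of the measure
    removes [x] from the argument of [f]. *)
Lemma haar_left_invariant : @left_invariant R H HH t comult phi.
Proof.
have [pl pb] := hint_bounded muH.
have phiZ a f : phi (a *: f) = a * phi f.
  have := pl a f 0; rewrite addr0 => ->.
  have -> : phi 0 = 0 by have := pl (-1) 0 0; rewrite scaler0 addr0 mulN1r addNr.
  by rewrite addr0.
move=> f; have [gl _ [glP glE]] := comult_gamma_l.
have [rl _ [rlP rlE]] := comult_rho_l; have [s st sE] := haar_slice.
exists gl, rl, s; split=> // g.
have key (K : Cc SS) : (forall p, K p = f (p.1 * p.2)%g * g p.1) ->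
    s K = phi f *: g :> Cc S.
  move=> KE; apply: Cc_ext_eq => x; rewrite sE CcZE.
  set k := ppull _ _ K.
  have lx : smooth_map S S (fun y => (x * y)%g).
    exact: (smooth_map_comp (ps x) mulS).
  have lx' : smooth_map S S (fun y => (x^-1 * y)%g).
    exact: (smooth_map_comp (ps (x^-1)%g) mulS).
  have lp := compact_preimage_sub S lx.1 lx'.1 (mulKg x).
  have -> : k = g x *: ppull lx lp f.
    by apply: Cc_ext_eq => y; rewrite CcZE !ppullE KE mulrC.
  rewrite phiZ mulrC; congr (_ * _).
  by apply: (hint_lmul muH (x := x)) => y; rewrite ppullE.
split.
  have -> : mL (phi f *: mone) g = phi f *: g :> Cc S by [].
  by rewrite key// => p; rewrite glE Cc_extE.
have -> : mR (phi f *: mone) g = phi f *: g :> Cc S by [].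
by rewrite key// => p; rewrite rlE Cc_extE mulrC.
Qed.

End Invariance.

Lemma Cc_essential_alg : essential_alg H.
Proof.
split.
  have [chi [V [_ V1 chi1 _]]] := bump S openT (Logic.I : setT (1%g : G)).
  exists chi; apply/eqP => c0; have := chi1 _ V1; rewrite c0.
  by move/eqP; rewrite eq_sym oner_eq0.
have [_ _] := @Cc_essential_left R G G S S id (smooth_map_id S) (Cc_alg S)
  (@Cc_mul R G S) (fun h v x => erefl).
by [].
Qed.

End LieGroup.

Theorem proposition9p2 (R : realType) (G : lieGroup R) :
  let S := lie_smooth G in
  let SS := prodStructure S S in
  exists (algH : is_born_alg (@Cc_mul R G S))
         (algHH : is_born_alg (@Cc_mul R (G * G)%type SS)),
  let H := BornAlg algH in
  let HH := BornAlg algHH in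
  exists (Delta : bhom H (multiplier HH))
         (mu : {measure set (borel G) -> \bar R}),
    [/\ forall (f : Cc S) (F : Cc SS) (r s : G),
          (mL (Delta f) F : Cc SS) (r, s) = f (r * s)%g * F (r, s) /\
          (mR (Delta f) F : Cc SS) (r, s) = F (r, s) * f (r * s)%g,
        is_left_haar mu &
        @is_quantum_group R H HH (@Cc_ext R G G S S) Delta
          (fun f : Cc S => haar_integral mu f)].
Proof.
move=> S SS; exists (Cc_alg S), (Cc_alg SS) => H HH.
(* Local compactness of the group, required for the Haar measure, comes from the charts. *)
have lcG (x : G) (U : set G) : open U -> U x ->
    exists K : set G, [/\ compact K, nbhs x K & K `<=` U].
  move=> oU Ux; have [c Ac cx] := atlas_cover S x.
  by have [K [cK nK KU _]] := chart_nbhs cx oU Ux; exists K.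
have mulc : continuous (fun x : G * G => (x.1 * x.2)%g) := (lie_mul_smooth G).1.
have invc : continuous (fun x : G => (x^-1)%g) := (lie_inv_smooth G).1.
have [mu [muH mupos]] := @haar_exists R G mulc invc (smooth_hausdorff S)
  (smooth_countable S) lcG.
exists (comult G), mu; split; [|exact: muH|].
  move=> f F r s.
  have e := mval_comult f (r, s).
  split.
    by have := mvalL (comult G f) F (r, s); rewrite e.
  by have := mvalR (comult G f) F (r, s); rewrite e mulrC.
split.
- exact: Cc_essential_alg.
- exact: Cc_approximation.
- exact: Cc_tensor_alg.
- by split; [exact: pullhom_essential|exact: comult_coassociative].
- by have [g ig [gP _]] := comult_gamma_l G; exists g.
- exact: comult_gamma_r.
- by have [g ig [gP _]] := comult_rho_l G; exists g.
- exact: comult_rho_r.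
- exact: hint_bounded muH.
- exact: hint_faithful muH mupos.
- exact: haar_left_invariant muH.
Qed.
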